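(* Let $\mathcal{G}$ be a Hausdorff, second countable, $\sigma$-compact LCA group, $0<p,q\leq\infty$, $m\in\mathcal{M}_v(\mathcal{G}\times\widehat{\mathcal{G}})$ and let $\varphi$ be the generalized Gaussian. Let $h\in\mathscr{A}_{\tilde v}(\mathcal{G})$ be such that $S_{h,\varphi}=S_{\varphi,h}=I_{L^2(\mathcal{G})}$ for a suitable quasi-lattice $\Lambda=\Lambda_1\times\Lambda_2\subseteq\mathcal{G}\times\widehat{\mathcal{G}}$. Then for every $f\in M^{p,q}_m(\mathcal{G})$ $$f=\sum_{\mathbf{w}\in\Lambda}\langle f,\pi(\mathbf{w})\varphi\rangle\,\pi(\mathbf{w})h=\sum_{\mathbf{w}\in\Lambda}\langle f,\pi(\mathbf{w})h\rangle\,\pi(\mathbf{w})\varphi,$$ with unconditional convergence in $M^{p,q}_m(\mathcal{G})$ if $p,q\neq\infty$, and with weak-$*$ convergence in $M^\infty_{1/v}(\mathcal{G})$ otherwise. Moreover, for every $f\in M^{p,q}_m(\mathcal{G})$ the following quasi-norm equivalences hold (constants independent of $f$): $$\|f\|_{M^{p,q}_m}\asymp\Big(\sum_{\mu\in\Lambda_2}\Big(\sum_{w\in\Lambda_1}|V_\varphi f(w,\mu)|^pm(w,\mu)^p\Big)^{q/p}\Big)^{1/q},\qquad \|f\|_{M^{p,q}_m}\asymp\Big(\sum_{\mu\in\Lambda_2}\Big(\sum_{w\in\Lambda_1}|V_hf(w,\mu)|^pm(w,\mu)^p\Big)^{q/p}\Big)^{1/q},$$ with the usual modifications if $p=\infty$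 or $q=\infty$.
   Context: Setting. $\mathcal{G}$ is written additively; $\widehat{\mathcal{G}}$ is its dual group, $\langle\xi,x\rangle=\xi(x)$; $dx$, $d\xi$ dual Haar measures. $T_xf(y)=f(y-x)$, $M_\xi f(y)=\langle\xi,y\rangle f(y)$, $\pi(x,\xi)=M_\xi T_x$, $V_gf(x,\xi)=\langle f,\pi(x,\xi)g\rangle$. By the structure theorem fix $\mathcal{G}\cong\mathbb{R}^d\times\mathcal{G}_0$, $\mathcal{G}_0$ an LCA group with compact open subgroup $\mathcal{K}$; then $\widehat{\mathcal{G}}\cong\mathbb{R}^d\times\widehat{\mathcal{G}}_0$ with compact open subgroup $\mathcal{K}^\perp\subseteq\widehat{\mathcal{G}}_0$. Gaussian: $\varphi(x_1,x_2)=e^{-\pi x_1^2}\chi_{\mathcal{K}}(x_2)$; $\mathcal{S}_{\mathcal{C}}(\mathcal{G})=\mathrm{span}\{\pi(x,\xi)\varphi\}$. Weights. $v$ is a weight (measurable, positive) on $\mathcal{G}\times\widehat{\mathcal{G}}$ that is submultiplicative, even, bounded below by a positive constant, with $\lim_nv(n\mathbf{x})^{1/n}=1$ for all $\mathbf{x}$. $\mathcal{M}_v$ is the set of weights $m$ with $m(\mathbf{x}+\mathbf{y})\le Cv(\mathbf{x})m(\mathbf{y})$ for some $C$. Reservoir and modulation spaces. $\mathcal{T}_{\tilde v}=\{f\in L^2(\mathcal{G}):V_{\varphi}f\in L^1_v\}$ with norm $\|V_\varphi f\|_{L^1_v}$; $\mathcal{R}_{\tilde v}$ = continuous antilinear functionals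 on $\mathcal{T}_{\tilde v}$. $\|F\|_{L^{p,q}_m}=(\int_{\widehat{\mathcal{G}}}(\int_{\mathcal{G}}|F|^pm^pdx)^{q/p}d\xi)^{1/q}$ (usual modifications); $\mathsf{M}_QF(\mathbf{x})=\operatorname{ess\,sup}_{\mathbf{y}\in\mathbf{x}+Q}|F(\mathbf{y})|$ for a measurable relatively compact unit neighbourhood $Q$. $M^{p,q}_m(\mathcal{G})=\{f\in\mathcal{R}_{\tilde v}:\mathsf{M}_QV_gf\in L^{p,q}_m\}$ with $\|f\|_{M^{p,q}_m}=\|\mathsf{M}_QV_gf\|_{L^{p,q}_m}$, $g\in\mathcal{S}_{\mathcal{C}}(\mathcal{G})\setminus\{0\}$ fixed (independent of $g,Q$ up to equivalence). $M^\infty_{1/v}=M^{\infty,\infty}_{1/v}$ is identified with the dual of $M^{1,1}_v$. The class $\mathscr{A}_{\tilde v}$. $\mathbb{H}_{\mathcal{G}}=\mathcal{G}\times\widehat{\mathcal{G}}\times\mathbb{T}$ with $(x,\xi,\tau)(x',\xi',\tau')=(x+x',\xi+\xi',\tau\tau'\langle\xi',x\rangle)$, $\tilde v(x,\xi,\tau)=v(x,\xi)$, $W^\varrho_gf(x,\xi,\tau)=\langle f,\tau M_\xi T_xg\rangle$. For a measurable relatively compact unit neighbourhood $Q\subseteq\mathbb{H}_{\mathcal{G}}$: $\mathsf{M}_QF(h)=\operatorname{ess\,sup}_{hQ}|F|$, $\mathsf{M}^R_QF(h)=\operatorname{ess\,sup}_{Qh}|F|$. $\mathbb{A}^r_{\tilde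 v}=\{g\in L^2(\mathcal{G}):\mathsf{M}_Q\mathsf{M}^R_QW^\varrho_gg\in L^r_{\tilde v}(\mathbb{H}_{\mathcal{G}})\}$ (independent of $Q$) and $\mathscr{A}_{\tilde v}(\mathcal{G})=\bigcap_{0<r\le1}\mathbb{A}^r_{\tilde v}$. Quasi-lattices and frame operators. $\Lambda=\Lambda_1\times\Lambda_2=(A_1\mathbb{Z}^d\times D_1)\times(A_2\mathbb{Z}^d\times D_2)\subseteq\mathcal{G}\times\widehat{\mathcal{G}}$, with $A_1,A_2\in GL(\mathbb{R}^d)$ and $D_1\subseteq\mathcal{G}_0$, $D_2\subseteq\widehat{\mathcal{G}}_0$ sets of coset representatives of $\mathcal{G}_0/\mathcal{K}$ and $\widehat{\mathcal{G}}_0/\mathcal{K}^\perp$. $S_{h,g}f=\sum_{\mathbf{w}\in\Lambda}\langle f,\pi(\mathbf{w})g\rangle\pi(\mathbf{w})h$ for $f\in L^2(\mathcal{G})$. *)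

(* Defs.v *)
From HB Require Import structures.
From mathcomp Require Import all_boot all_order all_algebra finmap.
From mathcomp Require Import all_classical all_reals all_analysis.
From mathcomp Require Import ess_sup_inf complex.

Set Implicit Arguments.
Unset Strict Implicit.
Unset Printing Implicit Defensive.

Import Order.TTheory GRing.Theory Num.Theory.
Import numFieldNormedType.Exports.

Local Open Scope classical_set_scope.
Local Open Scope ring_scope.

HB.mixin Record isLocallyCompactHausdorff G & TopologicalZmodule G := {
  lca_hausdorff : hausdorff_space G ;
  lca_locally_compact : locally_compact [set: G]
}.

#[short(type="lcaType")]
HB.structure Definition LCA :=
  {G of TopologicalZmodule G & isLocallyCompactHausdorff G}.

Definition sigma_compact (T : topologicalType) :=
  exists2 K : (set T)^nat, (forall n, compact (K n)) & \bigcup_n K n = [set: T].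

(* Measurable types of the library are pointed, hence the base point 0. *)
Definition with_point0 (G : zmodType) : Type := G.
HB.instance Definition _ (G : zmodType) := isPointed.Build (with_point0 G) 0.

Definition borel (G : PreTopologicalZmodule.type) :=
  @g_sigma_algebraType (with_point0 G) (@open G).
HB.instance Definition _ (G : PreTopologicalZmodule.type) :=
  Measurable.on (borel G).

Section circle.
Context (R : realType).

Record circle := Circle { circle_val :> R[i] ; _ : `|circle_val| == 1 }.

HB.instance Definition _ := [isSub for circle_val].
HB.instance Definition _ := [Choice of circle by <:].

Lemma circle_norm (z : circle) : `|circle_val z| = 1.
Proof. by case: z => z /= /eqP. Qed.

Lemma circle_neq0 (z : circle) : circle_val z != 0.
Proof. by rewrite -normr_eq0 circle_norm oner_eq0. Qed.

Fact circle_one_subproof : `|1 : R[i]| == 1. Proof. by rewrite normr1. Qed.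

Fact circle_mul_subproof (z w : circle) : `|circle_val z * circle_val w| == 1.
Proof. by rewrite normrM !circle_norm mulr1. Qed.

Fact circle_inv_subproof (z : circle) : `|(circle_val z)^-1| == 1.
Proof. by rewrite normfV circle_norm invr1. Qed.

Definition circle_one := Circle circle_one_subproof.
Definition circle_mul z w := Circle (circle_mul_subproof z w).
Definition circle_inv z := Circle (circle_inv_subproof z).

Fact circle_mulA : associative circle_mul.
Proof. by move=> x y z; apply: val_inj; rewrite /= mulrA. Qed.

Fact circle_mul1 : left_id circle_one circle_mul.
Proof. by move=> x; apply: val_inj; rewrite /= mul1r. Qed.

Fact circle_mulr1 : right_id circle_one circle_mul.
Proof. by move=> x; apply: val_inj; rewrite /= mulr1. Qed.

Fact circle_mulV : left_inverse circle_one circle_inv circle_mul.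
Proof. by move=> x; apply: val_inj; rewrite /= mulVf ?circle_neq0. Qed.

Fact circle_mulrV : right_inverse circle_one circle_inv circle_mul.
Proof. by move=> x; apply: val_inj; rewrite /= mulfV ?circle_neq0. Qed.

HB.instance Definition _ := isGroup.Build circle
  circle_mulA circle_mul1 circle_mulr1 circle_mulV circle_mulrV.

Lemma circle_mulC (x y : circle) : (x * y = y * x)%g.
Proof. by apply: val_inj; rewrite /= mulrC. Qed.

HB.instance Definition _ := isPointed.Build circle circle_one.
HB.instance Definition _ := Topological.copy circle
  (initial_topology (circle_val : circle -> R[i]^o)).

Lemma circle_val_continuous : continuous (circle_val : circle -> R[i]^o).
Proof. exact: initial_continuous. Qed.

Lemma circle_mul_continuous (T : topologicalType) (f g : T -> circle) :
  continuous f -> continuous g -> continuous (fun x => f x * g x)%g.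
Proof.
move=> cf cg; apply: (@continuous_comp_initial circle T R[i]^o circle_val).
have c k : continuous k -> continuous ((circle_val : circle -> R[i]^o) \o k).
  by move=> ck x; exact: (cvg_comp _ _ (ck x) (@circle_val_continuous (k x))).
by move=> x; apply: cvgM; [exact: c cf x|exact: c cg x].
Qed.

Lemma circle_inv_continuous (T : topologicalType) (f : T -> circle) :
  continuous f -> continuous (fun x => (f x)^-1)%g.
Proof.
move=> cf; apply: (@continuous_comp_initial circle T R[i]^o circle_val) => x.
apply: (@cvgV R[i] _ _ _ (circle_val \o f)); first exact: circle_neq0.
exact: (cvg_comp _ _ (cf x) (@circle_val_continuous (f x))).
Qed.

Definition borel_circle := g_sigma_algebraType (@open circle).
HB.instance Definition _ := Measurable.on borel_circle.

End circle.

Section dual_group.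
Context (R : realType) (G : lcaType).

Definition character : set {compact-open, G -> circle R} :=
  [set chi | continuous (chi : G -> circle R) /\
    forall x y : G, chi (x + y) = (chi x * chi y)%g].

Definition dual_group : Type := set_type character.

HB.instance Definition _ := Choice.on dual_group.
HB.instance Definition _ := Topological.on dual_group.

Definition char_eval (xi : dual_group) : G -> circle R := set_val xi.

Lemma char_eval_inj : injective char_eval.
Proof. by move=> xi eta; exact: val_inj. Qed.

Lemma char_evalP (xi : dual_group) : character (char_eval xi).
Proof. exact: set_valP. Qed.

Fact character0 : character (fun=> 1%g).
Proof. by split; [move=> x; exact: cvg_cst|move=> x y; rewrite mulg1]. Qed.

Fact characterD (xi eta : dual_group) :
  character (fun x => char_eval xi x * char_eval eta x)%g.
Proof.
have [cxi hxi] := char_evalP xi; have [ceta heta] := char_evalP eta.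
split; first exact: circle_mul_continuous.
move=> x y; rewrite hxi heta !mulgA; congr (_ * _)%g.
by rewrite -!mulgA; congr (_ * _)%g; rewrite circle_mulC.
Qed.

Fact characterN (xi : dual_group) : character (fun x => (char_eval xi x)^-1)%g.
Proof.
have [cxi hxi] := char_evalP xi.
split; first exact: circle_inv_continuous.
by move=> x y; rewrite hxi invgM circle_mulC.
Qed.

Definition dual0 : dual_group := exist (fun chi => chi \in character) _ (mem_set character0).
Definition dual_add (xi eta : dual_group) : dual_group :=
  exist (fun chi => chi \in character) _ (mem_set (characterD xi eta)).
Definition dual_opp (xi : dual_group) : dual_group :=
  exist (fun chi => chi \in character) _ (mem_set (characterN xi)).

Fact dual_addA : associative dual_add.
Proof. by move=> a b c; apply: val_inj; apply/funext => x /=; rewrite mulgA. Qed.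

Fact dual_addC : commutative dual_add.
Proof. by move=> a b; apply: val_inj; apply/funext => x; exact: circle_mulC. Qed.

Fact dual_add0 : left_id dual0 dual_add.
Proof. by move=> a; apply: val_inj; apply/funext => x /=; exact: mul1g. Qed.

Fact dual_addN : left_inverse dual0 dual_opp dual_add.
Proof. by move=> a; apply: val_inj; apply/funext => x /=; exact: mulVg. Qed.

HB.instance Definition _ := GRing.isZmodule.Build dual_group
  dual_addA dual_addC dual_add0 dual_addN.

End dual_group.

Arguments char_eval {R G} xi x.

Definition pairing (R : realType) (G : lcaType) (xi : dual_group R G) (x : G) :
  R[i] := circle_val (char_eval xi x).

Definition translation_invariant (R : realType) (T : topologicalType)
    (op : T -> T -> T) (mu : set T -> \bar R) :=
  forall (a : T) (A : set T), <<s @open T >> A -> mu (op a @` A) = mu A.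

(* On a second countable locally compact Hausdorff group every Borel measure
   that is finite on compact sets is regular. *)
Definition is_haar (R : realType) (T : topologicalType) (op : T -> T -> T)
    (mu : set T -> \bar R) :=
  [/\ translation_invariant op mu,
      forall K : set T, compact K -> (mu K < +oo)%E &
      forall U : set T, open U -> U !=set0 -> (0 < mu U)%E].

Section complex_integral.
Context {d : measure_display} {T : measurableType d} {R : realType}.
Context (mu : {measure set T -> \bar R}).
Implicit Types f g : T -> R[i].

Definition cmod (z : R[i]) : R := Normc.normc z.

Definition cmeasurable f :=
  measurable_fun [set: T] (fun x => complex.Re (f x)) /\
  measurable_fun [set: T] (fun x => complex.Im (f x)).

Definition cintegral f : R[i] :=
  Complex (\int[mu]_x complex.Re (f x)) (\int[mu]_x complex.Im (f x)).

Definition cLnorm (p : \bar R) f : \bar R :=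
  'N[mu]_p[(fun x => (cmod (f x))%:E)]%E.

Definition cL2 f := cmeasurable f /\ (cLnorm 2%:E f < +oo)%E.

Definition inner f g : R[i] := cintegral (fun x => f x * (g x)^*%C).

Definition ess_sup_on (D : set T) (F : T -> \bar R) : \bar R :=
  ess_sup mu ((fun x => `|F x|)%E \_ D).

End complex_integral.

Section time_frequency.
Context {R : realType} {G : lcaType}.
Local Notation Gh := (dual_group R G).
Implicit Types (f g : G -> R[i]) (z w : G * Gh).

Definition translation (x : G) f : G -> R[i] := fun y => f (y - x).

Definition modulation (xi : Gh) f : G -> R[i] := fun y => pairing xi y * f y.

Definition tfshift z f : G -> R[i] := modulation z.2 (translation z.1 f).

Definition is_dual_haar (mu : {measure set (borel G) -> \bar R})
    (nu : {measure set (borel Gh) -> \bar R}) :=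
  let fourier f (xi : Gh) := cintegral mu (fun x => f x * (pairing xi x)^*%C) in
  forall f, continuous (f : G -> R[i]^o) ->
    (cLnorm mu 1%:E f < +oo)%E -> (cLnorm nu 1%:E (fourier f) < +oo)%E ->
  forall x, f x = cintegral nu (fun xi => fourier f xi * pairing xi x).

Definition is_weight (m : G * Gh -> R) :=
  measurable_fun [set: (borel G * borel Gh)%type] m /\ forall z, 0 < m z.

Definition is_admissible (v : G * Gh -> R) :=
  [/\ is_weight v,
      forall z w, v (z + w) <= v z * v w,
      forall z, v (- z) = v z,
      exists2 c : R, 0 < c & forall z, c <= v z &
      forall z, (v (z *+ n)) `^ (n%:R^-1) @[n --> \oo] --> (1 : R)].

Definition is_moderate (v m : G * Gh -> R) :=
  is_weight m /\
  exists C : R, forall z w, m (z + w) <= C * v z * m w.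

End time_frequency.

Section structure.
Context {R : realType} {G G0 : lcaType} {d : nat}.
Local Notation Gh := (dual_group R G).
Implicit Types (phi : G -> 'cV[R]_d * G0) (K : set G0).

Definition is_lca_iso phi :=
  (forall x y, phi (x + y) = phi x + phi y) /\
  exists psi : 'cV[R]_d * G0 -> G,
    [/\ cancel phi psi, cancel psi phi, continuous phi & continuous psi].

Definition compact_open_subgroup K :=
  [/\ compact K, open K, K 0 & forall x y, K x -> K y -> K (x - y)].

Definition gaussian phi K : G -> R[i] := fun x =>
  (expR (- (pi * \sum_i (phi x).1 i 0 ^+ 2)) * \1_K (phi x).2)%:C%C.

Definition annihilator K : set (dual_group R G0) :=
  [set eta | forall k, K k -> pairing eta k = 1].

Definition coset_representatives (H : zmodType) (K D : set H) :=
  forall x, exists! d, D d /\ K (x - d).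

Definition expi (t : R) : R[i] := Complex (cos t) (sin t).

Definition lattice1 phi (A : 'M[R]_d) (D : set G0) : set G :=
  [set x | (exists k : 'cV[int]_d, (phi x).1 = A *m map_mx intr k) /\
    D (phi x).2].

(* The identification of the dual of R^d * G0 with R^d * dual G0 is
   <(a, eta), (x1, x2)> = e^(2 i pi a.x1) <eta, x2> *)
Definition lattice2 phi (A : 'M[R]_d) (D : set (dual_group R G0)) : set Gh :=
  [set xi | exists (k : 'cV[int]_d) (eta : dual_group R G0), D eta /\
    forall x, pairing xi x =
      expi (2 * pi * \sum_i (A *m map_mx intr k) i 0 * (phi x).1 i 0)
      * pairing eta (phi x).2].

End structure.

Definition lnorm {R : realType} {T : choiceType} (p : \bar R) (A : set T)
    (a : T -> \bar R) : \bar R :=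
  match p with
  | r%:E => ((\esum_(i in A) (`|a i| `^ r)) `^ r^-1)%E
  | +oo%E => ereal_sup [set `|a i|%E | i in A]
  | -oo%E => 0%E
  end.

(* e W tends to 0 along the net of the finite subsets W of L *)
Definition fin_cvg0 {R : realType} {I : choiceType} (L : set I)
    (e : {fset I} -> \bar R) :=
  forall eps : R, 0 < eps -> exists W0 : {fset I},
    [set` W0] `<=` L /\
    forall W : {fset I}, [set` W0] `<=` [set` W] -> [set` W] `<=` L ->
      (e W < eps%:E)%E.

Section modulation_spaces.
Context {R : realType} {G : lcaType}.
Local Notation Gh := (dual_group R G).
Local Notation phase_space := (borel G * borel Gh)%type.
Context (mu : {sigma_finite_measure set (borel G) -> \bar R})
  (nu : {sigma_finite_measure set (borel Gh) -> \bar R}).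
Context (phi : G -> R[i]) (v : G * Gh -> R).
Implicit Types (f g h : G -> R[i]) (F : (G -> R[i]) -> R[i]).
Implicit Types (m : G * Gh -> R) (p q : \bar R) (Q : set (G * Gh)).

(* An antilinear functional F acts on test functions by F f = <F, f>; a
   function g in L^2 is the functional inner mu g. *)
Definition stft F g : G * Gh -> R[i] := fun z => F (tfshift z g).

Definition test_norm f : \bar R :=
  'N[mu \x nu]_1[(fun z => (cmod (stft (inner mu f) phi z) * v z)%:E)]%E.

Definition test_space : set (G -> R[i]) :=
  [set f | cL2 mu f /\ (test_norm f < +oo)%E].

(* Only the values on the test space are meaningful. *)
Definition reservoir : set ((G -> R[i]) -> R[i]) :=
  [set F |
    (forall (c : R[i]) f g, test_space f -> test_space g ->
      F (fun x => c * f x + g x) = c^*%C * F f + F g) /\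
    exists C : R, forall f, test_space f ->
      ((cmod (F f))%:E <= C%:E * test_norm f)%E].

Definition gabor_span : set (G -> R[i]) :=
  [set g | exists (s : seq (R[i] * (G * Gh))),
    forall x, g x = \sum_(a <- s) a.1 * tfshift a.2 phi x].

Definition mixed_norm p q m (H : G * Gh -> \bar R) : \bar R :=
  'N[nu]_q[(fun xi => 'N[mu]_p[(fun x => H (x, xi) * (m (x, xi))%:E)])]%E.

Definition phase_unit_nbhd Q :=
  [/\ measurable (Q : set phase_space), precompact Q & nbhs (0 : G * Gh) Q].

Definition local_max Q (H : G * Gh -> \bar R) : G * Gh -> \bar R := fun z =>
  ess_sup_on (mu \x nu)%E [set z + y | y in Q] H.

Definition mod_norm p q m g Q F : \bar R :=
  mixed_norm p q m (local_max Q (fun z => (cmod (stft F g z))%:E)).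

Definition mod_space p q m g Q : set ((G -> R[i]) -> R[i]) :=
  [set F | reservoir F /\ (mod_norm p q m g Q F < +oo)%E].

End modulation_spaces.

Section heisenberg_group.
Context {R : realType} {G : lcaType}.
Local Notation Gh := (dual_group R G).
Local Notation heisenberg := (G * Gh * circle R)%type.
Context (mu : {sigma_finite_measure set (borel G) -> \bar R})
  (nu : {sigma_finite_measure set (borel Gh) -> \bar R})
  (tau : probability (borel_circle R) R).
Implicit Types (f g : G -> R[i]) (a b : heisenberg) (Q : set heisenberg)
  (F : heisenberg -> \bar R).

Definition heis_mul a b : heisenberg :=
  (a.1.1 + b.1.1, a.1.2 + b.1.2, (a.2 * b.2 * char_eval b.1.2 a.1.1)%g).

Definition heis_one : heisenberg := (0, 0, 1%g).

Definition heis_measure := ((mu \x nu) \x tau)%E.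

Definition heis_unit_nbhd Q :=
  [/\ measurable (Q : set (borel G * borel Gh * borel_circle R)%type),
      precompact Q & nbhs heis_one Q].

Definition heis_stft g f : heisenberg -> R[i] := fun a =>
  inner mu f (fun y => circle_val a.2 * tfshift a.1 g y).

Definition left_max Q F : heisenberg -> \bar R := fun a =>
  ess_sup_on heis_measure [set heis_mul a b | b in Q] F.

Definition right_max Q F : heisenberg -> \bar R := fun a =>
  ess_sup_on heis_measure [set heis_mul b a | b in Q] F.

Definition analyzing_r (v : G * Gh -> R) Q (r : R) : set (G -> R[i]) :=
  [set g | cL2 mu g /\
    ('N[heis_measure]_(r%:E)[(fun a =>
       left_max Q (right_max Q (fun b => (cmod (heis_stft g g b))%:E)) a
       * (v a.1)%:E)] < +oo)%E].

Definition analyzing (v : G * Gh -> R) Q : set (G -> R[i]) :=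
  [set g | forall r : R, 0 < r <= 1 -> analyzing_r v Q r g].

End heisenberg_group.

Section gabor_expansions.
Context {R : realType} {G : lcaType}.
Local Notation Gh := (dual_group R G).
Local Notation functional := ((G -> R[i]) -> R[i]).
Context (mu : {sigma_finite_measure set (borel G) -> \bar R})
  (nu : {sigma_finite_measure set (borel Gh) -> \bar R}).
Context (phi : G -> R[i]) (v : G * Gh -> R).
Implicit Types (f g h : G -> R[i]) (F : functional) (t : G * Gh -> functional).
Implicit Types (m : G * Gh -> R) (p q : \bar R) (Q : set (G * Gh)).
Implicit Types (L : set (G * Gh)).

(* S_{h,g} f = k, with unconditional convergence in L^2 *)
Definition frame_operator L h g f k :=
  fin_cvg0 L (fun W => cLnorm mu 2%:E (fun x =>
    k x - \sum_(w <- W) inner mu f (tfshift w g) * tfshift w h x)).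

(* For every countable family, unconditional convergence to F in a metrizable
   group amounts to convergence of the net of finite partial sums. *)
Definition mod_unconditional_sum p q m g Q L t F :=
  (forall w, L w -> mod_space mu nu phi v p q m g Q (t w)) /\
  fin_cvg0 L (fun W => mod_norm mu nu p q m g Q (fun k =>
    F k - \sum_(w <- W) t w k)).

(* The predual M^1_v is embedded in the reservoir through its representatives
   k in L^2, on which F in M^oo_{1/v} takes the value F k. *)
Definition mod_weakstar_sum g Q L t F :=
  let space := mod_space mu nu phi v +oo%E +oo%E (fun z => (v z)^-1) g Q in
  [/\ space F, forall w, L w -> space (t w) &
      forall k, test_space mu nu phi v k ->
        mod_space mu nu phi v 1%:E 1%:E v g Q (inner mu k) ->
      fin_cvg0 L (fun W => (cmod (F k - \sum_(w <- W) t w k))%:E)].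

(* w |-> <F, pi(w) g> pi(w) h *)
Definition gabor_term F g h : G * Gh -> functional := fun w k =>
  F (tfshift w g) * inner mu (tfshift w h) k.

Definition coefficient_norm p q m (L1 : set G) (L2 : set Gh) F g : \bar R :=
  lnorm q L2 (fun xi => lnorm p L1 (fun x =>
    (cmod (stft F g (x, xi)) * m (x, xi))%:E)).

Definition equivalent_on (X : set functional) (N1 N2 : functional -> \bar R) :=
  exists c C : R, [/\ 0 < c, 0 < C & forall F, X F ->
    (c%:E * N1 F <= N2 F)%E /\ (N2 F <= C%:E * N1 F)%E].

End gabor_expansions.

(* Main.v *)
(** Call a function on phase space decaying if its suprema over the cells of the
   quasi-lattice, multiplied by the weight, are r-summable for every r > 0. An
   explicit computation, based on shearing products of Gaussians, shows that
   z |-> <phi, pi(z) phi> decays. As h is analyzing, <h, pi(z) h> has rapidly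
   decreasing local suprema; expanding a translate of h in the Gabor frame, all
   the functions <f, pi(z) k> with f, k among phi, g, h decay.

   Upper bounds: expanding pi(z) g in the frame dominates V_g F, and V_g of the
   remainder after finitely many terms, by the convolution of a decaying kernel
   with the (remaining) coefficients, and a discrete Young inequality, valid for
   all 0 < p, q <= oo because decaying kernels are r-summable for small r,
   bounds the mixed norm. This also yields unconditional convergence.

   Lower bounds: the orthogonality relation of the short-time Fourier transform,
   applied to the partial sums of the frame expansion, dominates F(pi(w) phi) by
   the integral of a decaying kernel against the local suprema of V_g F. *)
From HB Require Import structures.
Require Import Defs.
From mathcomp Require Import all_boot all_order all_algebra finmap.
From mathcomp Require Import all_classical all_reals all_analysis.
From mathcomp Require Import measurable_realfun ess_sup_inf complex.
From mathcomp Require Import ring lra zify.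

Set Implicit Arguments.
Unset Strict Implicit.
Unset Printing Implicit Defensive.

Import Order.TTheory GRing.Theory Num.Theory.
Import numFieldNormedType.Exports.

Local Open Scope classical_set_scope.
Local Open Scope ring_scope.

(** * Complex-valued functions *)

Section complex_modulus.
Context {R : realType}.
Implicit Types (z w : R[i]) (r : R).

(** The quasi-lattice need not be a subgroup, so translating a lattice sum is replaced by the
    permutation w |-> [rnd t (w + x)]. For exponents below 1 there is no triangle inequality;
    summability of a kernel to every positive power makes up for it, since powers can be traded
    between kernel and sequence. A functional F is known only through its values on test functions
    and z |-> F (pi(z) g) is never shown to be measurable: it is handled by monotonicity of
    integrals and by essential suprema. The weight is only measurable and submultiplicative, so its
    boundedness on compact cells comes from a Steinhaus argument. The dual group carries the
    compact-open topology, and compactness of its cells is an Ascoli theorem for characters. The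
    Haar measure has no explicit normalization on R^d; the decay of the transform of the Gaussian
    follows from a functional equation instead of an integral formula. Finally [h] is only square
    integrable, so its local suprema are read off at almost every displacement of the lattice, and
    Fourier inversion is applied to continuous windows only. *)

Lemma normr_cmod z : `|z| = (cmod z)%:C%C. Proof. by []. Qed.

Lemma cmod_ge0 z : 0 <= cmod z.
Proof. by case: z => a b; exact: sqrtr_ge0. Qed.

Lemma cmod0 : cmod (0 : R[i]) = 0. Proof. exact: Normc.normc0. Qed.

Lemma cmodM z w : cmod (z * w) = cmod z * cmod w.
Proof. exact: Normc.normcM. Qed.

Lemma cmodN z : cmod (- z) = cmod z.
Proof. exact: normcN. Qed.

Lemma cmodD z w : cmod (z + w) <= cmod z + cmod w.
Proof. exact: le_normcD. Qed.

Lemma cmodB z w : cmod (z - w) <= cmod z + cmod w.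
Proof. by rewrite -(cmodN w); exact: cmodD. Qed.

Lemma cmodBC z w : cmod (z - w) = cmod (w - z).
Proof. by rewrite -cmodN opprB. Qed.

Lemma cmod_dist z w : cmod z <= cmod w + cmod (z - w).
Proof. by rewrite -[X in cmod X <= _](subrK w) addrC; exact: cmodD. Qed.

Lemma cmodJ z : cmod z^*%C = cmod z.
Proof. by case: z => a b; rewrite /cmod /= sqrrN. Qed.

Lemma cmod_real r : cmod r%:C%C = `|r|.
Proof. by rewrite /cmod /= expr0n /= addr0 sqrtr_sqr. Qed.

Lemma cmod_eq0 z : (cmod z == 0) = (z == 0).
Proof.
by apply/eqP/eqP => [/Normc.eq0_normc//|->]; exact: cmod0.
Qed.

Lemma cmod_sum (I : Type) (s : seq I) (P : pred I) (F : I -> R[i]) :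
  cmod (\sum_(i <- s | P i) F i) <= \sum_(i <- s | P i) cmod (F i).
Proof.
elim/big_rec2: _ => [|i x y _ xy]; first by rewrite cmod0.
by rewrite (le_trans (cmodD _ _))// lerD2l.
Qed.

Lemma Re_le_cmod z : `|complex.Re z| <= cmod z.
Proof.
case: z => a b; rewrite /cmod /= -sqrtr_sqr ler_wsqrtr//.
by rewrite lerDl sqr_ge0.
Qed.

Lemma Im_le_cmod z : `|complex.Im z| <= cmod z.
Proof.
case: z => a b; rewrite /cmod /= -sqrtr_sqr ler_wsqrtr//.
by rewrite lerDr sqr_ge0.
Qed.

Lemma cmod_le_ReIm z : cmod z <= `|complex.Re z| + `|complex.Im z|.
Proof.
case: z => a b; rewrite /cmod /=.
rewrite -[leRHS]ger0_norm ?addr_ge0// -sqrtr_sqr ler_wsqrtr// sqrrD.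
by rewrite !real_normK ?num_real// lerD2r lerDl mulrn_wge0// mulr_ge0.
Qed.

Lemma mulJ_cmod z : z * z^*%C = (cmod z ^+ 2)%:C%C.
Proof.
case: z => a b; rewrite /cmod /= sqr_sqrtr ?addr_ge0 ?sqr_ge0//.
by apply/eqP; rewrite eq_complex /=; apply/andP; split; apply/eqP; ring.
Qed.

Lemma ReD z w : complex.Re (z + w) = complex.Re z + complex.Re w.
Proof. by case: z w => [a b] [c e]. Qed.

Lemma ImD z w : complex.Im (z + w) = complex.Im z + complex.Im w.
Proof. by case: z w => [a b] [c e]. Qed.

Lemma ReM z w : complex.Re (z * w) =
  complex.Re z * complex.Re w - complex.Im z * complex.Im w.
Proof. by case: z w => [a b] [c e]. Qed.

Lemma ImM z w : complex.Im (z * w) =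
  complex.Re z * complex.Im w + complex.Im z * complex.Re w.
Proof. by case: z w => [a b] [c e]; rewrite /= addrC. Qed.

Lemma ReJ z : complex.Re z^*%C = complex.Re z. Proof. by case: z. Qed.

Lemma ImJ z : complex.Im z^*%C = - complex.Im z. Proof. by case: z. Qed.

Lemma conjcM z w : (z * w)^*%C = z^*%C * w^*%C.
Proof. exact: rmorphM. Qed.

Lemma conjcD z w : (z + w)^*%C = z^*%C + w^*%C.
Proof. exact: rmorphD. Qed.

Lemma complex_ext z w : complex.Re z = complex.Re w ->
  complex.Im z = complex.Im w -> z = w.
Proof. by case: z w => [a b] [c e] /= -> ->. Qed.

End complex_modulus.

(** * Measurability of complex-valued functions *)

Section complex_measurability.
Context {d : measure_display} {T : measurableType d} {R : realType}.
Implicit Types f g : T -> R[i].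

Lemma cmeasurable_cst (c : R[i]) : cmeasurable (fun _ : T => c).
Proof. by split; exact: measurable_cst. Qed.

Lemma cmeasurableD f g : cmeasurable f -> cmeasurable g ->
  cmeasurable (fun x => f x + g x).
Proof.
move=> [f1 f2] [g1 g2]; split.
  by under eq_fun do rewrite ReD; exact: measurable_funD.
by under eq_fun do rewrite ImD; exact: measurable_funD.
Qed.

Lemma cmeasurableM f g : cmeasurable f -> cmeasurable g ->
  cmeasurable (fun x => f x * g x).
Proof.
move=> [f1 f2] [g1 g2]; split.
  by under eq_fun do rewrite ReM; apply: measurable_funB; exact: measurable_funM.
by under eq_fun do rewrite ImM; apply: measurable_funD; exact: measurable_funM.
Qed.

Lemma cmeasurableJ f : cmeasurable f -> cmeasurable (fun x => (f x)^*%C).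
Proof.
move=> [f1 f2]; split; first by under eq_fun do rewrite ReJ.
by under eq_fun do rewrite ImJ; exact: measurableT_comp.
Qed.

Lemma cmeasurableZ (c : R[i]) f : cmeasurable f -> cmeasurable (fun x => c * f x).
Proof. by apply: cmeasurableM; exact: cmeasurable_cst. Qed.

Lemma cmeasurableB f g : cmeasurable f -> cmeasurable g ->
  cmeasurable (fun x => f x - g x).
Proof.
move=> mf mg; under eq_fun do rewrite -mulN1r.
by apply: cmeasurableD => //; exact: cmeasurableZ.
Qed.

Lemma measurable_cmod f : cmeasurable f ->
  measurable_fun setT (fun x => cmod (f x)).
Proof.
move=> [mf1 mf2].
rewrite (_ : (fun x => _) =
    fun x => Num.sqrt (complex.Re (f x) ^+ 2 + complex.Im (f x) ^+ 2)); last first.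
  by apply/funext => x; case: (f x).
apply: (measurable_comp measurableT) => //; first exact: (continuous_measurable_fun (@sqrt_continuous R)).
by apply: measurable_funD; exact: measurable_funX.
Qed.

Lemma measurable_cmodE f : cmeasurable f ->
  measurable_fun setT (fun x => (cmod (f x))%:E).
Proof. by move=> mf; apply/measurable_EFinP; exact: measurable_cmod. Qed.

Lemma cmeasurable_comp {d'} {T' : measurableType d'} (u : T' -> T) f :
  cmeasurable f -> measurable_fun setT u -> cmeasurable (fun x => f (u x)).
Proof. by move=> [mf1 mf2] mu; split;
  [exact: (measurableT_comp mf1 mu)|exact: (measurableT_comp mf2 mu)]. Qed.

End complex_measurability.
Arguments cmeasurable_comp {d T R d' T'} u [f].

Section nonneg_integral.
Context {d : measure_display} {T : measurableType d} {R : realType}.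
Variable mu : {measure set T -> \bar R}.
Local Open Scope ereal_scope.

(* No measurability is needed: for nonnegative functions the integral is the
   supremum of the integrals of the simple functions below. *)
Lemma ge0_le_integral_nomeas (f g : T -> \bar R) :
  (forall x, 0 <= f x) -> (forall x, f x <= g x) ->
  \int[mu]_x f x <= \int[mu]_x g x.
Proof.
move=> f0 fg; have g0 x : 0 <= g x by exact: le_trans (fg x).
rewrite !ge0_integralTE//; apply: le_ereal_sup => _ [h hf <-].
by exists h => // x; exact: le_trans (hf x) (fg x).
Qed.

(** Local maximal functions and the inner norms of a mixed norm enter only through this
    monotonicity; their measurability is never established. *)
Lemma le_Lnorm_nomeas (p : \bar R) (f g : T -> \bar R) : 0 < p ->
  (forall x, `|f x| <= `|g x|) -> 'N[mu]_p[f] <= 'N[mu]_p[g].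
Proof.
move=> p0 fg; rewrite unlock; case: p p0 => [r|_|//].
  rewrite lte_fin => r0; apply: gt0_ler_poweR.
  - by rewrite invr_ge0 ltW.
  - by rewrite in_itv /= leey andbT integral_ge0// => x _; exact: poweR_ge0.
  - by rewrite in_itv /= leey andbT integral_ge0// => x _; exact: poweR_ge0.
  apply: ge0_le_integral_nomeas => x; first exact: poweR_ge0.
  by apply: gt0_ler_poweR; rewrite ?in_itv /= ?leey ?abse_ge0 ?(ltW r0).
by case: ifPn => // _; apply: le_ess_sup; exact: nearW.
Qed.

End nonneg_integral.

(** * Integration of complex-valued functions *)

Section complex_integration.
Context {d : measure_display} {T : measurableType d} {R : realType}.
Variable mu : {measure set T -> \bar R}.
Implicit Types f g : T -> R[i].

Definition cintegrable f :=
  cmeasurable f /\ (\int[mu]_x (cmod (f x))%:E < +oo)%E.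

Lemma cintegrable_Re f : cintegrable f ->
  mu.-integrable setT (EFin \o (fun x => complex.Re (f x))).
Proof.
move=> [[mf _] fi]; apply/integrableP; split; first exact/measurable_EFinP.
apply: le_lt_trans fi; apply: ge0_le_integral_nomeas => //= x.
by rewrite lee_fin Re_le_cmod.
Qed.

Lemma cintegrable_Im f : cintegrable f ->
  mu.-integrable setT (EFin \o (fun x => complex.Im (f x))).
Proof.
move=> [[_ mf] fi]; apply/integrableP; split; first exact/measurable_EFinP.
apply: le_lt_trans fi; apply: ge0_le_integral_nomeas => //= x.
by rewrite lee_fin Im_le_cmod.
Qed.

Lemma le_cintegrable f (g : T -> R) : cmeasurable f ->
  (forall x, cmod (f x) <= g x) -> (\int[mu]_x (g x)%:E < +oo)%E ->
  cintegrable f.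
Proof.
move=> mf fg gi; split => //; apply: le_lt_trans gi.
by apply: ge0_le_integral_nomeas => x; rewrite lee_fin ?cmod_ge0.
Qed.

Lemma cintegrableZ (c : R[i]) f : cintegrable f -> cintegrable (fun x => c * f x).
Proof.
move=> [mf fi]; split; first exact: cmeasurableZ.
under eq_integral do rewrite cmodM EFinM.
rewrite ge0_integralZl_EFin//; first last.
- exact: cmod_ge0.
- exact: measurable_cmodE.
- by move=> x _; rewrite lee_fin cmod_ge0.
by rewrite lte_mul_pinfty// lee_fin cmod_ge0.
Qed.

Lemma eq_cintegral f g : f =1 g -> cintegral mu f = cintegral mu g.
Proof. by move=> /funext ->. Qed.

Lemma cintegral0 : cintegral mu (fun=> 0) = 0.
Proof. by rewrite /cintegral /Rintegral !integral0. Qed.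

Lemma cintegralD f g : cintegrable f -> cintegrable g ->
  cintegral mu (fun x => f x + g x) = cintegral mu f + cintegral mu g.
Proof.
move=> fi gi; apply: complex_ext; rewrite ?ReD ?ImD /=.
  under eq_Rintegral do rewrite ReD.
  by rewrite RintegralD//; exact: cintegrable_Re.
under eq_Rintegral do rewrite ImD.
by rewrite RintegralD//; exact: cintegrable_Im.
Qed.

Lemma cintegralZ (c : R[i]) f : cintegrable f ->
  cintegral mu (fun x => c * f x) = c * cintegral mu f.
Proof.
move=> fi; have iR := cintegrable_Re fi; have iI := cintegrable_Im fi.
apply: complex_ext; rewrite ?ReM ?ImM /=.
  under eq_Rintegral do rewrite ReM.
  rewrite RintegralB//; last 2 first.
  - exact: (integrableZl measurableT (complex.Re c) iR).
  - exact: (integrableZl measurableT (complex.Im c) iI).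
  by rewrite !RintegralZl.
under eq_Rintegral do rewrite ImM.
rewrite RintegralD//; last 2 first.
- exact: (integrableZl measurableT (complex.Re c) iI).
- exact: (integrableZl measurableT (complex.Im c) iR).
by rewrite !RintegralZl.
Qed.

Lemma cintegralZr (c : R[i]) f : cintegrable f ->
  cintegral mu (fun x => f x * c) = cintegral mu f * c.
Proof.
by move=> fi; under eq_cintegral do rewrite mulrC; rewrite cintegralZ// mulrC.
Qed.

Lemma cintegralJ f : cintegral mu (fun x => (f x)^*%C) = (cintegral mu f)^*%C.
Proof.
apply: complex_ext; rewrite ?ReJ ?ImJ /=.
  by under eq_Rintegral do rewrite ReJ.
under eq_Rintegral do rewrite ImJ.
rewrite /Rintegral integralE [in RHS]integralE/=.
have -> : ((fun x => (- complex.Im (f x))%:E)^\+ = (fun x => (complex.Im (f x))%:E)^\-)%E.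
  by apply/funext => x; rewrite !unlock.
have -> : ((fun x => (- complex.Im (f x))%:E)^\- = (fun x => (complex.Im (f x))%:E)^\+)%E.
  by apply/funext => x; rewrite !unlock /= opprK.
set a := integral _ _ _; set b := integral _ _ _.
by case: a => [a| |]; case: b => [b| |] //=; rewrite ?opprB ?oppr0.
Qed.

Lemma cintegralB f g : cintegrable f -> cintegrable g ->
  cintegral mu (fun x => f x - g x) = cintegral mu f - cintegral mu g.
Proof.
move=> fi gi; under eq_cintegral do rewrite -mulN1r.
rewrite cintegralD//; last exact: cintegrableZ.
by rewrite cintegralZ// mulN1r.
Qed.

(* Rotating the integral to the positive half line reduces the bound to that
   of the real part. *)
Lemma le_cmod_cintegral f : cmeasurable f ->
  ((cmod (cintegral mu f))%:E <= \int[mu]_x (cmod (f x))%:E)%E.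
Proof.
move=> mf; have [fi|] := ltP (\int[mu]_x (cmod (f x))%:E)%E +oo%E; last first.
  by rewrite leye_eq => /eqP ->; rewrite leey.
have If : cintegrable f by [].
have [->|I0] := eqVneq (cintegral mu f) 0.
  by rewrite cmod0 integral_ge0// => x _; rewrite lee_fin cmod_ge0.
set c := cintegral mu f in I0 *.
pose w := c^*%C / (cmod c)%:C%C.
have c0 : cmod c != 0 by rewrite cmod_eq0.
have cw : cmod w = 1.
  rewrite /w cmodM cmodJ [X in _ * X](_ : _ = (cmod c)^-1) ?divff//.
  by rewrite [LHS]Normc.normcV; congr _^-1; rewrite [LHS]cmod_real ger0_norm ?cmod_ge0.
have wc : w * c = (cmod c)%:C%C.
  rewrite /w mulrAC [_ * c]mulrC mulJ_cmod rmorphXn /= expr2 mulfK//.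
  by rewrite (inj_eq (@complexI R)).
have : cintegral mu (fun x => w * f x) = (cmod c)%:C%C by rewrite cintegralZ.
move=> /(congr1 (@complex.Re _)) /= <-.
have wi : cintegrable (fun x => w * f x) by exact: cintegrableZ.
rewrite /Rintegral fineK; last first.
  by apply: integrable_fin_num => //; exact: cintegrable_Re wi.
apply: le_trans (lee_abs _) _; apply: le_trans.
  apply: le_abse_integral => //; first exact: measurable_int (cintegrable_Re wi).
apply: ge0_le_integral_nomeas => x //=; rewrite lee_fin.
by rewrite (le_trans (Re_le_cmod _))// cmodM cw mul1r.
Qed.

End complex_integration.

Section complex_fubini.
Context {d1 d2 : measure_display} {T1 : measurableType d1}
  {T2 : measurableType d2} {R : realType}.
Variables (m1 : {sigma_finite_measure set T1 -> \bar R})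
  (m2 : {sigma_finite_measure set T2 -> \bar R}).
Implicit Type f : T1 * T2 -> R[i].

Lemma measurable_Rintegral_section (f : T1 * T2 -> R) : measurable_fun setT f ->
  measurable_fun setT (fun x => \int[m2]_y f (x, y)).
Proof.
move=> mf; rewrite /Rintegral; apply: measurableT_comp => //.
rewrite (_ : (fun x => _) = (fun x => \int[m2]_y (EFin \o f)^\+%E (x, y) -
    \int[m2]_y (EFin \o f)^\-%E (x, y))%E); last first.
  apply/funext => x; rewrite integralE.
  by congr (_ - _)%E; apply: eq_integral => y _; rewrite !unlock.
have mE : measurable_fun setT (EFin \o f) by exact/measurable_EFinP.
apply: emeasurable_funB.
- by apply: (measurable_fun_fubini_tonelli_F (EFin \o f)^\+%E) => //;
    exact: measurable_funepos.
- by apply: (measurable_fun_fubini_tonelli_F (EFin \o f)^\-%E) => //;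
    exact: measurable_funeneg.
Qed.

Lemma cmeasurable_cintegral f : cmeasurable f ->
  cmeasurable (fun x => cintegral m2 (fun y => f (x, y))).
Proof.
move=> [mf1 mf2]; split => /=.
- exact: (measurable_Rintegral_section mf1).
- exact: (measurable_Rintegral_section mf2).
Qed.

(** [Rintegral] is [fine] of an extended integral. Integrability of every section, rather than of
    almost every one, allows [fineK] at each point, so that both iterated integrals become extended
    ones. *)
Lemma Rintegral_fubini (f : T1 * T2 -> R) : measurable_fun setT f ->
  (\int[m1]_x \int[m2]_y `|(f (x, y))%:E| < +oo)%E ->
  (forall x, m2.-integrable setT (fun y => (f (x, y))%:E)) ->
  (forall y, m1.-integrable setT (fun x => (f (x, y))%:E)) ->
  \int[m1]_x (\int[m2]_y f (x, y)) = \int[m2]_y (\int[m1]_x f (x, y)).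
Proof.
move=> mf fi i2 i1; rewrite /Rintegral; congr fine.
under eq_integral => x _.
  rewrite fineK; last exact: integrable_fin_num (i2 x).
  over.
under [RHS]eq_integral => x _.
  rewrite fineK; last exact: integrable_fin_num (i1 x).
  over.
apply: (@Fubini _ _ _ _ _ m1 m2 (EFin \o f)).
by apply/integrable12ltyP => //; exact/measurable_EFinP.
Qed.

Lemma cintegral_fubini f : cmeasurable f ->
  (\int[m1]_x \int[m2]_y (cmod (f (x, y)))%:E < +oo)%E ->
  (forall x, (\int[m2]_y (cmod (f (x, y)))%:E < +oo)%E) ->
  (forall y, (\int[m1]_x (cmod (f (x, y)))%:E < +oo)%E) ->
  cintegral m1 (fun x => cintegral m2 (fun y => f (x, y))) =
  cintegral m2 (fun y => cintegral m1 (fun x => f (x, y))).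
Proof.
move=> mf fi fx fy.
have ix x : cintegrable m2 (fun y => f (x, y)).
  by split => //; apply: (cmeasurable_comp (pair x)).
have iy y : cintegrable m1 (fun x => f (x, y)).
  by split => //; apply: (cmeasurable_comp (pair^~ y)).
apply: complex_ext => /=.
- apply: (@Rintegral_fubini (fun z => complex.Re (f z))) => [|||].
  + by case: mf.
  + apply: le_lt_trans fi; apply: ge0_le_integral_nomeas => x.
      exact: integral_ge0.
    by apply: ge0_le_integral_nomeas => y //=; rewrite lee_fin Re_le_cmod.
  + by move=> x; exact: cintegrable_Re (ix x).
  + by move=> y; exact: cintegrable_Re (iy y).
- apply: (@Rintegral_fubini (fun z => complex.Im (f z))) => [|||].
  + by case: mf.
  + apply: le_lt_trans fi; apply: ge0_le_integral_nomeas => x.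
      exact: integral_ge0.
    by apply: ge0_le_integral_nomeas => y //=; rewrite lee_fin Im_le_cmod.
  + by move=> x; exact: cintegrable_Im (ix x).
  + by move=> y; exact: cintegrable_Im (iy y).
Qed.

End complex_fubini.

(** * Square integrable functions and their inner product *)

Section square_integrable.
Context {d : measure_display} {T : measurableType d} {R : realType}.
Variable mu : {measure set T -> \bar R}.
Implicit Types f g h : T -> R[i].
Local Notation "'N2 f" := (cLnorm mu 2%:E f) (at level 10).

Lemma integral_cmodM f g : cmeasurable f -> cmeasurable g ->
  (\int[mu]_x (cmod (f x) * cmod (g x))%:E <= 'N2 f * 'N2 g)%E.
Proof.
move=> mf mg.
have := @hoelder _ T R mu (fun x => cmod (f x)) (fun x => cmod (g x)) 2 2
  (measurable_cmod mf) (measurable_cmod mg).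
move=> /(_ ltac:(by []) ltac:(by []) ltac:(by rewrite [RHS]splitr !div1r)).
apply: le_trans; rewrite Lnorm1; apply: ge0_le_integral_nomeas => x.
  by rewrite lee_fin mulr_ge0 ?cmod_ge0.
by rewrite lee_fin ler_norm.
Qed.

Lemma le_inner f g : cmeasurable f -> cmeasurable g ->
  ((cmod (inner mu f g))%:E <= 'N2 f * 'N2 g)%E.
Proof.
move=> mf mg; apply: le_trans (integral_cmodM mf mg).
apply: le_trans.
  by apply: le_cmod_cintegral; apply: cmeasurableM => //; exact: cmeasurableJ.
by apply: ge0_le_integral_nomeas => x; rewrite lee_fin ?cmod_ge0// cmodM cmodJ.
Qed.

Lemma cL2_cintegrable f g : cL2 mu f -> cL2 mu g ->
  cintegrable mu (fun x => f x * (g x)^*%C).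
Proof.
move=> [mf fi] [mg gi]; apply: le_cintegrable.
- by apply: cmeasurableM => //; exact: cmeasurableJ.
- by move=> x; rewrite cmodM cmodJ; exact: lexx.
apply: le_lt_trans (integral_cmodM mf mg) _.
by rewrite lte_mul_pinfty ?Lnorm_ge0// ge0_fin_numE ?Lnorm_ge0.
Qed.

Lemma cLnorm_square f : 
  (cLnorm mu 2%:E f = (\int[mu]_x (cmod (f x) ^+ 2)%:E) `^ 2^-1)%E.
Proof.
rewrite /cLnorm unlock; congr (_ `^ _)%E; apply: eq_integral => x _.
by rewrite /= ger0_norm ?cmod_ge0// powR_mulrn// cmod_ge0.
Qed.

Lemma cLnorm2_ltyE f : (cLnorm mu 2%:E f < +oo)%E <->
  (\int[mu]_x (cmod (f x) ^+ 2)%:E < +oo)%E.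
Proof.
have i0 : (0 <= \int[mu]_x (cmod (f x) ^+ 2)%:E)%E.
  by apply: integral_ge0 => x _; rewrite lee_fin sqr_ge0.
rewrite cLnorm_square; split; last exact: poweR_lty.
by move=> h; apply: lty_poweRy h; rewrite ?invr_neq0.
Qed.

Lemma cLnormD f g : cmeasurable f -> cmeasurable g ->
  ('N2 (fun x => (f x + g x)%R) <= 'N2 f + 'N2 g)%E.
Proof.
move=> mf mg; have := @eminkowski _ T R mu (fun x => (cmod (f x))) (fun x => (cmod (g x))) 2%:E.
move=> /(_ (measurable_cmod mf) (measurable_cmod mg)) /(_ _)/wrap[].
  by rewrite lee_fin ler1n.
apply: le_trans; apply: le_Lnorm_nomeas => // x /=.
by rewrite lee_fin !ger0_norm ?cmod_ge0 ?addr_ge0 ?cmod_ge0// cmodD.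
Qed.

Lemma cLnormZ c f : cmeasurable f -> 
  ('N2 (fun x => (c * f x)%R) = (cmod c)%:E * 'N2 f)%E.
Proof.
move=> mf; rewrite !cLnorm_square.
under eq_integral do rewrite cmodM exprMn EFinM.
rewrite ge0_integralZl_EFin ?sqr_ge0//; first last.
- by apply/measurable_EFinP/measurable_funX; exact: measurable_cmod.
- by move=> x _; rewrite lee_fin sqr_ge0.
rewrite poweRM ?lee_fin ?sqr_ge0//; last first.
  by apply: integral_ge0 => x _; rewrite lee_fin sqr_ge0.
by rewrite poweR_EFin -powR_mulrn ?cmod_ge0// -powRrM divff ?powRr1 ?cmod_ge0.
Qed.

Lemma cL2D f g : cL2 mu f -> cL2 mu g -> cL2 mu (fun x => f x + g x).
Proof.
move=> [mf fi] [mg gi]; split; first exact: cmeasurableD.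
by apply: le_lt_trans (cLnormD mf mg) _; exact: lte_add_pinfty.
Qed.

Lemma cL2Z c f : cL2 mu f -> cL2 mu (fun x => c * f x).
Proof.
move=> [mf fi]; split; first exact: cmeasurableZ.
by rewrite cLnormZ// lte_mul_pinfty// lee_fin cmod_ge0.
Qed.

Lemma cL20 : cL2 mu (fun=> 0).
Proof.
split; first exact: cmeasurable_cst.
apply/cLnorm2_ltyE.
by under eq_integral do rewrite cmod0 expr0n; rewrite integral0.
Qed.

Lemma cL2_sum (I : Type) (s : seq I) (F : I -> T -> R[i]) :
  (forall i, cL2 mu (F i)) -> cL2 mu (fun x => \sum_(i <- s) F i x).
Proof.
move=> mF; elim: s => [|i s IH].
  by under eq_fun do rewrite big_nil; exact: cL20.
by under eq_fun do rewrite big_cons; exact: cL2D.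
Qed.

Lemma cL2B f g : cL2 mu f -> cL2 mu g -> cL2 mu (fun x => f x - g x).
Proof.
move=> mf mg; under eq_fun do rewrite -mulN1r.
by apply: cL2D => //; exact: cL2Z.
Qed.

Lemma innerJ f g : inner mu f g = (inner mu g f)^*%C.
Proof.
rewrite /inner -cintegralJ; apply: eq_cintegral => x.
by rewrite conjcM conjcK mulrC.
Qed.

Lemma innerDl f g h : cL2 mu f -> cL2 mu g -> cL2 mu h ->
  inner mu (fun x => f x + g x) h = inner mu f h + inner mu g h.
Proof.
move=> f2 g2 h2; rewrite /inner -cintegralD; try exact: cL2_cintegrable.
by apply: eq_cintegral => x; rewrite mulrDl.
Qed.

Lemma innerZl c f h : cL2 mu f -> cL2 mu h ->
  inner mu (fun x => c * f x) h = c * inner mu f h.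
Proof.
move=> f2 h2; rewrite /inner -cintegralZ; try exact: cL2_cintegrable.
by apply: eq_cintegral => x; rewrite mulrA.
Qed.

Lemma inner0l h : inner mu (fun=> 0) h = 0.
Proof.
by rewrite /inner; under eq_cintegral do rewrite mul0r; rewrite cintegral0.
Qed.

Lemma innerBl f g h : cL2 mu f -> cL2 mu g -> cL2 mu h ->
  inner mu (fun x => f x - g x) h = inner mu f h - inner mu g h.
Proof.
move=> f2 g2 h2; rewrite -[in RHS]mulN1r -innerZl// -innerDl//; last exact: cL2Z.
by congr (inner mu _ h); apply/funext => x; rewrite (mulN1r (g x)).
Qed.

Lemma inner_suml (I : Type) (s : seq I) (c : I -> R[i]) (F : I -> T -> R[i]) h :
  (forall i, cL2 mu (F i)) -> cL2 mu h ->
  inner mu (fun x => \sum_(i <- s) c i * F i x) h =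
  \sum_(i <- s) c i * inner mu (F i) h.
Proof.
move=> F2 h2; elim: s => [|i s IH].
  by under eq_fun do rewrite big_nil; rewrite big_nil inner0l.
under eq_fun do rewrite big_cons.
rewrite big_cons innerDl//; [by rewrite innerZl// IH|exact: cL2Z|].
by apply: cL2_sum => j; exact: cL2Z.
Qed.

End square_integrable.

(** * The circle and the dual group *)

(** Without a finite subcover the sets [A] minus finite unions generate a proper filter containing
    [A]; a cluster point x of it is contradicted by [W x]. The sets [W x] are neighbourhoods rather
    than open sets, which suits translates of cells. *)
Lemma compact_finite_cover (T : topologicalType) (A : set T) (W : T -> set T) :
  compact A -> (forall x, A x -> nbhs x (W x)) ->
  exists s : seq T, A `<=` [set y | exists2 x, x \in s & W x y].
Proof.
move=> cA AW; apply: contrapT => /forallNP ncov.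
pose B (s : seq T) := A `\` [set y | exists2 x, x \in s & W x y].
pose F := [set S : set T | exists s, B s `<=` S].
have FF : ProperFilter F.
  apply: Build_ProperFilter_ex.
    move=> S [s Bs]; apply: contrapT => /forallNP S0; apply: (ncov s) => y Ay.
    by apply: contrapT => ny; apply: (S0 y); exact: Bs.
  split; first by exists [::].
    move=> P P' [s Bs] [s' Bs']; exists (s ++ s') => y [Ay ny]; split.
      by apply: Bs; split => // -[x xs Wx]; apply: ny; exists x; rewrite // mem_cat xs.
    apply: Bs'; split => // -[x xs Wx]; apply: ny.
    by exists x; rewrite // mem_cat xs orbT.
  by move=> P P' PP' [s Bs]; exists s; exact: subset_trans PP'.
have FA : F A by exists [::] => y [].
have [x [Ax clx]] := cA F FF FA.
have FB : F (B [:: x]) by exists [:: x].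
have [y [[Ay ny] Wy]] := clx _ _ FB (AW x Ax).
by apply: ny; exists x; rewrite ?mem_head.
Qed.

Section complex_topology.
Context {R : realType}.
Implicit Types (z w : R[i]).

Lemma nbhs_cmodP (z : R[i]) (A : set R[i]) :
  nbhs (z : R[i]^o) A <-> exists2 e : R, 0 < e & forall w, cmod (z - w) < e -> A w.
Proof.
split.
  move=> /nbhs_normP[e /= e0 eA].
  move: e0; rewrite ltcE => /andP[/eqP Ie Re0].
  exists (complex.Re e) => // w zw; apply: eA => /=.
  by rewrite /ball_ /= normr_cmod ltcE /= Ie eqxx.
move=> [e e0 eA]; apply/(@nbhs_normP _ R[i]^o); exists e%:C%C => /=.
  by rewrite ltcE /= eqxx.
by move=> w; rewrite /ball_ /= normr_cmod ltcE /= eqxx /=; exact: eA.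
Qed.

Lemma cvg_cmodP (I : Type) (F : set_system I) (f : I -> R[i]) z : Filter F ->
  (f @ F --> (z : R[i]^o)) <->
  forall e, 0 < e -> \forall x \near F, cmod (z - f x) < e.
Proof.
move=> FF; split=> [fz e e0|fz A /nbhs_cmodP[e e0 eA]].
  by apply: (fz [set w | cmod (z - w) < e]); apply/nbhs_cmodP; exists e.
by apply: filterS (fz e e0) => x /=; exact: eA.
Qed.

Lemma cmod_lipschitz z w : `|cmod z - cmod w| <= cmod (z - w).
Proof.
have h1 := cmod_dist z w; have h2 := cmod_dist w z; rewrite cmodBC in h2.
rewrite ler_norml; lra.
Qed.

Lemma cmod_continuous : continuous (cmod : R[i]^o -> R).
Proof.
move=> z; apply/(@cvgrPdist_lt _ _ _ _ (nbhs_filter z)) => e e0.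
suff : \forall w \near (z : R[i]^o), cmod (z - w) < e.
  by apply: filterS => w; apply: le_lt_trans; exact: cmod_lipschitz.
by apply/nbhs_cmodP; exists e.
Qed.

Lemma conjc_continuous : continuous (conjc : R[i]^o -> R[i]^o).
Proof.
move=> z; apply/(@cvg_cmodP _ _ _ _ (nbhs_filter z)) => e e0.
apply: (iffRL (nbhs_cmodP _ _)); exists e => // w.
by rewrite -cmodJ rmorphB.
Qed.

Lemma ccontinuous_ReIm (T : topologicalType) (f : T -> R[i]) :
  continuous (fun x => complex.Re (f x)) ->
  continuous (fun x => complex.Im (f x)) -> continuous (f : T -> R[i]^o).
Proof.
move=> cRe cIm x; apply/cvg_cmodP => e e0.
have e2 : 0 < e / 2 by rewrite divr_gt0.
move/cvgrPdist_lt : (cRe x) => /(_ _ e2) h1.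
move/cvgrPdist_lt : (cIm x) => /(_ _ e2) h2.
near=> y; apply: le_lt_trans (cmod_le_ReIm _) _.
rewrite [ltRHS]splitr; apply: ltrD.
  have -> : complex.Re (f x - f y) = complex.Re (f x) - complex.Re (f y).
    by case: (f x) (f y) => ? ? [].
  by near: y.
have -> : complex.Im (f x - f y) = complex.Im (f x) - complex.Im (f y).
  by case: (f x) (f y) => ? ? [].
by near: y.
Unshelve. all: by end_near. Qed.

Lemma Re_continuous : continuous (@complex.Re R : R[i]^o -> R).
Proof.
move=> z; apply/(@cvgrPdist_lt _ _ _ _ (nbhs_filter z)) => e e0; apply/nbhs_cmodP; exists e => // w.
apply: le_lt_trans; apply: le_trans (Re_le_cmod _).
by case: z w => ? ? [].
Qed.

Lemma Im_continuous : continuous (@complex.Im R : R[i]^o -> R).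
Proof.
move=> z; apply/(@cvgrPdist_lt _ _ _ _ (nbhs_filter z)) => e e0; apply/nbhs_cmodP; exists e => // w.
apply: le_lt_trans; apply: le_trans (Im_le_cmod _).
by case: z w => ? ? [].
Qed.

Lemma expiD (s t : R) : expi (s + t) = expi s * expi t.
Proof.
by apply: complex_ext; rewrite ?ReM ?ImM /= ?cosD ?sinD//; ring.
Qed.

Lemma expi0 : expi 0 = 1 :> R[i].
Proof. by rewrite /expi cos0 sin0. Qed.

Lemma expi_pi : expi pi = -1 :> R[i].
Proof. by apply: complex_ext; rewrite /= ?cospi// sinpi oppr0. Qed.

Lemma cmod_expi (t : R) : cmod (expi t) = 1.
Proof. by rewrite /cmod /expi /= cos2Dsin2 sqrtr1. Qed.

Lemma expiN (t : R) : expi (- t) = (expi t)^*%C.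
Proof. by rewrite /expi cosN sinN. Qed.

Lemma expi_continuous : continuous (expi : R -> R[i]^o).
Proof.
apply: ccontinuous_ReIm; first exact: continuous_cos.
exact: continuous_sin.
Qed.

Lemma expi_surj z : cmod z = 1 -> exists2 t, -pi <= t <= pi & z = expi t.
Proof.
case: z => a b; rewrite /cmod /= => ab1.
have {}ab1 : a ^+ 2 + b ^+ 2 = 1.
  have ab0 : 0 <= a ^+ 2 + b ^+ 2 by rewrite addr_ge0 ?sqr_ge0.
  by rewrite -(sqr_sqrtr ab0) ab1 expr1n.
have a1 : -1 <= a <= 1.
  rewrite -ler_norml -(@ler_pXn2r _ 2)// ?nnegrE// real_normK ?num_real//.
  by rewrite expr1n -ab1 lerDl sqr_ge0.
have bE : sin (acos a) = `|b|.
  by rewrite sin_acos// -ab1 addrAC subrr add0r sqrtr_sqr.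
have a0 := acos_ge0 a1; have api := acos_lepi a1.
have [b0|b0] := leP 0 b.
  exists (acos a); first by rewrite api andbT (le_trans _ a0)// oppr_le0 pi_ge0.
  by apply: complex_ext => /=; rewrite ?acosK// bE ger0_norm.
exists (- acos a); first by rewrite lerN2 api /= (le_trans _ (pi_ge0 R))// oppr_le0.
by apply: complex_ext => /=; rewrite ?cosN ?sinN ?acosK// bE ltr0_norm// opprK.
Qed.

End complex_topology.

Section circle_topology.
Context {R : realType}.
Implicit Type z : circle R.

Lemma cmod_circle z : cmod (circle_val z) = 1.
Proof. by have := circle_norm z; rewrite normr_cmod => -[]. Qed.

Lemma nbhs_circleP z (A : set (circle R)) : nbhs z A <->
  exists2 e : R, 0 < e & forall w, cmod (circle_val z - circle_val w) < e -> A w.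
Proof.
split.
  move=> [B [[C oC CB] Bz BA]].
  have : nbhs (circle_val z : R[i]^o) C.
    by apply: open_nbhs_nbhs; split => //; move: Bz; rewrite -CB.
  by move=> /nbhs_cmodP[e e0 eC]; exists e => // w /eC Cw; apply: BA; rewrite -CB.
move=> [e e0 eA].
have : nbhs (circle_val z : R[i]^o) [set w | cmod (circle_val z - w) < e].
  by apply/nbhs_cmodP; exists e.
move=> /circle_val_continuous; apply: (@filterS _ _ _ _ A) => w /=; exact: eA.
Qed.

Lemma circle_cvgP (I : Type) (F : set_system I) (f : I -> circle R) z : Filter F ->
  (f @ F --> z) <-> ((fun i => circle_val (f i)) @ F --> (circle_val z : R[i]^o)).
Proof.
move=> FF; rewrite cvg_cmodP; split.
  by move=> fz e e0; apply: (fz [set w | cmod (circle_val z - circle_val w) < e]);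
    apply/nbhs_circleP; exists e.
by move=> fz A /nbhs_circleP[e e0 eA]; apply: filterS (fz e e0) => x /=; exact: eA.
Qed.

Fact circle_expi_subproof (t : R) : `|expi t| == 1.
Proof. by rewrite normr_cmod cmod_expi. Qed.

Definition circle_expi t := Circle (circle_expi_subproof t).

Lemma circle_expi_continuous : continuous (circle_expi : R -> circle R).
Proof. by move=> t; apply/circle_cvgP; exact: expi_continuous. Qed.

Lemma compact_circle : compact [set: circle R].
Proof.
rewrite (_ : setT = circle_expi @` `[- pi, pi]%classic); last first.
  apply/seteqP; split => // z _.
  have [t tpi zt] := expi_surj (cmod_circle z).
  by exists t; [rewrite /= in_itv|apply: val_inj].
apply: continuous_compact; last exact: segment_compact.
by apply: continuous_subspaceT => t; exact: circle_expi_continuous.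
Qed.

End circle_topology.

(** * The compact-open topology of the dual group *)

Section dual_topology.
Context {R : realType} {G : lcaType}.
Local Notation Gh := (dual_group R G).
Implicit Types (xi eta : Gh) (x y : G).

Lemma pairing_continuous xi : continuous (pairing xi : G -> R[i]^o).
Proof.
move=> x; apply/circle_cvgP; have [c _] := char_evalP xi; exact: c.
Qed.

Lemma pairingDr xi x y : pairing xi (x + y) = pairing xi x * pairing xi y.
Proof. by rewrite /pairing; have [_ ->] := char_evalP xi. Qed.

Lemma pairing0r xi : pairing xi 0 = 1.
Proof.
have : pairing xi 0 != 0 by rewrite -cmod_eq0 cmod_circle oner_neq0.
by move=> /mulfI; apply; rewrite -pairingDr addr0 mulr1.
Qed.

Lemma cmod_pairing xi x : cmod (pairing xi x) = 1.
Proof. exact: cmod_circle. Qed.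

Lemma pairing_conj xi x : (pairing xi x)^*%C = (pairing xi x)^-1.
Proof.
have u0 : pairing xi x != 0 by rewrite -cmod_eq0 cmod_circle oner_neq0.
apply: (mulfI u0); rewrite mulJ_cmod cmod_pairing expr1n divff//.
Qed.

Lemma pairingNr xi x : pairing xi (- x) = (pairing xi x)^*%C.
Proof.
have u0 : pairing xi x != 0 by rewrite -cmod_eq0 cmod_circle oner_neq0.
by apply: (mulfI u0); rewrite -pairingDr subrr pairing0r pairing_conj divff.
Qed.

Lemma pairingDl xi eta x : pairing (xi + eta) x = pairing xi x * pairing eta x.
Proof. by []. Qed.

Lemma pairing0l x : pairing (0 : Gh) x = 1.
Proof. by []. Qed.

Lemma pairingNl xi x : pairing (- xi) x = (pairing xi x)^*%C.
Proof. by rewrite pairing_conj. Qed.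

Lemma pairingBl xi eta x : pairing (xi - eta) x = pairing xi x * (pairing eta x)^*%C.
Proof. by rewrite pairingDl pairingNl. Qed.

Lemma pairing_ext xi eta : (forall x, pairing xi x = pairing eta x) -> xi = eta.
Proof.
by move=> h; apply: char_eval_inj; apply/funext => x; apply: val_inj; exact: h.
Qed.

(** The compact-open topology on the dual is that of uniform convergence on compact sets. One
    direction extracts a common radius from a compact source set; the other covers [C] by pieces on
    which [xi] is almost constant, each of which gives one subbasic condition. *)
Lemma nbhs_dualP xi (A : set Gh) : nbhs xi A <->
  exists (C : set G) (e : R), [/\ compact C, 0 < e &
    forall eta, (forall x, C x -> cmod (pairing xi x - pairing eta x) < e) -> A eta].
Proof.
split.
  move=> [_ [[B oB <-] Bxi BA]].
  pose F : set_system {compact-open, G -> circle R} := [set S |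
    exists (C : set G) (e : R), [/\ compact C, 0 < e &
    forall f : G -> circle R,
      (forall x, C x -> cmod (pairing xi x - circle_val (f x)) < e) -> S f]].
  have FF : Filter F.
    split; first by exists set0, 1; split => //; exact: compact0.
      move=> P P' [C [e [cC e0 h]]] [C' [e' [cC' e'0 h']]].
      exists (C `|` C'), (Num.min e e'); split; first exact: compactU.
        by rewrite lt_min e0.
      move=> f fC; split; [apply: h|apply: h'] => x Cx.
        by have := fC x (or_introl Cx); rewrite lt_min => /andP[].
      by have := fC x (or_intror Cx); rewrite lt_min => /andP[].
    move=> P P' PP' [C [e [cC e0 h]]]; exists C, e; split => // f fC.
    by apply: PP'; exact: h.
  (* [F] consists of the sets containing all functions uniformly close to [xi] on some compact set.
     Its convergence is tested on subbasic conditions K -> O, where compactness of [K] yields one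
     radius for all points. *)
  have /(_ B) : F --> (char_eval xi : {compact-open, G -> circle R}).
    apply/compact_open_cvgP => K O cK oO KO.
    pose P (e : R) x := forall w : circle R,
      cmod (pairing xi x - circle_val w) < e -> O w.
    have : \forall e \near (0 : R)^'+, K `<=` P e.
      move/compact_near_coveringP : cK; apply => x Kx.
      have : nbhs (char_eval xi x) O.
        by apply: open_nbhs_nbhs; split => //; apply: KO; exists x.
      move=> /nbhs_circleP[e e0 eO].
      have e2 : 0 < e / 2 by rewrite divr_gt0.
      have /cvg_cmodP /(_ _ e2) h := @pairing_continuous xi x.
      exists ([set y | cmod (pairing xi x - pairing xi y) < e / 2],
              [set t | t < e / 2]); first by split => //=; exact: nbhs_right_lt.
      move=> [y t] /= [xy te] w wt; apply: eO; rewrite -/(pairing xi x).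
      rewrite -[X in X - _](subrK (pairing xi y)) -addrA.
      apply: le_lt_trans (cmodD _ _) _.
      by rewrite [ltRHS]splitr ltrD// (lt_trans wt).
    move=> h.
    have [e [/= e0 Ke]] : exists e : R, 0 < e /\ K `<=` P e.
      have := @filter_ex _ _ _ _ (filterI (nbhs_right_gt (0 : R)) h).
      by move=> [e [e0 Ke]]; exists e.
    exists K, e; split => // f fK _ [x Kx <-]; apply: (Ke x Kx).
    exact: fK.
  have nB : nbhs (char_eval xi : {compact-open, G -> circle R}) B.
    by apply: open_nbhs_nbhs; split.
  move=> /(_ nB) [C [e [cC e0 h]]]; exists C, e; split => // eta etaC.
  by apply: BA; apply: h.
move=> [C [e [cC e0 eA]]].
suff : \forall eta \near xi, C `<=` (fun x => cmod (pairing xi x - pairing eta x) < e).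
  by apply: filterS => eta h; apply: eA => x; exact: h.
have cvC : near_covering_within C.
  by apply/near_covering_withinP; exact/compact_near_coveringP.
apply: (cvC _ (nbhs xi) (fun eta x => cmod (pairing xi x - pairing eta x) < e)).
move=> x Cx.
have e3 : 0 < e / 3 by rewrite divr_gt0.
(* The bound in [D] is not strict, so that [D] is compact, and the one in [O] is strict, so that [O]
   is open. As e/3 < e/2 the character [xi] maps [D] into [O], and e/3 + e/2 < e closes the
   estimate. *)
pose D := C `&` [set y | cmod (pairing xi x - pairing xi y) <= e / 3].
pose O := [set w : circle R | cmod (pairing xi x - circle_val w) < e / 2].
have oO : open O.
  rewrite openE => w Ow; apply/nbhs_circleP.
  exists (e / 2 - cmod (pairing xi x - circle_val w)); first by rewrite subr_gt0.
  move=> u wu; rewrite /O /= -[X in X - _](subrK (circle_val w)) -addrA.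
  by apply: le_lt_trans (cmodD _ _) _; rewrite -ltrBrDl.
have cD : compact D.
  apply: compact_closedI => //.
  apply: (@preimage_closed _ _ (fun y => cmod (pairing xi x - pairing xi y)) [set t | t <= e / 3]); last exact: closed_le.
  move=> y _; apply: (continuous_comp (f := fun y => pairing xi x - pairing xi y : R[i]^o)); last exact: cmod_continuous.
  by apply: cvgB; [exact: cvg_cst|exact: pairing_continuous].
have DO : (char_eval xi) @` D `<=` O.
  move=> _ [y [_ /= xy] <-]; rewrite /O /=; apply: le_lt_trans xy _.
  by rewrite ltr_pM2l// ltf_pV2 ?posrE// ltr_nat.
have /cvg_cmodP /(_ _ e3) h := @pairing_continuous xi x.
exists ([set y | cmod (pairing xi x - pairing xi y) < e / 3],
        [set eta : Gh | char_eval eta @` D `<=` O]).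
  split => //=; apply: open_nbhs_nbhs; split => //.
  by exists [set g : {compact-open, G -> circle R} | g @` D `<=` O] => //;
    exact: compact_open_open.
move=> [y eta] /= [xy etaD] Cy.
have := etaD (char_eval eta y) (ex_intro2 _ _ _ (conj Cy (ltW xy)) erefl).
rewrite /O /= => xe.
rewrite -[X in X - _](subrK (pairing xi x)) -addrA.
apply: le_lt_trans (cmodD _ _) _; rewrite cmodBC.
apply: lt_le_trans (ltrD xy xe) _; rewrite -mulrDr ler_piMr ?ltW//; lra.
Qed.

(** Joint continuity rests on local compactness: on a compact neighbourhood [C] of x, characters
    near [xi] are uniformly close to it. *)
Lemma pairing_continuous2 : continuous (fun p : Gh * G => pairing p.1 p.2 : R[i]^o).
Proof.
move=> [xi x]; apply/(@cvg_cmodP _ _ _ _ _ (nbhs_filter (xi, x))) => e e0 /=.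
have e2 : 0 < e / 2 by rewrite divr_gt0.
have [C nC cC] : exists2 C, nbhs x C & compact C.
  have [U] := @lca_locally_compact G x I.
  rewrite /within => nU [cU _]; exists U => //.
  exact: (@filterS _ (nbhs x) _ _ _ (fun y (h : [set: G] y -> U y) => h I) nU).
have /cvg_cmodP /(_ _ e2) h := @pairing_continuous xi x.
exists ([set eta | forall y, C y -> cmod (pairing xi y - pairing eta y) < e / 2],
   C `&` [set y | cmod (pairing xi x - pairing xi y) < e / 2]).
  split => /=; last exact: filterI.
  by apply/nbhs_dualP; exists C, (e / 2).
move=> [eta y] /= [h1 [Cy h2]].
rewrite -[X in X - _](subrK (pairing xi y)) -addrA.
by apply: le_lt_trans (cmodD _ _) _; rewrite [ltRHS]splitr ltrD// h1.
Qed.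

End dual_topology.

Section borel_product.
Context {X : PreTopologicalZmodule.type}.
Hypothesis X_second_countable : @second_countable X.

Lemma open_measurable_borel (Y : PreTopologicalZmodule.type) (O : set Y) :
  open O -> measurable (O : set (borel Y)).
Proof. by move=> oO; exact: sub_sigma_algebra. Qed.

(** The product carries the product sigma-algebra, which can be smaller than the Borel one. A
    countable base of [X] suffices: [O] is the countable union over base sets b of V b x b, where V
    b is the largest open set with V b x b inside [O]. The other factor may thus be the dual group
    or a phase space. *)
Lemma open_measurable_prod {d} {Y : measurableType d} (TY : topologicalType)
    (u : Y -> TY) (O : set (TY * X)) :
  (forall V : set TY, open V -> measurable (u @^-1` V)) -> open O ->
  measurable [set p : Y * borel X | O (u p.1, p.2)].
Proof.
move=> mu oO; have [B cB [oB bB]] := X_second_countable.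
pose V (b : set X) := \bigcup_(W in [set W : set TY | open W /\ W `*` b `<=` O]) W.
have oV b : open (V b) by apply: bigcup_open => W [].
have -> : [set p : Y * borel X | O (u p.1, p.2)] =
    \bigcup_(b : set_type B) ((u @^-1` V (set_val b)) `*` (set_val b : set (borel X))).
  apply/seteqP; split => [[y x] /= Oyx|[y x] [b _] [/= [W [oW WO] Wy] bx]]; last first.
    by apply: WO; split.
  move: oO; rewrite openE => /(_ _ Oyx) [[W b] /= [nW nb] WbO].
  have [b' [Bb' b'x] b'b] := bB x _ nb.
  exists (SigSub (mem_set Bb')) => //=; split => //=.
  exists (W^°)%classic; last exact: nW.
  split; first exact: open_interior.
  by move=> [y' x'] [/= /interior_subset Wy' b'x']; apply: WbO; split => //=; exact: b'b.
apply: countable_bigcupT_measurable.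
  have /countable_injP[f fB] := cB; apply/countable_injP.
  exists (fun b => f (set_val b)) => a b _ _ ab; apply: val_inj.
  by apply: fB ab; rewrite inE; exact: set_valP.
move=> b; apply: measurableX; first exact/mu.
by apply: open_measurable_borel; apply: oB; exact: set_valP.
Qed.

End borel_product.

(** * Characters of $R^d \times G_0$ *)

Section real_characters.
Context {R : realType}.

Lemma cmod_eq1_neq0 (z : R[i]) : cmod z = 1 -> z != 0.
Proof. by move=> z1; rewrite -cmod_eq0 z1 oner_neq0. Qed.

Lemma expi_neq0 (t : R) : expi t != 0.
Proof. by apply: cmod_eq1_neq0; exact: cmod_expi. Qed.

(* Near 0 the values have positive real part, so that square roots can be
   extracted without ambiguity along the dyadic points. *)
Lemma real_character (chi : R -> R[i]) :
  (forall s t, chi (s + t) = chi s * chi t) -> (forall t, cmod (chi t) = 1) ->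
  continuous (chi : R -> R[i]^o) -> exists a, forall t, chi t = expi (a * t).
Proof.
move=> chiD chi1 cchi.
have chi_neq0 t : chi t != 0 by apply: cmod_eq1_neq0.
have chi0 : chi 0 = 1.
  by apply: (mulfI (chi_neq0 0)); rewrite -chiD addr0 mulr1.
have near0 (f : R -> R[i]) e : continuous (f : R -> R[i]^o) -> f 0 = 1 -> 0 < e ->
    exists2 dl : R, 0 < dl & forall s, `|s| < dl -> cmod (1 - f s) < e.
  move=> cf f0 e0.
  have /cvg_cmodP /(_ _ e0) := cf 0; rewrite f0 => /nbhs_ballP[dl /= dl0 h].
  by exists dl => // s sdl; apply: h; rewrite /ball /= sub0r normrN.
have [dl' dl'0 hdl'] := near0 chi 1 cchi chi0 ltr01.
pose dl := dl' / 2.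
have dl0 : 0 < dl by rewrite divr_gt0.
have chiRe s : `|s| <= dl -> 0 < complex.Re (chi s).
  move=> sdl; have := hdl' s (le_lt_trans sdl _).
  rewrite /dl ltr_pdivrMr// ltr_pMr// ltr1n => /(_ isT) h.
  have := le_lt_trans (Re_le_cmod (1 - chi s)) h.
  rewrite ltr_norml => /andP[_].
  rewrite (_ : complex.Re _ = 1 - complex.Re (chi s)); last by case: (chi s).
  by rewrite ltrBlDr ltrDl.
have [th /andP[th1 th2] chith] := expi_surj (chi1 dl).
have cth : 0 < cos th.
  by have := chiRe dl; rewrite chith /=; apply; rewrite gtr0_norm.
have {}th1 : - pi < th.
  rewrite lt_neqAle th1 andbT; apply/eqP => thE; move: cth.
  by rewrite -thE cosN cospi ltr0N1.
have {}th2 : th < pi.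
  rewrite lt_neqAle th2 andbT; apply/eqP => thE; move: cth.
  by rewrite thE cospi ltr0N1.
have pow_gt0 n : 0 < (2 ^+ n : R) by rewrite exprn_gt0.
have thn n : 0 < cos (th / 2 ^+ n.+1).
  have h : `|th| < pi by rewrite ltr_norml th1.
  have : `|th / 2 ^+ n.+1| < pi / 2.
    rewrite normrM normfV (gtr0_norm (pow_gt0 _)) exprS invfM mulrA.
    rewrite mulrAC ltr_pM2r ?invr_gt0//.
    apply: le_lt_trans h; rewrite ler_piMr// invf_le1// exprn_ege1// ler1n//.
  by rewrite ltr_norml => /cos_gt0_pihalf.
have dln n : `|dl / 2 ^+ n| <= dl.
  by rewrite gtr0_norm ?divr_gt0// ler_piMr ?(ltW dl0)// invf_le1// exprn_ege1// ler1n.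
have chin n : chi (dl / 2 ^+ n) = expi (th / 2 ^+ n).
  elim: n => [|n IH]; first by rewrite expr0 !divr1.
  have half (x : R) : x / 2 ^+ n = x / 2 ^+ n.+1 + x / 2 ^+ n.+1.
    by rewrite -mulrDl -mulr2n -[x *+ 2]mulr_natr exprS invfM mulrA mulfK ?pnatr_eq0.
  set u := chi _; set w := expi _.
  have uw : (u - w) * (u + w) = 0.
    have : u * u = w * w by rewrite /u /w -chiD -expiD -!half IH.
    move=> h; rewrite mulrDr !mulrBl h; ring.
  move/eqP : uw; rewrite mulf_eq0 subr_eq0 => /orP[/eqP //|/eqP /(congr1 (@complex.Re R))].
  rewrite ReD /= => h.
  have := addr_gt0 (chiRe _ (dln n.+1)) (thn n).
  by rewrite h ltxx.
(* Dividing by the candidate exponential leaves a character equal to 1 at every integer multiple of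
   [dl / 2 ^+ n], hence on a dense set. *)
pose f t := chi t * expi (- (th / dl * t)).
have fD s t : f (s + t) = f s * f t.
  by rewrite /f chiD mulrDr opprD expiD mulrACA.
have f0 : f 0 = 1 by rewrite /f chi0 mulr0 oppr0 expi0 mulr1.
have f1 t : cmod (f t) = 1 by rewrite /f cmodM chi1 cmod_expi mulr1.
have fn n : f (dl / 2 ^+ n) = 1.
  rewrite /f chin -expiD [th / dl * _]mulrA divfK ?gt_eqF//.
  by rewrite subrr expi0.
have fN t : f t * f (- t) = 1 by rewrite -fD subrr.
have fk (k : int) n : f (k%:~R * (dl / 2 ^+ n)) = 1.
  have fknat (j : nat) : f (j%:R * (dl / 2 ^+ n)) = 1.
    elim: j => [|j IH]; first by rewrite mul0r.
    by rewrite -natr1 mulrDl mul1r fD IH fn mulr1.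
  case: k => j; first exact: fknat.
  rewrite NegzE mulrNz mulNr -[LHS]mul1r -[X in X * _](fknat j.+1); exact: fN.
exists (th / dl) => t.
suff ft : f t = 1.
  apply: (mulIf (expi_neq0 (- (th / dl * t)))).
  by rewrite -/(f t) ft -expiD subrr expi0.
apply/eqP; apply: contrapT => /negP ft.
(* Were f t different from 1, translating t by a multiple of a tiny dyadic step would bring it so
   close to 0 that f is nearer to 1 there than f t is, although the translation does not change the
   value of f. *)
have e0 : 0 < cmod (1 - f t).
  by rewrite lt_neqAle cmod_ge0 andbT eq_sym cmod_eq0 subr_eq0 eq_sym.
have cf : continuous (f : R -> R[i]^o).
  move=> s; apply: (@cvgM R[i]); first exact: cchi.
  apply: continuous_comp; last exact: expi_continuous.
  by apply: cvgN; apply: cvgMr; exact: cvg_id.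
have [eta eta0 heta] := near0 f _ cf f0 e0.
have eta_dl : 0 < eta / dl by rewrite divr_gt0.
have [n _ /(_ n (leqnn n)) hn] := near_infty_natSinv_expn_lt (PosNum eta_dl).
have {hn} dn : dl / 2 ^+ n < eta.
  by move: hn => /=; rewrite ltr_pdivlMr// mulrC mulrA mulr1.
have x0 : 0 < dl / 2 ^+ n by rewrite divr_gt0.
set x := dl / 2 ^+ n in x0 dn.
pose k := Num.floor (t / x).
have fE : f (t - k%:~R * x) = f t by rewrite fD -mulNr -mulrNz fk mulr1.
suff : cmod (1 - f t) < cmod (1 - f t) by rewrite ltxx.
rewrite -[X in cmod (1 - X) < _]fE; apply: heta.
have /andP[k1 k2] := floor_itv (t / x).
rewrite ger0_norm; last by rewrite subr_ge0 -ler_pdivlMr.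
apply: lt_trans dn; rewrite ltrBlDl -ltrBlDr -/x.
have -> : t - x = (t / x - 1) * x by rewrite mulrBl mul1r divfK ?gt_eqF.
by rewrite ltr_pM2r// ltrBlDr; move: k2; rewrite intrD.
Qed.

End real_characters.

Lemma continuous_bigsum (R : realType) (T : topologicalType) (I : Type) (s : seq I)
    (f : I -> T -> R) : (forall i, continuous (f i)) ->
  continuous (fun x => \sum_(i <- s) f i x).
Proof.
move=> cf; elim: s => [|i s IH] x.
  by under eq_fun do rewrite big_nil; exact: cvg_cst.
rewrite /continuous_at; under eq_fun do rewrite big_cons; rewrite big_cons.
by apply: cvgD; [exact: cf|exact: IH].
Qed.

Section euclidean_vectors.
Context {R : realType} {d : nat}.
Implicit Types a b : 'cV[R]_d.

Definition dotv a b : R := \sum_i a i 0 * b i 0.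

Lemma dotvDl a b c : dotv (a + b) c = dotv a c + dotv b c.
Proof. by rewrite -big_split; apply: eq_bigr => i _; rewrite mxE mulrDl. Qed.

Lemma dotvDr a b c : dotv a (b + c) = dotv a b + dotv a c.
Proof. by rewrite -big_split; apply: eq_bigr => i _; rewrite mxE mulrDr. Qed.

Lemma dotvZl t a b : dotv (t *: a) b = t * dotv a b.
Proof. by rewrite /dotv mulr_sumr; apply: eq_bigr => i _; rewrite mxE mulrA. Qed.

Lemma dotvZr t a b : dotv a (t *: b) = t * dotv a b.
Proof. by rewrite /dotv mulr_sumr; apply: eq_bigr => i _; rewrite mxE; ring. Qed.

Lemma dotvNl a b : dotv (- a) b = - dotv a b.
Proof. by rewrite -scaleN1r dotvZl mulN1r. Qed.

Lemma dotvNr a b : dotv a (- b) = - dotv a b.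
Proof. by rewrite -scaleN1r dotvZr mulN1r. Qed.

Lemma dotvC a b : dotv a b = dotv b a.
Proof. by apply: eq_bigr => i _; rewrite mulrC. Qed.

Lemma dotv_delta a i : dotv a (delta_mx i 0) = a i 0.
Proof.
rewrite /dotv (bigD1 i)//= big1 ?addr0; first by rewrite mxE !eqxx mulr1.
by move=> j ji; rewrite mxE (negbTE ji) mulr0.
Qed.

Lemma dotv0r a : dotv a 0 = 0.
Proof. by rewrite /dotv big1// => i _; rewrite mxE mulr0. Qed.

Lemma dotv0l a : dotv 0 a = 0.
Proof. by rewrite dotvC dotv0r. Qed.

Lemma dotv_ge0 a : 0 <= dotv a a.
Proof. by apply: sumr_ge0 => i _; rewrite -expr2 sqr_ge0. Qed.

Lemma cV_sum_delta a : a = \sum_i a i 0 *: delta_mx i 0.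
Proof.
rewrite [LHS]matrix_sum_delta; apply: eq_bigr => i _.
by rewrite (bigD1 0)//= big1 ?addr0// => j; rewrite ord1.
Qed.

Lemma cV_continuous (T : topologicalType) (f : T -> 'cV[R]_d) :
  (forall i, continuous (fun x => f x i 0)) -> continuous f.
Proof.
move=> cf x A [P nP PA].
have : \forall y \near x, forall i : 'I_d, P i 0 (f y i 0).
  by apply: filter_forall => i; apply: cf; exact: nP.
by apply: filterS => y h; apply: PA => i j; rewrite ord1.
Qed.

Lemma dotv_continuous (T : topologicalType) (f g : T -> 'cV[R]_d) :
  continuous f -> continuous g -> continuous (fun x => dotv (f x) (g x)).
Proof.
move=> cf cg; apply: continuous_bigsum => i x; apply: cvgM.
- apply: (@continuous_comp _ _ _ f (fun M : 'cV[R]_d => M i 0)); first exact: cf.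
  exact: coord_continuous.
- apply: (@continuous_comp _ _ _ g (fun M : 'cV[R]_d => M i 0)); first exact: cg.
  exact: coord_continuous.
Qed.

Lemma mulmx_continuous (A : 'M[R]_d) : continuous (mulmx A : 'cV[R]_d -> 'cV[R]_d).
Proof.
apply: cV_continuous => i x.
have -> : (fun a : 'cV[R]_d => (A *m a) i 0) = (fun a => dotv (row i A)^T a).
  by apply/funext => a; rewrite mxE; apply: eq_bigr => j _; rewrite !mxE.
by apply: (dotv_continuous (f := fun=> (row i A)^T) (g := id));
  [exact: cst_continuous|move=> y; exact: cvg_id].
Qed.

Lemma compact_cV_cube (r : R) : compact [set a : 'cV[R]_d | forall i, `|a i 0| <= r].
Proof.
have -> : [set a : 'cV[R]_d | forall i, `|a i 0| <= r] =
    (fun v : 'rV[R]_d => v^T) @` [set v : 'rV[R]_d | forall i, `[-r, r]%classic (v ord0 i)].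
  apply/seteqP; split => [a ar|_ [v vr <-] i].
    exists a^T; last by rewrite trmxK.
    by move=> i; rewrite /= mxE in_itv /= -ler_norml.
  by have := vr i; rewrite /= in_itv /= -ler_norml mxE.
apply: continuous_compact.
  apply: continuous_subspaceT; apply: cV_continuous => i x.
  have -> : (fun v : 'rV[R]_d => v^T i 0) = (fun v => v 0 i).
    by apply/funext => v; rewrite mxE.
  exact: coord_continuous.
by apply: (@rV_compact R d (fun=> `[-r, r]%classic)) => i; exact: segment_compact.
Qed.

Lemma mulmx_bounded (A : 'M[R]_d) (r : R) : exists r', forall a : 'cV[R]_d,
  (forall i, `|a i 0| <= r) -> forall i, `|(A *m a) i 0| <= r'.
Proof.
exists (\sum_i \sum_j `|A i j| * `|r|) => a ar i; rewrite mxE.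
apply: le_trans (ler_norm_sum _ _ _) _.
rewrite [leRHS](bigD1 i)//=; apply: (@le_trans _ _ (\sum_j `|A i j| * `|r|)).
  apply: ler_sum => j _; rewrite normrM ler_wpM2l//.
  exact: le_trans (ar j) (ler_norm _).
rewrite lerDl; apply: sumr_ge0 => k _; apply: sumr_ge0 => j _; exact: mulr_ge0.
Qed.

End euclidean_vectors.

Lemma ultra_compact_cvg (T : Type) (U : topologicalType) (F : set_system T)
    (f : T -> U) (A : set U) : UltraFilter F -> compact A -> F (f @^-1` A) ->
  exists2 z, A z & f @ F --> z.
Proof.
move=> FU cA FA; have [z [Az clz]] := cA _ (fmap_proper_filter f _) FA.
exists z => // N nN; have [//|nF] := in_ultra_setVsetC (f @^-1` N) FU.
have : (f @ F) (~` N) by [].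
by move=> /clz /(_ nN) [w []].
Qed.

Lemma cvg_subr0 (X : topologicalZmodType) (x : X) : (fun y => y - x) @ x --> (0 : X).
Proof.
rewrite -(subrr x).
apply: (@cvg_comp _ _ _ (fun y : X => (y, x)) (fun z => z.1 - z.2) _ (nbhs (x, x))).
  by apply: cvg_pair; [exact: cvg_id|exact: cvg_cst].
exact: (@sub_continuous X (x, x)).
Qed.

(** * An Ascoli theorem for characters *)

Section equicontinuous_characters.
Context {R : realType} {G : lcaType}.
Local Notation Gh := (dual_group R G).

Lemma cmodM1_sub (a b a' b' : R[i]) : cmod a = 1 -> cmod b' = 1 ->
  cmod (a * b - a' * b') <= cmod (a - a') + cmod (b - b').
Proof.
move=> a1 b1; have -> : a * b - a' * b' = (a - a') * b' + a * (b - b') by ring.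
by apply: le_trans (cmodD _ _) _; rewrite !cmodM a1 b1 mulr1 mul1r.
Qed.

(** Along an ultrafilter the values converge at each point, the circle being compact. The pointwise
    limit is multiplicative and inherits equicontinuity at 0, so it is a character; equicontinuity
    and a finite cover then upgrade pointwise convergence to uniform convergence on compact sets. *)
Lemma compact_equicontinuous_characters (E : set Gh) : closed E ->
  (forall e : R, 0 < e -> \forall x \near (0 : G), forall xi, E xi ->
     cmod (1 - pairing xi x) <= e) ->
  compact E.
Proof.
move=> clE equi; rewrite compact_ultra => F FU FE.
have FF : ProperFilter F := @ultra_proper _ _ FU.
have lim x : exists z : circle R, (fun xi : Gh => char_eval xi x) @ F --> z.
  have [|z _ zF] := @ultra_compact_cvg _ _ F (fun xi : Gh => char_eval xi x) _ FU
    (@compact_circle R); first exact: filterS FE.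
  by exists z.
pose chi x := projT1 (cid (lim x)).
have chiF x e : 0 < e -> F [set xi | cmod (circle_val (chi x) - pairing xi x) < e].
  move=> e0; have /circle_cvgP/cvg_cmodP := projT2 (cid (lim x)).
  by move=> /(_ _ e0).
have chiD x y : chi (x + y) = (chi x * chi y)%g.
  apply: val_inj; apply/eqP; apply: contrapT => /negP.
  rewrite -subr_eq0 -cmod_eq0 => c0.
  set c := cmod _ in c0.
  have c3 : 0 < c / 3 by rewrite divr_gt0// lt_neqAle eq_sym c0 cmod_ge0.
  have [xi [[h1 h2] h3]] :=
    @filter_ex _ _ _ _ (filterI (filterI (chiF x _ c3) (chiF y _ c3)) (chiF (x + y) _ c3)).
  have : c < c.
    rewrite [X in X < _](_ : c = cmod ((circle_val (chi (x + y)) - pairing xi (x + y)) +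
      (pairing xi x * pairing xi y - circle_val (chi x) * circle_val (chi y)))); last first.
      by rewrite pairingDr addrA subrK.
    apply: le_lt_trans (cmodD _ _) _.
    have := cmodM1_sub (pairing xi y) (circle_val (chi x)) (cmod_pairing xi x) (cmod_circle (chi y)).
    move: h1 h2; rewrite /= cmodBC => h1; rewrite cmodBC => h2 h4.
    apply: lt_le_trans (ltrD h3 (le_lt_trans h4 (ltrD h1 h2))) _; lra.
  by rewrite ltxx.
have chi_equi e : 0 < e -> \forall x \near (0 : G), cmod (1 - circle_val (chi x)) <= e.
  move=> e0; apply: filterS (equi e e0) => x h.
  apply/ler_addgt0Pr => r r0.
  have [xi [h1 h2]] := @filter_ex _ _ _ _ (filterI FE (chiF x _ r0)).
  rewrite -[X in X - _](subrK (pairing xi x)) -addrA.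
  apply: le_trans (cmodD _ _) _; rewrite lerD//; first exact: h.
  by rewrite cmodBC ltW.
have cchi : character (chi : {compact-open, G -> circle R}).
  split => // x; apply/circle_cvgP/(@cvg_cmodP _ _ _ _ _ (nbhs_filter x)) => e e0.
  have e2 : 0 < e / 2 by rewrite divr_gt0.
  have /= h := chi_equi _ e2.
  have cB := @cvg_subr0 G x.
  apply: (@filterS _ (nbhs x) _
    [set y | cmod (1 - circle_val (chi (y - x))) <= e / 2]); last exact: (cB _ h).
  move=> y /= {}h.
  have -> : circle_val (chi y) = circle_val (chi (y - x)) * circle_val (chi x).
    by have := chiD (y - x) x; rewrite subrK => ->.
  rewrite -[X in X - _]mul1r -mulrBl cmodM cmod_circle mulr1.
  by apply: le_lt_trans h _; rewrite ltr_pdivrMr// ltr_pMr// ltr1n.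
pose chi' : Gh := exist (fun c => c \in @character R G) _ (mem_set cchi).
have chi'E x : pairing chi' x = circle_val (chi x) by [].
have Fchi : F --> chi'.
  move=> A /nbhs_dualP[C [e [cC e0 eA]]].
  have e4 : 0 < e / 4 by rewrite divr_gt0.
  have nb : nbhs (0 : G) [set x | cmod (1 - circle_val (chi x)) <= e / 4 /\
      forall xi, E xi -> cmod (1 - pairing xi x) <= e / 4].
    exact: filterI (chi_equi _ e4) (equi _ e4).
  have [|s sC] := @compact_finite_cover G C (fun x => [set y |
      [set x | cmod (1 - circle_val (chi x)) <= e / 4 /\
      forall xi, E xi -> cmod (1 - pairing xi x) <= e / 4] (y - x)]) cC.
    move=> x _; have cB := @cvg_subr0 G x.
    exact: cB nb.
  have : F [set xi | forall x, x \in s -> cmod (circle_val (chi x) - pairing xi x) < e / 4].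
    elim: s {sC} => [|x s IH]; first by apply: filterS FE.
    apply: filterS (filterI (chiF x _ e4) IH) => xi [h1 h2] y.
    by rewrite inE => /orP[/eqP ->//|]; exact: h2.
  move=> /(filterI FE); apply: filterS => xi [Exi h]; apply: eA => y Cy.
  have [x xs /= [h1 h2]] := sC _ Cy.
  have yE (w : Gh) : pairing w y = pairing w (y - x) * pairing w x.
    by rewrite -pairingDr subrK.
  rewrite !yE; apply: le_lt_trans (cmodM1_sub _ _ (cmod_pairing _ _) (cmod_pairing _ _)) _.
  have h3 := h x xs; have h4 := h2 xi Exi.
  have : cmod (pairing chi' (y - x) - pairing xi (y - x)) <= e / 4 + e / 4.
    rewrite -[X in X - _](subrK 1) -addrA; apply: le_trans (cmodD _ _) _.
    by rewrite lerD// cmodBC.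
  rewrite -chi'E in h3; move=> h5; apply: le_lt_trans (lerD h5 (ltW h3)) _; lra.
exists chi'; split => //; apply: clE => N nN.
have [xi [h1 h2]] := @filter_ex _ _ _ _ (filterI FE (Fchi N nN)).
by exists xi.
Qed.

End equicontinuous_characters.

Lemma continuousT_comp (T U V : topologicalType) (f : T -> U) (g : U -> V) :
  continuous f -> continuous g -> continuous (fun x => g (f x)).
Proof. by move=> cf cg x; apply: continuous_comp; [exact: cf|exact: cg]. Qed.

Lemma continuousT_id (T : topologicalType) : continuous (fun x : T => x).
Proof. by move=> x; exact: cvg_id. Qed.

Lemma continuous_mull (R : realType) (c : R) : continuous (fun t : R => c * t).
Proof. by move=> t; apply: cvgMr; exact: cvg_id. Qed.

Lemma continuous_scalel (R : realType) d (a : 'cV[R]_d) : continuous (fun t : R => t *: a).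
Proof.
apply: cV_continuous => j.
have -> : (fun x : R => (x *: a) j 0) = (fun x => a j 0 * x).
  by apply/funext => x; rewrite mxE mulrC.
exact: continuous_mull.
Qed.

Lemma continuous_pair (T U V : topologicalType) (f : T -> U) (g : T -> V) :
  continuous f -> continuous g -> continuous (fun x => (f x, g x)).
Proof. by move=> cf cg x; apply: cvg_pair; [exact: cf|exact: cg]. Qed.

(** [is_lca_iso] provides the inverse only under an existential; the record names it, so that
    definitions can refer to it. *)
Record splitting (R : realType) (G G0 : lcaType) (d : nat)
    (iso : G -> 'cV[R]_d * G0) := Splitting {
  iso_inv : 'cV[R]_d * G0 -> G ;
  isoD : forall x y, iso (x + y) = iso x + iso y ;
  isoK : cancel iso iso_inv ;
  iso_invK : cancel iso_inv iso ;
  iso_continuous : continuous iso ;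
  iso_inv_continuous : continuous iso_inv }.
Arguments isoD {R G G0 d iso} _ x y.
Arguments isoK {R G G0 d iso} _ x.
Arguments iso_invK {R G G0 d iso} _ x.
Arguments iso_continuous {R G G0 d iso} _ x _ _.
Arguments iso_inv_continuous {R G G0 d iso} _ x _ _.

Lemma splitting_exists (R : realType) (G G0 : lcaType) (d : nat)
    (iso : G -> 'cV[R]_d * G0) : is_lca_iso iso -> inhabited (splitting iso).
Proof. by move=> [isoD [psi [h1 h2 h3 h4]]]; split; exact: (Splitting isoD h1 h2 h3 h4). Qed.

Section lca_structure.
Context {R : realType} {G G0 : lcaType} {d : nat}.
Context {iso : G -> 'cV[R]_d * G0} (S : splitting iso).
Local Notation psi := (iso_inv S).
Local Notation isoD := (isoD S).
Local Notation isoK := (isoK S).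
Local Notation psiK := (iso_invK S).
Local Notation iso_continuous := (iso_continuous S).
Local Notation psi_continuous := (iso_inv_continuous S).
Local Notation Gh := (dual_group R G).
Local Notation Gh0 := (dual_group R G0).

Lemma iso0 : iso 0 = 0.
Proof. by apply: (addrI (iso 0)); rewrite -isoD !addr0. Qed.

Lemma isoN x : iso (- x) = - iso x.
Proof. by apply: (addrI (iso x)); rewrite -isoD !subrr iso0. Qed.

Lemma isoB x y : iso (x - y) = iso x - iso y.
Proof. by rewrite isoD isoN. Qed.

Lemma psiD u w : psi (u + w) = psi u + psi w.
Proof. by rewrite -[RHS]isoK isoD !psiK. Qed.

Lemma psi0 : psi 0 = 0.
Proof. by rewrite -iso0 isoK. Qed.

(** [vec] and [tor] are the inclusions of the two factors R^d and [G0]. *)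
Definition vec (a : 'cV[R]_d) : G := psi (a, 0).
Definition tor (y : G0) : G := psi (0, y).

Lemma vecD a b : vec (a + b) = vec a + vec b.
Proof. by rewrite /vec -psiD; congr psi; apply/pair_equal_spec; rewrite /= addr0. Qed.

Lemma torD x y : tor (x + y) = tor x + tor y.
Proof. by rewrite /tor -psiD; congr psi; apply/pair_equal_spec; rewrite /= addr0. Qed.

Lemma vec0 : vec 0 = 0. Proof. exact: psi0. Qed.

Lemma tor0 : tor 0 = 0. Proof. exact: psi0. Qed.

Lemma iso_vec a : iso (vec a) = (a, 0). Proof. exact: psiK. Qed.

Lemma iso_tor y : iso (tor y) = (0, y). Proof. exact: psiK. Qed.

Lemma iso_decomp x : x = vec (iso x).1 + tor (iso x).2.
Proof.
rewrite /vec /tor -psiD -[LHS]isoK; congr psi.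
by case: (iso x) => a b; apply/pair_equal_spec; rewrite /= addr0 add0r.
Qed.

Lemma vec_continuous : continuous vec.
Proof.
have cf : continuous (fun a : 'cV[R]_d => (a, 0 : G0)).
  by apply: continuous_pair; [exact: continuousT_id|exact: cst_continuous].
exact: (continuousT_comp cf psi_continuous).
Qed.

Lemma tor_continuous : continuous tor.
Proof.
have cf : continuous (fun y : G0 => (0 : 'cV[R]_d, y)).
  by apply: continuous_pair; [exact: cst_continuous|exact: continuousT_id].
exact: (continuousT_comp cf psi_continuous).
Qed.

Lemma iso1_continuous : continuous (fun x => (iso x).1).
Proof. by move=> x; apply: continuous_comp; [exact: iso_continuous|exact: cvg_fst]. Qed.

Lemma iso2_continuous : continuous (fun x => (iso x).2).
Proof. by move=> x; apply: continuous_comp; [exact: iso_continuous|exact: cvg_snd]. Qed.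

Lemma pairing_bigsum (xi : Gh) (I : Type) (s : seq I) (f : I -> G) :
  pairing xi (\sum_(i <- s) f i) = \prod_(i <- s) pairing xi (f i).
Proof. by elim/big_rec2: _ => [|i y x _ <-]; rewrite ?pairing0r// pairingDr. Qed.

Lemma vec_bigsum (I : Type) (s : seq I) (f : I -> 'cV[R]_d) :
  vec (\sum_(i <- s) f i) = \sum_(i <- s) vec (f i).
Proof. by elim/big_rec2: _ => [|i y x _ <-]; rewrite ?vec0// vecD. Qed.

Lemma expi_bigsum (I : Type) (s : seq I) (f : I -> R) :
  expi (\sum_(i <- s) f i) = \prod_(i <- s) expi (f i) :> R[i].
Proof. by elim/big_rec2: _ => [|i y x _ <-]; rewrite ?expi0// expiD. Qed.

Lemma frequency_exists (xi : Gh) : exists a : 'cV[R]_d, forall x,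
  pairing xi (vec x) = expi (2 * pi * dotv a x).
Proof.
have h i : exists a : R, forall t, pairing xi (vec (t *: delta_mx i 0)) = expi (a * t).
  apply: (@real_character R (fun t => pairing xi (vec (t *: delta_mx i 0)))).
  - by move=> s t; rewrite scalerDl vecD pairingDr.
  - by move=> t; exact: cmod_pairing.
  - exact: (continuousT_comp (continuousT_comp (@continuous_scalel R d (delta_mx i 0))
      vec_continuous) (@pairing_continuous R G xi)).
pose a i := projT1 (cid (h i)).
have aP i t : pairing xi (vec (t *: delta_mx i 0)) = expi (a i * t).
  exact: (projT2 (cid (h i)) t).
have pi20 : 2 * pi != 0 :> R by rewrite mulf_neq0// gt_eqF// pi_gt0.
exists (\col_i (a i / (2 * pi))) => x.
rewrite [in LHS](cV_sum_delta x) vec_bigsum pairing_bigsum /dotv mulr_sumr expi_bigsum.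
apply: eq_bigr => i _; rewrite aP mxE; congr expi.
by rewrite mulrA [2 * pi * _]mulrC divfK.
Qed.

Definition freq (xi : Gh) : 'cV[R]_d := projT1 (cid (frequency_exists xi)).

Lemma pairing_vec (xi : Gh) x : pairing xi (vec x) = expi (2 * pi * dotv (freq xi) x).
Proof. exact: (projT2 (cid (frequency_exists xi)) x). Qed.

(** A vector along which a nonzero frequency makes exactly half a turn. The value -1 is far from 1,
    which separates frequencies ([freq_unique]) and bounds their distance ([freq_continuous]). *)
Lemma dotv_expi_half (a : 'cV[R]_d) i : a i 0 != 0 ->
  expi (2 * pi * dotv a ((2 * a i 0)^-1 *: delta_mx i 0)) = -1 :> R[i].
Proof.
move=> ai; rewrite dotvZr dotv_delta -expi_pi; congr expi.
by field; rewrite ai.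
Qed.

Lemma freq_unique (a b : 'cV[R]_d) :
  (forall x, expi (2 * pi * dotv a x) = expi (2 * pi * dotv b x) :> R[i]) -> a = b.
Proof.
move=> ab; apply/matrixP => i j; rewrite ord1; apply/eqP.
apply: contrapT => /negP; rewrite -subr_eq0 => ai.
have ai' : (a - b) i 0 != 0 by rewrite !mxE.
have := dotv_expi_half ai'; set x := _ *: _.
rewrite dotvDl dotvNl mulrDr expiD mulrN expiN ab mulJ_cmod cmod_expi expr1n.
move=> /(congr1 (@complex.Re R)) /=; apply/eqP.
by rewrite gt_eqF// (@lt_trans _ _ 0)// ltrN10.
Qed.

Lemma freqE (xi : Gh) a : (forall x, pairing xi (vec x) = expi (2 * pi * dotv a x)) ->
  freq xi = a.
Proof. by move=> h; apply: freq_unique => x; rewrite -pairing_vec h. Qed.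

Lemma freqD xi eta : freq (xi + eta) = freq xi + freq eta.
Proof.
by apply: freqE => x; rewrite pairingDl !pairing_vec -expiD -mulrDr -dotvDl.
Qed.

Lemma freq0 : freq 0 = 0.
Proof. by apply: freqE => x; rewrite dotv0l mulr0 expi0. Qed.

Lemma freqN xi : freq (- xi) = - freq xi.
Proof. by apply: (addrI (freq xi)); rewrite -freqD !subrr freq0. Qed.

Fact lift_character (a : 'cV[R]_d) (eta : Gh0) :
  @character R G (fun x => circle_expi (2 * pi * dotv a (iso x).1) *
    char_eval eta (iso x).2)%g.
Proof.
split => [|x y].
  have [c _] := char_evalP eta.
  apply: circle_mul_continuous; last exact: (continuousT_comp iso2_continuous c).
  apply: (continuousT_comp _ (@circle_expi_continuous R)).
  apply: (continuousT_comp _ (@continuous_mull R (2 * pi))).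
  exact: (dotv_continuous (@cst_continuous _ _ a) iso1_continuous).
apply: val_inj => /=; have [_ c] := char_evalP eta.
rewrite isoD /= dotvDr mulrDr expiD c /=; ring.
Qed.

Definition dual_lift a eta : Gh :=
  exist (fun c => c \in @character R G) _ (mem_set (lift_character a eta)).

Lemma pairing_lift a eta x :
  pairing (dual_lift a eta) x = expi (2 * pi * dotv a (iso x).1) * pairing eta (iso x).2.
Proof. by []. Qed.

Lemma freq_lift a eta : freq (dual_lift a eta) = a.
Proof. by apply: freqE => x; rewrite pairing_lift iso_vec /= pairing0r mulr1. Qed.

Fact res_character (xi : Gh) : @character R G0 (fun y => char_eval xi (tor y)).
Proof.
have [c m] := char_evalP xi; split => [y|x y]; last by rewrite torD m.
by apply: (@continuous_comp _ _ _ tor (char_eval xi)); [exact: tor_continuous|exact: c].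
Qed.

Definition res (xi : Gh) : Gh0 :=
  exist (fun c => c \in @character R G0) _ (mem_set (res_character xi)).

Lemma pairing_res xi y : pairing (res xi) y = pairing xi (tor y).
Proof. by []. Qed.

Lemma resB xi eta : res (xi - eta) = res xi - res eta.
Proof. by apply: pairing_ext. Qed.

Lemma res_lift a eta : res (dual_lift a eta) = eta.
Proof.
apply: pairing_ext => y; rewrite pairing_res pairing_lift iso_tor /=.
by rewrite dotv0r mulr0 expi0 mul1r.
Qed.

Lemma lift_freq_res xi : dual_lift (freq xi) (res xi) = xi.
Proof.
apply: pairing_ext => x; rewrite pairing_lift pairing_res -pairing_vec -pairingDr.
by rewrite -iso_decomp.
Qed.

Lemma liftD a b xi eta : dual_lift (a + b) (xi + eta) = dual_lift a xi + dual_lift b eta.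
Proof.
apply: pairing_ext => x; rewrite pairingDl !pairing_lift dotvDl mulrDr expiD pairingDl.
ring.
Qed.

Lemma freq_continuous : continuous freq.
Proof.
apply: cV_continuous => i xi; apply/(@cvgrPdist_lt _ _ _ _ (nbhs_filter xi)) => e e0.
(* If the i-th frequencies of two characters differ by at least e, the half-turn point of their
   difference lies in the segment of length r on either side of 0; there the characters take
   opposite values, at distance 2. *)
pose r := (2 * e)^-1.
pose C := (fun t : R => vec (t *: delta_mx i 0)) @` `[- r, r]%classic.
have cC : compact C.
  apply: continuous_compact; last exact: segment_compact.
  apply: continuous_subspaceT.
  exact: (continuousT_comp (@continuous_scalel R d (delta_mx i 0)) vec_continuous).
apply/nbhs_dualP; exists C, 1; split => // eta h.
rewrite ltNge; apply/negP => ei.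
have {}ei : e <= `|freq (xi - eta) i 0|.
  by rewrite freqD freqN !mxE.
have ai0 : freq (xi - eta) i 0 != 0.
  by rewrite -normr_gt0 (lt_le_trans e0).
have := dotv_expi_half ai0; set x := _ *: _ => hx.
have : C (vec x).
  exists (2 * freq (xi - eta) i 0)^-1 => //=.
  rewrite in_itv /= -ler_norml normfV normrM ger0_norm// /r lef_pV2 ?posrE ?ler_pM2l//.
    by rewrite mulr_gt0// normr_gt0.
  by rewrite mulr_gt0.
move=> /h; rewrite -pairing_vec pairingBl in hx *.
have -> : pairing xi (vec x) = - pairing eta (vec x).
  have /mulfI := cmod_eq1_neq0 (cmod_pairing eta (vec x)); apply.
  rewrite mulrN -expr2.
  have := congr1 (fun w => pairing eta (vec x) * w * pairing eta (vec x)) hx.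
  rewrite mulrN1 mulNr -expr2 => <-.
  set a := pairing xi _; set b := pairing eta _.
  have -> : b * (a * b^*%C) * b = (b * b^*%C) * (b * a) by ring.
  by rewrite mulJ_cmod cmod_pairing expr1n mul1r.
rewrite -opprD cmodN -mulr2n -mulr_natl cmodM cmod_pairing mulr1.
have -> : cmod (2 : R[i]) = 2.
  by have := cmod_real (2 : R); rewrite ger0_norm// => <-; congr cmod; rewrite rmorph_nat.
by rewrite ltNge ler1n.
Qed.

Variable K : set G0.

(** This is R^d x K^perp seen inside [Gh], the annihilator of the compact subgroup [tor K]. *)
Definition dual_tor : set Gh := [set xi | forall y, K y -> pairing xi (tor y) = 1].

Lemma dual_torE xi : dual_tor xi <-> annihilator K (res xi).
Proof. by []. Qed.

Lemma dual_torB xi eta : dual_tor xi -> dual_tor eta -> dual_tor (xi - eta).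
Proof.
by move=> h1 h2 y Ky; rewrite pairingBl h1// h2// conjc1 mulr1.
Qed.

Lemma dual_tor0 : dual_tor 0. Proof. by []. Qed.

(** The circle has no small subgroups. While w = z^(2^n) stays within 1/2 of 1, the factor 1 + w of
    1 - w^2 has modulus at least 3/2, so repeated squaring multiplies the distance to 1 by 3/2 each
    time. *)
Lemma small_subgroup (z : R[i]) :
  (forall n, cmod (1 - z ^+ n) < 2^-1) -> z = 1.
Proof.
move=> h; apply/eqP; apply: contrapT => /negP z1.
have c0 : 0 < cmod (1 - z) by rewrite lt_neqAle cmod_ge0 andbT eq_sym cmod_eq0 subr_eq0 eq_sym.
have grow n : (3 / 2) ^+ n * cmod (1 - z) <= cmod (1 - z ^+ (2 ^ n)%N).
  elim: n => [|n IH]; first by rewrite expr0 mul1r expn0 expr1.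
  rewrite expnS mulnC exprM; have := h (2 ^ n)%N; set w := z ^+ _ in IH * => hw.
  have -> : 1 - w ^+ 2 = (1 - w) * (1 + w) by ring.
  rewrite cmodM exprS -mulrA mulrC; apply: ler_pM => //; try exact: cmod_ge0.
    by rewrite mulr_ge0 ?exprn_ge0 ?cmod_ge0// divr_ge0.
  have : cmod 2 <= cmod (1 + w) + cmod (1 - w).
    apply: le_trans (cmodD _ _); rewrite (_ : 1 + w + (1 - w) = 2)//; ring.
  have -> : cmod (2 : R[i]) = 2.
    by have := cmod_real (2 : R); rewrite ger0_norm// => <-; congr cmod; rewrite rmorph_nat.
  move: hw; lra.
have : exists n, 1 < (3 / 2 : R) ^+ n * cmod (1 - z).
  pose N := (Num.trunc ((cmod (1 - z))^-1 * 2)).+1; exists N.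
  have hN : (cmod (1 - z))^-1 * 2 < N%:R.
    have /truncn_itv/andP[_ //] : 0 <= (cmod (1 - z))^-1 * 2.
    by rewrite mulr_ge0 ?invr_ge0 ?cmod_ge0.
  have bern n : 1 + n%:R / 2 <= (3 / 2 : R) ^+ n.
    elim: n => [|n IH]; first by rewrite mul0r addr0 expr0.
    rewrite exprS -natr1; have : 0 <= n%:R :> R by []. move: IH; nra.
  have : (cmod (1 - z))^-1 < (3 / 2) ^+ N by have := bern N; lra.
  by rewrite -[X in X < _ * _](mulVf (lt0r_neq0 c0)) ltr_pM2r.
move=> [n hn]; have := lt_trans (lt_le_trans hn (grow n)) (h (2 ^ n)%N); lra.
Qed.

Hypothesis K_subgroup : compact_open_subgroup K.

Lemma K_mul n y : K y -> K (y *+ n).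
Proof.
have [_ _ K0 KB] := K_subgroup.
have KN y' : K y' -> K (- y') by move=> Ky; rewrite -sub0r; exact: KB.
move=> Ky; elim: n => [|n IH]; first by rewrite mulr0n.
by rewrite mulrS -[y *+ n]opprK; apply: KB => //; exact: KN.
Qed.

Lemma torMn y n : tor (y *+ n) = tor y *+ n.
Proof. by elim: n => [|n IH]; rewrite ?mulr0n ?tor0// !mulrS torD IH. Qed.

Lemma pairingMn (xi : Gh) x n : pairing xi (x *+ n) = pairing xi x ^+ n.
Proof. by elim: n => [|n IH]; rewrite ?mulr0n ?pairing0r ?expr0// mulrS exprS pairingDr IH. Qed.

(** A character within 1/2 of an element of [dual_tor] on the compact subgroup [tor K] sends that
    subgroup into a small neighbourhood of 1, hence to 1. *)
Lemma dual_tor_open : open dual_tor.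
Proof.
have [cK _ _ _] := K_subgroup.
rewrite openE => xi Xxi; apply/nbhs_dualP.
exists (tor @` K), 2^-1; split => //.
  apply: continuous_compact => //; apply: continuous_subspaceT; exact: tor_continuous.
move=> eta h y Ky; apply: small_subgroup => n.
rewrite -pairingMn -torMn.
have Kyn := K_mul n Ky.
by rewrite -(Xxi _ Kyn); apply: h; exists (y *+ n).
Qed.

Lemma dual_tor_closed : closed dual_tor.
Proof.
have [cK _ _ _] := K_subgroup.
move=> xi clxi.
have ctor : compact (tor @` K).
  by apply: continuous_compact => //; apply: continuous_subspaceT; exact: tor_continuous.
have [eta [Xeta h]] : exists eta, dual_tor eta /\
    forall x, (tor @` K) x -> cmod (pairing xi x - pairing eta x) < 2^-1.
  have [|eta [h1 h2]] := clxi [set eta | forall x, (tor @` K) x ->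
      cmod (pairing xi x - pairing eta x) < 2^-1].
    by apply/nbhs_dualP; exists (tor @` K), 2^-1; split.
  by exists eta.
move=> y Ky; apply: small_subgroup => n; rewrite -pairingMn -torMn.
have Kyn := K_mul n Ky.
by rewrite cmodBC -(Xeta _ Kyn); apply: h; exists (y *+ n).
Qed.

Lemma pairing_dual_tor xi x : dual_tor xi -> K (iso x).2 ->
  pairing xi x = expi (2 * pi * dotv (freq xi) (iso x).1).
Proof.
by move=> Xxi Kx; rewrite {1}(iso_decomp x) pairingDr pairing_vec Xxi ?mulr1.
Qed.

Lemma closed_freq_cube (r : R) : closed [set xi | forall i, `|freq xi i 0| <= r].
Proof.
have -> : [set xi | forall i, `|freq xi i 0| <= r] =
    \bigcap_(i : 'I_d) [set xi | `|freq xi i 0| <= r].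
  by apply/seteqP; split => [xi h i _|xi h i]; [exact: h|exact: (h i I)].
apply: closed_bigI => i _.
have c : continuous (fun xi => `|freq xi i 0|).
  move=> xi; apply: (@cvg_norm _ _ _ _ (nbhs_filter xi)).
  apply: (@continuous_comp _ _ _ freq (fun M : 'cV[R]_d => M i 0)).
    exact: freq_continuous.
  exact: coord_continuous.
apply: (@preimage_closed _ _ (fun xi => `|freq xi i 0|) [set t | t <= r]); last exact: closed_le.
by move=> xi _; exact: c.
Qed.

Lemma compact_dual_cell (r : R) :
  compact [set xi | dual_tor xi /\ forall i, `|freq xi i 0| <= r].
Proof.
have [cK oK K0 KB] := K_subgroup.
apply: compact_equicontinuous_characters.
  by apply: closedI; [exact: dual_tor_closed|exact: closed_freq_cube].
move=> e e0.
have /cvg_cmodP /(_ _ e0) := @expi_continuous R 0.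
rewrite expi0 => /nbhs_ballP[dl /= dl0 hdl].
(* On this set of characters the scalar product with x is at most d|r|s in modulus, so the phase
   stays below [dl]; the summand 1 keeps the denominator positive. *)
pose s := dl / (2 * pi * (d%:R * `|r| + 1)).
have dr0 : 0 < d%:R * `|r| + 1 by rewrite ltr_wpDl// mulr_ge0.
have s0 : 0 < s by rewrite divr_gt0// mulr_gt0// mulr_gt0// pi_gt0.
have n1 : nbhs (0 : G) [set x | forall i : 'I_d, `|(iso x).1 i 0| < s].
  apply: filter_forall => i.
  have c : continuous (fun x : G => (iso x).1 i 0).
    move=> x; apply: (@continuous_comp _ _ _ (fun x : G => (iso x).1) (fun M : 'cV[R]_d => M i 0)).
      exact: iso1_continuous.
    exact: coord_continuous.
  move/(@cvgrPdist_lt _ _ _ _ (nbhs_filter 0)) : (c 0) => /(_ _ s0).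
  by apply: filterS => x /=; rewrite iso0 /= mxE sub0r normrN.
have n2 : nbhs (0 : G) [set x | K (iso x).2].
  apply: (iso2_continuous (x := 0)); apply: open_nbhs_nbhs; split => //.
  by rewrite iso0.
apply: filterS (filterI n1 n2) => x [x1 x2] xi [Xxi xir].
rewrite pairing_dual_tor//; apply/ltW; apply: hdl.
rewrite /ball /= sub0r normrN normrM ger0_norm ?mulr_ge0 ?pi_ge0//.
have : `|dotv (freq xi) (iso x).1| <= d%:R * `|r| * s.
  apply: le_trans (ler_norm_sum _ _ _) _.
  apply: (@le_trans _ _ (\sum_(i < d) `|r| * s)); last first.
    by rewrite sumr_const card_ord -mulrA mulr_natl.
  apply: ler_sum => i _; rewrite normrM ler_pM// ?(ltW (x1 i))//.
  exact: le_trans (xir i) (ler_norm _).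
move=> h; apply: (@le_lt_trans _ _ (2 * pi * (d%:R * `|r| * s))).
  by rewrite ler_wpM2l// mulr_ge0// pi_ge0.
rewrite (_ : dl = 2 * pi * ((d%:R * `|r| + 1) * s)); last first.
  by rewrite /s mulrA mulrC divfK// gt_eqF// mulr_gt0// mulr_gt0// pi_gt0.
rewrite ltr_pM2l ?mulr_gt0 ?pi_gt0// ltr_pM2r//.
by rewrite ltrDl.
Qed.

Lemma compact_lca_cell (r : R) :
  compact [set x : G | K (iso x).2 /\ forall i, `|(iso x).1 i 0| <= r].
Proof.
have [cK oK K0 KB] := K_subgroup.
have -> : [set x : G | K (iso x).2 /\ forall i, `|(iso x).1 i 0| <= r] =
    psi @` ([set a : 'cV[R]_d | forall i, `|a i 0| <= r] `*` K).
  apply/seteqP; split => [x [Kx xr]|_ [[a y] [/= ar Ky] <-]]; last by rewrite psiK.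
  by exists (iso x) => //; exact: isoK.
apply: continuous_compact; first by apply: continuous_subspaceT; exact: psi_continuous.
by apply: compact_setX => //; exact: compact_cV_cube.
Qed.

End lca_structure.

Lemma dual_shift_continuous (R : realType) (G : lcaType) (a : dual_group R G) :
  continuous (fun xi => xi + a).
Proof.
move=> xi A /nbhs_dualP[C [e [cC e0 h]]]; apply/nbhs_dualP; exists C, e; split => // eta eC.
apply: h => x Cx; rewrite !pairingDl -mulrBl cmodM cmod_pairing mulr1.
exact: eC.
Qed.

Lemma group_shift_continuous (X : topologicalZmodType) (a : X) : continuous (fun x => x + a).
Proof.
move=> x; apply: (@cvg_comp _ _ _ (fun y : X => (y, a)) (fun z => z.1 + z.2) _ (nbhs (x, a))).
  by apply: cvg_pair; [exact: cvg_id|exact: cvg_cst].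
exact: (@add_continuous X (x, a)).
Qed.

(** * Tilings *)

Section tilings.
Variables (R : realType) (d : nat) (X : PreTopologicalZmodule.type).

(** Common structure of the group, its dual and their product. [crd] is a continuous homomorphism
    onto R^d under which the lattice becomes Z^d, [sec] a section of it with values in the open
    subgroup [stab] (R^d x K or R^d x K^perp), and [reps] represents the cosets of [stab] by
    elements of coordinate 0. Continuity is asked of translations, the form in which it is proved
    for the dual group. *)
Record tiling := Tiling {
  crd : X -> 'cV[R]_d ;
  stab : set X ;
  sec : 'cV[R]_d -> X ;
  reps : set X ;
  crdD : forall x y, crd (x + y) = crd x + crd y ;
  secK : cancel sec crd ;
  stab_sec : forall a, stab (sec a) ;
  stab0 : stab 0 ;
  stabB : forall x y, stab x -> stab y -> stab (x - y) ;
  repsP : forall x, exists! e, reps e /\ stab (x - e) ;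
  crd_reps : forall e, reps e -> crd e = 0 ;
  crd_continuous : continuous crd ;
  stab_open : open stab ;
  stab_compact : forall r : R, compact [set x | stab x /\ forall i, `|crd x i 0| <= r] ;
  shift_continuous : forall a, continuous (fun x : X => x + a) }.

Context (t : tiling).
Local Notation c := (crd t).
Local Notation H := (stab t).

Lemma nbhs_shift x A : nbhs (0 : X) A -> nbhs x [set y | A (y - x)].
Proof. by rewrite -(subrr x) => /(@shift_continuous t (- x) x). Qed.

Lemma crd0 : c 0 = 0.
Proof. by apply: (addrI (c 0)); rewrite -crdD !addr0. Qed.

Lemma crdN x : c (- x) = - c x.
Proof. by apply: (addrI (c x)); rewrite -crdD !subrr crd0. Qed.

Lemma crdB x y : c (x - y) = c x - c y.
Proof. by rewrite crdD crdN. Qed.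

Lemma stabN x : H x -> H (- x).
Proof. by move=> Hx; rewrite -sub0r; apply: stabB => //; exact: stab0. Qed.

Lemma stabD x y : H x -> H y -> H (x + y).
Proof. by move=> Hx Hy; rewrite -[y]opprK; apply: stabB => //; exact: stabN. Qed.

(** Cubes are compact and symmetric and their sizes add up; the half-open cells below have
    translates that partition the group. *)
Definition cube (n : nat) : set X := [set x | H x /\ forall i, `|c x i 0| <= n%:R].

Definition cell : set X :=
  [set x | H x /\ forall i, - 2^-1 <= c x i 0 < 2^-1].

Definition lattice : set X :=
  [set x | exists (k : 'cV[int]_d) e, reps t e /\ x = sec t (map_mx intr k) + e].

Definition rep (x : X) : X := projT1 (cid (repsP t x)).

Lemma rep_reps x : reps t (rep x).
Proof. by rewrite /rep; case: cid => e [[]]. Qed.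

Lemma stab_rep x : H (x - rep x).
Proof. by rewrite /rep; case: cid => e [[]]. Qed.

Lemma rep_unique x e : reps t e -> H (x - e) -> rep x = e.
Proof. by move=> re He; have [_ u] := projT2 (cid (repsP t x)); exact: u. Qed.

Definition idx (x : X) : 'cV[int]_d := \col_i Num.floor (c x i 0 + 2^-1).

(** The lattice point whose cell contains x. Rounding stands in for subtraction of lattice points,
    which may leave the quasi-lattice. *)
Definition rnd (x : X) : X := sec t (map_mx intr (idx x)) + rep x.

Lemma lattice_rnd x : lattice (rnd x).
Proof. by exists (idx x), (rep x); split => //; exact: rep_reps. Qed.

Lemma crd_lattice k e : reps t e -> c (sec t (map_mx intr k) + e) = map_mx intr k.
Proof. by move=> re; rewrite crdD secK crd_reps// addr0. Qed.

Lemma cell_rnd x : cell (x - rnd x).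
Proof.
split.
  rewrite /rnd opprD addrA addrAC; apply: stabB; last exact: stab_sec.
  exact: stab_rep.
move=> i; rewrite crdB crd_lattice; last exact: rep_reps.
rewrite !mxE.
have /andP[h1 h2] := floor_itv (c x i 0 + 2^-1).
by rewrite intrD in h2; lra.
Qed.

Lemma idx_lattice k e u : reps t e -> cell u -> idx (sec t (map_mx intr k) + e + u) = k.
Proof.
move=> re [Hu cu]; apply/matrixP => i j; rewrite ord1 mxE crdD crd_lattice// !mxE.
apply: floor_def; have := cu i; rewrite intrD; lra.
Qed.

Lemma rnd_lattice w u : lattice w -> cell u -> rnd (w + u) = w.
Proof.
move=> [k [e [re ->]]] cu; rewrite /rnd idx_lattice//; congr (_ + _).
apply: rep_unique => //; case: cu => Hu _.
rewrite addrAC addrK; apply: stabD => //; exact: stab_sec.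
Qed.

Lemma cell0 : cell 0.
Proof. by split; [exact: stab0|move=> i; rewrite crd0 mxE; lra]. Qed.

(** Substitute for translation invariance of lattice sums. On integer coordinates the map is the
    shift by [idx x]; on representatives it is the permutation that adding x induces on the cosets
    of [stab]. *)
Lemma rnd_bij x : set_bij lattice lattice (fun w => rnd (w + x)).
Proof.
have idxD k e y : reps t e -> idx (sec t (map_mx intr k) + e + y) = k + idx y.
  move=> re; apply/matrixP => i j; rewrite ord1 !mxE crdD crd_lattice// !mxE -addrA.
  by rewrite floorDzr ?intrKfloor// intr_int.
split => [w _|w1 w2|w' [k' [e' [re' ->]]]]; first exact: lattice_rnd.
  rewrite !inE => -[k1 [e1 [re1 ->]]] [k2 [e2 [re2 ->]]] h.
  have Hc (y1 y2 : X) : rnd y1 = rnd y2 -> H (y1 - y2).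
    move=> y12; rewrite -(subrK (rnd y1) y1) {2}y12 -addrA -[rnd y2 - y2]opprB.
    by apply: stabB; [have [] := cell_rnd y1|have [] := cell_rnd y2].
  have ee : e1 = e2.
    rewrite -(rep_unique re1 (x := e1)); last by rewrite subrr; exact: stab0.
    apply: rep_unique => //; have := Hc _ _ h.
    rewrite opprD addrACA subrr addr0 opprD addrACA => h'.
    rewrite -(addKr (sec t (map_mx intr k1) - sec t (map_mx intr k2)) (e1 - e2)).
    apply: stabD => //; apply: stabN; apply: stabB; exact: stab_sec.
  have := congr1 c h; rewrite /rnd !crd_lattice ?idxD//; try exact: rep_reps.
  move=> kk; suff -> : k1 = k2 by rewrite ee.
  apply/matrixP => i j; have := congr1 (fun M : 'cV_d => M i j) kk.
  by rewrite !mxE => /intr_inj /addIr.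
exists (sec t (map_mx intr (k' - idx x)) + rep (e' - x)).
  by exists (k' - idx x), (rep (e' - x)); split => //; exact: rep_reps.
rewrite /rnd idxD; last exact: rep_reps.
rewrite subrK; congr (_ + _); apply: rep_unique => //.
rewrite -!addrA; apply: stabD; first exact: stab_sec.
rewrite addrA -opprB; apply: stabN; rewrite opprD addrA addrAC.
exact: stab_rep.
Qed.

Lemma cubeD m n x y : cube m x -> cube n y -> cube (m + n) (x + y).
Proof.
move=> [Hx cx] [Hy cy]; split; first exact: stabD.
move=> i; rewrite crdD mxE natrD; apply: le_trans (ler_normD _ _) _.
by rewrite lerD.
Qed.

Lemma cubeN n x : cube n x -> cube n (- x).
Proof.
move=> [Hx cx]; split; first exact: stabN.
by move=> i; rewrite crdN mxE normrN.
Qed.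

Lemma cube0 n : cube n 0.
Proof. by split; [exact: stab0|move=> i; rewrite crd0 mxE normr0]. Qed.

Lemma cell_cube x : cell x -> cube 1 x.
Proof. by move=> [Hx cx]; split => // i; rewrite ler_norml; have := cx i; lra. Qed.

Lemma coord_open (a b : R) : open [set x | H x /\ forall i, a < c x i 0 < b].
Proof.
rewrite openE => x [Hx h].
have n1 : nbhs x H by apply: open_nbhs_nbhs; split => //; exact: stab_open.
have n2 : nbhs x [set y | forall i, a < c y i 0 < b].
  apply: filter_forall => i.
  have cc : continuous (fun x => c x i 0).
    exact: (continuousT_comp (@crd_continuous t) (@coord_continuous R d 1 i 0)).
  apply: (cc x [set s | a < s < b]); apply: open_nbhs_nbhs; split; last exact: h.
  rewrite (_ : [set s | a < s < b] = `]a, b[%classic); first exact: itv_open.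
  by apply/seteqP; split => s; rewrite /= in_itv.
by apply: filterS (filterI n1 n2) => y [].
Qed.

Lemma nbhs_cell : nbhs (0 : X) cell.
Proof.
have n0 : nbhs (0 : X) [set x | H x /\ forall i, - 2^-1 < c x i 0 < 2^-1].
  apply: open_nbhs_nbhs; split; first exact: coord_open.
  by split; [exact: stab0|move=> i; rewrite crd0 mxE; lra].
apply: (@filterS _ _ (nbhs_filter (0 : X)) _ cell _ n0).
move=> x [Hx h]; split => // i; have /andP[h1 h2] := h i; rewrite h2 ltW//.
Qed.

Lemma compact_cube n : compact (cube n). Proof. exact: stab_compact. Qed.

Lemma nbhs_cube n x : (0 < n)%N -> nbhs x [set y | cube n (y - x)].
Proof.
move=> n0; apply: (@nbhs_shift x (cube n)).
apply: (@filterS _ _ (nbhs_filter (0 : X)) _ (cube n) _ nbhs_cell) => y /cell_cube [Hy cy].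
by split => // i; apply: le_trans (cy i) _; rewrite ler1n.
Qed.

Lemma precompact_cubes (P : set X) : precompact P ->
  exists s : seq X, P `<=` [set y | exists2 x, x \in s & cube 1 (y - x)].
Proof.
rewrite precompactE => cP.
have [|s sP] := @compact_finite_cover X (closure P) (fun x => [set y | cube 1 (y - x)]) cP.
  by move=> x _; exact: nbhs_cube.
by exists s => y Py; apply: sP; exact: subset_closure.
Qed.

Lemma cube_cover n (V : set X) : nbhs (0 : X) V ->
  exists s : seq X, cube n `<=` [set y | exists2 x, x \in s & V (y - x)].
Proof.
move=> nV; have [|s sP] := @compact_finite_cover X (cube n) (fun x => [set y | V (y - x)]) (@compact_cube n).
  by move=> x _; exact: nbhs_shift.
by exists s.
Qed.

End tilings.

Arguments crd {R d X} t x.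
Arguments stab {R d X} t x.
Arguments cube {R d X} t n x.
Arguments cell {R d X} t x.
Arguments rnd {R d X} t x.
Arguments lattice {R d X} t x.

Section borel_maps.
Context {R : realType} {dY : measure_display} {Y : measurableType dY}
  {T : topologicalType}.

Definition borel_map (u : Y -> T) := forall V : set T, open V -> measurable (u @^-1` V).

Lemma borel_map_measurable (u : Y -> T) (g : T -> R) : borel_map u -> continuous g ->
  measurable_fun setT (fun y => g (u y)).
Proof.
move=> bu cg; apply: (measurability _ (RGenOInfty.measurableE R)) => _ [_ [a ->] <-].
rewrite setTI; apply: (bu (g @^-1` `]a, +oo[%classic)).
by move/continuousP : cg; apply; rewrite set_itvoy; exact: open_gt.
Qed.

Lemma borel_map_cmeasurable (u : Y -> T) (g : T -> R[i]) : borel_map u ->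
  continuous (g : T -> R[i]^o) -> cmeasurable (fun y => g (u y)).
Proof.
move=> bu cg; split.
  apply: (borel_map_measurable (g := fun x => complex.Re (g x))) => //.
  exact: (continuousT_comp cg (@Re_continuous R)).
apply: (borel_map_measurable (g := fun x => complex.Im (g x))) => //.
exact: (continuousT_comp cg (@Im_continuous R)).
Qed.

Lemma borel_map_comp (T' : topologicalType) (u : Y -> T) (g : T -> T') :
  borel_map u -> continuous g -> forall V : set T', open V -> measurable ((fun y => g (u y)) @^-1` V).
Proof.
move=> bu cg V oV; apply: (bu (g @^-1` V)).
by move/continuousP : cg; apply.
Qed.

End borel_maps.

Lemma borel_map_id (X : PreTopologicalZmodule.type) : borel_map (fun x : borel X => x : X).
Proof. by move=> V oV; exact: open_measurable_borel. Qed.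

Lemma borel_map_measurable_borel (dY : measure_display) (Y : measurableType dY)
    (X : PreTopologicalZmodule.type) (u : Y -> X) : borel_map u ->
  measurable_fun setT (u : Y -> borel X).
Proof.
move=> bu; apply: (@measurability _ _ Y (borel X) setT u (@open X)) => // _ [V oV <-].
by rewrite setTI; exact: bu.
Qed.

(** * Translation of Haar integrals *)

Section haar_translation.
Context {R : realType} {X : PreTopologicalZmodule.type}.
Variable lam : {sigma_finite_measure set (borel X) -> \bar R}.
Hypothesis haar : is_haar (fun x y : X => x + y) lam.
Hypothesis shift_cont : forall a : X, continuous (fun x : X => x + a).

Lemma measurable_shift (a : X) :
  measurable_fun setT ((fun x : X => x + a) : borel X -> borel X).
Proof.
apply: borel_map_measurable_borel.
exact: (borel_map_comp (@borel_map_id X) (@shift_cont a)).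
Qed.

Lemma haar_preimage_shift (a : X) (A : set (borel X)) : measurable A ->
  lam ((fun x : X => x + a) @^-1` A) = lam A.
Proof.
move=> mA; have [inv _ _] := haar.
rewrite -(inv (- a) A mA); congr (lam _); apply/seteqP; split => [x /= Ax|_ [x Ax <-] /=].
  by exists (x + a) => //; rewrite addrC addrK.
by rewrite addrC addrA subrr add0r.
Qed.

Lemma ge0_integral_shift (a : X) (f : X -> \bar R) :
  measurable_fun [set: borel X] f -> (forall x, (0 <= f x)%E) ->
  (\int[lam]_x f (x + a)%R = \int[lam]_x f x)%E.
Proof.
move=> mf f0; have ms := measurable_shift a.
have := @ge0_integral_pushforward _ _ _ _ R _ ms lam setT f measurableT mf (fun x _ => f0 x).
rewrite preimage_setT => <-; apply: eq_measure_integral => A mA _.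
exact: haar_preimage_shift.
Qed.

Lemma Rintegral_shift (a : X) (f : X -> R) : measurable_fun [set: borel X] f ->
  \int[lam]_x f (x + a) = \int[lam]_x f x.
Proof.
move=> mf; have mE : measurable_fun [set: borel X] (EFin \o f) by exact/measurable_EFinP.
rewrite /Rintegral integralE [in RHS]integralE; congr (fine (_ - _)).
- rewrite -[RHS](@ge0_integral_shift a (EFin \o f)^\+%E)//; last exact: measurable_funepos.
  by apply: eq_integral => x _; rewrite !unlock.
- rewrite -[RHS](@ge0_integral_shift a (EFin \o f)^\-%E)//; last exact: measurable_funeneg.
  by apply: eq_integral => x _; rewrite !unlock.
Qed.

Lemma cintegral_shift (a : X) (f : X -> R[i]) : cmeasurable (f : borel X -> R[i]) ->
  cintegral lam (fun x => f (x + a)) = cintegral lam f.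
Proof.
move=> [m1 m2]; apply: complex_ext => /=.
  exact: (Rintegral_shift a m1).
exact: (Rintegral_shift a m2).
Qed.

Lemma haar_translate (a : X) (A : set X) : measurable (A : set (borel X)) ->
  measurable ([set a + x | x in A] : set (borel X)) /\ lam [set a + x | x in A] = lam A.
Proof.
move=> mA; have [inv _ _] := haar; split; last exact: inv.
have -> : [set a + x | x in A] = (fun x : X => x + (- a)) @^-1` A.
  apply/seteqP; split => [_ [x Ax <-]|x /= Ax].
    by rewrite /= addrC addrA addNr add0r.
  by exists (x - a) => //; rewrite addrC subrK.
by rewrite -[X in measurable X]setTI; exact: (measurable_shift (- a)).
Qed.

End haar_translation.

(** * Countability of the lattice and integration cell by cell *)

Section tiling_measure.
Context {R : realType} {d : nat} {X : PreTopologicalZmodule.type} (t : tiling R d X).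
Variable lam : {sigma_finite_measure set (borel X) -> \bar R}.
Hypothesis haar : is_haar (fun x y : X => x + y) lam.
Local Notation c := (crd t).
Local Notation H := (stab t).
Local Notation L := (lattice t).

Lemma measurable_cell : measurable (cell t : set (borel X)).
Proof.
have mc i : measurable_fun [set: borel X] (fun x : X => c x i 0).
  apply: (borel_map_measurable (@borel_map_id X) (g := fun x => c x i 0)).
  exact: (continuousT_comp (@crd_continuous _ _ _ t) (@coord_continuous R d 1 i 0)).
have -> : cell t = H `&` \bigcap_(i in [set: 'I_d])
    ((fun x : X => c x i 0) @^-1` `[- 2^-1, 2^-1[%classic).
  apply/seteqP; split => [x [Hx h]|x [Hx h]]; split => // i.
    by move=> _; rewrite /= in_itv /= h.
  by have := h i I; rewrite /= in_itv.
apply: measurableI; first by apply: open_measurable_borel; exact: stab_open.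
apply: fin_bigcap_measurable => // i _.
rewrite -[X in measurable X]setTI; exact: (mc i).
Qed.

Lemma cell_gt0 : (0 < lam (cell t))%E.
Proof.
have [_ _ pos] := haar.
pose U := [set x | H x /\ forall i, - 2^-1 < c x i 0 < 2^-1].
have oU : open U by exact: coord_open.
apply: (@lt_le_trans _ _ (lam U)).
  apply: pos => //; exists 0; split; first exact: stab0.
  by move=> i; rewrite crd0 mxE; lra.
apply: le_measure; rewrite ?inE; [exact: open_measurable_borel|exact: measurable_cell|].
by move=> x [Hx h]; split => // i; have := h i; lra.
Qed.

Lemma measurable_cube n : measurable (cube t n : set (borel X)).
Proof.
have mc i : measurable_fun [set: borel X] (fun x : X => c x i 0).
  apply: (borel_map_measurable (@borel_map_id X) (g := fun x => c x i 0)).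
  exact: (continuousT_comp (@crd_continuous _ _ _ t) (@coord_continuous R d 1 i 0)).
have -> : cube t n = H `&` \bigcap_(i in [set: 'I_d])
    ((fun x : X => c x i 0) @^-1` `[- n%:R, n%:R]%classic).
  apply/seteqP; split => [x [Hx h]|x [Hx h]]; split => // i.
    by move=> _; rewrite /= in_itv /= -ler_norml.
  by have := h i I; rewrite /= in_itv /= -ler_norml.
apply: measurableI; first by apply: open_measurable_borel; exact: stab_open.
apply: fin_bigcap_measurable => // i _.
rewrite -[X in measurable X]setTI; exact: (mc i).
Qed.

Lemma cell_lty : (lam (cell t) < +oo)%E.
Proof.
have [_ fin _] := haar.
apply: (@le_lt_trans _ _ (lam (cube t 1))); last exact/fin/compact_cube.
by apply: le_measure; rewrite ?inE; [exact: measurable_cell|exact: measurable_cube|exact: cell_cube].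
Qed.

Lemma measurable_lattice_cell w (V : set X) : measurable (V : set (borel X)) ->
  measurable ([set w + x | x in V] : set (borel X)) /\ lam [set w + x | x in V] = lam V.
Proof. exact: (haar_translate haar (@shift_continuous _ _ _ t)). Qed.

Lemma lattice_cell_fiber w : L w -> [set x | rnd t x = w] = [set w + u | u in cell t].
Proof.
move=> Lw; apply/seteqP; split => [x /= <-|_ [u cu <-]]; last exact: rnd_lattice.
by exists (x - rnd t x); [exact: cell_rnd|rewrite addrC subrK].
Qed.

(* The cells are pairwise disjoint of equal positive measure in a sigma-finite
   space. *)
Lemma countable_lattice : countable L.
Proof.
have [F FT mF] := sigma_finiteT lam.
pose C w := [set w + u | u in cell t].
have mC w : measurable (C w : set (borel X)) /\ lam (C w) = lam (cell t).
  exact: measurable_lattice_cell measurable_cell.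
have tC : trivIset L C.
  move=> w w' Lw Lw' [x [Cx Cx']].
  by move: Cx Cx'; rewrite /C -!lattice_cell_fiber// => /= -> .
pose S n k := [set w | L w /\ ((k.+1%:R^-1)%:E < lam (F n `&` C w))%E].
have finS n k : finite_set (S n k).
  apply: contrapT => /infinite_set_fsetP infS.
  have [mFn Fn] := mF n.
  have Fnfin : lam (F n) \is a fin_num by rewrite ge0_fin_numE.
  pose N := (Num.trunc (fine (lam (F n)) * k.+1%:R)).+1.
  have [B BS cB] := infS N.
  have mFC w : measurable (F n `&` C w : set (borel X)).
    by apply: measurableI => //; have [] := mC w.
  have h1 : (\sum_(w <- B) lam (F n `&` C w) <= lam (F n))%E.
    rewrite -measure_fbigsetU//.
      apply: le_measure; rewrite ?inE//.
        by apply: bigsetU_measurable => w _; exact: mFC.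
      by rewrite -bigcup_fset => x [w _ []].
    move=> w w' Bw Bw' [x [[_ Cx] [_ Cx']]]; apply: tC.
    - by have [] := BS _ Bw.
    - by have [] := BS _ Bw'.
    - by exists x.
  have h2 : (\sum_(w <- B) (k.+1%:R^-1)%:E <= \sum_(w <- B) lam (F n `&` C w))%E.
    rewrite big_seq_cond [leRHS]big_seq_cond; apply: lee_sum => w /andP[Bw _].
    by have [_ /ltW] := BS _ Bw.
  have := le_trans h2 h1; rewrite sumEFin -(fineK Fnfin) lee_fin big_const_seq count_predT iter_addr_0.
  rewrite leNgt => /negP; apply.
  have f0 : 0 <= fine (lam (F n)) * k.+1%:R by rewrite mulr_ge0// fine_ge0.
  rewrite -[ltRHS]mulr_natl ltr_pdivlMr//.
  have /andP[_ /lt_le_trans] := truncn_itv f0; apply.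
  by rewrite ler_nat.
have -> : L = \bigcup_n \bigcup_k S n k.
  apply/seteqP; split => [w Lw|w [n _ [k _ []]]]//.
  apply: contrapT => nS.
  have z n : lam (F n `&` C w) = 0.
    apply/eqP; rewrite -measure_le0 leNgt; apply/negP => pos; apply: nS.
    exists n => //.
    have [mFn Fn] := mF n; have [mCw _] := mC w.
    have fin : lam (F n `&` C w) \is a fin_num.
      rewrite ge0_fin_numE//; apply: le_lt_trans Fn.
      by apply: le_measure; rewrite ?inE//; exact: measurableI.
    have pos' : 0 < fine (lam (F n `&` C w)) by rewrite fine_gt0// pos -ge0_fin_numE.
    exists (Num.trunc (fine (lam (F n `&` C w)))^-1) => //; split => //.
    rewrite -(fineK fin) lte_fin invf_plt ?posrE//.
    have /truncn_itv/andP[_ //] : 0 <= (fine (lam (F n `&` C w)))^-1 by rewrite invr_ge0 ltW.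
  have : lam (C w) = 0.
    have [mCw _] := mC w.
    apply/eqP; rewrite -measure_le0.
    have -> : C w = \bigcup_n (F n `&` C w) by rewrite -setI_bigcupl -FT setTI.
    apply: le_trans (measure_sigma_subadditive _ _ _ (@subset_refl _ _)) _ => //.
    - by move=> n; apply: measurableI => //; have [] := mF n.
    - by apply: bigcupT_measurable => n; apply: measurableI => //; have [] := mF n.
    - by rewrite eseries0// => n _ _; exact: z.
  have [_ ->] := mC w => h; have := cell_gt0; by rewrite h ltxx.
apply: bigcup_countable => // n _; apply: bigcup_countable => // k _.
exact: finite_set_countable.
Qed.

Lemma rnd_fiber_measurable w : measurable ([set x | rnd t x = w] : set (borel X)).
Proof.
have [Lw|nLw] := pselect (L w).
  by rewrite lattice_cell_fiber//; have [] := measurable_lattice_cell w measurable_cell.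
rewrite (_ : [set x | _] = set0) ?measurable0//.
by apply/seteqP; split => // x /= xw; apply: nLw; rewrite -xw; exact: lattice_rnd.
Qed.

Lemma bigcup_lattice_measurable (P : set X) (F : X -> set (borel X)) :
  P `<=` L -> (forall w, P w -> measurable (F w)) -> measurable (\bigcup_(w in P) F w).
Proof.
move=> PL mF; have [f fP] : exists f : X -> nat, {in P &, injective f}.
  apply/countable_injP; apply: sub_countable countable_lattice; exact: subset_card_le.
have -> : \bigcup_(w in P) F w =
    \bigcup_n \bigcup_(w in P `&` [set w | f w = n]) F w.
  apply/seteqP; split => [x [w Pw Fx]|x [n _ [w [Pw _] Fx]]]; last by exists w.
  by exists (f w) => //; exists w.
apply: bigcupT_measurable => n.
have [[w [Pw fw]]|nw] := pselect (exists w, P w /\ f w = n); last first.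
  rewrite (_ : _ `&` _ = set0) ?bigcup_set0//.
  by apply/seteqP; split => // w [Pw fw]; apply: nw; exists w.
rewrite (_ : _ `&` _ = [set w]) ?bigcup_set1; first exact: mF.
apply/seteqP; split => [w' [Pw' fw']|_ ->]//.
by apply: fP; rewrite ?inE// fw'.
Qed.

(** [rnd t] takes countably many values, each on a measurable set, so the preimage of any set is a
    countable union of cells. *)
Lemma measurable_rnd {d'} {T' : measurableType d'} (f : X -> T') :
  measurable_fun [set: borel X] (fun x => f (rnd t x)).
Proof.
move=> _ A mA; rewrite setTI.
have -> : (fun x => f (rnd t x)) @^-1` A = \bigcup_(w in L `&` f @^-1` A) [set x | rnd t x = w].
  apply/seteqP; split => [x Ax|x [w [_ Aw] /= xw]]; last by rewrite /= xw.
  by exists (rnd t x) => //; split => //; exact: lattice_rnd.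
apply: bigcup_lattice_measurable => w; first by case.
by move=> _; exact: rnd_fiber_measurable.
Qed.

Definition lattice_translates (V : set X) : set X := [set y | V (y - rnd t y)].

Lemma lattice_translatesE (V : set X) : V `<=` cell t ->
  lattice_translates V = \bigcup_(w in L) [set w + u | u in V].
Proof.
move=> VC; apply/seteqP; split => [y /= Vy|_ [w Lw [u Vu <-]]].
  exists (rnd t y); first exact: lattice_rnd.
  by exists (y - rnd t y) => //; rewrite addrC subrK.
by rewrite /lattice_translates /= rnd_lattice//; [rewrite addrC addKr|exact: VC].
Qed.

Lemma measurable_lattice_translates (V : set X) : measurable (V : set (borel X)) ->
  V `<=` cell t -> measurable (lattice_translates V : set (borel X)).
Proof.
move=> mV VC; rewrite lattice_translatesE//; apply: bigcup_lattice_measurable => // w _.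
by have [] := measurable_lattice_cell w mV.
Qed.

Lemma measurable_step (b : X -> \bar R) (V : set X) : measurable (V : set (borel X)) ->
  V `<=` cell t ->
  measurable_fun [set: borel X] (fun x => b (rnd t x) * (\1_V (x - rnd t x)%R)%:E)%E.
Proof.
move=> mV VC; apply: emeasurable_funM; first exact: measurable_rnd.
apply/measurable_EFinP.
have -> : (fun x => \1_V (x - rnd t x)) = \1_(lattice_translates V) :> (X -> R) by [].
exact: measurable_indic (measurable_lattice_translates mV VC).
Qed.

(** Numbering the lattice splits the integral into countably many cells, each contributing [lam V]
    times a value of [b]. The displacement by u serves later to probe a cell by several translates
    of one small set [V]. *)
Lemma integral_step (b : X -> \bar R) (V : set X) u : (forall x, (0 <= b x)%E) ->
  measurable (V : set (borel X)) -> V `<=` cell t ->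
  (\int[lam]_x (b (rnd t (x - u)%R) * (\1_V (x - u - rnd t (x - u))%R)%:E) =
   \esum_(w in L) (b w * lam V))%E.
Proof.
move=> b0 mV VC.
pose g x := (b (rnd t x) * (\1_V (x - rnd t x)%R)%:E)%E.
have g0 x : (0 <= g x)%E by rewrite mule_ge0// lee_fin.
have mg : measurable_fun [set: borel X] g by exact: measurable_step.
have -> : (\int[lam]_x (b (rnd t (x - u)%R) * (\1_V (x - u - rnd t (x - u))%R)%:E) =
    \int[lam]_x g x)%E.
  exact: (@ge0_integral_shift _ _ _ haar (@shift_continuous _ _ _ t) (- u) g).
have [f fL] : exists f : X -> nat, {in L &, injective f}.
  by apply/countable_injP; exact: countable_lattice.
pose F n : set (borel X) := [set x | f (rnd t x) = n].
have mF n : measurable (F n).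
  have := @measurable_rnd _ _ f; move=> /(_ measurableT [set n]).
  by rewrite setTI; apply.
have tF : trivIset setT F by move=> m n _ _ [x [/= <- <-]].
have FT : \bigcup_n F n = setT by apply/seteqP; split => // x _; exists (f (rnd t x)).
have := @ge0_integral_bigcup _ _ _ lam F g mF; rewrite FT => -> //.
have FE w : L w -> F (f w) = [set w + u | u in cell t].
  move=> Lw; rewrite -lattice_cell_fiber//; apply/seteqP; split => x; rewrite /F /=; [move=> fx|by move=> ->].
  by apply: fL => //; rewrite inE//; exact: lattice_rnd.
have intF w : L w -> (\int[lam]_(x in F (f w)) g x = b w * lam V)%E.
  move=> Lw; have mE := measurable_lattice_translates mV VC.
  under eq_integral => x.
    rewrite inE FE// -lattice_cell_fiber// => /= xw; rewrite /g xw.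
    rewrite (_ : \1_V (x - w) = \1_(lattice_translates V) x); last first.
      by rewrite -xw.
    over.
  rewrite ge0_integralZl//; last first.
    by apply/measurable_EFinP; apply: measurable_funTS; exact: measurable_indic.
  rewrite integral_indic//; congr (_ * _)%E.
  have [mw <-] := measurable_lattice_cell w mV; congr (lam _).
  rewrite FE//; apply/seteqP; split => [y [Ey [v cv vy]]|_ [v Vv <-]].
    by exists v => //; move: Ey; rewrite -vy /lattice_translates /= rnd_lattice// addrC addKr.
  split; last by exists v => //; exact: VC.
  by rewrite /lattice_translates /= rnd_lattice//; [rewrite addrC addKr|exact: VC].
rewrite nneseries_esumT; last by move=> n; exact: integral_ge0.
have -> : (\esum_(w in L) (b w * lam V) = \esum_(n in f @` L) \int[lam]_(x in F n) g x)%E.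
  rewrite (@reindex_esum _ _ _ L (f @` L) f)//; last first.
    by split => [x Lx|//|//]; exists x.
  by apply: eq_esum => w Lw; rewrite intF.
rewrite [RHS]esum_mkcond; apply: eq_esum => n _.
case: ifPn => //; rewrite notin_setE => nfL.
rewrite (_ : F n = set0) ?integral_set0//.
apply/seteqP; split => // x /= xn; apply: nfL; exists (rnd t x) => //; exact: lattice_rnd.
Qed.

End tiling_measure.

(** * Tilings of the group and of its dual *)

HB.instance Definition _ (X Y : PreTopologicalZmodule.type) :=
  Topological.on (X * Y)%type.

Lemma fst_continuousT (T U : topologicalType) : continuous (fun z : T * U => z.1).
Proof. by move=> z; exact: cvg_fst. Qed.

Lemma snd_continuousT (T U : topologicalType) : continuous (fun z : T * U => z.2).
Proof. by move=> z; exact: cvg_snd. Qed.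

Section group_tilings.
Context {R : realType} {G G0 : lcaType} {d : nat}.
Context {iso : G -> 'cV[R]_d * G0} (S : splitting iso).
Context {K : set G0} (K_subgroup : compact_open_subgroup K).
Context {A : 'M[R]_d} (A_unit : A \in unitmx).
Local Notation Gh := (dual_group R G).

Lemma mulmx_invK : cancel (mulmx A : 'cV_d -> _) (mulmx (invmx A)).
Proof. by move=> a; exact: mulKmx. Qed.

(** By [mulmx_bounded] the cube in the coordinates transformed by A lies in a larger cube in the
    original coordinates, as a closed subset. *)
Lemma compact_linear_cube (X : topologicalType) (f : X -> 'cV[R]_d) (H : set X) (r : R) :
  continuous f -> (forall r, compact [set x | H x /\ forall i, `|f x i 0| <= r]) ->
  compact [set x | H x /\ forall i, `|(invmx A *m f x) i 0| <= r].
Proof.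
move=> cf cH; have [r' r'P] := mulmx_bounded A r.
pose B := [set x | forall i, `|(invmx A *m f x) i 0| <= r].
have cB : closed B.
  have -> : B = \bigcap_(i in setT) [set x | `|(invmx A *m f x) i 0| <= r].
    by apply/seteqP; split => x h i *; apply: h.
  apply: closed_bigI => i _.
  have c1 : continuous (fun x => `|(invmx A *m f x) i 0|).
    have c2 := continuousT_comp cf (@mulmx_continuous R d (invmx A)).
    have c3 := continuousT_comp c2 (@coord_continuous R d 1 i 0).
    by move=> x; apply: cvg_norm; exact: c3.
  exact: (@closed_comp _ _ _ [set s : R | s <= r] (fun x _ => c1 x) (@closed_le R r)).
have -> : [set x | H x /\ forall i, `|(invmx A *m f x) i 0| <= r] =
    [set x | H x /\ forall i, `|f x i 0| <= r'] `&` B.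
  apply/seteqP; split => [x [Hx hx]|x [[Hx _] hx]]; last by [].
  by split => //; split => // i; rewrite -[f x](mulKVmx A_unit); exact: r'P.
exact: (compact_closedI (cH r') cB).
Qed.

Lemma group_repsP {D : set G0} : coset_representatives K D -> forall x : G,
  exists! e, ((iso e).1 = 0 /\ D (iso e).2) /\ K (iso (x - e)).2.
Proof.
move=> DP x; have [e0 [[De Ke] u]] := DP (iso x).2.
exists (tor S e0); split.
  by rewrite (isoB S) iso_tor.
move=> e [[e1 De'] Ke']; rewrite (iso_decomp S e) e1 vec0 add0r; congr tor.
by apply: u; split => //; move: Ke'; rewrite (isoB S).
Qed.

(** Multiplication by [invmx A] turns the lattice A Z^d into Z^d. The definition is transparent
    because later proofs compute with its fields. *)
Definition group_tiling {D : set G0} (DP : coset_representatives K D) : tiling R d G.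
Proof.
refine (@Tiling R d G (fun x => invmx A *m (iso x).1) [set x | K (iso x).2]
  (fun a => vec S (A *m a)) [set e | (iso e).1 = 0 /\ D (iso e).2]
  _ _ _ _ _ (group_repsP DP) _ _ _ _ (@group_shift_continuous G)).
- by move=> x y; rewrite (isoD S) mulmxDr.
- by move=> a; rewrite iso_vec mulmx_invK.
- by move=> a; rewrite /= iso_vec; have [_ _ K0 _] := K_subgroup.
- by rewrite /= (iso0 S); have [_ _ K0 _] := K_subgroup.
- by move=> x y; rewrite /= (isoB S) => Kx Ky; have [_ _ _ KB] := K_subgroup; exact: KB.
- by move=> e [-> _]; rewrite mulmx0.
- exact: (continuousT_comp (iso1_continuous S) (@mulmx_continuous _ _ _)).
- have [_ oK _ _] := K_subgroup; by move/continuousP : (iso2_continuous S); exact.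
- move=> r; apply: (compact_linear_cube (iso1_continuous S)) => r'.
  exact: (compact_lca_cell S K_subgroup).
Defined.

Lemma lattice_group_tiling (D : set G0) (DP : coset_representatives K D) :
  lattice (group_tiling DP) = lattice1 iso A D.
Proof.
apply/seteqP; split => [x [k [e [[e1 De] ->]]]|x [[k xk] Dx]].
  by split; [exists k|]; rewrite (isoD S) iso_vec/= ?e1 ?addr0 ?add0r.
exists k, (tor S (iso x).2); split; first by rewrite /= iso_tor.
by rewrite [LHS](iso_decomp S) xk.
Qed.

Local Notation D2_representatives D := (coset_representatives (annihilator K) D).

Lemma dual_repsP (D : set (dual_group R G0)) : D2_representatives D -> forall x : Gh,
  exists! e, (freq S e = 0 /\ D (res S e)) /\ dual_tor S K (x - e).
Proof.
move=> DP x; have [e0 [[De Ke] u]] := DP (res S x).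
exists (dual_lift S 0 e0); split.
  by rewrite freq_lift res_lift; split => //; apply/dual_torE; rewrite resB res_lift.
move=> e [[e1 De'] /dual_torE Ke']; rewrite -(lift_freq_res S e) e1; congr dual_lift.
by apply: u; split => //; move: Ke'; rewrite resB.
Qed.

Definition dual_tiling (D : set (dual_group R G0)) (DP : D2_representatives D) :
  tiling R d Gh.
Proof.
refine (@Tiling R d Gh (fun x => invmx A *m freq S x) (dual_tor S K)
  (fun a => dual_lift S (A *m a) 0) [set e | freq S e = 0 /\ D (res S e)]
  _ _ _ _ (@dual_torB _ _ _ _ _ S K) (dual_repsP DP) _ _ _ _ (@dual_shift_continuous R G)).
- by move=> x y; rewrite freqD mulmxDr.
- by move=> a; rewrite freq_lift mulmx_invK.
- by move=> a; apply/dual_torE; rewrite res_lift.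
- exact: dual_tor0.
- by move=> e [-> _]; rewrite mulmx0.
- exact: (continuousT_comp (@freq_continuous _ _ _ _ _ S) (@mulmx_continuous _ _ _)).
- exact: dual_tor_open.
- move=> r; apply: (compact_linear_cube (@freq_continuous _ _ _ _ _ S)) => r'.
  exact: compact_dual_cell.
Defined.

Lemma lattice_dual_tiling (D : set (dual_group R G0)) (DP : D2_representatives D) :
  lattice (dual_tiling DP) = lattice2 iso A D.
Proof.
apply/seteqP; split => [x [k [e [[e1 De] ->]]]|x [k [eta [De xP]]]].
  exists k, (res S e); split => // y.
  rewrite -{1}(lift_freq_res S e) -liftD e1 addr0 add0r pairing_lift.
  by rewrite /dotv; congr (expi _ * _); rewrite mulr_sumr mulr_sumr; apply: eq_bigr => i _; ring.
exists k, (dual_lift S 0 eta); rewrite /= freq_lift res_lift; split => //.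
rewrite -liftD addr0 add0r; apply: pairing_ext => y; rewrite xP pairing_lift.
by congr (expi _ * _); rewrite mulr_sumr mulr_sumr; apply: eq_bigr => i _; ring.
Qed.

End group_tilings.

Section product_tiling.
Context {R : realType} {d1 d2 : nat} {X Y : PreTopologicalZmodule.type}.
Context (t1 : tiling R d1 X) (t2 : tiling R d2 Y).
Implicit Types z : X * Y.

Let crdP z : 'cV[R]_(d1 + d2) := col_mx (crd t1 z.1) (crd t2 z.2).
Let stabP : set (X * Y) := [set z | stab t1 z.1 /\ stab t2 z.2].
Let secP (a : 'cV[R]_(d1 + d2)) : X * Y := (sec t1 (usubmx a), sec t2 (dsubmx a)).
Let repsPr : set (X * Y) := [set z | reps t1 z.1 /\ reps t2 z.2].

Lemma col_mx_coord (a : 'cV[R]_d1) (b : 'cV[R]_d2) (P : R -> Prop) :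
  (forall i, P (col_mx a b i 0)) <-> (forall i, P (a i 0)) /\ (forall i, P (b i 0)).
Proof.
split => [h|[h1 h2] i].
  by split => i; [have := h (lshift _ i); rewrite col_mxEu|have := h (rshift _ i); rewrite col_mxEd].
by case: (splitP i) => j ij; [rewrite (_ : i = lshift _ j) ?col_mxEu//; apply: val_inj|
  rewrite (_ : i = rshift _ j) ?col_mxEd//; apply: val_inj].
Qed.

Definition product_tiling : tiling R (d1 + d2) (X * Y)%type.
Proof.
refine (@Tiling R (d1 + d2) (X * Y)%type crdP stabP secP repsPr _ _ _ _ _ _ _ _ _ _ _).
- by move=> x y; rewrite /crdP !crdD add_col_mx.
- by move=> a; rewrite /crdP /= !secK vsubmxK.
- by move=> a; split; exact: stab_sec.
- by split; exact: stab0.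
- by move=> x y [h1 h2] [h3 h4]; split; exact: stabB.
- move=> [x y]; have [e [[re se] ue]] := repsP t1 x; have [f [[rf sf] uf]] := repsP t2 y.
  exists (e, f); split => // -[e' f'] /= [[re' rf'] [se' sf']].
  by rewrite (ue e')// (uf f').
- by move=> e [h1 h2]; rewrite /crdP !crd_reps// col_mx0.
- apply: cV_continuous => i; case: (splitP i) => j ij.
    have -> : (fun z => crdP z i 0) = (fun z => crd t1 z.1 j 0).
      by apply/funext => z; rewrite (_ : i = lshift _ j) ?col_mxEu//; apply: val_inj.
    have cc := continuousT_comp (@fst_continuousT X Y) (@crd_continuous _ _ _ t1).
    exact: (continuousT_comp cc (@coord_continuous R d1 1 j 0)).
  have -> : (fun z => crdP z i 0) = (fun z => crd t2 z.2 j 0).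
    by apply/funext => z; rewrite (_ : i = rshift _ j) ?col_mxEd//; apply: val_inj.
  have cc := continuousT_comp (@snd_continuousT X Y) (@crd_continuous _ _ _ t2).
  exact: (continuousT_comp cc (@coord_continuous R d2 1 j 0)).
- apply: (@openI _ ((fun z : X * Y => z.1) @^-1` stab t1) ((fun z : X * Y => z.2) @^-1` stab t2)).
    by move/continuousP : (@fst_continuousT X Y); apply; exact: stab_open.
  by move/continuousP : (@snd_continuousT X Y); apply; exact: stab_open.
- move=> r; have -> : [set x | stabP x /\ (forall i, `|crdP x i 0| <= r)] =
    [set x | stab t1 x /\ forall i, `|crd t1 x i 0| <= r] `*`
    [set x | stab t2 x /\ forall i, `|crd t2 x i 0| <= r].
    apply/seteqP; split => [z [[h1 h2] /(col_mx_coord _ _ (fun a => `|a| <= r)) [h3 h4]]|z [[h1 h2] [h3 h4]]] //.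
    by split => //; apply/(col_mx_coord _ _ (fun a => `|a| <= r)).
  by apply: compact_setX; exact: stab_compact.
- move=> [a b]; apply: continuous_pair.
    exact: (continuousT_comp (@fst_continuousT X Y) (@shift_continuous _ _ _ t1 a)).
  exact: (continuousT_comp (@snd_continuousT X Y) (@shift_continuous _ _ _ t2 b)).
Defined.

Lemma lattice_product : lattice product_tiling = lattice t1 `*` lattice t2.
Proof.
apply/seteqP; split => [_ [k [[e1 e2] [[r1 r2] ->]]]|[x y] [[k1 [e1 [r1 /= ->]]] [k2 [e2 [r2 /= ->]]]]].
  split; [exists (usubmx k), e1|exists (dsubmx k), e2]; split => //=.
    by rewrite map_usubmx.
  by rewrite map_dsubmx.
exists (col_mx k1 k2), (e1, e2); split => //=.
by rewrite /secP map_col_mx col_mxKu col_mxKd.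
Qed.

Lemma cube_product n : cube product_tiling n = cube t1 n `*` cube t2 n.
Proof.
apply/seteqP; split => [z [[h1 h2] /(col_mx_coord _ _ (fun a => `|a| <= n%:R)) [h3 h4]]|z [[h1 h2] [h3 h4]]] //.
by split => //; apply/(col_mx_coord _ _ (fun a => `|a| <= n%:R)).
Qed.

Lemma cell_product : cell product_tiling = cell t1 `*` cell t2.
Proof.
apply/seteqP; split => [z [[h1 h2] /(col_mx_coord _ _ (fun a => - 2^-1 <= a < 2^-1)) [h3 h4]]|z [[h1 h2] [h3 h4]]] //.
by split => //; apply/(col_mx_coord _ _ (fun a => - 2^-1 <= a < 2^-1)).
Qed.

Lemma rnd_product z : rnd product_tiling z = (rnd t1 z.1, rnd t2 z.2).
Proof.
have zE : (rnd t1 z.1, rnd t2 z.2) + (z.1 - rnd t1 z.1, z.2 - rnd t2 z.2) = z.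
  by case: z => x y; apply/pair_equal_spec; rewrite /= !(addrC (rnd _ _)) !subrK.
rewrite -{1}zE; apply: rnd_lattice.
  by rewrite lattice_product; split; exact: lattice_rnd.
by rewrite cell_product; split; exact: cell_rnd.
Qed.

End product_tiling.

(** * Decaying kernels and mixed sequence norms *)

Section power_sums.
Context {R : realType}.
Local Open Scope ereal_scope.
Implicit Types (x y : \bar R) (r s : R).

Lemma poweR_addr x r s : 0 <= x -> (0 < r)%R -> (0 < s)%R ->
  x `^ r * x `^ s = x `^ (r + s).
Proof.
case: x => [x x0 r0 s0|_ r0 s0|//].
  by rewrite !poweR_EFin -EFinM powRD//; apply/implyP => /eqP; lra.
by rewrite !poweRyr ?gt_eqF ?addr_gt0// mulyy.
Qed.

Lemma poweRrK x r : 0 <= x -> (0 < r)%R -> (x `^ r) `^ r^-1 = x.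
Proof. by move=> x0 r0; rewrite -poweRrM mulfV ?gt_eqF// poweRe1. Qed.

Lemma poweRrVK x r : 0 <= x -> (0 < r)%R -> (x `^ r^-1) `^ r = x.
Proof. by move=> x0 r0; rewrite -poweRrM mulVf ?gt_eqF// poweRe1. Qed.

Lemma le_poweR r x y : (0 < r)%R -> 0 <= x -> x <= y -> x `^ r <= y `^ r.
Proof.
move=> r0 x0 xy; apply: gt0_ler_poweR => //; first exact: ltW.
  by rewrite in_itv /= x0 leey.
by rewrite in_itv /= (le_trans x0)// leey.
Qed.

(** For 0 <= t <= s one has t/s <= (t/s)^r, that is s^r (t/s) <= t^r; take s = x + y and add the
    cases t = x and t = y. *)
Lemma poweR_le_add r x y : (0 < r <= 1)%R -> 0 <= x -> 0 <= y ->
  (x + y) `^ r <= x `^ r + y `^ r.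
Proof.
move=> /andP[r0 r1]; case: x => [x x0|_ y0|//]; last first.
  have yN : y != -oo by rewrite gt_eqF// (lt_le_trans _ y0).
  rewrite addye// poweRyr ?gt_eqF// addye ?leey//.
  by rewrite gt_eqF// (lt_le_trans _ (poweR_ge0 _ _)).
case: y => [y y0|_|//]; last first.
  by rewrite addey// !poweRyr ?gt_eqF// addey ?leey// gt_eqF// (lt_le_trans _ (poweR_ge0 _ _)).
rewrite -EFinD !poweR_EFin -EFinD lee_fin.
move: x0 y0; rewrite !lee_fin => x0 y0.
have [xy0|] := eqVneq (x + y)%R 0%R.
  by rewrite xy0 powR0 ?gt_eqF// addr_ge0 ?powR_ge0.
move=> xy; have xyp : (0 < x + y)%R by rewrite lt_def xy addr_ge0.
have scale (t : R) : (0 <= t)%R -> (t <= x + y)%R -> ((x + y) `^ r * (t / (x + y)) <= t `^ r)%R.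
  move=> t0 txy; rewrite -{2}(divfK xy t) powRM ?divr_ge0 ?(ltW xyp)//.
  rewrite [leLHS]mulrC ler_wpM2r ?powR_ge0//.
  have [->|tn0] := eqVneq t 0%R; first by rewrite mul0r powR_ge0.
  apply: ger1_powR => //.
  by rewrite divr_gt0 ?ler_pdivrMr ?mul1r// lt_def tn0.
apply: le_trans (lerD (scale x x0 _) (scale y y0 _)); try lra.
by rewrite -mulrDr -mulrDl divff// mulr1.
Qed.

Context {T : choiceType}.
Implicit Types (A B : set T) (a b : T -> \bar R).

Lemma esum_term A a i : (forall i, 0 <= a i) -> A i -> a i <= \esum_(i in A) a i.
Proof.
move=> a0 Ai; apply: esum_ge; exists [set i]; first by split => // _ ->.
by rewrite fsbig_set1.
Qed.

Lemma esum_le_set A B a : (forall i, 0 <= a i) -> A `<=` B ->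
  \esum_(i in A) a i <= \esum_(i in B) a i.
Proof.
move=> a0 AB; rewrite esum_mkcond [leRHS]esum_mkcond; apply: le_esum => i _.
case: ifPn => [/set_mem Ai|_]; first by rewrite mem_set//; exact: AB.
by case: ifPn.
Qed.

Lemma esumZl (c : \bar R) A a : 0 <= c -> (forall i, 0 <= a i) ->
  \esum_(i in A) (c * a i) = c * \esum_(i in A) a i.
Proof.
move=> c0 a0.
have le (c' : \bar R) b : 0 <= c' -> (forall i, 0 <= b i) ->
    \esum_(i in A) (c' * b i) <= c' * \esum_(i in A) b i.
  move=> c'0 b0; apply: ge_ereal_sup => _ [X [finX XA] <-].
  rewrite -ge0_mule_fsumr//; apply: lee_wpmul2l => //.
  by apply: esum_ge; exists X.
apply/eqP; rewrite eq_le le//=; move: c0; case: c => [c|_|//].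
  move=> c0; move: (c0); rewrite lee_fin le0r => /orP[/eqP ->|{}c0].
    by rewrite mul0e esum1// => i _; rewrite mul0e.
  rewrite -lee_pdivlMl//.
  apply: le_trans (le (c^-1)%:E _ _ _) => [||i]; last by rewrite mule_ge0// lee_fin ltW.
    by apply: le_esum => i _; rewrite muleA -EFinM mulVf ?gt_eqF// mul1e.
  by rewrite lee_fin invr_ge0 ltW.
(* The remaining case is c = +oo, where a single nonzero term makes both sides infinite. *)
have [aA|/existsNP[i /not_implyP[Ai ai]]] := pselect (forall i, A i -> a i = 0).
  by rewrite (esum1 aA) mule0 esum_ge0// => i Ai; rewrite aA// mule0.
have aip : 0 < a i by rewrite lt_def a0 andbT; exact/eqP.
apply: le_trans (@esum_term A (fun i => +oo * a i) i _ Ai); first by rewrite (gt0_mulye aip) leey.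
by move=> j; rewrite mule_ge0.
Qed.

Lemma esum_poweR_le r A a : (0 < r <= 1)%R -> (forall i, 0 <= a i) ->
  (\esum_(i in A) a i) `^ r <= \esum_(i in A) (a i) `^ r.
Proof.
move=> r01 a0; have /andP[r0 r1] := r01.
rewrite -[leRHS](@poweRrVK _ r)//; last by apply: esum_ge0 => i _; exact: poweR_ge0.
apply: le_poweR => //; first exact: esum_ge0.
apply: ge_ereal_sup => _ [X [finX XA] <-].
rewrite -[leLHS](@poweRrK _ r)//; last by rewrite fsume_ge0.
apply: le_poweR; [by rewrite invr_gt0|exact: poweR_ge0|].
apply: (@le_trans _ _ (\sum_(x \in X) (a x) `^ r)); last by apply: esum_ge; exists X.
rewrite !fsbig_finite//=.
suff [_ //] : 0 <= \sum_(i <- fset_set X) a i /\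
  (\sum_(i <- fset_set X) a i) `^ r <= \sum_(i <- fset_set X) (a i) `^ r.
elim/big_ind2: _ => [|x1 x2 y1 y2 [x0 h1] [y0 h2]|i _].
- by rewrite poweR0r ?gt_eqF.
- split; first exact: adde_ge0.
  by apply: le_trans (poweR_le_add r01 x0 y0) _; exact: leeD.
- by [].
Qed.

Lemma esum_poweR_ge r A a : (1 <= r)%R -> (forall i, 0 <= a i) ->
  \esum_(i in A) (a i) `^ r <= (\esum_(i in A) a i) `^ r.
Proof.
move=> r1 a0; have r0 : (0 < r)%R by lra.
rewrite -[leLHS](@poweRrVK _ r)//; last by apply: esum_ge0 => i _; exact: poweR_ge0.
apply: le_poweR => //; first exact: poweR_ge0.
have rV : (0 < r^-1 <= 1)%R by rewrite invr_gt0 r0 invf_le1.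
apply: le_trans (esum_poweR_le A rV _) _ => [i|]; first exact: poweR_ge0.
by apply: le_esum => i _; rewrite poweRrK.
Qed.

Lemma exchange_esum {T' : choiceType} A (B : set T') (a : T -> T' -> \bar R) :
  (forall i j, 0 <= a i j) ->
  \esum_(i in A) \esum_(j in B) a i j = \esum_(j in B) \esum_(i in A) a i j.
Proof.
move=> a0; rewrite esum_esum// esum_esum//.
rewrite (@reindex_esum _ _ _ (B `*`` fun=> A) (A `*`` fun=> B) (fun k => (k.2, k.1)))//.
split => [[j i] [/= Bj Ai]//|[j i] [j' i'] _ _ [-> ->]//|[i j] [/= Ai Bj]].
by exists (j, i).
Qed.

(* The sequence b k^(1/2) is bounded by its l^p norm, and k^(1/2) is summable. *)
Lemma esumM_poweR_le r A (k b : T -> \bar R) : (0 < r)%R ->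
  (forall i, 0 <= k i) -> (forall i, 0 <= b i) ->
  (\esum_(i in A) k i * b i) `^ r <=
  (\esum_(i in A) (k i) `^ 2^-1) `^ r * \esum_(i in A) (k i) `^ (r / 2) * (b i) `^ r.
Proof.
move=> r0 k0 b0; pose X := \esum_(i in A) (k i) `^ (r / 2) * (b i) `^ r.
have X0 : 0 <= X by apply: esum_ge0 => i _; rewrite mule_ge0 ?poweR_ge0.
have K0 : 0 <= \esum_(i in A) (k i) `^ 2^-1 by apply: esum_ge0 => i _; exact: poweR_ge0.
rewrite -/X -[X in _ * X](@poweRrVK _ r)// -poweRM//; last exact: poweR_ge0.
apply: le_poweR => //; first by apply: esum_ge0 => i _; rewrite mule_ge0.
rewrite muleC -esumZl//; [|exact: poweR_ge0|by move=> i; exact: poweR_ge0].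
apply: le_esum => i Ai.
have kE : k i = (k i) `^ (2^-1 + 2^-1) by rewrite (_ : 2^-1 + 2^-1 = 1)%R ?poweRe1//; lra.
rewrite {1}kE -poweR_addr ?invr_gt0// -muleA [leRHS]muleC; apply: lee_wpmul2l; first exact: poweR_ge0.
rewrite -[leLHS](@poweRrK _ r)//; last by rewrite mule_ge0 ?poweR_ge0.
apply: le_poweR; [by rewrite invr_gt0|exact: poweR_ge0|].
rewrite poweRM ?poweR_ge0// -poweRrM mulrC.
by apply: (@esum_term A (fun i => (k i) `^ (r / 2) * (b i) `^ r)) => // j; rewrite mule_ge0 ?poweR_ge0.
Qed.

(** Unlike plain summability this is stable under every positive power of the sequence
    ([rapid_of_poweR]), and that stability carries the case of exponents below 1. *)
Definition rapid A b := forall r : R, (0 < r <= 1)%R -> \esum_(i in A) (b i) `^ r < +oo.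

Lemma rapid_poweR A b r : (forall i, 0 <= b i) -> rapid A b -> (0 < r)%R ->
  \esum_(i in A) (b i) `^ r < +oo.
Proof.
move=> b0 rb r0; have [r1|r1] := leP r 1%R; first by apply: rb; rewrite r0 r1.
apply: le_lt_trans (esum_poweR_ge _ (ltW r1) b0) _; apply: poweR_lty.
by have := rb 1%R; under eq_esum do rewrite poweRe1//; apply; lra.
Qed.

Lemma rapid_sum A b : (forall i, 0 <= b i) -> rapid A b -> \esum_(i in A) b i < +oo.
Proof.
move=> b0 rb; have := rb 1%R; under eq_esum do rewrite poweRe1//.
by apply; lra.
Qed.

Lemma rapid_of_poweR A b s : (forall i, 0 <= b i) -> rapid A b -> (0 < s)%R ->
  rapid A (fun i => (b i) `^ s).
Proof.
move=> b0 rb s0 r /andP[r0 r1].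
under eq_esum do rewrite -poweRrM.
by apply: rapid_poweR => //; exact: mulr_gt0.
Qed.

Lemma le_rapid A a b : (forall i, 0 <= a i) -> (forall i, A i -> a i <= b i) ->
  rapid A b -> rapid A a.
Proof.
move=> a0 ab rb r r01; have /andP[r0 _] := r01.
apply: le_lt_trans (rb r r01); apply: le_esum => i Ai.
by apply: le_poweR => //; exact: ab.
Qed.

Lemma rapidZ A (c : \bar R) b : 0 <= c -> c < +oo -> (forall i, 0 <= b i) -> rapid A b ->
  rapid A (fun i => c * b i).
Proof.
move=> c0 cfin b0 rb r r01.
under eq_esum do rewrite poweRM//.
rewrite esumZl ?poweR_ge0//; last by move=> i; exact: poweR_ge0.
apply: lte_mul_pinfty; [exact: poweR_ge0| |exact: rb].
rewrite ge0_fin_numE ?poweR_ge0//; exact: poweR_lty.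
Qed.

Lemma rapidD A a b : (forall i, 0 <= a i) -> (forall i, 0 <= b i) ->
  rapid A a -> rapid A b -> rapid A (fun i => a i + b i).
Proof.
move=> a0 b0 ra rb r r01.
apply: (@le_lt_trans _ _ (\esum_(i in A) ((a i) `^ r + (b i) `^ r))).
  by apply: le_esum => i _; exact: poweR_le_add.
rewrite esumD; [|by move=> i _; exact: poweR_ge0..].
by apply: lte_add_pinfty; [exact: ra|exact: rb].
Qed.

End power_sums.

Section mixed_sequence_norms.
Context {R : realType}.
Local Open Scope ereal_scope.
Implicit Types p q : \bar R.

Lemma le_lnorm {T : choiceType} p (A : set T) a b : 0 < p ->
  (forall t, A t -> `|a t| <= `|b t|) -> lnorm p A a <= lnorm p A b.
Proof.
case: p => [r|_ ab|//]; rewrite ?lte_fin /=.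
  move=> r0 ab; apply: le_poweR; first by rewrite invr_gt0.
    by apply: esum_ge0 => i _; exact: poweR_ge0.
  by apply: le_esum => t At; apply: le_poweR => //; exact: ab.
apply: ge_ereal_sup => _ [t At <-]; apply: le_trans (ab t At) _.
by apply: ereal_sup_ubound; exists t.
Qed.

Lemma lnormZ {T : choiceType} p (A : set T) (c : R) a : 0 < p -> (0 < c)%R ->
  lnorm p A (fun t => c%:E * a t) = c%:E * lnorm p A a.
Proof.
case: p => [r|_ c0|//]; rewrite ?lte_fin /=.
  move=> r0 c0.
  under eq_esum => t _ do rewrite abseM poweRM// gee0_abs ?lee_fin ?ltW//.
  rewrite esumZl ?poweR_ge0//; last by move=> i; exact: poweR_ge0.
  rewrite poweRM ?poweR_ge0//; last by apply: esum_ge0 => i _; exact: poweR_ge0.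
  by rewrite poweRrK// lee_fin ltW.
rewrite -ereal_sup_pZl//; congr ereal_sup.
apply/seteqP; split => [_ [t At <-]|_ [_ [t At <-] <-]].
  by exists `|a t|; [exists t|rewrite abseM (@gee0_abs _ c%:E) ?lee_fin ?ltW].
by exists t => //; rewrite abseM (@gee0_abs _ c%:E) ?lee_fin ?ltW.
Qed.

Lemma reindex_lnorm {T T' : choiceType} p (A : set T) (B : set T') (e : T -> T') a :
  set_bij A B e -> lnorm p A (fun t => a (e t)) = lnorm p B a.
Proof.
move=> eB; case: p => [r||]//=; first by rewrite (@reindex_esum _ _ _ A B e (fun t => `|a t| `^ r) eB).
congr ereal_sup; apply/seteqP; split => [_ [t At <-]|_ [t Bt <-]].
  by exists (e t) => //; have [h _ _] := eB; exact: h.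
by have [_ _ h] := eB; have [s As <-] := h t Bt; exists s.
Qed.

(** Instead of a triangle inequality the weights are allowed to change. For p = r finite,
    [esumM_poweR_le] moves the power r inside the sum, the two sums are exchanged, and the same
    lemma with exponent 1/r undoes the power. The new weights are a constant times a power of [k],
    hence rapid, and no case distinction at p = 1 occurs. *)
Lemma quasi_minkowski {I T : choiceType} p (S : set I) (A : set T) (k : I -> \bar R) :
  0 < p -> (forall i, 0 <= k i) -> rapid S k ->
  exists k' : I -> \bar R, [/\ forall i, 0 <= k' i, rapid S k' &
    forall B : I -> T -> \bar R, (forall i t, 0 <= B i t) ->
    lnorm p A (fun t => \esum_(i in S) k i * B i t) <=
    \esum_(i in S) k' i * lnorm p A (B i)].
Proof.
case: p => [r r0 k0 rk|_ k0 rk|//]; last first.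
  exists k; split => // B B0 /=; apply: ge_ereal_sup => _ [t At <-].
  rewrite gee0_abs; last by apply: esum_ge0 => i _; rewrite mule_ge0.
  apply: le_esum => i _; apply: lee_wpmul2l => //.
  by apply: ereal_sup_ubound; exists t => //; rewrite gee0_abs.
rewrite lte_fin in r0.
pose K1 := (\esum_(i in S) (k i) `^ 2^-1) `^ r.
pose K2 := (\esum_(i in S) ((k i) `^ (r / 2)) `^ 2^-1) `^ r^-1.
have K1fin : K1 < +oo by apply: poweR_lty; apply: rapid_poweR.
have r2 : (0 < r / 2)%R by rewrite divr_gt0.
have K2fin : K2 < +oo.
  apply: poweR_lty; apply: rapid_poweR => //; first by move=> i; exact: poweR_ge0.
  exact: rapid_of_poweR.
have s0 : (0 < r / 2 * (r^-1 / 2))%R by rewrite !mulr_gt0 ?invr_gt0.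
(* The exponent of [k i] is 1/4: each of the two applications of [esumM_poweR_le] spends half of the
   kernel on summability. *)
exists (fun i => K1 `^ r^-1 * K2 * (k i) `^ (r / 2 * (r^-1 / 2))); split.
- by move=> i; rewrite !mule_ge0 ?poweR_ge0.
- apply: rapidZ; [by rewrite mule_ge0 ?poweR_ge0| |by move=> i; exact: poweR_ge0|exact: rapid_of_poweR].
  by apply: lte_mul_pinfty; rewrite ?ge0_fin_numE ?poweR_ge0//; exact: poweR_lty.
move=> B B0 /=.
have e0 (f : T -> \bar R) : 0 <= \esum_(t in A) (f t) `^ r by apply: esum_ge0 => t _; exact: poweR_ge0.
have N0 i : 0 <= \esum_(t in A) (B i t) `^ r by exact: e0.
have NE i : \esum_(t in A) `|B i t| `^ r = \esum_(t in A) (B i t) `^ r.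
  by apply: eq_esum => t _; rewrite gee0_abs.
under [leRHS]eq_esum do rewrite NE.
have M0 i : 0 <= (\esum_(t in A) (B i t) `^ r) `^ r^-1 by exact: poweR_ge0.
apply: (@le_trans _ _ ((K1 * \esum_(i in S) (k i) `^ (r / 2) * \esum_(t in A) (B i t) `^ r) `^ r^-1)).
  apply: le_poweR; [by rewrite invr_gt0|exact: (e0 (fun t => `|\esum_(i in S) k i * B i t|))|].
  rewrite (_ : \esum_(i in S) k i `^ (r / 2) * _ =
      \esum_(i in S) \esum_(t in A) k i `^ (r / 2) * (B i t) `^ r); last first.
    by apply: eq_esum => i _; rewrite esumZl ?poweR_ge0// => t; exact: poweR_ge0.
  rewrite exchange_esum; last by move=> i t; rewrite mule_ge0 ?poweR_ge0.
  rewrite -esumZl ?poweR_ge0//; last by move=> t; apply: esum_ge0 => i _; rewrite mule_ge0 ?poweR_ge0.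
  apply: le_esum => t _; rewrite gee0_abs; last by apply: esum_ge0 => i _; rewrite mule_ge0.
  exact: esumM_poweR_le.
rewrite poweRM ?poweR_ge0//; last by apply: esum_ge0 => i _; rewrite mule_ge0 ?poweR_ge0.
under [leRHS]eq_esum do rewrite -muleA.
rewrite esumZl; [|by rewrite mule_ge0 ?poweR_ge0|by move=> i; rewrite mule_ge0 ?poweR_ge0].
rewrite -muleA; apply: lee_wpmul2l; first exact: poweR_ge0.
have := @esumM_poweR_le R I r^-1 S (fun i => (k i) `^ (r / 2)) (fun i => \esum_(t in A) (B i t) `^ r).
rewrite invr_gt0 -/K2 => /(_ r0 (fun i => poweR_ge0 _ _) N0) /le_trans; apply.
by under [X in _ * X <= _]eq_esum do rewrite -poweRrM.
Qed.

End mixed_sequence_norms.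


(** * Stability properties of decaying kernels *)

Section kernels.
Context {R : realType} {d : nat} {X : PreTopologicalZmodule.type} (t : tiling R d X).
Variable v : X -> R.
Hypothesis v_gt0 : forall x, 0 < v x.
Hypothesis v_sub : forall x y, v (x + y) <= v x * v y.
Hypothesis v_even : forall x, v (- x) = v x.
Hypothesis v_cube : forall n, exists C, forall x, cube t n x -> v x <= C.
Local Notation L := (lattice t).
Local Open Scope ereal_scope.
Implicit Types (Theta : X -> \bar R) (x y z : X).

(** A majorant [kappa] on the lattice stands for the supremum over a cube. All cube sizes n are
    asked for at once, so that rounding errors, shifts and compact windows only cost an increase of
    n. *)
Definition decaying Theta := forall n, exists kappa : X -> \bar R,
  [/\ forall w, 0 <= kappa w,
      forall w u, L w -> cube t n u -> Theta (w + u)%R <= kappa w &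
      rapid L (fun w => kappa w * (v w)%:E)].

Lemma v_shift n : exists2 C : R, (0 < C)%R & forall x u, cube t n u -> (v (x + u) <= C * v x)%R.
Proof.
have [C CP] := v_cube n.
have C0 : (0 < C)%R by apply: lt_le_trans (v_gt0 0%R) (CP 0%R _); exact: cube0.
exists C => // x u ux; apply: le_trans (v_sub x u) _.
by rewrite mulrC ler_wpM2r ?CP// ltW.
Qed.

Lemma cube_sub_rnd x : cube t 1 (x - rnd t x)%R.
Proof. exact/cell_cube/cell_rnd. Qed.

Lemma le_decaying Theta Theta' : (forall z, Theta z <= Theta' z) -> decaying Theta' -> decaying Theta.
Proof.
move=> h k n; have [kappa [k0 kb kr]] := k n; exists kappa; split => // w u Lw nu.
exact: le_trans (h _) (kb _ _ Lw nu).
Qed.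

Lemma decayingZ (c : R) Theta : (0 <= c)%R -> decaying Theta -> decaying (fun z => c%:E * Theta z).
Proof.
move=> c0 k n; have [kappa [k0 kb kr]] := k n; exists (fun w => c%:E * kappa w); split.
- by move=> w; rewrite mule_ge0.
- by move=> w u Lw nu; apply: lee_wpmul2l => //; exact: kb.
- have v0 w : 0 <= kappa w * (v w)%:E by rewrite mule_ge0// lee_fin ltW.
  under eq_fun do rewrite -muleA; apply: rapidZ => //; exact: ltry.
Qed.

Lemma decayingD Theta Theta' : decaying Theta -> decaying Theta' ->
  decaying (fun z => Theta z + Theta' z).
Proof.
move=> k k' n; have [kappa [k0 kb kr]] := k n; have [kappa' [k0' kb' kr']] := k' n.
exists (fun w => kappa w + kappa' w); split.
- by move=> w; rewrite adde_ge0.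
- by move=> w u Lw nu; apply: leeD; [exact: kb|exact: kb'].
- under eq_fun do rewrite ge0_muleDl//.
  by apply: rapidD => // w; rewrite mule_ge0// lee_fin ltW.
Qed.

Lemma rapid_finite {T : choiceType} (A : set T) (a : T -> R) : finite_set A ->
  (forall i, 0 <= a i)%R -> rapid A (fun i => (a i)%:E).
Proof.
move=> fA a0 r r01; rewrite esum_fset//; last by move=> i _; exact: poweR_ge0.
by rewrite fsbig_finite//= sumEFin ltry.
Qed.

(** Subadditivity of x |-> x^r bounds the power of the superposition by a double sum.
    Submultiplicativity splits [v w] into [v (a i)] and v at the rounded point, up to a constant for
    the rounding error, and [rnd_bij] then removes the shift from the lattice sum. *)
Lemma decaying_esum {I : choiceType} (A : set I) (c : I -> \bar R) (a : I -> X) Theta :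
  (forall i, 0 <= c i) -> (forall z, 0 <= Theta z) -> decaying Theta ->
  rapid A (fun i => c i * (v (a i))%:E) ->
  decaying (fun z => \esum_(i in A) c i * Theta (z + a i)%R).
Proof.
move=> c0 T0 kT rc n; have [kappa [k0 kb kr]] := kT (n + 1)%N.
have [C C0 CP] := v_shift 1.
have split_at (y : X) : y = (rnd t y + (y - rnd t y))%R by rewrite addrC subrK.
have kv0 w : 0 <= kappa w * (v w)%:E by rewrite mule_ge0// lee_fin ltW.
have cv0 i : 0 <= c i * (v (a i))%:E by rewrite mule_ge0// lee_fin ltW.
exists (fun w => \esum_(i in A) c i * kappa (rnd t (w + a i)%R)); split.
- by move=> w; apply: esum_ge0 => i _; rewrite mule_ge0.
- move=> w u Lw nu; apply: le_esum => i _; apply: lee_wpmul2l => //.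
  rewrite addrAC [X in Theta (X + _)%R]split_at -addrA; apply: kb; first exact: lattice_rnd.
  by rewrite addnC; apply: cubeD => //; exact: cube_sub_rnd.
move=> r r01; have /andP[r0 r1] := r01.
pose b i w := (C%:E * ((c i * (v (a i))%:E) *
  (kappa (rnd t (w + a i)%R) * (v (rnd t (w + a i)%R))%:E))) `^ r.
have b0 i w : 0 <= b i w by exact: poweR_ge0.
apply: (@le_lt_trans _ _ (\esum_(w in L) \esum_(i in A) b i w)).
  apply: le_esum => w Lw.
  rewrite muleC -esumZl ?lee_fin ?(ltW (v_gt0 _))//; last by move=> i; rewrite mule_ge0.
  apply: le_trans (esum_poweR_le _ r01 _) _ => [i|].
    by rewrite !mule_ge0// lee_fin ltW.
  apply: le_esum => i _; apply: le_poweR => //; first by rewrite !mule_ge0// lee_fin ltW.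
  have vw : (v w <= C * (v (a i) * v (rnd t (w + a i))))%R.
    have {1}<- : (rnd t (w + a i) - a i + (w + a i - rnd t (w + a i)) = w)%R.
      by rewrite addrC addrA subrK addrK.
    apply: le_trans (CP _ _ (cube_sub_rnd _)) _; rewrite ler_pM2l// mulrC.
    by apply: le_trans (v_sub _ _) _; rewrite v_even.
  apply: le_trans (lee_wpmul2r _ (_ : _ <= (C * (v (a i) * v (rnd t (w + a i))))%:E)) _.
  - by rewrite mule_ge0.
  - by rewrite lee_fin.
  - rewrite !EFinM -muleA muleACA; apply: lee_wpmul2l; first by rewrite lee_fin ltW.
    by rewrite (muleC (v _)%:E) (muleC (v _)%:E (kappa _)).
rewrite exchange_esum//.
apply: (@le_lt_trans _ _ (\esum_(i in A) (C%:E * (c i * (v (a i))%:E)) `^ r *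
    \esum_(w in L) (kappa w * (v w)%:E) `^ r)).
  apply: le_esum => i _.
  rewrite (@reindex_esum _ _ _ L L (fun w => rnd t (w + a i)%R) (fun w => (kappa w * (v w)%:E) `^ r) (rnd_bij t (a i))).
  rewrite -esumZl ?poweR_ge0//; last by move=> w; exact: poweR_ge0.
  have C0' : 0 <= C%:E by rewrite lee_fin ltW.
  by apply: le_esum => w _; rewrite /b muleA [leLHS]poweRM// mule_ge0.
under eq_esum do rewrite muleC.
rewrite esumZl; [|by apply: esum_ge0 => w _; exact: poweR_ge0|by move=> i; exact: poweR_ge0].
apply: lte_mul_pinfty; first by apply: esum_ge0 => w _; exact: poweR_ge0.
  rewrite ge0_fin_numE; last by apply: esum_ge0 => w _; exact: poweR_ge0.
  exact: kr.
suff : rapid A (fun i => C%:E * (c i * (v (a i))%:E)) by apply.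
by apply: rapidZ => //; [rewrite lee_fin ltW|exact: ltry].
Qed.

Lemma decaying_shift a Theta : (forall z, 0 <= Theta z) -> decaying Theta ->
  decaying (fun z => Theta (z + a)%R).
Proof.
move=> T0 kT.
apply: (@le_decaying _ (fun z => \esum_(i in [set tt]) 1 * Theta (z + a)%R)).
  by move=> z; rewrite esum_set1 mul1e.
apply: (@decaying_esum _ [set tt] (fun=> 1) (fun=> a)) => //.
under eq_fun do rewrite mul1e.
by apply: rapid_finite => // i; exact: ltW.
Qed.

Lemma decaying0 : decaying (fun=> 0).
Proof.
move=> n; exists (fun=> 0); split => // r /andP[r0 _].
by rewrite esum1// => w _; rewrite mul0e poweR0r ?gt_eqF.
Qed.

Lemma decaying_sum {I : Type} (s : seq I) (F : I -> X -> \bar R) :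
  (forall i, decaying (F i)) -> decaying (fun z => \sum_(i <- s) F i z)%E.
Proof.
move=> kF; elim: s => [|i s IH].
  by under eq_fun do rewrite big_nil; exact: decaying0.
by under eq_fun do rewrite big_cons; exact: (decayingD (kF i) IH).
Qed.

(** Finitely many translates of the unit cube cover [P], so the suprema over displacements y in [P]
    are dominated by a finite sum of shifts of [Theta]. *)
Lemma decaying_window Theta (P : set X) n : (forall z, 0 <= Theta z) -> decaying Theta -> precompact P ->
  exists kappa : X -> \bar R, [/\ forall w, 0 <= kappa w,
    forall w u y, L w -> cube t n u -> P y -> Theta (w + u - y)%R <= kappa w &
    rapid L (fun w => kappa w * (v w)%:E)].
Proof.
move=> T0 kT /(@precompact_cubes _ _ _ t)[s sP].
have [kappa [k0 kb kr]] := @decaying_sum X s _ (fun x => decaying_shift (- x)%R T0 kT) (n + 1)%N.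
exists kappa; split => // w u y Lw nu /sP[x xs ux].
have Tx z : Theta (z - x)%R <= \sum_(x <- s) Theta (z - x)%R.
  by rewrite (big_rem x)//= leeDl// sume_ge0.
rewrite (_ : w + u - y = w + (u - (y - x)) - x)%R; last first.
  by rewrite opprB !addrA addrAC addrK.
apply: le_trans (Tx _) (kb _ _ Lw _); apply: cubeD => //; exact: cubeN.
Qed.

End kernels.

Lemma shift_cancel (V : zmodType) (r s z u y : V) : r - (z + u + y) = s + (r - (s + z) - u) - y.
Proof. by rewrite !opprD !addrA (addrAC s r) subrr add0r. Qed.

(** * A discrete Young inequality for mixed quasi-norms *)

Section convolution.
Context {R : realType} {d1 d2 : nat} {X Y : PreTopologicalZmodule.type}.
Context (t1 : tiling R d1 X) (t2 : tiling R d2 Y).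
Local Notation Z := (X * Y)%type.
Local Notation t := (product_tiling t1 t2).
Variable v : Z -> R.
Hypothesis v_gt0 : forall x, 0 < v x.
Hypothesis v_sub : forall x y, v (x + y) <= v x * v y.
Hypothesis v_even : forall x, v (- x) = v x.
Hypothesis v_cube : forall n, exists C, forall x, cube t n x -> v x <= C.
Local Notation L := (lattice t).
Local Open Scope ereal_scope.

Definition lattice_norm (p q : \bar R) (c : Z -> \bar R) : \bar R :=
  lnorm q (lattice t2) (fun y => lnorm p (lattice t1) (fun x => c (x, y))).

Lemma lnorm_ge0 {T : choiceType} p (A : set T) (a : T -> \bar R) : A !=set0 -> 0 <= lnorm p A a.
Proof.
move=> [s As]; case: p => [r||]//=; first exact: poweR_ge0.
by apply: (@le_trans _ _ `|a s|) => //; apply: ereal_sup_ubound; exists s.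
Qed.

Lemma lattice_neq0 (d : nat) (X' : PreTopologicalZmodule.type) (t' : tiling R d X') : lattice t' !=set0.
Proof. by exists (rnd t' 0%R); exact: lattice_rnd. Qed.

Lemma le_lattice_norm p q (a b : Z -> \bar R) : 0 < p -> 0 < q ->
  (forall z, L z -> `|a z| <= `|b z|) -> lattice_norm p q a <= lattice_norm p q b.
Proof.
move=> p0 q0 ab; apply: le_lnorm => // y Ly.
rewrite !gee0_abs; try by apply: lnorm_ge0; exact: lattice_neq0.
by apply: le_lnorm => // x Lx; apply: ab; rewrite lattice_product; split.
Qed.

Lemma lattice_normZ p q (c : R) (a : Z -> \bar R) : 0 < p -> 0 < q -> (0 < c)%R ->
  lattice_norm p q (fun z => c%:E * a z) = c%:E * lattice_norm p q a.
Proof.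
move=> p0 q0 c0; rewrite /lattice_norm -lnormZ//; congr (lnorm _ _ _).
by apply/funext => y; rewrite lnormZ.
Qed.

Lemma lattice_norm_shift p q (b : Z -> \bar R) s : 
  lattice_norm p q (fun z => b (rnd t (z + s)%R)) = lattice_norm p q b.
Proof.
rewrite /lattice_norm -[RHS](reindex_lnorm q _ (rnd_bij t2 s.2)); congr (lnorm _ _ _).
apply/funext => y; rewrite -[RHS](reindex_lnorm p _ (rnd_bij t1 s.1)); congr (lnorm _ _ _).
by apply/funext => x; rewrite rnd_product.
Qed.

(** [quasi_minkowski], applied to the inner norm and then to the outer one, takes the sum over s out
    of the norm. Rounding on a product acts on each factor separately, so each shifted sequence has
    the same mixed norm as [b]. *)
Lemma lattice_norm_young p q (k : Z -> \bar R) : 0 < p -> 0 < q -> (forall s, 0 <= k s) ->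
  rapid L k -> exists2 C : R, (0 < C)%R & forall b : Z -> \bar R, (forall z, 0 <= b z) ->
  lattice_norm p q (fun z => \esum_(s in L) k s * b (rnd t (z + s)%R)) <=
  C%:E * lattice_norm p q b.
Proof.
move=> p0 q0 k0 rk.
have [k1 [k10 rk1 H1]] := @quasi_minkowski R Z X p L (lattice t1) k p0 k0 rk.
have [k2 [k20 rk2 H2]] := @quasi_minkowski R Z Y q L (lattice t2) k1 q0 k10 rk1.
have K20 : 0 <= \esum_(s in L) k2 s by exact: esum_ge0.
exists (fine (\esum_(s in L) k2 s) + 1)%R; first by rewrite ltr_wpDl// fine_ge0.
move=> b b0; have N0 : 0 <= lattice_norm p q b by apply: lnorm_ge0; exact: lattice_neq0.
apply: (@le_trans _ _ (\esum_(s in L) k2 s * lattice_norm p q b)); last first.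
  under eq_esum do rewrite muleC.
  rewrite esumZl// muleC; apply: lee_wpmul2r => //.
  rewrite EFinD fineK ?leeDl// ge0_fin_numE//; exact: rapid_sum.
apply: (@le_trans _ _ (\esum_(s in L) k2 s *
    lattice_norm p q (fun z => b (rnd t (z + s)%R)))); last first.
  by apply: le_esum => s _; rewrite lattice_norm_shift.
apply: le_trans (H2 (fun s y => lnorm p (lattice t1) (fun x => b (rnd t ((x, y) + s)%R))) _).
  apply: le_lnorm => // y Ly.
  rewrite gee0_abs; last by apply: lnorm_ge0; exact: lattice_neq0.
  apply: le_trans (lee_abs _).
  exact: (H1 (fun s x => b (rnd t ((x, y) + s)%R))).
by move=> s y; apply: lnorm_ge0; exact: lattice_neq0.
Qed.

(** The majorant [a] bounds the convolution simultaneously on a whole cell and for all displacements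
    in [P], because it has to dominate local maximal functions. Moderateness transfers [m] from z to
    the rounded point at the price of a factor v, which the decay of the kernel absorbs. *)
Lemma decaying_convolution (Theta : Z -> \bar R) (P : set Z) (m : Z -> R) p q :
  (forall z, 0 <= Theta z) -> decaying t v Theta -> precompact P ->
  (forall z, 0 < m z)%R -> (exists C, forall z w, m (z + w) <= C * v z * m w)%R ->
  0 < p -> 0 < q ->
  exists2 C : R, (0 < C)%R & forall b : Z -> \bar R, (forall z, 0 <= b z) ->
  exists a : Z -> \bar R, [/\ forall z, 0 <= a z,
    forall z u y, L z -> cube t 1 u -> P y ->
      \esum_(w in L) Theta (w - (z + u + y))%R * b w <= a z &
    lattice_norm p q (fun z => a z * (m z)%:E) <=
    C%:E * lattice_norm p q (fun z => b z * (m z)%:E)].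
Proof.
move=> T0 kT cP m0 [Cm CmP] p0 q0.
(* Size 2 is one unit for the rounding error in [rnd t (s + z)] and one for the offset u. *)
have [kappa [k0 kb kr]] := decaying_window v_gt0 v_sub v_even v_cube 2 T0 kT cP.
have [C C0 CP] := v_shift v_gt0 v_sub v_cube 1.
have Cm0 : (0 < Cm)%R.
  have := lt_le_trans (m0 _) (CmP 0 0)%R; rewrite -mulrA pmulr_lgt0//.
  by rewrite mulr_gt0.
pose k s := (Cm * C)%:E * (kappa s * (v s)%:E).
have kv0 s : 0 <= kappa s * (v s)%:E by rewrite mule_ge0// lee_fin ltW.
have kk0 s : 0 <= k s by rewrite mule_ge0// lee_fin mulr_ge0// ltW.
have rk : rapid L k by apply: rapidZ => //; [rewrite lee_fin mulr_ge0// ltW|exact: ltry].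
have [C' C'0 C'P] := lattice_norm_young p0 q0 kk0 rk.
exists C' => // b b0; exists (fun z => \esum_(s in L) kappa s * b (rnd t (z + s)%R)).
split.
- by move=> z; apply: esum_ge0 => s _; rewrite mule_ge0.
- move=> z u y Lz cu Py.
  rewrite (@reindex_esum _ _ _ L L (fun w => rnd t (w + z)%R) _ (rnd_bij t z)).
  apply: le_esum => s Ls; rewrite (addrC z s); apply: lee_wpmul2r => //.
  set r := rnd t _.
  rewrite (_ : r - (z + u + y) = s + (r - (s + z) - u) - y)%R; last first.
    exact: shift_cancel.
  apply: kb => //; apply: (@cubeD _ _ _ _ 1 1); last exact: cubeN.
  by rewrite -opprB; apply: cubeN; exact: cube_sub_rnd.
apply: le_trans (C'P (fun z => b z * (m z)%:E) _); last first.
  by move=> z; rewrite mule_ge0// lee_fin ltW.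
apply: le_lattice_norm => // z Lz.
have s0 (f : Z -> \bar R) : (forall s, 0 <= f s) -> 0 <= \esum_(s in L) f s.
  by move=> f0; apply: esum_ge0.
rewrite !gee0_abs; last 2 first.
- by apply: s0 => s; rewrite mule_ge0// mule_ge0// lee_fin (ltW (m0 _)).
- by rewrite mule_ge0 ?s0 ?lee_fin ?(ltW (m0 _))// => s; rewrite mule_ge0.
rewrite muleC -esumZl ?lee_fin ?(ltW (m0 _))//; last by move=> s; rewrite mule_ge0.
apply: le_esum => s _; set r := rnd t _.
have mz : (m z <= (Cm * C) * v s * m r)%R.
  rewrite -{1}(subrK r z); apply: le_trans (CmP _ _) _.
  rewrite ler_wpM2r ?(ltW (m0 _))// -mulrA ler_wpM2l ?(ltW Cm0)//.
  rewrite (_ : z - r = - s + (z + s - r))%R; last by rewrite !addrA (addrC (- s)%R) subrK.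
  by apply: le_trans (CP _ _ (cube_sub_rnd _ _)) _; rewrite v_even.
apply: (@le_trans _ _ ((Cm * C * v s * m r)%:E * (kappa s * b r))).
  by apply: lee_wpmul2r; [rewrite mule_ge0|rewrite lee_fin].
rewrite /k !EFinM -!muleA; do 2 (apply: lee_wpmul2l; first by rewrite lee_fin ltW).
by rewrite [leRHS]muleCA [X in _ * X <= _]muleCA (muleC (m r)%:E).
Qed.

End convolution.

(** * Mixed norms of step functions *)

Section step_norms.
Context {R : realType} {d : nat} {X : PreTopologicalZmodule.type} (t : tiling R d X).
Variable lam : {sigma_finite_measure set (borel X) -> \bar R}.
Hypothesis haar : is_haar (fun x y : X => x + y) lam.
Local Notation L := (lattice t).
Local Open Scope ereal_scope.

Lemma lam_setT_gt0 : 0 < lam [set: borel X].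
Proof.
apply: lt_le_trans (cell_gt0 t haar) _; apply: le_measure; rewrite ?inE//.
exact: measurable_cell.
Qed.

Lemma not_negligible (A B : set (borel X)) : measurable A -> 0 < lam A -> A `<=` B ->
  ~ lam.-negligible B.
Proof.
move=> mA A0 AB /(negligibleS AB) /negligibleP nA.
by move: A0; rewrite nA// ltxx.
Qed.

Lemma Lnorm_step p (V : set X) : 0 < p -> measurable (V : set (borel X)) ->
  V `<=` cell t -> 0 < lam V ->
  exists2 c : R, (0 < c)%R & forall (b : X -> \bar R) u, (forall x, 0 <= b x) ->
  'N[lam]_p[(fun x => b (rnd t (x - u)%R) * (\1_V (x - u - rnd t (x - u))%R)%:E)] =
  c%:E * lnorm p L b.
Proof.
move=> p0 mV VC V0.
have Vfin : lam V < +oo.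
  apply: le_lt_trans (cell_lty t haar).
  by apply: le_measure; rewrite ?inE//; exact: measurable_cell.
have VE : lam V = (fine (lam V))%:E by rewrite fineK// ge0_fin_numE.
have f0 : (0 < fine (lam V))%R by rewrite fine_gt0// V0.
case: p p0 => [r r0|_|//].
  rewrite lte_fin in r0.
  exists (fine (lam V) `^ r^-1)%R; first exact: powR_gt0.
  move=> b u b0; rewrite unlock /=.
  have -> : \int[lam]_x `|b (rnd t (x - u)%R) * (\1_V (x - u - rnd t (x - u))%R)%:E| `^ r =
     \int[lam]_x ((b (rnd t (x - u)%R)) `^ r * (\1_V (x - u - rnd t (x - u))%R)%:E).
    apply: eq_integral => x _; rewrite indicE; case: (_ \in V) => /=.
      by rewrite !mule1 gee0_abs.
    by rewrite !mule0 abse0 poweR0r ?gt_eqF.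
  rewrite (integral_step haar u (fun x => poweR_ge0 (b x) r) mV VC).
  under eq_esum do rewrite muleC.
  rewrite esumZl; [|exact: ltW|by move=> x; exact: poweR_ge0].
  rewrite poweRM; [|exact: ltW|by apply: esum_ge0 => x _; exact: poweR_ge0].
  rewrite VE poweR_EFin; congr (_ * (_ `^ _)).
  by apply: eq_esum => x _; rewrite gee0_abs.
exists 1%R => // b u b0; rewrite mul1e unlock /= lam_setT_gt0.
have Lb0 : 0 <= ereal_sup [set `|b i| | i in L].
  by apply: (@lnorm_ge0 _ _ +oo L b); exact: lattice_neq0.
apply/eqP; rewrite eq_le; apply/andP; split.
  apply/ess_supP; apply: nearW => x /=; rewrite indicE; case: (_ \in V).
    by rewrite mule1; apply: ereal_sup_ubound; exists (rnd t (x - u)%R) => //; exact: lattice_rnd.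
  by rewrite mule0 abse0.
apply: ge_ereal_sup => _ [w Lw <-]; rewrite gee0_abs// leNgt; apply/negP => lt.
have := ess_sup_ge lam (abse \o (fun x => b (rnd t (x - u)%R) * (\1_V (x - u - rnd t (x - u))%R)%:E)).
have [mw lw] := measurable_lattice_cell t haar (w + u)%R mV.
apply: (@not_negligible [set (w + u + x)%R | x in V]) => //; first by rewrite lw.
move=> _ [x Vx <-] /=; apply/negP; rewrite -ltNge.
have -> : (w + u + x - u = w + x)%R by rewrite addrAC addrK.
rewrite rnd_lattice//; last exact: VC.
by rewrite (addrC w x) addrK indicE mem_set// mule1 gee0_abs.
Qed.

Lemma Lnorm_lattice p : 0 < p ->
  exists2 c : R, (0 < c)%R & forall b : X -> \bar R, (forall x, 0 <= b x) ->
  'N[lam]_p[(fun x => b (rnd t x))] = c%:E * lnorm p L b.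
Proof.
move=> p0; have [c c0 cP] := Lnorm_step p0 (measurable_cell t) (@subset_refl _ _) (cell_gt0 t haar).
exists c => // b b0; rewrite -(cP b 0%R b0); apply: eq_Lnorm => x.
by rewrite subr0 indicE mem_set ?mule1//; exact: cell_rnd.
Qed.

End step_norms.

Section mixed_step_norms.
Context {R : realType} {G : lcaType} {d1 d2 : nat}.
Local Notation Gh := (dual_group R G).
Context (t1 : tiling R d1 G) (t2 : tiling R d2 Gh).
Variables (mu : {sigma_finite_measure set (borel G) -> \bar R})
  (nu : {sigma_finite_measure set (borel Gh) -> \bar R}).
Hypothesis mu_haar : is_haar (fun x y : G => x + y) mu.
Hypothesis nu_haar : is_haar (fun x y : Gh => x + y) nu.
Local Notation Z := (G * Gh)%type.
Local Notation t := (product_tiling t1 t2).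
Local Notation L := (lattice t).
Local Open Scope ereal_scope.

Lemma mixed_norm_lattice p q (m : Z -> R) : 0 < p -> 0 < q -> 
  (forall z, 0 < m z)%R -> (exists C, forall z u, cube t 1 u -> m (z + u) <= C * m z)%R ->
  exists2 C : R, (0 < C)%R & forall (H a : Z -> \bar R), (forall z, 0 <= a z) ->
  (forall z, `|H z| <= a (rnd t z)) ->
  mixed_norm mu nu p q m H <= C%:E * lattice_norm t1 t2 p q (fun z => a z * (m z)%:E).
Proof.
move=> p0 q0 m0 [C CP].
have C0 : (0 < C)%R.
  by have := lt_le_trans (m0 _) (CP 0 0 (cube0 t 1))%R; rewrite pmulr_lgt0.
have [c1 c10 c1P] := Lnorm_lattice t1 mu_haar p0.
have [c2 c20 c2P] := Lnorm_lattice t2 nu_haar q0.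
exists (C * (c1 * c2))%R; first by rewrite !mulr_gt0.
move=> H a a0 Ha.
pose am z := C%:E * (a z * (m z)%:E).
have am0 z : 0 <= am z by rewrite !mule_ge0// lee_fin ltW.
apply: (@le_trans _ _ ('N[nu]_q[(fun y => 'N[mu]_p[(fun x => am (rnd t1 x, rnd t2 y))])])).
  apply: le_Lnorm_nomeas => // y; rewrite !gee0_abs ?Lnorm_ge0//.
  apply: le_Lnorm_nomeas => // x; rewrite abseM (gee0_abs (am0 _)).
  apply: le_trans (lee_wpmul2r _ (Ha _)) _ => //.
  rewrite gee0_abs ?lee_fin ?(ltW (m0 _))// rnd_product /= /am muleCA.
  apply: lee_wpmul2l => //; rewrite -EFinM lee_fin.
  set z : Z := (x, y); set r := (_, _); rewrite -{1}(subrK r z) addrC; apply: CP.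
  have -> : r = rnd t z by rewrite rnd_product.
  exact: (cube_sub_rnd t z).
under [X in 'N[_]__[X]]eq_fun => y do rewrite (c1P (fun x => am (x, rnd t2 y)) (fun x => am0 _)).
rewrite (c2P (fun y => c1%:E * lnorm p (lattice t1) (fun x => am (x, y)))); last first.
  by move=> y; rewrite mule_ge0 ?lee_fin ?(ltW c10)//; apply: lnorm_ge0; exact: lattice_neq0.
rewrite lnormZ// -/(lattice_norm t1 t2 p q am) lattice_normZ// !muleA -!EFinM.
by rewrite (_ : c2 * c1 * C = C * (c1 * c2))%R//; ring.
Qed.

(** Only the values of [H] on the small rectangles w + V1 x V2 + u enter. A step function supported
    on them has a mixed norm proportional to the lattice norm of its values, as the rectangles have
    positive measure. *)
Lemma lattice_le_mixed_norm p q (m : Z -> R) (V1 : set G) (V2 : set Gh) (u : Z) :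
  0 < p -> 0 < q -> (forall z, 0 < m z)%R ->
  (exists C, forall w x, cell t x -> m w <= C * m (w + x + u))%R ->
  measurable (V1 : set (borel G)) -> measurable (V2 : set (borel Gh)) ->
  V1 `<=` cell t1 -> V2 `<=` cell t2 -> 0 < mu V1 -> 0 < nu V2 ->
  exists2 C : R, (0 < C)%R & forall (H b : Z -> \bar R), (forall z, 0 <= b z) ->
  (forall w x, L w -> V1 x.1 -> V2 x.2 -> b w <= `|H (w + x + u)%R|) ->
  lattice_norm t1 t2 p q (fun z => b z * (m z)%:E) <= C%:E * mixed_norm mu nu p q m H.
Proof.
move=> p0 q0 m0 [C CP] mV1 mV2 V1C V2C V10 V20.
have C0 : (0 < C)%R.
  by have := lt_le_trans (m0 _) (CP 0 0 (cell0 t))%R; rewrite pmulr_lgt0.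
have [c1 c10 c1P] := Lnorm_step mu_haar p0 mV1 V1C V10.
have [c2 c20 c2P] := Lnorm_step nu_haar q0 mV2 V2C V20.
exists (C * (c1 * c2)^-1)%R; first by rewrite !mulr_gt0// invr_gt0 mulr_gt0.
move=> H b b0 bH.
pose bm z := C^-1%:E * (b z * (m z)%:E).
have bm0 z : 0 <= bm z.
  by apply: mule_ge0; [rewrite lee_fin invr_ge0 ltW|rewrite mule_ge0// lee_fin ltW].
rewrite EFinM -muleA -lee_pdivrMl// -lattice_normZ ?invr_gt0// -/bm.
rewrite lee_pdivlMl ?mulr_gt0//.
apply: (@le_trans _ _ ('N[nu]_q[(fun y => 'N[mu]_p[(fun x =>
    bm (rnd t1 (x - u.1)%R, rnd t2 (y - u.2)%R) *
    (\1_V1 (x - u.1 - rnd t1 (x - u.1))%R)%:E)] * (\1_V2 (y - u.2 - rnd t2 (y - u.2))%R)%:E)])).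
  under [X in _ <= 'N[_]__[X]]eq_fun => y do
    rewrite (c1P (fun x => bm (x, rnd t2 (y - u.2)%R)) u.1 (fun x => bm0 _)).
  rewrite (c2P (fun y => c1%:E * lnorm p (lattice t1) (fun x => bm (x, y)))); last first.
    by move=> y; rewrite mule_ge0 ?lee_fin ?(ltW c10)//; apply: lnorm_ge0; exact: lattice_neq0.
  by rewrite lnormZ// muleA -EFinM mulrC.
apply: le_Lnorm_nomeas => // y; rewrite [leRHS]gee0_abs ?Lnorm_ge0//.
rewrite indicE; have [yV|_] := boolP (_ \in V2); last by rewrite mule0 abse0 Lnorm_ge0.
rewrite mule1 gee0_abs ?Lnorm_ge0//; apply: le_Lnorm_nomeas => // x.
rewrite indicE; have [xV|_] := boolP (_ \in V1); last by rewrite mule0 abse0.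
rewrite mule1 gee0_abs//; move/set_mem in xV; move/set_mem in yV.
rewrite abseM [X in _ * X]gee0_abs ?lee_fin ?(ltW (m0 _))//.
pose w : Z := (rnd t1 (x - u.1)%R, rnd t2 (y - u.2)%R).
pose e : Z := ((x - u.1 - rnd t1 (x - u.1))%R, (y - u.2 - rnd t2 (y - u.2))%R).
have xy : (x, y) = (w + e + u)%R.
  by apply/pair_equal_spec; rewrite /= !(addrC (rnd _ _)) !subrK.
have Lw : L w by rewrite lattice_product; split; exact: lattice_rnd.
rewrite /bm -/w xy muleCA.
apply: lee_pmul; rewrite ?b0//.
- by rewrite mule_ge0// lee_fin ?invr_ge0 ltW.
- exact: bH.
rewrite lee_pdivrMl// lee_fin; apply: CP.
by rewrite cell_product; split; [exact: V1C|exact: V2C].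
Qed.

End mixed_step_norms.

(** * Growth of submultiplicative weights *)

Section sum_tails.
Context {R : realType}.
Local Open Scope ereal_scope.

Lemma esum_tail {T : choiceType} (A : set T) (a : T -> \bar R) (e : R) :
  (forall i, 0 <= a i) -> \esum_(i in A) a i < +oo -> (0 < e)%R ->
  exists W : {fset T}, [set` W] `<=` A /\
    \esum_(i in A) (if i \in W then 0 else a i) < e%:E.
Proof.
move=> a0 fin e0.
have S0 : 0 <= \esum_(i in A) a i by apply: esum_ge0.
have Sfin : \esum_(i in A) a i \is a fin_num by rewrite ge0_fin_numE.
have [_ [X [finX XA] <-] lt] : exists2 x, [set \sum_(x \in X) a x | X in fsets A] x &
    \esum_(i in A) a i - e%:E < x.
  by apply: ub_ereal_sup_adherent.
exists (fset_set X); rewrite fset_setK//; split => //.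
have := @esumID R T X A a (fun i _ => a0 i).
rewrite (setIidr XA) (esum_fset finX); last by move=> i _; exact: a0.
move=> SE.
have -> : \esum_(i in A) (if i \in fset_set X then 0 else a i) = \esum_(i in A `&` ~` X) a i.
  rewrite esum_mkcondr; apply: eq_esum => i _; rewrite in_fset_set//.
  by rewrite in_setC; case: (i \in X).
have D0 : 0 <= \esum_(i in A `&` ~` X) a i by apply: esum_ge0.
have X0 : 0 <= \sum_(x \in X) a x by rewrite fsume_ge0.
move: fin Sfin lt; rewrite SE => {SE S0}.
move: (\sum_(x \in X) a x) (\esum_(i in _ `&` _) a i) X0 D0 => [x||] [y||]//= _ _ _ _.
by rewrite -!EFinD !lte_fin; lra.
Qed.

Context {d1 d2 : nat} {X Y : PreTopologicalZmodule.type}.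
Context (t1 : tiling R d1 X) (t2 : tiling R d2 Y).
Local Notation Z := (X * Y)%type.
Local Notation t := (product_tiling t1 t2).

(** A finite set [M] of rows carries the outer sum up to a small error; in each of these rows a
    finite set carries the inner sum, with an error that depends on the number of rows. This is
    where finite exponents are used. *)
Lemma lattice_norm_tail p q (b : Z -> \bar R) (e : R) : 0 < p -> 0 < q ->
  p <> +oo -> q <> +oo -> (forall z, 0 <= b z) -> lattice_norm t1 t2 p q b < +oo ->
  (0 < e)%R -> exists W0 : {fset Z}, [set` W0] `<=` lattice t /\
    forall W : {fset Z}, [set` W0] `<=` [set` W] ->
    lattice_norm t1 t2 p q (fun z => if z \in W then 0 else b z) < e%:E.
Proof.
case: p => [r|//|//]; case: q => [s|//|//]; rewrite !lte_fin => r0 s0 _ _ b0 fin e0.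
suff [W0 [W0L W0P]] : exists W0 : {fset Z}, [set` W0] `<=` lattice t /\
    lattice_norm t1 t2 r%:E s%:E (fun z => if z \in W0 then 0 else b z) < e%:E.
  exists W0; split => // W W0W; apply: le_lt_trans W0P; apply: le_lattice_norm => // z _.
  case: ifPn => zW; case: ifPn => zW0; rewrite ?abse0//.
  by move: zW; rewrite (W0W z zW0).
pose S y := \esum_(x in lattice t1) (b (x, y)) `^ r.
have S0 y : 0 <= S y by apply: esum_ge0 => x _; exact: poweR_ge0.
have lE (c : Z -> \bar R) : (forall z, 0 <= c z) -> lattice_norm t1 t2 r%:E s%:E c =
   (\esum_(y in lattice t2) (\esum_(x in lattice t1) (c (x, y)) `^ r) `^ (s / r)) `^ s^-1.
  move=> c0; rewrite /lattice_norm /=; congr (_ `^ _); apply: eq_esum => y _.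
  rewrite gee0_abs ?poweR_ge0// -poweRrM mulrC; congr (_ `^ _).
  by apply: eq_esum => x _; rewrite gee0_abs.
move: fin; rewrite lE// => fin.
have sr : (0 < s / r)%R by exact: divr_gt0.
have T0 y : 0 <= S y `^ (s / r) by exact: poweR_ge0.
have {}fin : \esum_(y in lattice t2) S y `^ (s / r) < +oo.
  by apply: lty_poweRy fin; rewrite invr_eq0 gt_eqF.
(* The error [D] occurs twice, for the rows outside [M] and for the tails of the rows in [M]. The
   tolerance h for one row satisfies h^(s/r) = D / (|M| + 1), so all the rows of [M] together cost
   at most [D], and D + D = e^s / 2. *)
pose D := (e `^ s / 4)%R; have D0 : (0 < D)%R by rewrite divr_gt0 ?powR_gt0.
have [M [ML Mtail]] := esum_tail T0 fin D0.
pose h := ((D / (#|` M|.+1)%:R) `^ (r / s))%R.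
have h0 : (0 < h)%R by apply: powR_gt0; rewrite divr_gt0.
have WP y : exists W : {fset X}, lattice t2 y -> [set` W] `<=` lattice t1 /\
    \esum_(x in lattice t1) (if x \in W then 0 else (b (x, y)) `^ r) < h%:E.
  have [Ly|] := pselect (lattice t2 y); last by exists fset0.
  have Sy : S y < +oo.
    apply: (@lty_poweRy _ _ (s / r)); first by rewrite gt_eqF.
    exact: le_lt_trans (@esum_term _ _ (lattice t2) (fun y => S y `^ (s / r)) y T0 Ly) fin.
  have [W [h1 h2]] := esum_tail (fun x => poweR_ge0 (b (x, y)) r) Sy h0.
  by exists W.
have {WP} [W WP] := choice WP.
pose W0 : {fset Z} := seq_fset tt [seq ((x, y) : Z) | y <- M, x <- W y].
have W0P x y : ((x, y) \in W0) = (y \in M) && (x \in W y).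
  rewrite seq_fsetE; apply/allpairsPdep/andP => [[y' [x' [yM xW [-> ->]]]]|[yM xW]]; first by split.
  by exists y, x.
exists W0; split.
  move=> [x y] /=; rewrite W0P => /andP[yM xW]; rewrite lattice_product.
  have Ly : lattice t2 y by exact: ML.
  by split => //; have [h1 _] := WP y Ly; exact: h1.
rewrite lE; last by move=> z; case: ifP.
rewrite (_ : e%:E = ((e `^ s)%:E) `^ s^-1); last first.
  by rewrite -[X in (X)%:E `^ _]/(fine (e%:E `^ s)) -poweR_EFin poweRrK// lee_fin ltW.
have ltp (x y : \bar R) : 0 <= x -> x < y -> x `^ s^-1 < y `^ s^-1.
  move=> x0 xy; rewrite ltNge; apply/negP => h1.
  have := le_poweR s0 (poweR_ge0 _ _) h1; rewrite !poweRrVK ?(le_trans x0 (ltW xy))//.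
  by rewrite leNgt xy.
apply: ltp; first by apply: esum_ge0 => y _; exact: poweR_ge0.
apply: (@le_lt_trans _ _ (\esum_(y in lattice t2) (if y \in M then (D / (#|` M|.+1)%:R)%:E else 0) +
    \esum_(y in lattice t2) (if y \in M then 0 else S y `^ (s / r)))).
  rewrite -esumD; last 2 first.
  - by move=> y _; case: ifP => // _; rewrite lee_fin divr_ge0// ltW.
  - by move=> y _; case: ifP.
  apply: le_esum => y Ly; have [yM|yM] := boolP (y \in M).
    have [_ hy] := WP y Ly; rewrite adde0.
    have -> : (D / (#|` M|.+1)%:R)%:E = h%:E `^ (s / r).
      rewrite poweR_EFin /h -powRrM (_ : r / s * (s / r) = 1)%R; last by field; rewrite !gt_eqF.
      by rewrite powRr1// divr_ge0// ltW.
    apply: le_poweR => //; first by apply: esum_ge0 => x _; exact: poweR_ge0.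
    apply: le_trans (ltW hy); apply: le_esum => x _; rewrite W0P yM /=.
    by case: ifP => // _; rewrite poweR0r ?gt_eqF.
  rewrite add0e; apply: le_poweR => //; first by apply: esum_ge0 => x _; exact: poweR_ge0.
  by apply: le_esum => x _; rewrite W0P (negbTE yM).
apply: (@le_lt_trans _ _ (D%:E + D%:E)); last by rewrite -EFinD lte_fin /D; have := powR_gt0 s e0; lra.
apply: leeD; last exact: ltW.
rewrite (_ : \esum_(y in lattice t2) _ = \esum_(y in [set` M]) (D / (#|` M|.+1)%:R)%:E).
  rewrite esum_fset//; last by move=> y _; rewrite lee_fin divr_ge0// ltW.
  rewrite fsbig_finite//= set_fsetK sumEFin lee_fin big_const_seq count_predT iter_addr_0 -[leLHS]mulr_natr.
  by rewrite mulrAC ler_pdivrMr// ler_wpM2l ?(ltW D0)// ler_nat.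
rewrite -(setIidr ML) esum_mkcondr; apply: eq_esum => y Ly.
by rewrite (_ : (y \in [set` M]) = (y \in M))//; apply/idP/idP => [/set_mem|/mem_set].
Qed.

End sum_tails.

(** * Volumes of boxes *)

Section box_counting.
Context {R : realType} {d : nat} {X : PreTopologicalZmodule.type} (t : tiling R d X).
Variable lam : {sigma_finite_measure set (borel X) -> \bar R}.
Hypothesis haar : is_haar (fun x y : X => x + y) lam.
Local Notation c := (crd t).
Local Notation H := (stab t).

Definition box (a : R) (n : nat) : set X := [set x | H x /\ forall i, a <= c x i 0 < a + n%:R].

Lemma measurable_box a n : measurable (box a n : set (borel X)).
Proof.
have mc i : measurable_fun [set: borel X] (fun x : X => c x i 0).
  apply: (borel_map_measurable (@borel_map_id X) (g := fun x => c x i 0)).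
  exact: (continuousT_comp (@crd_continuous _ _ _ t) (@coord_continuous R d 1 i 0)).
have -> : box a n = H `&` \bigcap_(i in [set: 'I_d])
    ((fun x : X => c x i 0) @^-1` `[a, a + n%:R[%classic).
  apply/seteqP; split => [x [Hx h]|x [Hx h]]; split => // i.
    by move=> _; rewrite /= in_itv /= h.
  by have := h i I; rewrite /= in_itv.
apply: measurableI; first by apply: open_measurable_borel; exact: stab_open.
apply: fin_bigcap_measurable => // i _.
rewrite -[X in measurable X]setTI; exact: (mc i).
Qed.

Lemma box_translate a n (k : 'cV[R]_d) :
  [set sec t k + x | x in box a n] = [set x | H x /\ forall i, a + k i 0 <= c x i 0 < a + k i 0 + n%:R].
Proof.
apply/seteqP; split => [_ [x [Hx cx] <-]|x [Hx cx]].
  split; first by apply: stabD => //; exact: stab_sec.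
  by move=> i; rewrite crdD secK mxE; have := cx i; lra.
exists (x - sec t k); last by rewrite addrC subrK.
split; first by apply: stabB => //; exact: stab_sec.
by move=> i; rewrite crdB secK !mxE; have := cx i; lra.
Qed.

Lemma lam_box_shift a n : lam (box a n) = lam (box 0 n).
Proof.
have [_ <-] := haar_translate haar (@shift_continuous _ _ _ t) (sec t (const_mx a)) (measurable_box 0 n).
rewrite box_translate; congr (lam _); apply/seteqP.
by split => x [Hx cx]; split => // i; have := cx i; rewrite mxE add0r.
Qed.

Lemma lam_box1 : (0 < lam (box 0 1))%E /\ (lam (box 0 1) < +oo)%E.
Proof.
have cE : cell t = box (- 2^-1) 1.
  by apply/seteqP; split => x [Hx cx]; split => // i; have := cx i; lra.
by rewrite -(lam_box_shift (- 2^-1)) -cE; split; [exact: cell_gt0|exact: cell_lty].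
Qed.

Lemma lam_box n : lam (box 0 n) = ((n ^ d)%:R%:E * lam (box 0 1))%E.
Proof.
pose vk (k : {ffun 'I_d -> 'I_n}) : 'cV[R]_d := \col_i (k i)%:R.
pose F k : set (borel X) := [set sec t (vk k) + x | x in box 0 1].
have FE k : F k = [set x | H x /\ forall i, (k i)%:R <= c x i 0 < (k i).+1%:R].
  rewrite /F box_translate; apply/seteqP.
  by split => x [Hx cx]; split => // i; have := cx i; rewrite mxE add0r natr1.
have FP k : measurable (F k) /\ lam (F k) = lam (box 0 1).
  exact: (haar_translate haar (@shift_continuous _ _ _ t) _ (measurable_box 0 1)).
have -> : box 0 n = \bigcup_(k in [set: {ffun 'I_d -> 'I_n}]) F k.
  apply/seteqP; split => [x [Hx cx]|x [k _]]; last first.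
    rewrite FE => -[Hx cx]; split => // i; have /andP[h1 h2] := cx i.
    rewrite (le_trans _ h1)//= add0r (lt_le_trans h2)// ler_nat; exact: ltn_ord.
  have tr i : (Num.trunc (c x i 0%R) < n)%N.
    have /andP[h1 h2] := cx i; rewrite add0r in h2.
    have /andP[h3 _] := truncn_itv h1.
    by rewrite -(ltr_nat R); exact: le_lt_trans h3 h2.
  exists [ffun i => Ordinal (tr i)] => //; rewrite FE; split => // i.
  by rewrite ffunE /=; apply: truncn_itv; have /andP[] := cx i.
rewrite measure_fin_bigcup//.
- have [_ fin] := lam_box1; have bE : lam (box 0 1) = (fine (lam (box 0 1)))%:E.
    by rewrite fineK// ge0_fin_numE.
  rewrite (fsbig_fwiden (enum {: {ffun 'I_d -> 'I_n}})) ?enum_uniq//; last 2 first.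
  - by move=> k _ /=; rewrite mem_enum.
  - by move=> k [_ []].
  rewrite (eq_bigr _ (fun k _ => (FP k).2)) bE sumEFin -EFinM big_const_seq count_predT.
  by rewrite iter_addr_0 -cardE card_ffun !card_ord mulr_natl.
- exact: finite_finset.
- move=> k k' _ _ [x []]; rewrite !FE => -[_ h] [_ h']; apply/ffunP => i; apply/val_inj.
  have /andP[h1 h2] := h i; have /andP[h3 h4] := h' i.
  have := le_lt_trans h1 h4; have := le_lt_trans h3 h2; rewrite !ltr_nat !ltnS => a b.
  by apply/eqP; rewrite eqn_leq; apply/andP; split.
- by move=> k _; have [] := FP k.
Qed.

End box_counting.

(** * Boundedness and exponential growth of the weight *)

Section weights.
Context {R : realType} {d1 d2 : nat} {X Y : PreTopologicalZmodule.type}.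
Context (t1 : tiling R d1 X) (t2 : tiling R d2 Y).
Variables (mu : {sigma_finite_measure set (borel X) -> \bar R})
  (nu : {sigma_finite_measure set (borel Y) -> \bar R}).
Hypothesis mu_haar : is_haar (fun x y : X => x + y) mu.
Hypothesis nu_haar : is_haar (fun x y : Y => x + y) nu.
Local Notation Z := (X * Y)%type.
Local Notation t := (product_tiling t1 t2).
Local Notation lam := (mu \x nu)%E.

Lemma measurable_product_shift (u : Z) :
  measurable_fun [set: (borel X * borel Y)%type]
    ((fun z : Z => z + u) : (borel X * borel Y)%type -> (borel X * borel Y)%type).
Proof.
apply/measurable_fun_pairP; split.
  exact: (measurableT_comp (measurable_shift (@shift_continuous _ _ _ t1) u.1) measurable_fst).
exact: (measurableT_comp (measurable_shift (@shift_continuous _ _ _ t2) u.2) measurable_snd).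
Qed.

Lemma product_haar_shift (u : Z) (A : set (borel X * borel Y)%type) : measurable A ->
  lam ((fun z : Z => z + u) @^-1` A) = lam A.
Proof.
move=> mA; rewrite /product_measure1 /=.
have mf := measurable_fun_xsection nu mA.
rewrite -(@ge0_integral_shift _ _ mu mu_haar (@shift_continuous _ _ _ t1) u.1 (nu \o xsection A) mf)//.
apply: eq_integral => x _ /=.
rewrite -(@haar_preimage_shift _ _ nu nu_haar u.2 _
  (measurable_xsection ((x + u.1 : X) : borel X) mA)); congr (nu _).
Qed.

Variable v : Z -> R.
Hypothesis v_meas : measurable_fun [set: (borel X * borel Y)%type] v.
Hypothesis v_gt0 : forall x, 0 < v x.
Hypothesis v_sub : forall x y, v (x + y) <= v x * v y.
Hypothesis v_even : forall x, v (- x) = v x.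

(** Bernoulli's inequality gives (N / (N + 2))^D >= 1 - 2D / (N + 2), which exceeds 1/2 for N = 4D +
    4. Hence enlarging the side of a box from N to N + 2 less than doubles its volume. *)
Lemma bernoulli_ratio (D : nat) : exists N : nat, (N.+2 ^ D < 2 * N ^ D)%N.
Proof.
exists (4 * D + 4)%N; set N := (4 * D + 4)%N.
have bern n (k : nat) : (n <= k)%N -> ((k.+2 - 2 * n) * k.+2 ^ n <= k ^ n * k.+2)%N.
  elim: n => [|n IH] nk; first by rewrite muln0 subn0 expn0 muln1 mul1n.
  have := IH (ltnW nk); rewrite !expnS.
  set a := (k.+2 ^ n)%N; set b := (k ^ n)%N => h.
  have h1 : ((k.+2 - 2 * n) * a * k <= b * k.+2 * k)%N by rewrite leq_mul2r h orbT.
  have h2 : ((k.+2 - 2 * n.+1) * k.+2 <= (k.+2 - 2 * n) * k)%N by nia.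
  apply: leq_trans (_ : (k.+2 - 2 * n) * k * a <= _)%N; first by rewrite mulnA leq_mul2r h2 orbT.
  by move: h1; nia.
have := bern D N; have -> : (D <= N)%N by rewrite /N; lia.
move=> /(_ isT) h.
have h2 : (N.+2 < 2 * (N.+2 - 2 * D))%N by rewrite /N; lia.
have p0 : (0 < N.+2 ^ D)%N by rewrite expn_gt0.
by move: h h2 p0; move: (N.+2 ^ D)%N (N ^ D)%N; nia.
Qed.

(* Two translates of a set filling more than half of a box must meet, so every
   small u is a difference of two points of a sublevel set of v. *)
Lemma weight_bounded_cube1 : exists C, forall u, cube t 1 u -> v u <= C.
Proof.
have [N NP] := bernoulli_ratio (d1 + d2).
have [b10 b1f] := lam_box1 t1 mu_haar; have [b20 b2f] := lam_box1 t2 nu_haar.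
pose b := fine (mu (box t1 0 1)) * fine (nu (box t2 0 1)).
have b0 : 0 < b by rewrite mulr_gt0 ?fine_gt0 ?b10 ?b20.
pose B a n : set (borel X * borel Y)%type := box t1 a n `*` box t2 a n.
have mB a n : measurable (B a n) by apply: measurableX; exact: measurable_box.
have lB a n : lam (B a n) = ((n ^ (d1 + d2))%:R * b)%:E.
  rewrite product_measure1E; [|exact: measurable_box..].
  have e1 : mu (box t1 a n) = ((n ^ d1)%:R * fine (mu (box t1 0 1)))%:E.
    by rewrite (lam_box_shift t1 mu_haar) (lam_box t1 mu_haar n) EFinM fineK// ge0_fin_numE.
  have e2 : nu (box t2 a n) = ((n ^ d2)%:R * fine (nu (box t2 0 1)))%:E.
    by rewrite (lam_box_shift t2 nu_haar) (lam_box t2 nu_haar n) EFinM fineK// ge0_fin_numE.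
  transitivity (((n ^ d1)%:R * fine (mu (box t1 0 1)))%:E * ((n ^ d2)%:R * fine (nu (box t2 0 1)))%:E)%E.
    by congr (_ * _)%E; [exact: e1|exact: e2].
  by rewrite -EFinM expnD natrM /b; congr (_%:E); ring.
pose E n : set (borel X * borel Y)%type := B 0 N `&` [set z | v z <= n%:R].
have mE n : measurable (E n).
  apply: measurableI => //; rewrite -[X in measurable X]setTI.
  have -> : [set z | v z <= n%:R] = v @^-1` `]-oo, n%:R]%classic.
    by apply/seteqP; split => z; rewrite /= in_itv.
  exact: v_meas.
have EB : \bigcup_n E n = B 0 N.
  apply/seteqP; split => [z [n _ []]//|z Bz].
  exists (Num.trunc (v z)).+1 => //; split => //=.
  by have /andP[_ /ltW] := truncn_itv (ltW (v_gt0 z)).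
have cvgE : lam (E n) @[n --> \oo] --> lam (B 0 N).
  rewrite -EB; apply: nondecreasing_cvg_mu => //; first by rewrite EB; exact: mB.
  move=> m n mn; apply/subsetPset => z [Bz vz]; split => //=.
  by apply: le_trans vz _; rewrite ler_nat.
(* The threshold is half the volume of the box of side N + 2, which contains the sublevel set in the
   box of side N together with its translate by any u of the unit cube. *)
have [n nP] : exists n, (((N.+2 ^ (d1 + d2))%:R * b / 2)%:E < lam (E n))%E.
  apply: contrapT => /forallNP h.
  have : (lam (B 0%R N) <= ((N.+2 ^ (d1 + d2))%:R * b / 2)%:E)%E.
    apply: cvge_le cvgE; apply: nearW => n /=.
    by rewrite leNgt; exact/negP/h.
  rewrite lB lee_fin ler_pdivlMr// -mulrA [b * 2]mulrC mulrA ler_pM2r// -natrM ler_nat.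
  by rewrite mulnC leqNgt NP.
exists (n%:R * n%:R) => u u1.
suff [x [[_ vx] [_ vxu]]] : exists x, E n x /\ E n (x + u).
  have -> : u = x + u - x by rewrite addrAC subrr add0r.
  apply: le_trans (v_sub _ _) _; rewrite v_even.
  by apply: ler_pM => //; exact: ltW.
apply: contrapT => /forallNP disj.
pose E' : set (borel X * borel Y)%type := (fun z : Z => z + u) @^-1` E n.
have mE' : measurable E'.
  by rewrite -[X in measurable X]setTI; exact: measurable_product_shift.
have EE' : E n `&` E' = set0 by apply/seteqP; split => // x; exact: disj.
have sub : E n `|` E' `<=` B (-1) N.+2.
  have [[u1H u2H] uc] : (stab t1 u.1 /\ stab t2 u.2) /\
      ((forall i, `|crd t1 u.1 i 0| <= 1) /\ (forall i, `|crd t2 u.2 i 0| <= 1)).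
    by move: u1; rewrite cube_product => -[[h1 h2] [h3 h4]].
  have N2 : N.+2%:R = N%:R + 2 :> R by rewrite -addn2 natrD.
  move=> z [[[[z1 z1c] [z2 z2c]] _]|[[[z1 z1c] [z2 z2c]] _]]; rewrite /B /box /= N2.
    by split; split => // i; [have := z1c i|have := z2c i]; lra.
  have [uc1 uc2] := uc; split; split.
  - by rewrite -(addrK u.1 z.1); exact: stabB.
  - by move=> i; have := z1c i; have := uc1 i; rewrite ler_norml crdD mxE; lra.
  - by rewrite -(addrK u.2 z.2); exact: stabB.
  - by move=> i; have := z2c i; have := uc2 i; rewrite ler_norml crdD mxE; lra.
have : (lam (E n `|` E') <= lam (B (-1)%R N.+2))%E.
  by apply: le_measure; rewrite ?inE//; exact: measurableU.
have lE' : lam E' = lam (E n) := product_haar_shift u (mE n).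
have lU : lam (E n `|` E') = (lam (E n) + lam E')%E by exact: measureU.
rewrite lU lE' lB; apply/negP; rewrite -ltNge.
rewrite (_ : (N.+2 ^ (d1 + d2))%:R * b = (N.+2 ^ (d1 + d2))%:R * b / 2 + (N.+2 ^ (d1 + d2))%:R * b / 2).
  by rewrite EFinD; apply: lteD.
exact: splitr.
Qed.

(** For positive n, a point of the cube of size n is reached by n unit steps along [sec], each
    costing a factor M. The two extra factors account for the starting point [sec] at 0 and for the
    final remainder, whose coordinates vanish. *)
Lemma weight_growth : exists2 M : R, 1 <= M & forall n z, cube t n z -> v z <= M ^+ n.+2.
Proof.
have [C CP] := weight_bounded_cube1.
exists (Num.max 1 C); first by rewrite le_max lexx.
set M := Num.max 1 C; have M1 : 1 <= M by rewrite le_max lexx.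
have M0 : 0 <= M by lra.
have MP u : cube t 1 u -> v u <= M by move=> /CP h; rewrite le_max h orbT.
move=> [|n] z nz.
  have z1 : cube t 1 z by case: nz => h1 h2; split => // i; apply: le_trans (h2 i) _; lra.
  by apply: le_trans (MP _ z1) _; rewrite expr2 ler_peMl.
have [Hz cz] := nz; pose a := crd t z.
pose s (j : nat) := sec t ((j%:R / n.+1%:R) *: a).
have step j : cube t 1 (s j.+1 - s j).
  split; first by apply: stabB; exact: stab_sec.
  move=> i; rewrite crdB !secK -scalerBl mxE -mulrBl -natr1 (addrC j%:R) addrK mul1r normrM.
  rewrite ger0_norm ?invr_ge0// ler_pdivrMl// mulr1; exact: cz.
have Sj j : v (s j) <= M ^+ j.+1.
  elim: j => [|j IH].
    rewrite expr1; apply: MP; split; first exact: stab_sec.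
    by move=> i; rewrite secK mxE mul0r mul0r normr0.
  rewrite -(subrK (s j) (s j.+1)); apply: le_trans (v_sub _ _) _.
  by rewrite exprS; apply: ler_pM (MP _ (step j)) IH; exact: ltW.
rewrite -(subrK (s n.+1) z); apply: le_trans (v_sub _ _) _.
rewrite exprS; apply: ler_pM (Sj _); [exact: ltW|exact: ltW|apply: MP].
split; first by apply: stabB => //; exact: stab_sec.
by move=> i; rewrite crdB secK divff// scale1r subrr mxE normr0.
Qed.

Lemma weight_bounded_cube n : exists C, forall u, cube t n u -> v u <= C.
Proof. by have [M _ MP] := weight_growth; exists (M ^+ n.+2); exact: MP. Qed.

End weights.

Section geometric_sums.
Context {R : realType}.
Local Open Scope ereal_scope.

Lemma esum_nat_geometric (th : R) : (0 <= th < 1)%R ->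
  \esum_(n in [set: nat]) (th ^+ n)%:E < +oo.
Proof.
move=> /andP[th0 th1]; rewrite -nneseries_esumT; last by move=> n; rewrite lee_fin exprn_ge0.
apply: (@le_lt_trans _ _ ((1 - th)^-1)%:E); last exact: ltry.
apply: lime_le; first by apply: is_cvg_nneseries => n _ _; rewrite lee_fin exprn_ge0.
apply: nearW => n; rewrite sumEFin lee_fin -(ler_pM2r (x := 1 - th)) ?subr_gt0//.
rewrite mulVf ?gt_eqF ?subr_gt0//.
have -> : ((\sum_(0 <= i < n) th ^+ i) * (1 - th) = 1 - th ^+ n)%R.
  elim: n => [|n IH]; first by rewrite big_nil expr0; ring.
  by rewrite big_nat_recr//= mulrDl IH exprS; ring.
by rewrite gerBl exprn_ge0.
Qed.

Lemma esum_int_exp (r : R) : (0 < r)%R ->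
  \esum_(k in [set: int]) (expR (- r * `|k%:~R|))%:E < +oo.
Proof.
move=> r0; pose th := expR (- r).
have th01 : (0 <= th < 1)%R by rewrite expR_ge0 expR_lt1 oppr_lt0.
have e n : (th ^+ n = expR (- r * n%:R))%R by rewrite -expRM_natr.
rewrite (@esumID _ _ (range Posz)); last by move=> k _; rewrite lee_fin expR_ge0.
rewrite !setTI (_ : ~` range Posz = range Negz); last first.
  apply/seteqP; split => [[n|n] h|_ [n _ <-] [m _ mn]]; [|by exists n|by []].
  by exfalso; apply: h; exists n.
rewrite !esum_image; try by move=> ? ? _ _ [].
apply: lte_add_pinfty.
  apply: le_lt_trans (esum_nat_geometric th01); apply: le_esum => n _.
  by rewrite lee_fin e -pmulrn ger0_norm.
apply: le_lt_trans (esum_nat_geometric th01); apply: le_esum => n _.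
rewrite lee_fin e ler_expR ler_wnM2l ?oppr_le0 ?ltW// NegzE mulrNz normrN -pmulrn ger0_norm//.
by rewrite ltr_nat.
Qed.

Lemma esum_cV_exp (n : nat) (r : R) : (0 < r)%R ->
  \esum_(k in [set: 'cV[int]_n]) (\prod_(i < n) expR (- r * `|(k i ord0)%:~R|))%:E < +oo.
Proof.
move=> r0; elim: n => [|n IH].
  rewrite (_ : [set: 'cV[int]_0] = [set 0%R]); last first.
    by apply/seteqP; split => // k _; apply/matrixP => -[].
  by rewrite esum_set1 ?big_ord0 ?ltry// lee_fin.
have p0 m (k : 'cV[int]_m) : 0 <= (\prod_(i < m) expR (- r * `|(k i ord0)%:~R|))%:E.
  by rewrite lee_fin; apply: prodr_ge0 => i _; exact: expR_ge0.
pose e (x : int * 'cV[int]_n) : 'cV[int]_n.+1 := col_mx (const_mx x.1 : 'cV_1) x.2.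
rewrite (@reindex_esum _ _ _ ([set: int] `*`` fun=> [set: 'cV[int]_n]) _ e); last first.
  split => // [[a x] [b y] _ _ h|k _].
    have [ab xy] := @eq_col_mx int 1 n 1 _ _ _ _ h.
    apply/pair_equal_spec; split => //.
    by have := congr1 (fun M : 'cV_1 => M ord0 ord0) ab; rewrite !mxE.
  exists ((k : 'cV_(1 + n)) (lshift n ord0) ord0, dsubmx (k : 'cV_(1 + n))) => //.
  have kE : const_mx ((k : 'cV_(1 + n)) (lshift n ord0) ord0) = usubmx (k : 'cV_(1 + n)).
    by apply/matrixP => i j; rewrite !ord1 !mxE.
  by rewrite /e /= kE; exact: (@vsubmxK _ 1 n).
rewrite -(@esum_esum _ _ _ [set: int] (fun=> [set: 'cV[int]_n]) (fun a x =>
  (\prod_(i < n.+1) expR (- r * `|(e (a, x) i ord0)%:~R|))%:E))//.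
rewrite (eq_esum (b := fun a => (expR (- r * `|a%:~R|))%:E *
    \esum_(k in [set: 'cV[int]_n]) (\prod_(i < n) expR (- r * `|(k i ord0)%:~R|))%:E)); last first.
  move=> a _; rewrite -esumZl ?lee_fin ?expR_ge0//.
  apply: eq_esum => k _; rewrite -EFinM; congr (_%:E).
  have e1 : e (a, k) (lshift n (ord0 : 'I_1)) ord0 = a.
    by apply: etrans (@col_mxEu _ 1 n _ _ _ _ _) _; rewrite mxE.
  have e2 i : e (a, k) (@rshift 1 n i) ord0 = k i ord0 by exact: (@col_mxEd _ 1 n).
  rewrite (@big_split_ord _ _ _ 1 n) /= big_ord1 e1; congr (_ * _)%R.
  by apply: eq_bigr => i _; rewrite e2.
under eq_esum do rewrite muleC.
rewrite esumZl; last 2 first.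
- by apply: esum_ge0 => k _; exact: p0.
- by move=> a; rewrite lee_fin expR_ge0.
apply: lte_mul_pinfty; [by apply: esum_ge0 => k _; exact: p0| |exact: esum_int_exp].
by rewrite ge0_fin_numE//; apply: esum_ge0 => k _; exact: p0.
Qed.

End geometric_sums.

(** * Gaussian bounds against exponentially growing weights *)

Section gaussian_kernels.
Context {R : realType} {d : nat} {X : PreTopologicalZmodule.type} (t : tiling R d X).
Variables (v : X -> R) (M : R).
Hypothesis v_gt0 : forall x, 0 < v x.
Hypothesis M_ge1 : 1 <= M.
Hypothesis v_growth : forall n z, cube t n z -> v z <= M ^+ n.+2.
Local Notation L := (lattice t).
Local Notation H := (stab t).
Local Notation c := (crd t).

(** Quadratic decay beats the exponential growth of the weight. Since [Theta] is at most 0 outside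
    the open subgroup [H], only the lattice points in [H] count, and these form a single copy of
    Z^d. *)
Lemma gaussian_decaying (Theta : X -> \bar R) (C ep : R) : 0 <= C -> 0 < ep ->
  (forall z, H z -> (Theta z <= (C * expR (- (ep * \sum_i c z i ord0 ^+ 2)))%:E)%E) ->
  (forall z, ~ H z -> (Theta z <= 0)%E) -> decaying t v Theta.
Proof.
move=> C0 ep0 TH TN n.
(* Completing the square gives ep s^2 >= B|s| - B^2 / (4 ep). The rate [B] exceeds ln M by 1, so a
   factor e^(-|k|) remains for each coordinate after the growth of v is paid for; the term B n in
   [K] covers the distance from s to the lattice coordinate k. *)
pose B := ln M + 1; have B0 : 1 <= B by rewrite lerDr ln_ge0.
pose K := B ^+ 2 / (4 * ep) + B * n%:R.
have tail (s k : R) : `|s - k| <= n%:R -> - (ep * s ^+ 2) <= K - B * `|k|.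
  move=> sk; have h1 : - (ep * s ^+ 2) <= B ^+ 2 / (4 * ep) - B * `|s|.
    rewrite -subr_ge0 (_ : _ - _ = ep * (`|s| - B / (2 * ep)) ^+ 2).
      by rewrite mulr_ge0 ?sqr_ge0// ltW.
    by rewrite -(real_normK (num_real s)); field; rewrite gt_eqF.
  have h2 : `|k| <= `|s| + n%:R.
    by rewrite -{1}(subKr s k); apply: le_trans (ler_normB _ _) _; rewrite lerD2l.
  by rewrite /K; nra.
pose F (b : R) w := \prod_(i < d) expR (- b * `|c w i ord0|).
have F0 b w : 0 <= F b w by apply: prodr_ge0 => i _; exact: expR_ge0.
exists (fun w => (if w \in H then C * expR (K * d%:R) * F B w else 0)%:E); split.
- by move=> w; rewrite lee_fin; case: ifP => // _; rewrite !mulr_ge0 ?expR_ge0.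
- move=> w u Lw [Hu cu]; have [Hwu|nH] := pselect (H (w + u)); last first.
    by apply: le_trans (TN _ nH) _; rewrite lee_fin; case: ifP => // _; rewrite !mulr_ge0 ?expR_ge0.
  have Hw : H w by rewrite -(addrK u w); exact: stabB.
  rewrite mem_set//; apply: le_trans (TH _ Hwu) _; rewrite lee_fin -mulrA ler_wpM2l//.
  rewrite /F -expR_sum -expRD ler_expR mulr_sumr -sumrN.
  rewrite (_ : K * d%:R = \sum_(i < d) K); last by rewrite sumr_const card_ord mulr_natr.
  rewrite -big_split /=; apply: ler_sum => i _; rewrite mulNr; apply: tail.
  by rewrite crdD mxE addrAC subrr add0r.
move=> r /andP[r0 _].
pose C' := C * expR (K * d%:R) * M ^+ 2.
have M00 : 0 <= M := le_trans ler01 M_ge1.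
have C'0 : 0 <= C' by rewrite /C' !mulr_ge0 ?expR_ge0.
have bound w : L w -> H w -> C * expR (K * d%:R) * F B w * v w <= C' * F 1 w.
  move=> [k [e [re wE]]] Hw.
  have cw i : c w i ord0 = (k i ord0)%:~R by rewrite wE crd_lattice// mxE.
  have cub : cube t (\sum_i `|k i ord0|)%N w.
    split => // i; rewrite cw -intr_norm -[X in X%:~R]/(Posz `|k i ord0|%N) -pmulrn ler_nat.
    by rewrite (bigD1 i)//= leq_addr.
  apply: le_trans (ler_wpM2l _ (v_growth cub)) _; first by rewrite !mulr_ge0 ?expR_ge0.
  rewrite -addn2 exprD /C' -[leLHS]mulrA -[leRHS]mulrA ler_wpM2l ?mulr_ge0 ?expR_ge0//.
  rewrite mulrA (mulrC _ (M ^+ 2)) ler_wpM2l ?exprn_ge0// mulrC.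
  have M0 : 0 < M := lt_le_trans ltr01 M_ge1.
  rewrite -{1}(lnK (x := M)) ?posrE// -expRM_natr /F -!expR_sum -expRD ler_expR.
  rewrite natr_sum mulr_sumr -big_split /=; apply: ler_sum => i _.
  have -> : (`|k i ord0|%N)%:R = `|c w i ord0| by rewrite cw -intr_norm -[X in X%:~R]/(Posz `|k i ord0|%N) -pmulrn.
  by rewrite /B; lra.
pose G w := ((C' * F 1 w) `^ r)%:E.
have G0 w : (0 <= G w)%E by rewrite lee_fin powR_ge0.
apply: (@le_lt_trans _ _ (\esum_(w in L `&` H) G w)%E).
  rewrite esum_mkcondr; apply: le_esum => w Lw.
  case: ifP => [/set_mem Hw|_]; last by rewrite mul0e poweR0r ?gt_eqF.
  rewrite -EFinM poweR_EFin lee_fin; apply: ge0_ler_powR; rewrite ?nnegrE ?mulr_ge0 ?expR_ge0 ?(ltW r0) ?(ltW (v_gt0 _))//.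
  exact: bound.
(* Exactly one coset representative lies in [H], namely that of 0. *)
have [e0 e0P] : exists e, L `&` H `<=` [set sec t (map_mx intr k) + e | k in [set: 'cV[int]_d]].
  exists (rep t 0) => _ [[k [e [re ->]]] Hw]; exists k => //; congr (_ + _).
  apply: rep_unique => //; rewrite sub0r; apply: stabN.
  rewrite -(addKr (sec t (map_mx intr k)) e) addrC; apply: stabB => //; exact: stab_sec.
have inj : set_inj [set: 'cV[int]_d] (fun k => sec t (map_mx intr k) + e0).
  move=> k k' _ _ h; have := congr1 c h; rewrite !crdD !secK => /addIr kk.
  apply/matrixP => i j; have := congr1 (fun N : 'cV[R]_d => N i j) kk.
  by rewrite !mxE => /intr_inj.
apply: le_lt_trans (esum_le_set G0 e0P) _; rewrite esum_image//.
pose D := ((C' * expR (\sum_i `|c e0 i ord0|)) `^ r)%:E.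
have D0 : (0 <= D)%E by rewrite lee_fin powR_ge0.
apply: (@le_lt_trans _ _ (\esum_(k in [set: 'cV[int]_d])
    (D * (\prod_(i < d) expR (- r * `|(k i ord0)%:~R|))%:E))%E).
  apply: le_esum => k _; rewrite -EFinM lee_fin.
  have FE : F 1 (sec t (map_mx intr k) + e0) <=
      expR (\sum_i `|c e0 i ord0|) * \prod_(i < d) expR (- `|(k i ord0)%:~R|).
    rewrite /F -!expR_sum -expRD ler_expR -big_split /=; apply: ler_sum => i _.
    rewrite mulN1r crdD secK !mxE.
    have := ler_distD (- (c e0 i ord0)) (k i ord0)%:~R (0 : R).
    rewrite !subr0 opprK normrN; lra.
  apply: (@le_trans _ _ ((C' * (expR (\sum_i `|c e0 i ord0|) *
      \prod_(i < d) expR (- `|(k i ord0)%:~R|))) `^ r)).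
    apply: ge0_ler_powR; rewrite ?(ltW r0)// ?nnegrE.
    - by rewrite mulr_ge0.
    - by rewrite !mulr_ge0 ?expR_ge0// prodr_ge0// => i _; exact: expR_ge0.
    - by rewrite ler_wpM2l.
  rewrite mulrA powRM; last 2 first.
  - by rewrite mulr_ge0 ?expR_ge0.
  - by apply: prodr_ge0 => i _; exact: expR_ge0.
  rewrite ler_wpM2l ?powR_ge0// -!expR_sum /powR gt_eqF ?expR_gt0// expRK mulr_sumr.
  by rewrite ler_expR; apply: ler_sum => i _; rewrite mulrN mulNr.
rewrite esumZl//; last by move=> k; rewrite lee_fin; apply: prodr_ge0 => i _; exact: expR_ge0.
by apply: lte_mul_pinfty; [|rewrite ge0_fin_numE ?ltry|exact: esum_cV_exp].
Qed.

End gaussian_kernels.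

(** * Gaussians *)

Section decaying_integrals.
Context {R : realType} {d : nat} {X : PreTopologicalZmodule.type} (t : tiling R d X).
Variable lam : {sigma_finite_measure set (borel X) -> \bar R}.
Hypothesis haar : is_haar (fun x y : X => x + y) lam.
Local Open Scope ereal_scope.

Lemma decaying_integral_lty (Theta : X -> \bar R) : (forall x, 0 <= Theta x) ->
  decaying t (fun=> 1%R) Theta -> \int[lam]_x Theta x < +oo.
Proof.
move=> T0 kT; have [kappa [k0 kb kr]] := kT 1%N.
have [c c0 cP] := Lnorm_lattice t haar (lte01 : 0 < 1%:E).
apply: (@le_lt_trans _ _ (\int[lam]_x kappa (rnd t x))).
  apply: ge0_le_integral_nomeas => // x.
  by rewrite -{1}(subrK (rnd t x) x) addrC; apply: kb; [exact: lattice_rnd|exact: cube_sub_rnd].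
have -> : \int[lam]_x kappa (rnd t x) = 'N[lam]_1[(fun x => kappa (rnd t x))].
  by rewrite Lnorm1; apply: eq_integral => x _; rewrite gee0_abs.
rewrite cP//=; apply: lte_mul_pinfty; [by rewrite lee_fin ltW|by []|].
rewrite invr1 poweRe1; last by apply: esum_ge0 => x _; exact: poweR_ge0.
under eq_esum do rewrite poweRe1 ?abse_ge0// gee0_abs//.
apply: rapid_sum => //; rewrite (_ : kappa = fun w => kappa w * 1)//.
by apply/funext => w; rewrite mule1.
Qed.

End decaying_integrals.

Lemma cmeasurable_continuous_prod (R : realType) (dY : measure_display) (Y : measurableType dY)
    (TY : topologicalType) (X : PreTopologicalZmodule.type) (u : Y -> TY) (f : TY * X -> R[i]) :
  @second_countable X -> borel_map u -> continuous (f : TY * X -> R[i]^o) ->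
  cmeasurable (fun p : Y * borel X => f (u p.1, p.2)).
Proof.
move=> sc bu cf; apply: (borel_map_cmeasurable (u := fun p : Y * borel X => (u p.1, p.2 : X))) => //.
by move=> V oV; exact: (open_measurable_prod sc (u := u)).
Qed.

Lemma sum_sqr_mulmx (R : realType) (d : nat) (B : 'M[R]_d) :
  exists2 C : R, 0 < C & forall a : 'cV[R]_d, \sum_i (B *m a) i 0 ^+ 2 <= C * \sum_i a i 0 ^+ 2.
Proof.
pose C0 := \sum_i (\sum_j `|B i j|) ^+ 2.
have C00 : 0 <= C0 by apply: sumr_ge0 => i _; exact: sqr_ge0.
exists (C0 + 1); first by lra.
move=> a; set q := \sum_i a i 0 ^+ 2.
have q0 : 0 <= q by apply: sumr_ge0 => i _; exact: sqr_ge0.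
have aq j : `|a j 0| <= Num.sqrt q.
  rewrite -sqrtr_sqr ler_wsqrtr// /q (bigD1 j)//= lerDl.
  by apply: sumr_ge0 => i _; exact: sqr_ge0.
apply: (@le_trans _ _ (C0 * q)); last by rewrite mulrDl mul1r lerDl.
rewrite /C0 mulr_suml; apply: ler_sum => i _.
rewrite -[in leRHS](sqr_sqrtr q0) -exprMn -[leLHS]real_normK ?num_real//.
rewrite ler_sqr ?nnegrE ?mulr_ge0 ?sqrtr_ge0 ?sumr_ge0//.
rewrite mxE; apply: le_trans (ler_norm_sum _ _ _) _; rewrite mulr_suml.
by apply: ler_sum => j _; rewrite normrM; apply: ler_wpM2l.
Qed.

Lemma cst_mul_measure_le_integral (dT : measure_display) (T : measurableType dT) (R : realType)
    (lam : {measure set T -> \bar R}) (c : R) (U : set T) (f : T -> \bar R) : measurable U ->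
  (0 <= c%:E)%E -> (forall x, 0 <= f x)%E -> (forall x, U x -> c%:E <= f x)%E ->
  (c%:E * lam U <= \int[lam]_x f x)%E.
Proof.
move=> mU c0 f0 cf; rewrite -[X in lam X]setIT -integral_indic// -ge0_integralZl//; last first.
  by apply/measurable_EFinP; exact: measurable_indic.
apply: ge0_le_integral_nomeas => x; first by rewrite mule_ge0.
rewrite indicE; have [/set_mem Ux|_] := boolP (x \in U); first by rewrite mule1 cf.
by rewrite mule0.
Qed.

Lemma creal_mulACA (R : realType) (r s : R) (z w : R[i]) :
  r%:C%C * z * (s%:C%C * w) = (r * s)%:C%C * (z * w).
Proof. by rewrite mulrACA; congr (_ * _); apply: complex_ext => /=; ring. Qed.

Lemma cmod_realB (R : realType) (r s : R) : cmod (r%:C%C - s%:C%C) = `|r - s|.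
Proof. by rewrite -cmod_real; congr cmod; apply: complex_ext => /=; ring. Qed.

(** |r - s| = r + s - 2 min(r, s). *)
Lemma dist_gap (R : realType) (r s c : R) : c <= r -> c <= s -> `|r - s| + 2 * c <= r + s.
Proof.
by case: (lerP s r); lra.
Qed.

(** * Gaussians, their Fourier transforms and their ambiguity functions *)

Section gaussians.
Context {R : realType} {G G0 : lcaType} {d : nat}.
Context {iso : G -> 'cV[R]_d * G0} (S : splitting iso).
Context {K : set G0} (K_subgroup : compact_open_subgroup K).
Context {A : 'M[R]_d} (A_unit : A \in unitmx).
Context {D : set G0} (DP : coset_representatives K D).
Local Notation Gh := (dual_group R G).
Local Notation t1 := (group_tiling S K_subgroup A_unit DP).
Hypothesis G_second_countable : @second_countable G.
Variable mu : {sigma_finite_measure set (borel G) -> \bar R}.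
Hypothesis mu_haar : is_haar (fun x y : G => x + y) mu.

Definition sq (x : G) : R := \sum_i (iso x).1 i 0 ^+ 2.
Definition gauss (c : R) (x : G) : R := expR (- (c * sq x)) * \1_K (iso x).2.

Lemma sqE x : sq x = dotv (iso x).1 (iso x).1.
Proof. by apply: eq_bigr => i _; rewrite expr2. Qed.

Lemma sq_ge0 x : 0 <= sq x. Proof. by apply: sumr_ge0 => i _; exact: sqr_ge0. Qed.

Lemma sqN x : sq (- x) = sq x.
Proof. by rewrite !sqE (isoN S) dotvNl dotvNr opprK. Qed.

Lemma gauss_ge0 c x : 0 <= gauss c x.
Proof. by rewrite mulr_ge0 ?expR_ge0. Qed.

Lemma gauss_gt0 c x : K (iso x).2 -> 0 < gauss c x.
Proof. by move=> Kx; rewrite /gauss indicE mem_set// mulr1 expR_gt0. Qed.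

Lemma gauss_out c x : ~ K (iso x).2 -> gauss c x = 0.
Proof. by move=> Kx; rewrite /gauss indicE memNset// mulr0. Qed.

Lemma gaussK c x : K (iso x).2 -> gauss c x = expR (- (c * sq x)).
Proof. by move=> Kx; rewrite /gauss indicE mem_set// mulr1. Qed.

Lemma K_sub x y : K x -> K y -> K (x - y).
Proof. by have [_ _ _ KB] := K_subgroup; exact: KB. Qed.

Lemma K_opp x : K x -> K (- x).
Proof. by have [_ _ K0 _] := K_subgroup; rewrite -sub0r; exact: K_sub. Qed.

Lemma K_add x y : K x -> K y -> K (x + y).
Proof. by move=> Kx Ky; rewrite -[y]opprK; apply: K_sub => //; exact: K_opp. Qed.

Lemma gaussN c x : gauss c (- x) = gauss c x.
Proof.
have [Kx|Kx] := pselect (K (iso x).2).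
  by rewrite !gaussK ?sqN// (isoN S); exact: K_opp.
rewrite !gauss_out// (isoN S) => /K_opp /=; by rewrite opprK.
Qed.

(** [K] is compact in a Hausdorff group, hence closed as well as open. *)
Lemma indic_K_continuous : continuous (fun x : G => \1_K (iso x).2 : R).
Proof.
have [cK oK _ _] := K_subgroup.
have clK : closed K by apply: compact_closed => //; exact: lca_hausdorff.
have cont : continuous (\1_K : G0 -> R).
  move=> y; have [Ky|nKy] := pselect (K y).
    apply: (near_cst_continuous (1 : R)).
    have : nbhs y K by apply: open_nbhs_nbhs.
    by apply: filterS => z Kz; rewrite indicE mem_set.
  apply: (near_cst_continuous (0 : R)).
  have : nbhs y (~` K) by apply: open_nbhs_nbhs; split => //; exact: closed_openC.
  by apply: filterS => z Kz; rewrite indicE memNset.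
exact: (continuousT_comp (iso2_continuous S) cont).
Qed.

Lemma sq_continuous : continuous sq.
Proof.
have -> : sq = fun x => dotv (iso x).1 (iso x).1 by apply/funext => x; rewrite sqE.
by apply: dotv_continuous; exact: iso1_continuous.
Qed.

Lemma gauss_continuous c : continuous (gauss c).
Proof.
have c1 : continuous (fun x => expR (- (c * sq x))).
  have h := continuousT_comp sq_continuous (@continuous_mull R (- c)).
  have -> : (fun x => expR (- (c * sq x))) = (fun x => expR (- c * sq x)).
    by apply/funext => x; rewrite mulNr.
  exact: (continuousT_comp h (@continuous_expR R)).
by move=> x; apply: cvgM; [exact: c1|exact: indic_K_continuous].
Qed.

Lemma creal_continuous (T : topologicalType) (f : T -> R) : continuous f ->
  continuous ((fun x => (f x)%:C%C) : T -> R[i]^o).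
Proof. by move=> cf; apply: ccontinuous_ReIm => //= x; exact: cvg_cst. Qed.

Lemma gauss_decaying c : 0 < c -> decaying t1 (fun=> 1) (fun x => (gauss c x)%:E).
Proof.
move=> c0; have [C C0 CP] := sum_sqr_mulmx (invmx A).
have gr n z : cube t1 n z -> (1 : R) <= 1 ^+ n.+2 by rewrite expr1n.
apply: (@gaussian_decaying _ _ _ t1 (fun=> 1) 1 (fun=> ltr01) (lexx 1) gr _ 1 (c / C)) => //.
- by rewrite divr_gt0.
- move=> z Hz; rewrite lee_fin mul1r gaussK//= ler_expR lerN2 mulrAC ler_pdivrMr//.
  by rewrite -mulrA ler_wpM2l ?(ltW c0)// mulrC; exact: CP.
- by move=> z Hz; rewrite gauss_out.
Qed.

Lemma gauss_integral_lty c : 0 < c -> (\int[mu]_x (gauss c x)%:E < +oo)%E.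
Proof.
move=> c0; apply: (@decaying_integral_lty _ _ _ t1 mu mu_haar) => [x|].
  by rewrite lee_fin gauss_ge0.
exact: gauss_decaying.
Qed.

Lemma cgauss_continuous c : continuous ((fun x => (gauss c x)%:C%C) : G -> R[i]^o).
Proof. exact/creal_continuous/gauss_continuous. Qed.

Lemma cmeasurable_cgauss c : cmeasurable ((fun x => (gauss c x)%:C%C) : borel G -> R[i]).
Proof.
exact: (borel_map_cmeasurable (@borel_map_id G) (@cgauss_continuous c)).
Qed.

Lemma cmod_cgauss c x : cmod (gauss c x)%:C%C = gauss c x.
Proof. by rewrite cmod_real ger0_norm ?gauss_ge0. Qed.

Definition gphase (a : 'cV[R]_d) (x : G) : R[i] := expi (- (2 * pi * dotv a (iso x).1)).

Lemma cmod_gphase a x : cmod (gphase a x) = 1. Proof. exact: cmod_expi. Qed.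

Lemma cmodDD (z : R[i]) : cmod (z + z) = 2 * cmod z.
Proof.
have -> : z + z = (2 : R)%:C%C * z.
  by apply: complex_ext; case: z => a b /=; ring.
by rewrite cmodM cmod_real ger0_norm.
Qed.

Lemma gphaseD a x y : gphase a (x + y) = gphase a x * gphase a y.
Proof. by rewrite /gphase (isoD S) dotvDr mulrDr opprD expiD. Qed.

Lemma gphaseN a x : gphase (- a) x = (gphase a x)^*%C.
Proof. by rewrite /gphase dotvNl mulrN opprK -expiN opprK. Qed.

Lemma gphase_continuous a : continuous (gphase a : G -> R[i]^o).
Proof.
have c1 : continuous (fun x => - (2 * pi) * dotv a (iso x).1).
  apply: (continuousT_comp (f := fun x => dotv a (iso x).1) (g := fun s => - (2 * pi) * s)).
    by apply: dotv_continuous; [move=> x; exact: cvg_cst|exact: iso1_continuous].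
  exact: continuous_mull.
have -> : gphase a = (fun x => expi (- (2 * pi) * dotv a (iso x).1)).
  by apply/funext => x; rewrite mulNr.
exact: (continuousT_comp c1 (@expi_continuous R)).
Qed.

Definition gint (c : R) (a : 'cV[R]_d) : R[i] :=
  cintegral mu (fun x => (gauss c x)%:C%C * gphase a x).

Lemma cmeasurable_continuousM (f g : G -> R[i]) : continuous (f : G -> R[i]^o) ->
  continuous (g : G -> R[i]^o) -> cmeasurable ((fun x => f x * g x) : borel G -> R[i]).
Proof.
move=> cf cg; apply: cmeasurableM.
  exact: (borel_map_cmeasurable (@borel_map_id G) cf).
exact: (borel_map_cmeasurable (@borel_map_id G) cg).
Qed.

Lemma gint_measurable c a :
  cmeasurable ((fun x => (gauss c x)%:C%C * gphase a x) : borel G -> R[i]).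
Proof. by apply: cmeasurable_continuousM; [exact: cgauss_continuous|exact: gphase_continuous]. Qed.

Lemma gint_integrable c a : 0 < c -> cintegrable mu (fun x => (gauss c x)%:C%C * gphase a x).
Proof.
move=> c0; split; first exact: gint_measurable.
under eq_integral do rewrite cmodM cmod_gphase mulr1 cmod_cgauss.
exact: gauss_integral_lty.
Qed.

(** The parallelogram law. Only the Euclidean part of y is halved, division by 2 being meaningless
    in [G0]; on that factor [gauss_shear] uses that [K] is a subgroup. *)
Lemma sq_shear (x y : G) : sq (x - vec S (2^-1 *: (iso y).1)) +
  sq (y + (x - vec S (2^-1 *: (iso y).1))) = 2 * sq x + 2^-1 * sq y.
Proof.
rewrite !sqE (isoD S y) (isoB S) iso_vec /=.
by rewrite /dotv !mulr_sumr -!big_split; apply: eq_bigr => i _; rewrite !mxE /=; field.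
Qed.

Lemma gauss_shear (c : R) (x y : G) : gauss c (x - vec S (2^-1 *: (iso y).1)) *
  gauss c (y + (x - vec S (2^-1 *: (iso y).1))) = gauss (2 * c) x * gauss (c / 2) y.
Proof.
set u := vec S _.
have u2 z : (iso (z - u)).2 = (iso z).2 by rewrite (isoB S) iso_vec /= subr0.
have yxu : (iso (y + (x - u))).2 = (iso y).2 + (iso x).2 by rewrite (isoD S) /= u2.
have [Kx|Kx] := pselect (K (iso x).2); last first.
  by rewrite gauss_out ?u2// mul0r gauss_out// mul0r.
have [Ky|Ky] := pselect (K (iso y).2); last first.
  rewrite [RHS]mulrC (@gauss_out _ y)// mul0r mulrC gauss_out ?mul0r// yxu => h.
  by apply: Ky; rewrite -(addrK (iso x).2 (iso y).2); exact: K_sub.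
rewrite !gaussK// ?u2// ?yxu; last exact: K_add.
rewrite -!expRD; congr expR.
by rewrite -!opprD -mulrDr sq_shear; field.
Qed.

Lemma gphase_shear a b (x y : G) : gphase a (x - vec S (2^-1 *: (iso y).1)) *
  gphase b (y + (x - vec S (2^-1 *: (iso y).1))) =
  gphase (a + b) x * gphase (2^-1 *: (b - a)) y.
Proof.
rewrite /gphase -!expiD -!opprD -!mulrDr; congr (expi (- (_ * _))).
rewrite (isoD S y) (isoB S) iso_vec /= dotvZl !(dotvDl, dotvDr, dotvNl, dotvNr, dotvZr).
by field.
Qed.

Lemma measurable_gauss c : measurable_fun [set: borel G] (fun y => (gauss c y)%:E).
Proof. by apply/measurable_EFinP; have [] := cmeasurable_cgauss c. Qed.

Lemma gauss_integral_shift c (z : G) :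
  (\int[mu]_y (gauss c (y + z)%R)%:E = \int[mu]_y (gauss c y)%:E)%E.
Proof.
apply: (@ge0_integral_shift _ _ mu mu_haar (@group_shift_continuous G) z (fun y => (gauss c y)%:E)).
  exact: measurable_gauss.
by move=> y; rewrite lee_fin gauss_ge0.
Qed.

Lemma ge0_gauss_integral c : (0 <= \int[mu]_y (gauss c y)%:E)%E.
Proof. by apply: integral_ge0 => y _; rewrite lee_fin gauss_ge0. Qed.

(* Shearing (x, y) |-> (x - y/2, x + y/2) diagonalizes the product of two
   Gaussians. *)
Lemma gint_mul a b : gint (2 * pi) a * gint (2 * pi) b =
  gint (4 * pi) (a + b) * gint pi (2^-1 *: (b - a)).
Proof.
have pi0 : 0 < pi :> R by exact: pi_gt0.
have p2 : 0 < 2 * pi :> R by rewrite mulr_gt0.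
have p4 : 0 < 4 * pi :> R by rewrite mulr_gt0.
pose F c a' x := (gauss c x)%:C%C * gphase a' x.
pose f (p : G * G) := F (2 * pi) a p.1 * F (2 * pi) b (p.2 + p.1).
have cF c a' : continuous (F c a' : G -> R[i]^o).
  by move=> x; apply: cvgM; [exact: cgauss_continuous|exact: gphase_continuous].
have cf : continuous (f : G * G -> R[i]^o).
  have c1 := continuousT_comp (@fst_continuousT G G) (cF (2 * pi) a).
  have cadd : continuous (fun p : G * G => p.2 + p.1).
    have := continuousT_comp (continuous_pair (@snd_continuousT G G) (@fst_continuousT G G)) (@add_continuous G).
    exact.
  have c2 := continuousT_comp cadd (cF (2 * pi) b).
  by move=> p; apply: cvgM; [exact: c1|exact: c2].
have mf : cmeasurable (f : borel G * borel G -> R[i]).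
  have := cmeasurable_continuous_prod G_second_countable (@borel_map_id G) cf.
  by congr cmeasurable; apply/funext => -[].
have fE x y : cmod (f (x, y)) = gauss (2 * pi) x * gauss (2 * pi) (y + x).
  by rewrite cmodM; congr (_ * _); rewrite /F cmodM cmod_gphase mulr1 cmod_cgauss.
pose I2 := (\int[mu]_y (gauss (2 * pi) y)%:E)%E.
have fin1 x : (\int[mu]_y (cmod (f (x, y)))%:E = (gauss (2 * pi) x)%:E * I2)%E.
  under eq_integral do rewrite fE EFinM.
  have mg : measurable_fun [set: borel G] (fun y => (gauss (2 * pi) (y + x))%:E).
    apply: (measurableT_comp (measurable_gauss (2 * pi))).
    exact: (measurable_shift (@group_shift_continuous G) x).
  rewrite (@ge0_integralZl _ _ _ mu setT measurableT _ mg (gauss (2 * pi) x)%:E).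
  - by rewrite gauss_integral_shift.
  - by move=> y _; rewrite lee_fin gauss_ge0.
  - by rewrite lee_fin gauss_ge0.
have fub : cintegral mu (fun x => cintegral mu (fun y => f (x, y))) =
    cintegral mu (fun y => cintegral mu (fun x => f (x, y))).
  apply: (@cintegral_fubini _ _ _ _ R mu mu f mf).
  - under eq_integral do rewrite fin1.
    rewrite ge0_integralZr//; last 3 first.
    + exact: measurable_gauss.
    + by move=> x _; rewrite lee_fin gauss_ge0.
    + exact: ge0_gauss_integral.
    apply: lte_mul_pinfty; [exact: ge0_gauss_integral| |exact: gauss_integral_lty].
    by rewrite ge0_fin_numE ?ge0_gauss_integral//; exact: gauss_integral_lty.
  - move=> x; rewrite fin1; apply: lte_mul_pinfty; rewrite ?lee_fin ?gauss_ge0//.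
    exact: gauss_integral_lty.
  - move=> y; apply: le_lt_trans (gauss_integral_lty p2); apply: ge0_le_integral_nomeas.
      by move=> x; rewrite lee_fin cmod_ge0.
    move=> x; rewrite lee_fin fE -[leRHS]mulr1 ler_wpM2l ?gauss_ge0//.
    rewrite /gauss; apply: mulr_ile1; rewrite ?expR_ge0//.
      by rewrite expR_le1 oppr_le0 mulr_ge0 ?sq_ge0// ltW.
have LE : cintegral mu (fun x => cintegral mu (fun y => f (x, y))) =
    gint (2 * pi) a * gint (2 * pi) b.
  have -> : (fun x => cintegral mu (fun y => f (x, y))) =
      (fun x => F (2 * pi) a x * gint (2 * pi) b).
    apply/funext => x; rewrite /f /= cintegralZ; last first.
      split.
        apply: (cmeasurable_comp (fun y : borel G => (y + x : borel G)) (gint_measurable (2 * pi) b)).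
        exact: (measurable_shift (@group_shift_continuous G) x).
      under eq_integral do rewrite /F cmodM cmod_gphase mulr1 cmod_cgauss.
      by rewrite gauss_integral_shift; exact: gauss_integral_lty.
    congr (_ * _).
    exact: (cintegral_shift mu_haar (@group_shift_continuous G) x (gint_measurable (2 * pi) b)).
  exact: (cintegralZr (gint (2 * pi) b) (gint_integrable a p2)).
rewrite -LE fub.
have -> : (fun y => cintegral mu (fun x => f (x, y))) =
    (fun y => gint (4 * pi) (a + b) * F pi (2^-1 *: (b - a)) y).
  apply/funext => y; pose u := vec S (2^-1 *: (iso y).1).
  have mfy : cmeasurable ((fun x => f (x, y)) : borel G -> R[i]).
    apply: (borel_map_cmeasurable (@borel_map_id G) (g := fun x => f (x, y))).
    apply: (continuousT_comp (f := fun x : G => (x, y)) _ cf).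
    by apply: continuous_pair; [exact: continuousT_id|move=> x; exact: cvg_cst].
  rewrite -(cintegral_shift mu_haar (@group_shift_continuous G) (- u) mfy).
  rewrite -cintegralZr; last exact: gint_integrable.
  apply: eq_cintegral => x; rewrite /f /F /=.
  have -> : (gauss (2 * pi) (x - u))%:C%C * gphase a (x - u) *
      ((gauss (2 * pi) (y + (x - u)))%:C%C * gphase b (y + (x - u))) =
      (gauss (2 * pi) (x - u) * gauss (2 * pi) (y + (x - u)))%:C%C *
      (gphase a (x - u) * gphase b (y + (x - u))) :> R[i].
    exact: creal_mulACA.
  rewrite gauss_shear.
  rewrite gphase_shear.
  have -> : 2 * (2 * pi) = 4 * pi :> R by rewrite mulrA -natrM.
  have -> : 2 * pi / 2 = pi :> R by rewrite mulrAC mulfV ?mul1r ?pnatr_eq0.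
  by rewrite -creal_mulACA.
exact: (cintegralZ (gint (4 * pi) (a + b)) (gint_integrable (2^-1 *: (b - a)) pi0)).
Qed.

Local Notation j := (gint (2 * pi)).
Definition gauss_mass : R := fine (\int[mu]_y (gauss (2 * pi) y)%:E)%E.
Local Notation J0 := gauss_mass.

Lemma p2_gt0 : 0 < 2 * pi :> R. Proof. by rewrite mulr_gt0 ?pi_gt0. Qed.

Lemma gint0 : j 0 = J0%:C%C.
Proof.
have g0 x : gphase 0 x = 1 by rewrite /gphase dotv0l mulr0 oppr0 expi0.
apply: complex_ext; rewrite /gint /cintegral.
  rewrite /gauss_mass /Rintegral; congr fine; apply: eq_integral => x _.
  by rewrite g0 mulr1.
rewrite [RHS]/= -[RHS]/(fine 0%E) /Rintegral; congr fine.
by apply: integral0_eq => x _; rewrite g0 mulr1.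
Qed.

Lemma gintN a : j (- a) = (j a)^*%C.
Proof.
rewrite /gint -cintegralJ; apply: eq_cintegral => x.
rewrite gphaseN conjcM; congr (_ * _).
by apply: complex_ext => //=; rewrite oppr0.
Qed.

Lemma unit_box_gt0 : (0 < mu [set x : G | K (iso x).2 /\ forall i, (-1 < (iso x).1 i 0 < 1)%R])%E /\
  open [set x : G | K (iso x).2 /\ forall i, (-1 < (iso x).1 i 0 < 1)%R].
Proof.
pose t0 := group_tiling S K_subgroup (unitmx1 R d) DP.
have -> : [set x : G | K (iso x).2 /\ forall i, (-1 < (iso x).1 i 0 < 1)%R] =
  [set x : G | stab t0 x /\ forall i, (-1 < crd t0 x i 0 < 1)%R].
  by apply/seteqP; split => x [Kx cx]; split => // i; have := cx i; rewrite /= invmx1 mul1mx.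
have o : open [set x : G | stab t0 x /\ forall i, (-1 < crd t0 x i 0 < 1)%R] by exact: coord_open.
split => //; have [_ _ pos] := mu_haar; apply: pos => //.
exists 0; split; first exact: stab0.
by move=> i; rewrite crd0 mxE; lra.
Qed.

Lemma J0_gt0 : 0 < J0.
Proof.
rewrite /gauss_mass; apply: fine_gt0; rewrite (gauss_integral_lty p2_gt0) andbT.
have [pos o] := unit_box_gt0; set U := (X in mu X) in pos o.
pose c : R := expR (- (2 * pi * d%:R)).
apply: (@lt_le_trans _ _ (c%:E * mu U)%E); first by rewrite mule_gt0// lte_fin expR_gt0.
have mU : measurable (U : set (borel G)) by exact: open_measurable_borel.
apply: (@cst_mul_measure_le_integral _ _ R mu c U _ mU) => [|x|x [Kx cx]]; rewrite lee_fin ?expR_ge0 ?gauss_ge0//.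
rewrite gaussK// ler_expR lerN2 ler_wpM2l ?(ltW p2_gt0)//.
rewrite /sq -[leRHS](_ : \sum_(i < d) 1 = _); last by rewrite sumr_const card_ord.
by apply: ler_sum => i _; have := cx i; nra.
Qed.

Lemma gint_le a : cmod (j a) <= J0.
Proof.
rewrite -lee_fin /gauss_mass fineK; last by rewrite ge0_fin_numE ?ge0_gauss_integral// gauss_integral_lty// p2_gt0.
apply: le_trans (le_cmod_cintegral mu (gint_measurable (2 * pi) a)) _.
apply: ge0_le_integral_nomeas => x; first by rewrite lee_fin cmod_ge0.
by rewrite cmodM cmod_gphase mulr1 cmod_cgauss.
Qed.

(* Where the phase is -1, a translate of the Gaussian cancels part of it. *)
Lemma gint_gap : exists2 dl : R, 0 < dl & forall a : 'cV[R]_d, 4^-1 <= dotv a a ->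
  cmod (j a) <= J0 - dl.
Proof.
have [pos o] := unit_box_gt0; set U := (X in mu X) in pos o.
have mU : measurable (U : set (borel G)) by exact: open_measurable_borel.
(* A lower bound for the Gaussian where all coordinates are at most 2 in modulus. This covers x in
   [U] and also x + u, the coordinates of u being at most 1. *)
pose c : R := expR (- (2 * pi * (4 * d%:R))).
have c0 : 0 < c by exact: expR_gt0.
have Jfin : (\int[mu]_y (gauss (2 * pi) y)%:E \is a fin_num)%E.
  by rewrite ge0_fin_numE ?ge0_gauss_integral// gauss_integral_lty// p2_gt0.
have cUfin : (mu U < +oo)%E.
  have := gauss_integral_lty p2_gt0.
  apply: contraTT; rewrite -!leNgt !leye_eq => /eqP Uoo.
  have : (c%:E * mu U <= \int[mu]_y (gauss (2 * pi) y)%:E)%E.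
    apply: (@cst_mul_measure_le_integral _ _ R mu c U _ mU) => [|x|x [Kx cx]]; rewrite ?lee_fin ?(ltW c0) ?gauss_ge0//.
    rewrite gaussK// ler_expR lerN2 ler_wpM2l ?(ltW p2_gt0)//.
    rewrite /sq mulr_natr -[leRHS](_ : \sum_(i < d) 4 = _); last by rewrite sumr_const card_ord.
    by apply: ler_sum => i _; have := cx i; nra.
  by rewrite Uoo gt0_muley ?lte_fin// leye_eq.
pose dl := c * fine (mu U).
have dl0 : 0 < dl by rewrite mulr_gt0// fine_gt0// pos.
exists dl => // a a4.
(* The scalar product of a and tv is 1/2, so the phase at u is -1. The squared length of tv is 1 /
   (4 |a|^2), which is at most 1 by the lower bound 1/4 on |a|^2. *)
pose tv := (2 * dotv a a)^-1 *: a; pose u := vec S tv.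
have aa0 : 0 < dotv a a by lra.
have phu : gphase a u = -1.
  rewrite /gphase iso_vec /= dotvZr (_ : 2 * pi * _ = pi); last by field; rewrite gt_eqF.
  by rewrite expiN expi_pi rmorphN rmorph1.
have t1 i : `|tv i 0| <= 1.
  rewrite -(@ler_pXn2r _ 2)// ?nnegrE// expr1n -normrX ger0_norm ?sqr_ge0//.
  apply: (@le_trans _ _ (dotv tv tv)).
    by rewrite /dotv (bigD1 i)//= -expr2 lerDl; apply: sumr_ge0 => k _; rewrite -expr2 sqr_ge0.
  rewrite dotvZl dotvZr mulrA.
  have -> : (2 * dotv a a)^-1 * (2 * dotv a a)^-1 * dotv a a = (4 * dotv a a)^-1.
    by field; rewrite gt_eqF.
  by rewrite invf_le1; lra.
pose g1 x := (gauss (2 * pi) x)%:C%C; pose g2 x := (gauss (2 * pi) (x + u))%:C%C.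
have mg2 : cmeasurable (g2 : borel G -> R[i]).
  apply: (cmeasurable_comp (fun y : borel G => (y + u : borel G)) (cmeasurable_cgauss (2 * pi))).
  exact: (measurable_shift (@group_shift_continuous G) u).
have mph : cmeasurable (gphase a : borel G -> R[i]).
  exact: (borel_map_cmeasurable (@borel_map_id G) (@gphase_continuous a)).
have ig2 : cintegrable mu (fun x => g2 x * gphase a x).
  split; first exact: cmeasurableM.
  under eq_integral do rewrite cmodM cmod_gphase mulr1 cmod_cgauss.
  by rewrite gauss_integral_shift; exact: gauss_integral_lty p2_gt0.
have jE : j a = - cintegral mu (fun x => g2 x * gphase a x).
  rewrite /gint -(cintegral_shift mu_haar (@group_shift_continuous G) u (gint_measurable (2 * pi) a)).
  rewrite -mulN1r -cintegralZ//; apply: eq_cintegral => x.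
  by rewrite gphaseD phu /g2; ring.
have j2 : j a + j a = cintegral mu (fun x => (g1 x - g2 x) * gphase a x).
  under eq_cintegral do rewrite mulrBl.
  rewrite cintegralB//; last exact: gint_integrable p2_gt0.
  by rewrite {2}jE.
have mind : measurable_fun [set: borel G] (fun x => (2 * c * \1_U x)%:E).
  by apply/measurable_EFinP; apply: measurable_funM => //; exact: measurable_indic.
have key : (\int[mu]_x (cmod ((g1 x - g2 x) * gphase a x))%:E + (2 * dl)%:E <=
    (2 * J0)%:E)%E.
  have -> : (2 * dl)%:E = (\int[mu]_x (2 * c * \1_U x)%:E)%E.
    under eq_integral do rewrite EFinM.
    rewrite ge0_integralZl//; last 2 first.
    - by apply/measurable_EFinP; exact: measurable_indic.
    - by rewrite lee_fin mulr_ge0// ltW.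
    rewrite integral_indic// setIT /dl mulrA EFinM fineK// ge0_fin_numE//.
  have mdiff : measurable_fun [set: borel G] (fun x => (cmod ((g1 x - g2 x) * gphase a x))%:E).
    apply: measurable_cmodE; apply: cmeasurableM => //; apply: cmeasurableB => //.
    exact: cmeasurable_cgauss.
  rewrite -ge0_integralD//; last 2 first.
  - by move=> x _; rewrite lee_fin cmod_ge0.
  - by move=> x _; rewrite lee_fin !mulr_ge0// ltW.
  have -> : (2 * J0)%:E = (\int[mu]_x ((gauss (2 * pi) x)%:E + (gauss (2 * pi) (x + u)%R)%:E))%E.
    rewrite ge0_integralD//; last 4 first.
    - by move=> x _; rewrite lee_fin gauss_ge0.
    - exact: measurable_gauss.
    - by move=> x _; rewrite lee_fin gauss_ge0.
    - by apply: (measurableT_comp (measurable_gauss (2 * pi))); exact: (measurable_shift (@group_shift_continuous G) u).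
    rewrite (gauss_integral_shift (2 * pi) u) -(fineK Jfin) -/gauss_mass.
    by rewrite -EFinD; congr EFin; move: J0 => y; ring.
  apply: ge0_le_integral_nomeas => x.
    by rewrite adde_ge0// lee_fin ?cmod_ge0// !mulr_ge0// ltW.
  rewrite -!EFinD lee_fin cmodM cmod_gphase mulr1 /g1 /g2 cmod_realB.
  have := gauss_ge0 (2 * pi) x; have := gauss_ge0 (2 * pi) (x + u).
  rewrite indicE; have [/set_mem [Kx cx]|_] := boolP (x \in U); last first.
    by move=> h1 h2; rewrite mulr0 -[0](mulr0 2); exact: dist_gap.
  have cle y : K (iso y).2 -> (forall i, `|(iso y).1 i 0| <= 2) -> c <= gauss (2 * pi) y.
    move=> Ky cy; rewrite gaussK// ler_expR lerN2 ler_wpM2l ?(ltW p2_gt0)//.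
    rewrite /sq mulr_natr -[leRHS](_ : \sum_(i < d) 4 = _); last by rewrite sumr_const card_ord.
    apply: ler_sum => i _; rewrite -(real_normK (num_real _)).
    by have := cy i; have := normr_ge0 ((iso y).1 i 0); nra.
  have h1 : c <= gauss (2 * pi) x.
    by apply: cle => // i; rewrite ler_norml; have := cx i; lra.
  have h2 : c <= gauss (2 * pi) (x + u).
    apply: cle; rewrite (isoD S) iso_vec/= ?addr0// => i; rewrite mxE.
    apply: le_trans (ler_normD _ _) _; have := t1 i.
    have : `|(iso x).1 i 0| <= 1 by rewrite ler_norml; have := cx i; lra.
    by lra.
  move=> _ _; rewrite mulr1.
  exact: dist_gap.
have : ((cmod (j a + j a))%:E + (2 * dl)%:E <= (2 * J0)%:E)%E.
  apply: le_trans key; rewrite j2 leeD2r//; apply: le_cmod_cintegral.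
  apply: cmeasurableM => //; apply: cmeasurableB => //; exact: cmeasurable_cgauss.
by rewrite -EFinD lee_fin cmodDD -mulrDr ler_pM2l// lerBrDr.
Qed.

(** Four instances of [gint_mul] share their right-hand factors. Eliminating these gives j(2a)
    j(0)^3 = j(a)^3 j(-a), and j(-a) is the conjugate of j(a). *)
Lemma gint_quartic a : cmod (j (2 *: a)) * J0 * (J0 * J0) =
  cmod (j a) * cmod (j a) * (cmod (j a) * cmod (j a)).
Proof.
have s1 : 2^-1 *: (0 - 2 *: a) = - a.
  by rewrite sub0r scalerN scalerA mulVf ?pnatr_eq0// scale1r.
have s2 : a + a = 2 *: a by rewrite -mulr2n scaler_nat.
have s3 : 2^-1 *: (- a - a) = - a.
  by rewrite -opprD s2 scalerN scalerA mulVf ?pnatr_eq0// scale1r.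
have e1 := gint_mul (2 *: a) 0; have e2 := gint_mul a a.
have e3 := gint_mul a (- a); have e4 := gint_mul 0 0.
rewrite addr0 s1 in e1; rewrite subrr scaler0 s2 in e2.
rewrite subrr s3 in e3; rewrite addr0 subr0 scaler0 in e4.
have cj0 : cmod (j 0) = J0.
  by rewrite gint0 cmod_real; apply: ger0_norm; apply: ltW; exact: J0_gt0.
have cjN : cmod (j (- a)) = cmod (j a) by rewrite gintN cmodJ.
rewrite -cj0 -[X in _ = _ * (_ * X)]cjN.
move: (j (2 *: a)) (j a) (j (- a)) (j 0) (gint (4 * pi) (2 *: a)) (gint pi (- a))
  (gint pi 0) (gint (4 * pi) 0) e1 e2 e3 e4 => z1 z2 z3 z4 z5 z6 z7 z8 e1 e2 e3 e4.
by rewrite -!cmodM e1 e2 e3 e4; congr cmod; ring.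
Qed.

(** For f = |j| / j(0) the quartic relation reads f(2a) = f(a)^4, matching |2a|^2 = 4 |a|^2. A bound
    rho < 1 for |a|^2 >= 1/4 gives the estimate on the shell 1/4 <= |a|^2 <= 1 with ep = - ln rho,
    and doubling propagates it outwards. No Gaussian integral is evaluated. *)
Lemma gint_decay : exists (C ep : R), [/\ 0 < C, 0 < ep &
  forall a : 'cV[R]_d, cmod (j a) <= C * expR (- (ep * dotv a a))].
Proof.
have [dl dl0 gap] := gint_gap; have J0p := J0_gt0.
have quart := gint_quartic; have jle := gint_le.
move: j J0 gap J0p quart jle => jj JJ gap J0p quart jle.
pose f a := cmod (jj a) / JJ.
have f0 a : 0 <= f a by rewrite divr_ge0 ?cmod_ge0 ?ltW.
have f1 a : f a <= 1 by rewrite ler_pdivrMr// mul1r.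
have f4 a : f (2 *: a) = f a ^+ 4.
  rewrite /f; move: (cmod (jj (2 *: a))) (cmod (jj a)) (quart a) => w1 w2 h.
  have h2 : w2 ^+ 4 = w1 * JJ * (JJ * JJ) by rewrite h; ring.
  by rewrite expr_div_n h2; field; rewrite gt_eqF.
have [rho [rho0 rho1 fr]] : exists rho, [/\ 0 < rho, rho < 1 & forall a, 4^-1 <= dotv a a -> f a <= rho].
  exists (Num.max (1 - dl / JJ) 2^-1); split.
  - by rewrite lt_max; apply/orP; right; lra.
  - rewrite gt_max; apply/andP; split; last by lra.
    by rewrite gtrBl divr_gt0.
  - move=> a h; rewrite le_max; apply/orP; left.
    by rewrite ler_pdivrMr// mulrBl mul1r divfK ?gt_eqF//; exact: gap.
pose ep := - ln rho; have ep0 : 0 < ep by rewrite oppr_gt0 ln_lt0// rho0.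
have rhoE : rho = expR (- ep) by rewrite opprK lnK.
have dec n : forall a, 4^-1 <= dotv a a -> dotv a a <= 4 ^+ n -> f a <= expR (- (ep * dotv a a)).
  elim: n => [|n IH] a h1 h2.
    apply: le_trans (fr a h1) _; rewrite rhoE ler_expR lerN2.
    by rewrite expr0 in h2; rewrite -[leRHS]mulr1 ler_wpM2l// ltW.
  have [h3|h3] := leP (dotv a a) 1.
    apply: le_trans (fr a h1) _; rewrite rhoE ler_expR lerN2.
    by rewrite -[leRHS]mulr1 ler_wpM2l// ltW.
  pose b := 2^-1 *: a.
  have bb : dotv b b = dotv a a / 4 by rewrite dotvZl dotvZr; field.
  have -> : a = 2 *: b by rewrite scalerA divff// scale1r.
  rewrite f4; apply: (@le_trans _ _ (expR (- (ep * dotv b b)) ^+ 4)).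
    apply: lerXn2r; rewrite ?nnegrE ?f0 ?expR_ge0//; apply: IH; rewrite bb; first by lra.
    by rewrite ler_pdivrMr// -exprSr.
  have -> : dotv (2 *: b) (2 *: b) = 4 * dotv b b by rewrite dotvZl dotvZr mulrA -natrM.
  by rewrite -expRM_natr mulNr -mulrA [X in - (_ * X)]mulrC.
(* The factor e^ep takes care of |a|^2 < 1/4, where only f <= 1 is known. *)
exists (JJ * expR ep), ep; split => //; first by rewrite mulr_gt0 ?expR_gt0.
move=> a; rewrite -mulrA -expRD -ler_pdivrMl// mulrC -/(f a).
have [h|h] := leP 4^-1 (dotv a a).
  have [n hn] : exists n, dotv a a <= 4 ^+ n.
    exists (Num.trunc (dotv a a)).+1.
    have /andP[_ h1] := truncn_itv (dotv_ge0 a); apply: le_trans (ltW h1) _.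
    by rewrite -natrX ler_nat; apply: ltnW; exact: ltn_expl.
  by apply: le_trans (dec n a h hn) _; rewrite ler_expR; lra.
apply: le_trans (f1 a) _; rewrite -[leLHS]expR0 ler_expR.
by have := dotv_ge0 a; nra.
Qed.

Local Notation dtor := (dual_tor S K).

Definition gauss_hat (xi : Gh) : R[i] :=
  cintegral mu (fun x => (gauss (2 * pi) x)%:C%C * (pairing xi x)^*%C).

Lemma pairing_conj_continuous (xi : Gh) : continuous ((fun x => (pairing xi x)^*%C) : G -> R[i]^o).
Proof.
exact: (continuousT_comp (@pairing_continuous R G xi) (@conjc_continuous R)).
Qed.

Lemma gauss_hat_measurable (xi : Gh) :
  cmeasurable ((fun x => (gauss (2 * pi) x)%:C%C * (pairing xi x)^*%C) : borel G -> R[i]).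
Proof.
by apply: cmeasurable_continuousM; [exact: cgauss_continuous|exact: pairing_conj_continuous].
Qed.

Lemma gauss_hat_dual_tor (xi : Gh) : dtor xi -> gauss_hat xi = j (freq S xi).
Proof.
move=> xid; apply: eq_cintegral => x.
have [Kx|Kx] := pselect (K (iso x).2); last by rewrite gauss_out// !mul0r.
by rewrite (pairing_dual_tor xid Kx) /gphase expiN.
Qed.

(** The Gaussian is invariant under translation by [tor S y] for y in [K], so its transform at xi
    equals itself times the conjugate of xi at [tor S y], a factor different from 1. *)
Lemma gauss_hat_out (xi : Gh) : ~ dtor xi -> gauss_hat xi = 0.
Proof.
move=> /existsNP[y /not_implyP[Ky xy]].
set z := pairing xi (tor S y) in xy.
have gt x : gauss (2 * pi) (x + tor S y) = gauss (2 * pi) x.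
  have e1 : (iso (x + tor S y)).1 = (iso x).1 by rewrite (isoD S) iso_tor /= addr0.
  have e2 : (iso (x + tor S y)).2 = (iso x).2 + y by rewrite (isoD S) iso_tor.
  have [Kx|Kx] := pselect (K (iso x).2).
    by rewrite !gaussK ?e2//; [rewrite !sqE e1|exact: K_add].
  rewrite !gauss_out// e2 => h; apply: Kx; rewrite -(addrK y (iso x).2); exact: K_sub.
have gint1 : cintegrable mu (fun x => (gauss (2 * pi) x)%:C%C * (pairing xi x)^*%C).
  split; first exact: gauss_hat_measurable.
  under eq_integral do rewrite cmodM cmodJ cmod_pairing mulr1 cmod_cgauss.
  exact: (gauss_integral_lty p2_gt0).
have : gauss_hat xi = z^*%C * gauss_hat xi.
  rewrite {1}/gauss_hat -(cintegral_shift mu_haar (@group_shift_continuous G) (tor S y) (gauss_hat_measurable xi)).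
  rewrite -(cintegralZ z^*%C gint1); apply: eq_cintegral => x.
  rewrite gt pairingDr conjcM -/z; set p := conjc (pairing xi x); set w := conjc z.
  by rewrite [p * w]mulrC mulrCA.
move/eqP; rewrite -[X in X == _]mul1r -subr_eq0 -mulrBl mulf_eq0 => /orP[|/eqP//].
rewrite subr_eq0 => /eqP z1; exfalso; apply: xy.
by rewrite -[LHS]conjcK -z1 conjc1.
Qed.

Local Notation phi := (fun x : G => (gauss pi x)%:C%C : R[i]).

Lemma gaussianE : gaussian iso K = phi.
Proof. by []. Qed.

(** Displacing the integration variable by half the Euclidean part of x separates the product of two
    Gaussians into one in the variable and one in x, by the shear with y = -x. *)
Lemma stft_gauss (x : G) (xi : Gh) : inner mu phi (tfshift (x, xi) phi) =
  (gauss (pi / 2) x)%:C%C * (pairing xi (vec S (2^-1 *: (iso x).1)))^*%C * gauss_hat xi.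
Proof.
pose u := vec S (2^-1 *: (iso (- x)).1).
have uE : vec S (2^-1 *: (iso x).1) = - u.
  by rewrite /u (isoN S) /= scalerN; apply/eqP; rewrite -addr_eq0 -vecD addrN vec0.
have gint1 : cintegrable mu (fun x => (gauss (2 * pi) x)%:C%C * (pairing xi x)^*%C).
  split; first exact: gauss_hat_measurable.
  under eq_integral do rewrite cmodM cmodJ cmod_pairing mulr1 cmod_cgauss.
  exact: (gauss_integral_lty p2_gt0).
rewrite /inner.
have mf : cmeasurable ((fun y => phi y * (tfshift (x, xi) phi y)^*%C) : borel G -> R[i]).
  apply: cmeasurableM; first exact: cmeasurable_cgauss.
  apply: cmeasurableJ; apply: cmeasurableM.
    exact: (borel_map_cmeasurable (@borel_map_id G) (@pairing_continuous R G xi)).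
  apply: (cmeasurable_comp (fun y : borel G => (y - x : borel G)) (cmeasurable_cgauss pi)).
  exact: (measurable_shift (@group_shift_continuous G) (- x)).
rewrite -(cintegral_shift mu_haar (@group_shift_continuous G) (- u) mf) -(cintegralZ _ gint1).
apply: eq_cintegral => s; rewrite uE /tfshift /modulation /translation /=.
have -> : s - u - x = - x + (s - u) by rewrite addrC.
rewrite !conjcM (_ : (((gauss pi (- x + (s - u)))%:C)^*)%C = (gauss pi (- x + (s - u)))%:C%C :> R[i]); last first.
  by apply: complex_ext => //=; rewrite oppr0.
set p := conjc (pairing xi (s - u)).
have pull (a b : R) : a%:C%C * (p * b%:C%C) = (a * b)%:C%C * p :> R[i].
  by rewrite [p * _]mulrC mulrA; congr (_ * _); apply: complex_ext => /=; ring.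
rewrite pull gauss_shear gaussN /p pairingDr conjcM.
have -> : (gauss (2 * pi) s * gauss (pi / 2) x)%:C%C =
   (gauss (pi / 2) x)%:C%C * (gauss (2 * pi) s)%:C%C :> R[i].
  by apply: complex_ext => /=; ring.
by rewrite [X in _ * X = _]mulrC mulrACA.
Qed.

Lemma cL2_gauss : cL2 mu phi.
Proof.
split; first exact: cmeasurable_cgauss.
apply/cLnorm2_ltyE; apply: le_lt_trans (gauss_integral_lty p2_gt0).
apply: ge0_le_integral_nomeas => x; first by rewrite lee_fin sqr_ge0.
rewrite cmod_cgauss; have [Kx|Kx] := pselect (K (iso x).2); last by rewrite !gauss_out// expr0n.
by rewrite !gaussK// -expRM_natl lee_fin ler_expR mulrN lerN2 mulrA.
Qed.

Section decay.
Context {A2 : 'M[R]_d} (A2_unit : A2 \in unitmx).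
Context {D2 : set (dual_group R G0)} (D2P : coset_representatives (annihilator K) D2).
Local Notation t2 := (dual_tiling S K_subgroup A2_unit D2P).
Local Notation t := (product_tiling t1 t2).
Variables (v : G * Gh -> R) (M : R).
Hypothesis v_gt0 : forall z, 0 < v z.
Hypothesis M_ge1 : 1 <= M.
Hypothesis v_growth : forall n z, cube t n z -> v z <= M ^+ n.+2.

Lemma stft_gauss_decaying :
  decaying t v (fun z => (cmod (inner mu phi (tfshift z phi)))%:E).
Proof.
have [C [ep [C0 ep0 jd]]] := gint_decay.
have [C1 C10 C1P] := sum_sqr_mulmx (invmx A); have [C2 C20 C2P] := sum_sqr_mulmx (invmx A2).
pose e1 := Num.min (pi / 2 / C1) (ep / C2).
have p20 : 0 < pi / 2 :> R by rewrite divr_gt0 ?pi_gt0.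
have e10 : 0 < e1 by rewrite lt_min (divr_gt0 p20 C10) (divr_gt0 ep0 C20).
have bd z : cmod (inner mu phi (tfshift z phi)) = gauss (pi / 2) z.1 * cmod (gauss_hat z.2).
  by case: z => x xi; rewrite stft_gauss !cmodM cmodJ cmod_pairing mulr1 cmod_cgauss.
apply: (@gaussian_decaying _ _ _ t v M v_gt0 M_ge1 v_growth _ C e1 (ltW C0) e10).
- move=> z h; rewrite bd; have [Kx xid] := h; case: z h Kx xid => x xi _ Kx xid; rewrite gaussK// (gauss_hat_dual_tor xid) lee_fin.
  apply: le_trans (ler_wpM2l (expR_ge0 _) (jd _)) _.
  rewrite mulrCA -expRD ler_wpM2l ?(ltW C0)// ler_expR -opprD lerN2.
  rewrite big_split_ord /=.
  under eq_bigr do rewrite col_mxEu. under [X in _ * (_ + X)]eq_bigr do rewrite col_mxEd.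
  rewrite mulrDr; apply: lerD.
    apply: (@le_trans _ _ (pi / 2 / C1 * (C1 * sq x))); last by rewrite mulrA divfK ?gt_eqF.
    apply: ler_pM; [exact: ltW|by apply: sumr_ge0 => i _; exact: sqr_ge0|by rewrite ge_min lexx|exact: C1P].
  apply: (@le_trans _ _ (ep / C2 * (C2 * dotv (freq S xi) (freq S xi)))); last by rewrite mulrA divfK ?gt_eqF.
  apply: ler_pM; [exact: ltW|by apply: sumr_ge0 => i _; exact: sqr_ge0|by rewrite ge_min lexx orbT|].
  by apply: le_trans (C2P _) _; rewrite ler_wpM2l ?(ltW C20)//; apply: ler_sum => i _; rewrite expr2.
- move=> z h; rewrite bd lee_fin; case: z h => x xi h; rewrite -[(x, xi).1]/x -[(x, xi).2]/xi.
  have [Kx|Kx] := pselect (K (iso x).2); last by rewrite gauss_out// mul0r.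
  have [xid|xid] := pselect (dtor xi); first by case: h.
  by rewrite gauss_hat_out// cmod0 mulr0.
Qed.

End decay.

End gaussians.

(** * Short-time Fourier transforms *)

Lemma integral_eqZl (dT : measure_display) (T : measurableType dT) (R : realType)
    (lam : {measure set T -> \bar R}) (c : R) (f F : T -> R) :
  0 <= c -> measurable_fun setT (EFin \o f) -> (forall x, 0 <= f x) ->
  (forall x, F x = c * f x) -> (\int[lam]_x (F x)%:E = c%:E * \int[lam]_x (f x)%:E)%E.
Proof.
move=> c0 mf f0 FE; rewrite -ge0_integralZl//.
  by apply: eq_integral => x _; rewrite FE EFinM.
by move=> x _; rewrite lee_fin.
Qed.

Section pair_projections.
Context {d1 d2 d3 : measure_display} {T1 : measurableType d1} {T2 : measurableType d2}
  {T3 : measurableType d3}.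

Lemma measurable_pair_fst : measurable_fun [set: (T1 * T2 * T3)%type] (fun p => (p.1.1, p.2)).
Proof. exact: (measurable_fun_pair (measurableT_comp measurable_fst measurable_fst) measurable_snd). Qed.

Lemma measurable_pair_snd : measurable_fun [set: (T1 * T2 * T3)%type] (fun p => (p.1.2, p.2)).
Proof. exact: (measurable_fun_pair (measurableT_comp measurable_snd measurable_fst) measurable_snd). Qed.

End pair_projections.

Section stft.
Context {R : realType} {G : lcaType}.
Local Notation Gh := (dual_group R G).
Local Notation Z := (borel G * borel Gh)%type.
Hypothesis sc : @second_countable G.
Variables (mu : {sigma_finite_measure set (borel G) -> \bar R})
  (nu : {sigma_finite_measure set (borel Gh) -> \bar R}).
Hypothesis mu_haar : is_haar (fun x y : G => x + y) mu.
Implicit Types (f g h k : G -> R[i]) (z w : G * Gh).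

Let shift (a : G) : continuous (fun x : G => x + a) := @group_shift_continuous G a.

Lemma measurable_sub : measurable_fun setT ((fun p : borel G * borel G => (p.2 : G) - p.1) : _ -> borel G).
Proof.
apply: borel_map_measurable_borel => V oV.
have cB : continuous (fun p : G * G => p.2 - p.1).
  have := continuousT_comp (continuous_pair (@snd_continuousT G G)
    (continuousT_comp (@fst_continuousT G G) (@opp_continuous G))) (@add_continuous G).
  exact.
have := open_measurable_prod sc (@borel_map_id G) (O := (fun p : G * G => p.2 - p.1) @^-1` V).
by apply; move/continuousP : cB; apply.
Qed.

Lemma cmeasurable_pairing : cmeasurable ((fun p : borel Gh * borel G => pairing (p.1 : Gh) (p.2 : G)) : _ -> R[i]).
Proof. exact: (cmeasurable_continuous_prod sc (@borel_map_id Gh) (@pairing_continuous2 R G)). Qed.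

Lemma cmeasurable_tfshift2 g : cmeasurable (g : borel G -> R[i]) ->
  cmeasurable ((fun p : Z * borel G => tfshift (p.1 : G * Gh) g p.2) : _ -> R[i]).
Proof.
move=> mg; rewrite /tfshift /modulation /translation; apply: cmeasurableM.
  exact: (cmeasurable_comp _ cmeasurable_pairing (@measurable_pair_snd _ _ _ (borel G) (borel Gh) (borel G))).
apply: (cmeasurable_comp (fun p : Z * borel G => (p.2 : G) - p.1.1 : borel G) mg).
have m1 : measurable_fun setT ((fun p : Z * borel G => (p.1.1, p.2)) : _ -> borel G * borel G).
  exact: (@measurable_pair_fst _ _ _ (borel G) (borel Gh) (borel G)).
exact: (measurableT_comp measurable_sub m1).
Qed.

Lemma cmeasurable_tfshift z g : cmeasurable (g : borel G -> R[i]) ->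
  cmeasurable (tfshift z g : borel G -> R[i]).
Proof.
move=> mg; apply: (cmeasurable_comp (fun y : borel G => ((z : Z), y)) (cmeasurable_tfshift2 mg)).
exact: pair1_measurable.
Qed.

Lemma cmeasurable_stft f g : cmeasurable (f : borel G -> R[i]) -> cmeasurable (g : borel G -> R[i]) ->
  cmeasurable ((fun z : Z => inner mu f (tfshift (z : G * Gh) g)) : _ -> R[i]).
Proof.
move=> mf mg; rewrite /inner.
apply: (@cmeasurable_cintegral _ _ _ _ R mu (fun p : Z * borel G => f p.2 * (tfshift (p.1 : G * Gh) g p.2)^*%C)).
apply: cmeasurableM; first exact: (cmeasurable_comp snd mf measurable_snd).
by apply: cmeasurableJ; exact: cmeasurable_tfshift2.
Qed.

Lemma cmod_tfshift z g y : cmod (tfshift z g y) = cmod (g (y - z.1)).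
Proof. by rewrite cmodM cmod_pairing mul1r. Qed.

Lemma cLnorm_tfshift z g : cmeasurable (g : borel G -> R[i]) ->
  cLnorm mu 2%:E (tfshift z g) = cLnorm mu 2%:E g.
Proof.
move=> mg; rewrite !cLnorm_square; congr (_ `^ _)%E.
under eq_integral do rewrite cmod_tfshift.
apply: (@ge0_integral_shift _ _ mu mu_haar shift (- z.1) (fun x => (cmod (g x) ^+ 2)%:E)).
  by apply/measurable_EFinP; apply: measurable_funX; exact: measurable_cmod.
by move=> x; rewrite lee_fin sqr_ge0.
Qed.

Lemma cL2_tfshift z g : cL2 mu g -> cL2 mu (tfshift z g).
Proof. by move=> [mg lg]; split; [exact: cmeasurable_tfshift|rewrite cLnorm_tfshift]. Qed.

(** Time-frequency shifts compose up to a phase, the constant [c] of the proof, which the modulus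
    removes. All later estimates are therefore made on moduli. *)
Lemma cmod_inner_tfshift z w f g : cL2 mu f -> cL2 mu g ->
  cmod (inner mu (tfshift w f) (tfshift z g)) = cmod (inner mu f (tfshift (z - w) g)).
Proof.
move=> Lf Lg; have [mf _] := Lf; have [mg _] := Lg; rewrite /inner.
have m1 : cmeasurable ((fun y => tfshift w f y * (tfshift z g y)^*%C) : borel G -> R[i]).
  by apply: cmeasurableM; [|apply: cmeasurableJ]; exact: cmeasurable_tfshift.
rewrite -(cintegral_shift mu_haar shift w.1 m1).
pose c := pairing w.2 w.1 * (pairing z.2 w.1)^*%C.
have c1 : cmod c = 1 by rewrite cmodM cmodJ !cmod_pairing mulr1.
have E : (fun y => tfshift w f (y + w.1) * (tfshift z g (y + w.1))^*%C) =
    (fun y => c * (f y * (tfshift (z - w) g y)^*%C)).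
  apply/funext => y; rewrite /tfshift /modulation /translation /= !pairingDr pairingBl !conjcM conjcK.
  by rewrite addrK (_ : y + w.1 - z.1 = y - (z.1 - w.1)) ?opprB ?addrA// /c; ring.
have int := cL2_cintegrable Lf (cL2_tfshift (z - w) Lg).
by rewrite E (cintegralZ c int) cmodM c1 mul1r.
Qed.

Lemma cmod_inner_sym f g : cmod (inner mu f g) = cmod (inner mu g f).
Proof. by rewrite innerJ cmodJ. Qed.

Lemma cmod_inner_tfshiftl z f g : cL2 mu f -> cL2 mu g ->
  cmod (inner mu (tfshift z f) g) = cmod (inner mu f (tfshift (- z) g)).
Proof.
move=> Lf Lg; have e : g = tfshift 0 g.
  by apply/funext => y; rewrite /tfshift /modulation /translation /= pairing0l mul1r subr0.
by rewrite {1}e cmod_inner_tfshift// sub0r.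
Qed.

Lemma cmod_stft_sym z f g : cL2 mu f -> cL2 mu g ->
  cmod (inner mu f (tfshift z g)) = cmod (inner mu g (tfshift (- z) f)).
Proof. by move=> Lf Lg; rewrite cmod_inner_sym cmod_inner_tfshiftl. Qed.

Hypothesis nu_dual : is_dual_haar mu nu.

(** The constant of the orthogonality relation. It takes the place of <g, h>, and
    [reflected_inner_shift] obtains it from an integral over y - x by a translation alone. *)
Definition reflected_inner g h : R[i] := cintegral mu (fun x => g (- x) * (h (- x))^*%C).

(** Continuity is what Fourier inversion asks for; boundedness and the square integrable reflection
    serve the two applications of Fubini's theorem. *)
Definition window g := [/\ continuous (g : G -> R[i]^o), cL2 mu g,
  cL2 mu (fun x => g (- x)) & exists B : R, forall x, cmod (g x) <= B].

(** At fixed x the short-time Fourier transform is the Fourier transform of [u], which is continuous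
    and integrable, so [nu_dual] applies. *)
Lemma stft_inversion f h x y : window f -> window h ->
  (\int[nu]_xi (cmod (inner mu f (tfshift (x, xi) h)))%:E < +oo)%E ->
  cintegral nu (fun xi : borel Gh => inner mu f (tfshift (x, xi : Gh) h) * pairing (xi : Gh) y) =
  f y * (h (y - x))^*%C.
Proof.
move=> [cf Lf _ _] [ch Lh _ _] fin; pose u t := f t * (h (t - x))^*%C.
have cu : continuous (u : G -> R[i]^o).
  have c1 := continuousT_comp (continuousT_comp (@shift (- x)) ch) (@conjc_continuous R).
  by move=> t; apply: cvgM; [exact: cf|exact: c1].
have E xi t : u t * (pairing xi t)^*%C = f t * (tfshift (x, xi) h t)^*%C.
  by rewrite /u /tfshift /modulation /translation conjcM -mulrA [X in _ * X]mulrC.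
have FE xi : cintegral mu (fun t => u t * (pairing xi t)^*%C) = inner mu f (tfshift (x, xi) h).
  by apply: eq_cintegral => t; rewrite E.
have := @nu_dual u cu; rewrite -/(u y) => ->.
- by apply: eq_cintegral => xi; rewrite FE.
- rewrite /cLnorm Lnorm1.
  have mh : cmeasurable (tfshift (x, 0) h : borel G -> R[i]).
    by apply: cmeasurable_tfshift; have [] := Lh.
  under eq_integral => t _ do rewrite gee0_abs ?lee_fin ?cmod_ge0// cmodM cmodJ EFinM.
  have := integral_cmodM mu (proj1 Lf) mh.
  under eq_integral => t _ do rewrite cmod_tfshift EFinM.
  move=> /le_lt_trans; apply; rewrite cLnorm_tfshift; last by have [] := Lh.
  apply: lte_mul_pinfty; rewrite ?Lnorm_ge0//; last by have [] := Lh.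
  by rewrite ge0_fin_numE ?Lnorm_ge0//; have [] := Lf.
- rewrite /cLnorm Lnorm1; apply: le_lt_trans fin; apply: ge0_le_integral_nomeas => xi //.
  by rewrite FE gee0_abs ?lee_fin ?cmod_ge0.
Qed.

Lemma reflected_inner_shift g h y : cL2 mu (fun x => g (- x)) -> cL2 mu (fun x => h (- x)) ->
  cintegral mu (fun x => g (y - x) * (h (y - x))^*%C) = reflected_inner g h.
Proof.
move=> Lg Lh; have [m1 _] := cL2_cintegrable Lg Lh.
rewrite /reflected_inner -(cintegral_shift mu_haar shift (- y) m1).
by apply: eq_cintegral => x; rewrite opprB.
Qed.

Lemma integral_cL2M f g : cL2 mu f -> cL2 mu g ->
  (\int[mu]_x (cmod (f x) * cmod (g x))%:E < +oo)%E.
Proof.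
move=> [mf Lf] [mg Lg]; apply: le_lt_trans (integral_cmodM mu mf mg) _.
by apply: lte_mul_pinfty; rewrite ?Lnorm_ge0// ge0_fin_numE ?Lnorm_ge0.
Qed.

(* Fourier inversion of t |-> f t * conj (h (t - x)), for each x, stands in
   for Plancherel's theorem. *)
Lemma stft_orthogonality f h g k : window f -> window h -> window g -> cL2 mu k ->
  (forall x, \int[nu]_xi (cmod (inner mu f (tfshift (x, xi) h)))%:E < +oo)%E ->
  cintegral mu (fun x => cintegral nu (fun xi =>
    inner mu f (tfshift (x, xi) h) * (inner mu k (tfshift (x, xi) g))^*%C)) =
  reflected_inner g h * inner mu f k.
Proof.
move=> Wf Wh Wg Lk fin; have [cf Lf Lf' [Bf fB]] := Wf; have [ch Lh Lh' [Bh hB]] := Wh.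
have [cg Lg Lg' [Bg gB]] := Wg; have [mk _] := Lk; have [mf _] := Lf.
have [mh _] := Lh; have [mg _] := Lg.
have inv x : cintegral nu (fun xi => inner mu f (tfshift (x, xi) h) * (inner mu k (tfshift (x, xi) g))^*%C) =
    cintegral mu (fun y => (f y * (k y)^*%C) * (g (y - x) * (h (y - x))^*%C)).
  pose V xi := inner mu f (tfshift (x, xi) h).
  pose F (p : borel Gh * borel G) := V p.1 * ((k p.2)^*%C * tfshift (x, (p.1 : Gh)) g p.2).
  have mx : measurable_fun setT ((fun xi : borel Gh => (x : borel G, xi)) : borel Gh -> Z).
    exact: pair1_measurable.
  have mV : cmeasurable (V : borel Gh -> R[i]).
    exact: (cmeasurable_comp (fun xi : borel Gh => (x : borel G, xi) : Z) (cmeasurable_stft mf mh)).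
  have mF : cmeasurable F.
    apply: cmeasurableM; first exact: (cmeasurable_comp fst mV).
    apply: cmeasurableM; first exact: (cmeasurable_comp snd (cmeasurableJ mk)).
    apply: (cmeasurable_comp (fun p : borel Gh * borel G => ((x : borel G, p.1) : Z, p.2)) (cmeasurable_tfshift2 mg)).
    exact: (measurable_fun_pair (measurableT_comp mx measurable_fst) measurable_snd).
  have Lgx z := cL2_tfshift z Lg.
  have cF xi y : cmod (F (xi, y)) = cmod (V xi) * (cmod (k y) * cmod (g (y - x))).
    rewrite /F [LHS]cmodM; congr (_ * _); rewrite [LHS]cmodM cmodJ.
    by congr (_ * _); exact: cmod_tfshift.
  have kg xi : (\int[mu]_y (cmod (F (xi, y)))%:E = (cmod (V xi))%:E *
      \int[mu]_y (cmod (k y) * cmod (tfshift (x, 0) g y))%:E)%E.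
    apply: integral_eqZl; first exact: cmod_ge0.
    - apply/measurable_EFinP; apply: measurable_funM; apply: measurable_cmod => //.
      exact: cmeasurable_tfshift.
    - by move=> y; rewrite mulr_ge0 ?cmod_ge0.
    - by move=> y; rewrite cF (cmod_tfshift (x, 0)).
  have I0 : (0 <= \int[mu]_y (cmod (k y) * cmod (tfshift (x, 0) g y))%:E)%E.
    by apply: integral_ge0 => y _; rewrite lee_fin mulr_ge0 ?cmod_ge0.
  have Ifin := integral_cL2M Lk (Lgx (x, 0)).
  transitivity (cintegral nu (fun xi => cintegral mu (fun y => F (xi, y)))).
    apply: eq_cintegral => xi.
    have kgi : cintegrable mu (fun y => (k y)^*%C * tfshift (x, xi) g y).
      have := cL2_cintegrable (Lgx (x, xi)) Lk; congr cintegrable.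
      by apply/funext => y; rewrite mulrC.
    rewrite -[RHS]/(cintegral mu (fun y => V xi * ((k y)^*%C * tfshift (x, xi) g y))).
    rewrite (cintegralZ (V xi) kgi) -/(V xi); congr (_ * _).
    rewrite /inner -cintegralJ; apply: eq_cintegral => y.
    by rewrite conjcM conjcK.
  rewrite (cintegral_fubini (m1 := nu) (m2 := mu) mF).
  - apply: eq_cintegral => y; rewrite /F.
    transitivity (cintegral nu (fun xi => (k y)^*%C * g (y - x) * (V xi * pairing xi y))).
      apply: eq_cintegral => xi; rewrite -[LHS]/(V xi * ((k y)^*%C * (pairing (xi : Gh) y * g (y - x)))).
      move: (V xi) (conjc (k y)) (pairing (xi : Gh) y) (g (y - x)) => a b c e; ring.
    have Vi : cintegrable nu (fun xi : borel Gh => V xi * pairing (xi : Gh) y).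
      split.
        apply: cmeasurableM => //.
        apply: (cmeasurable_comp (fun xi : borel Gh => (xi, y : borel G)) cmeasurable_pairing).
        exact: pair2_measurable.
      rewrite (_ : (\int[nu]_xi _)%E = (\int[nu]_xi (cmod (V xi))%:E)%E); first exact: fin.
      by apply: eq_integral => xi _; rewrite cmodM cmod_pairing mulr1.
    rewrite (cintegralZ _ Vi) (stft_inversion y Wf Wh (fin x)).
    move: (f y) (g (y - x)) (conjc (k y)) (conjc (h (y - x))) => a b c e; ring.
  - under eq_integral do rewrite kg.
    rewrite ge0_integralZr//.
    + by apply: lte_mul_pinfty => //; rewrite ?ge0_fin_numE ?integral_ge0 ?fin// => *; rewrite lee_fin cmod_ge0.
    + exact: measurable_cmodE.
    + by move=> xi _; rewrite lee_fin cmod_ge0.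
  - by move=> xi; rewrite kg; apply: lte_mul_pinfty; rewrite ?lee_fin ?cmod_ge0.
  - move=> y; rewrite (_ : (\int[nu]_xi _)%E = (cmod (k y) * cmod (g (y - x)))%:E *
        \int[nu]_xi (cmod (V xi))%:E)%E.
      by apply: lte_mul_pinfty; rewrite ?lee_fin ?mulr_ge0 ?cmod_ge0//; exact: fin.
    apply: integral_eqZl; first by rewrite mulr_ge0 ?cmod_ge0.
    + exact: measurable_cmodE.
    + by move=> xi; rewrite cmod_ge0.
    + by move=> xi; rewrite cF mulrC.
(* After inversion in xi the variables x and y both range over [G]. Integrating over x first
   produces the same constant [reflected_inner mu g h] for every y. *)
rewrite (eq_cintegral mu inv).
pose F (p : borel G * borel G) := (f p.2 * (k p.2)^*%C) *
  (g ((p.2 : G) - p.1) * (h ((p.2 : G) - p.1))^*%C).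
have mfk : cmeasurable ((fun y => f y * (k y)^*%C) : borel G -> R[i]).
  by apply: cmeasurableM => //; exact: cmeasurableJ.
have mgh : cmeasurable ((fun y => g y * (h y)^*%C) : borel G -> R[i]).
  by apply: cmeasurableM => //; exact: cmeasurableJ.
have mF : cmeasurable F.
  apply: cmeasurableM; first exact: (cmeasurable_comp snd mfk).
  exact: (cmeasurable_comp (fun p : borel G * borel G => (p.2 : G) - p.1 : borel G) mgh measurable_sub).
pose c := (\int[mu]_x (cmod (g (- x)) * cmod (h (- x)))%:E)%E.
have c0 : (0 <= c)%E by apply: integral_ge0 => x _; rewrite lee_fin mulr_ge0 ?cmod_ge0.
have cfin : (c < +oo)%E by exact: integral_cL2M Lg' Lh'.
have mr : measurable_fun [set: borel G] (fun x => (cmod (g (- x)) * cmod (h (- x)))%:E).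
  by apply/measurable_EFinP; apply: measurable_funM; apply: measurable_cmod; [have [] := Lg'|have [] := Lh'].
have cF x y : cmod (F (x, y)) =
    cmod (f y) * cmod (k y) * (cmod (g (y - x)) * cmod (h (y - x))).
  by rewrite /F [LHS]cmodM; congr (_ * _); rewrite [LHS]cmodM cmodJ.
have Fy y : (\int[mu]_x (cmod (F (x, y)))%:E = (cmod (f y) * cmod (k y))%:E * c)%E.
  rewrite /c -(@ge0_integral_shift _ _ mu mu_haar shift (- y) _ mr); last first.
    by move=> x; rewrite lee_fin mulr_ge0 ?cmod_ge0.
  apply: integral_eqZl; first by rewrite mulr_ge0 ?cmod_ge0.
  - exact: (measurableT_comp mr (measurable_shift shift (- y))).
  - by move=> x; rewrite mulr_ge0 ?cmod_ge0.
  - by move=> x; rewrite cF opprB.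
have mfk' : measurable_fun [set: borel G] (fun y => (cmod (f y) * cmod (k y))%:E).
  by apply/measurable_EFinP; apply: measurable_funM; exact: measurable_cmod.
have Ifk := integral_cL2M Lf Lk.
have Ifk0 : (0 <= \int[mu]_y (cmod (f y) * cmod (k y))%:E)%E.
  by apply: integral_ge0 => x _; rewrite lee_fin mulr_ge0 ?cmod_ge0.
transitivity (cintegral mu (fun y => cintegral mu (fun x => F (x, y)))).
  apply: (cintegral_fubini (m1 := mu) (m2 := mu) mF).
  - rewrite (@fubini_tonelli _ _ _ _ _ mu mu (fun p => (cmod (F p))%:E)).
    + under eq_integral do rewrite Fy.
      rewrite ge0_integralZr//; last by move=> y _; rewrite lee_fin mulr_ge0 ?cmod_ge0.
      by apply: lte_mul_pinfty => //; rewrite ge0_fin_numE.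
    + exact: measurable_cmodE.
    + by move=> p; rewrite lee_fin cmod_ge0.
  (* Finiteness for every single x is where the bounds on [f] and [h] enter. *)
  - move=> x; apply: (@le_lt_trans _ _ ((Bf * Bh)%:E * \int[mu]_y (cmod (k y) * cmod (tfshift (x, 0) g y))%:E)%E).
      have B0 : 0 <= Bf * Bh.
        by apply: mulr_ge0; [apply: le_trans (fB 0)|apply: le_trans (hB 0)]; exact: cmod_ge0.
      rewrite -ge0_integralZl ?lee_fin//; last 2 first.
      - apply/measurable_EFinP; apply: measurable_funM; apply: measurable_cmod => //.
        exact: cmeasurable_tfshift.
      - by move=> y _; rewrite lee_fin mulr_ge0 ?cmod_ge0.
      apply: ge0_le_integral_nomeas => y; first by rewrite lee_fin cmod_ge0.
      rewrite -EFinM lee_fin cF (cmod_tfshift (x, 0)).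
      have := fB y; have := hB (y - x); have := cmod_ge0 (f y); have := cmod_ge0 (h (y - x)).
      have := cmod_ge0 (k y); have := cmod_ge0 (g (y - x)).
      rewrite [(x, 0).1]/=.
      move: (cmod (f y)) (cmod (k y)) (cmod (g (y - x))) (cmod (h (y - x))) => a b r e r0 b0 e0 a0 eB aB.
      rewrite (_ : a * b * (r * e) = a * e * (b * r)); last by ring.
      by apply: ler_wpM2r; rewrite ?mulr_ge0//; apply: ler_pM.
    apply: lte_mul_pinfty; rewrite ?lee_fin//.
      by apply: mulr_ge0; [apply: le_trans (fB 0)|apply: le_trans (hB 0)]; exact: cmod_ge0.
    exact: integral_cL2M Lk (cL2_tfshift _ Lg).
  - by move=> y; rewrite Fy; apply: lte_mul_pinfty; rewrite ?lee_fin ?mulr_ge0 ?cmod_ge0.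
rewrite mulrC -(cintegralZr _ (cL2_cintegrable Lf Lk)); apply: eq_cintegral => y.
rewrite /F /= cintegralZ ?reflected_inner_shift//.
split.
  apply: (cmeasurable_comp (fun x : borel G => (y : G) - x : borel G) mgh).
  exact: (measurableT_comp measurable_sub (pair2_measurable (y : borel G))).
rewrite (_ : (\int[mu]_x _)%E = c)//.
rewrite /c -(@ge0_integral_shift _ _ mu mu_haar shift (- y) _ mr); last first.
  by move=> x; rewrite lee_fin mulr_ge0 ?cmod_ge0.
by apply: eq_integral => x _; rewrite cmodM cmodJ opprB.
Qed.

Lemma le_stft_orthogonality f h g k : window f -> window h -> window g -> cL2 mu k ->
  (forall x, \int[nu]_xi (cmod (inner mu f (tfshift (x, xi) h)))%:E < +oo)%E ->
  ((cmod (reflected_inner g h))%:E * (cmod (inner mu f k))%:E <=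
   \int[(mu \x nu)]_z ((cmod (inner mu f (tfshift z h)))%:E * (cmod (inner mu k (tfshift z g)))%:E))%E.
Proof.
move=> Wf Wh Wg Lk fin.
have [_ [mf _] _ _] := Wf; have [_ [mh _] _ _] := Wh; have [_ [mg _] _ _] := Wg; have [mk _] := Lk.
rewrite -EFinM -cmodM -(stft_orthogonality Wf Wh Wg Lk fin).
pose H (z : Z) := inner mu f (tfshift (z : G * Gh) h) * (inner mu k (tfshift (z : G * Gh) g))^*%C.
have mH : cmeasurable H.
  by apply: cmeasurableM; [|apply: cmeasurableJ]; exact: cmeasurable_stft.
apply: le_trans (le_cmod_cintegral mu (cmeasurable_cintegral nu mH)) _.
rewrite [leRHS](_ : _ = \int[(mu \x nu)]_z (cmod (H z))%:E)%E; last first.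
  by apply: eq_integral => z _; rewrite cmodM cmodJ EFinM.
rewrite (@fubini_tonelli1 _ _ _ _ _ mu nu).
- apply: ge0_le_integral_nomeas => x; first by rewrite lee_fin cmod_ge0.
  apply: le_cmod_cintegral.
  exact: (cmeasurable_comp (fun xi : borel Gh => (x : borel G, xi) : Z) mH (pair1_measurable _)).
- exact: measurable_cmodE.
- by move=> z; rewrite lee_fin cmod_ge0.
Qed.

End stft.

(** * Integrals and lattice sums *)

Section lattice_integrals.
Context {R : realType} {d1 d2 : nat} {X Y : PreTopologicalZmodule.type}.
Context (t1 : tiling R d1 X) (t2 : tiling R d2 Y).
Variables (mu : {sigma_finite_measure set (borel X) -> \bar R})
  (nu : {sigma_finite_measure set (borel Y) -> \bar R}).
Hypothesis mu_haar : is_haar (fun x y : X => x + y) mu.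
Hypothesis nu_haar : is_haar (fun x y : Y => x + y) nu.
Local Notation Z := (X * Y)%type.
Local Notation BZ := (borel X * borel Y)%type.
Local Notation t := (product_tiling t1 t2).
Local Notation L := (lattice t).
Local Open Scope ereal_scope.

Lemma integral_rnd (d : nat) (T : PreTopologicalZmodule.type) (t' : tiling R d T)
    (lam : {sigma_finite_measure set (borel T) -> \bar R}) (b : T -> \bar R) :
  is_haar (fun x y : T => x + y)%R lam -> (forall x, 0 <= b x) ->
  \int[lam]_x b (rnd t' x) = \esum_(w in lattice t') (b w * lam (cell t')).
Proof.
move=> haar b0.
rewrite -(integral_step haar 0%R b0 (measurable_cell t') (@subset_refl _ _)).
by apply: eq_integral => x _; rewrite subr0 indicE mem_set ?mule1//; exact: cell_rnd.
Qed.

(** The fibres of [rnd t] are countably many rectangles, so they are measurable for the product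
    sigma-algebra. *)
Lemma measurable_rnd_product {d'} {T' : measurableType d'} (f : Z -> T') :
  measurable_fun [set: BZ] (fun z : BZ => f (rnd t (z : Z))).
Proof.
move=> _ A mA; rewrite setTI.
have /countable_injP[f1 f1P] := countable_lattice t1 mu_haar.
have /countable_injP[f2 f2P] := countable_lattice t2 nu_haar.
pose S n k : set BZ := [set z | [/\ f1 (rnd t1 z.1) = n, f2 (rnd t2 z.2) = k & A (f (rnd t (z : Z)))]].
have -> : (fun z : BZ => f (rnd t (z : Z))) @^-1` A = \bigcup_n \bigcup_k S n k.
  apply/seteqP; split => [z Az|z [n _ [k _ []]]]//.
  by exists (f1 (rnd t1 z.1)) => //; exists (f2 (rnd t2 z.2)).
apply: bigcupT_measurable => n; apply: bigcupT_measurable => k.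
have [[z0 [zn zk zA]]|nS] := pselect (exists z, S n k z); last first.
  rewrite (_ : S n k = set0) ?measurable0//.
  by apply/seteqP; split => // z Sz; apply: nS; exists z.
rewrite (_ : S n k = [set x : borel X | f1 (rnd t1 x) = n] `*` [set y : borel Y | f2 (rnd t2 y) = k]).
  apply: measurableX.
    have := @measurable_rnd _ _ _ t1 mu mu_haar _ _ f1; move=> /(_ measurableT [set n]).
    by rewrite setTI; apply.
  have := @measurable_rnd _ _ _ t2 nu nu_haar _ _ f2; move=> /(_ measurableT [set k]).
  by rewrite setTI; apply.
apply/seteqP; split => [z []|z [/= zn' zk']]//; split => //.
suff -> : rnd t (z : Z) = rnd t (z0 : Z) by [].
rewrite !rnd_product; apply/pair_equal_spec; split.
  by apply: f1P; rewrite ?inE ?zn ?zn'//; exact: lattice_rnd.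
by apply: f2P; rewrite ?inE ?zk ?zk'//; exact: lattice_rnd.
Qed.

Lemma esum_lattice_product (a : Z -> \bar R) : (forall z, 0 <= a z) ->
  \esum_(x in lattice t1) \esum_(y in lattice t2) a (x, y) = \esum_(z in L) a z.
Proof.
move=> a0; rewrite esum_esum// lattice_product.
rewrite (_ : lattice t1 `*`` (fun=> lattice t2) = lattice t1 `*` lattice t2); last by apply/seteqP; split => z [].
by apply: eq_esum => -[].
Qed.

Lemma integral_rnd_product (a : Z -> \bar R) : (forall z, 0 <= a z) ->
  \int[(mu \x nu)]_z a (rnd t z) = mu (cell t1) * nu (cell t2) * \esum_(z in L) a z.
Proof.
move=> a0; rewrite (fubini_tonelli1 (m1 := mu) (m2 := nu))//; last exact: measurable_rnd_product.
rewrite /fubini_F.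
have s0 x : 0 <= \esum_(y in lattice t2) a (x, y) by apply: esum_ge0.
have c20 := ltW (cell_gt0 t2 nu_haar).
transitivity (\int[mu]_x (nu (cell t2) * \esum_(y in lattice t2) a (rnd t1 x, y))).
  apply: eq_integral => x _; rewrite -esumZl//.
  transitivity (\int[nu]_y a (rnd t1 x, rnd t2 y)).
    by apply: eq_integral => y _; rewrite rnd_product.
  rewrite (@integral_rnd _ _ t2 nu (fun y => a (rnd t1 x, y)) nu_haar)//.
  by apply: eq_esum => y _; rewrite muleC.
rewrite (@integral_rnd _ _ t1 mu (fun x => nu (cell t2) * \esum_(y in lattice t2) a (x, y)) mu_haar); last first.
  by move=> x; rewrite mule_ge0.
under eq_esum do rewrite muleC muleA.
rewrite esumZl//; last by rewrite mule_ge0// ltW// (cell_gt0 t1 mu_haar).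
by rewrite esum_lattice_product.
Qed.

Lemma integral_le_lattice : exists2 C : R, (0 < C)%R & forall Theta a : Z -> \bar R,
  (forall z, 0 <= Theta z) -> (forall z, 0 <= a z) -> (forall z, Theta z <= a (rnd t z)) ->
  \int[(mu \x nu)]_z Theta z <= C%:E * \esum_(z in L) a z.
Proof.
have f1 : mu (cell t1) \is a fin_num by rewrite ge0_fin_numE// cell_lty.
have f2 : nu (cell t2) \is a fin_num by rewrite ge0_fin_numE// cell_lty.
exists (fine (mu (cell t1)) * fine (nu (cell t2)))%R.
  by rewrite mulr_gt0// fine_gt0// ?cell_gt0 ?cell_lty.
move=> Theta a T0 a0 Ta; rewrite EFinM !fineK// -integral_rnd_product//.
exact: ge0_le_integral_nomeas.
Qed.

Lemma integral_product_shift (u : Z) (f : Z -> \bar R) : measurable_fun [set: BZ] f ->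
  (forall z, 0 <= f z) -> \int[(mu \x nu)]_z f (z + u)%R = \int[(mu \x nu)]_z f z.
Proof.
move=> mf f0.
have ms := measurable_product_shift t1 t2 u.
rewrite (@fubini_tonelli1 _ _ _ _ R mu nu (fun z : BZ => f (z + u)%R) (measurableT_comp mf ms) (fun z => f0 (z + u)%R)).
rewrite (@fubini_tonelli1 _ _ _ _ R mu nu f mf f0).
rewrite /fubini_F.
have mF : measurable_fun [set: borel X] (fun x => \int[nu]_y f (x, y)).
  by apply: (measurable_fun_fubini_tonelli_F (m2 := nu) (f : BZ -> _)).
rewrite -(@ge0_integral_shift _ _ mu mu_haar (@shift_continuous _ _ _ t1) u.1 _ mF); last first.
  by move=> x; apply: integral_ge0.
apply: eq_integral => x _.
apply: (@ge0_integral_shift _ _ nu nu_haar (@shift_continuous _ _ _ t2) u.2 (fun y => f ((x + u.1)%R, y))) => //.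
exact: (measurableT_comp mf (pair1_measurable (x + u.1 : borel X)%R)).
Qed.

Section weighted.
Variable v : Z -> R.
Hypothesis v_gt0 : forall x, (0 < v x)%R.
Hypothesis v_sub : forall x y, (v (x + y) <= v x * v y)%R.
Hypothesis v_even : forall x, v (- x)%R = v x.
Hypothesis v_cube : forall n, exists C, forall x, cube t n x -> (v x <= C)%R.

Lemma decaying_integral (Theta : Z -> \bar R) : (forall z, 0 <= Theta z) -> decaying t v Theta ->
  \int[(mu \x nu)]_z (Theta z * (v z)%:E) < +oo.
Proof.
move=> T0 kT; have [kappa [k0 kb kr]] := kT 1%N.
have [C C0 CP] := v_shift v_gt0 v_sub v_cube 1.
have [C' C'0 C'P] := integral_le_lattice.
have a0 w : 0 <= C%:E * (kappa w * (v w)%:E) by rewrite !mule_ge0 ?lee_fin// ltW.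
apply: le_lt_trans (C'P _ (fun w => C%:E * (kappa w * (v w)%:E)) _ a0 _) _.
- by move=> z; rewrite mule_ge0 ?lee_fin// ltW.
- move=> z; rewrite muleCA -EFinM.
  rewrite -[X in Theta X * _](subrK (rnd t z)) addrC.
  apply: lee_pmul => //; rewrite ?lee_fin ?(ltW (v_gt0 _))//.
    by apply: kb; [exact: lattice_rnd|exact: cube_sub_rnd].
  by rewrite -{1}(subrK (rnd t z) z) addrC; apply: CP; exact: cube_sub_rnd.
rewrite esumZl ?lee_fin ?(ltW C0)//; last by move=> w; rewrite mule_ge0 ?lee_fin// ltW.
rewrite muleA -EFinM; apply: lte_mul_pinfty => //; first by rewrite lee_fin mulr_ge0// ltW.
by apply: rapid_sum kr => w; rewrite mule_ge0 ?lee_fin// ltW.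
Qed.

(** A slice at fixed x is controlled by a single row of the lattice sum, and the lower bound on v
    removes the weight. Orthogonality relations ask for this at every x. *)
Lemma decaying_section (Theta : Z -> \bar R) (x : X) : (forall z, 0 <= Theta z) ->
  decaying t v Theta -> (exists2 c : R, (0 < c)%R & forall z, (c <= v z)%R) ->
  \int[nu]_y Theta (x, y) < +oo.
Proof.
move=> T0 kT [c c0 cv]; have [kappa [k0 kb kr]] := kT 1%N.
pose b y := kappa (rnd t1 x, y).
apply: (@le_lt_trans _ _ (\int[nu]_y b (rnd t2 y))).
  apply: ge0_le_integral_nomeas => // y.
  have -> : b (rnd t2 y) = kappa (rnd t (x, y)) by rewrite rnd_product.
  rewrite -[X in Theta X](subrK (rnd t (x, y))) addrC.
  by apply: kb; [exact: lattice_rnd|exact: cube_sub_rnd].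
rewrite (@integral_rnd _ _ t2 nu b nu_haar); last by move=> y; exact: k0.
under eq_esum do rewrite muleC.
rewrite esumZl ?ltW ?(cell_gt0 t2)//; last by move=> y; exact: k0.
apply: lte_mul_pinfty; first exact/ltW/(cell_gt0 t2).
  by rewrite ge0_fin_numE// cell_lty.
have v0 w : 0 <= kappa w * (v w)%:E by rewrite mule_ge0 ?lee_fin// ltW.
have s0 x' : 0 <= \esum_(y in lattice t2) (kappa (x', y) * (v (x', y))%:E) by apply: esum_ge0.
have := rapid_sum v0 kr; rewrite -esum_lattice_product// => fin.
have : \esum_(y in lattice t2) b y <= (c^-1)%:E *
    \esum_(x in lattice t1) \esum_(y in lattice t2) (kappa (x, y) * (v (x, y))%:E).
  apply: (@le_trans _ _ ((c^-1)%:E * \esum_(y in lattice t2) (kappa (rnd t1 x, y) * (v (rnd t1 x, y))%:E))).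
    rewrite -esumZl ?lee_fin ?invr_ge0 ?(ltW c0)//.
    apply: le_esum => y _; rewrite muleCA -[leLHS]mule1; apply: lee_wpmul2l; first exact: k0.
    by rewrite -EFinM lee_fin ler_pdivlMl// mulr1.
  apply: lee_wpmul2l; first by rewrite lee_fin invr_ge0 ltW.
  by apply: (esum_term s0); exact: lattice_rnd.
move=> /le_lt_trans; apply; apply: lte_mul_pinfty => //.
by rewrite lee_fin invr_ge0 ltW.
Qed.

(* A witness that 0 lies in a relatively compact set: X * Y is not assumed to be
   Hausdorff. *)
Variable P0 : set Z.
Hypotheses (P0_precompact : precompact P0) (P00 : P0 0%R).

(** This is [decaying_convolution] for p = q = +oo, the moderate weight 1/v and the sequence v,
    whose weighted norm is at most 1. *)
Lemma decaying_lattice_sum (Theta : Z -> \bar R) : (forall z, 0 <= Theta z) -> decaying t v Theta ->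
  exists2 C : R, (0 < C)%R & forall z,
  \esum_(w in L) (Theta (w - z)%R * (v w)%:E) <= (C * v z)%:E.
Proof.
move=> T0 kT.
have m0 z : (0 < (v z)^-1)%R by rewrite invr_gt0.
have mod : exists C, forall z w, ((v (z + w))^-1 <= C * v z * (v w)^-1)%R.
  exists 1%R => z w; rewrite mul1r ler_pdivlMr// mulrC ler_pdivrMr// mulrC.
  rewrite -{1}(addKr z w) addrC -(v_even z); apply: le_trans (v_sub _ _) _.
  by rewrite (addrC z) mulrC.
have [C C0 CP] := @decaying_convolution _ _ _ _ _ t1 t2 v v_gt0 v_sub v_even v_cube Theta P0
  (fun z => (v z)^-1)%R +oo +oo T0 kT P0_precompact m0 mod (ltry 0) (ltry 0).
have [C' C'0 C'P] := v_shift v_gt0 v_sub v_cube 1.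
have [a [a0 aP aC]] := CP (fun w => (v w)%:E) (fun w => ltW (v_gt0 w)).
have aw w : L w -> a w <= (C * v w)%:E.
  move=> Lw.
  have : a w * ((v w)^-1)%:E <= C%:E.
    apply: (@le_trans _ _ (lattice_norm t1 t2 +oo +oo (fun z => a z * ((v z)^-1)%:E))).
      rewrite /lattice_norm /=; move: Lw; rewrite lattice_product => -[L1w L2w].
      have aw0 z : 0 <= a z * ((v z)^-1)%:E by rewrite mule_ge0 ?lee_fin// ltW.
      apply: (@le_trans _ _ (ereal_sup [set `|a (x, w.2) * ((v (x, w.2))^-1)%:E| | x in lattice t1])).
        by apply: ereal_sup_ubound; exists w.1 => //; rewrite gee0_abs// -surjective_pairing.
      apply: le_trans (lee_abs _) _; apply: ereal_sup_ubound; by exists w.2.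
    apply: le_trans aC _; rewrite -[leRHS]mule1; apply: lee_wpmul2l; first by rewrite lee_fin ltW.
    apply: ge_ereal_sup => _ [y Ly <-]; rewrite gee0_abs; last by apply: lnorm_ge0 (lattice_neq0 t1).
    apply: ge_ereal_sup => _ [x Lx <-].
    by rewrite -EFinM divff ?gt_eqF// abse1.
  by rewrite lee_pdivrMr// -EFinM.
exists (C * C')%R; first by rewrite mulr_gt0.
move=> z.
have := aP (rnd t z) (z - rnd t z)%R 0%R (lattice_rnd t z) (cube_sub_rnd t z) P00.
rewrite addr0 (addrC (rnd t z)) subrK => /le_trans; apply.
apply: le_trans (aw _ (lattice_rnd t z)) _; rewrite lee_fin -mulrA ler_wpM2l ?(ltW C0)//.
rewrite (_ : rnd t z = z + - (z - rnd t z))%R; last by rewrite opprB addrC subrK.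
by apply: C'P; apply: cubeN; exact: cube_sub_rnd.
Qed.

End weighted.

End lattice_integrals.

(** * Frame expansions of functionals *)

Section countable_sums.
Context {dT : measure_display} {T : measurableType dT} {R : realType}.
Variable lam : {measure set T -> \bar R}.
Local Open Scope ereal_scope.

(** The enumeration depends on [A] alone, so that one series represents the sums of all the
    functions of a family and monotone convergence applies. *)
Lemma esum_nat {I : choiceType} (A : set I) : countable A ->
  exists e : nat -> option I, forall a : I -> \bar R, (forall i, 0 <= a i) ->
  \esum_(i in A) a i = \sum_(n <oo) (if e n is Some i then a i else 0).
Proof.
move=> /countable_injP[f fP].
pose e n := if pselect (exists i, A i /\ f i = n) is left h then Some (projT1 (cid h)) else None.
have eP i : A i -> e (f i) = Some i.
  move=> Ai; rewrite /e; case: pselect => [h|[]]; last by exists i.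
  by congr Some; have [Aj fj] := projT2 (cid h); apply: fP; rewrite ?inE.
exists e => a a0.
have e0 n : 0 <= (if e n is Some i then a i else 0) by case: (e n).
rewrite nneseries_esumT//.
rewrite (@esumID _ _ (f @` A))// setTI [X in _ + X]esum1 ?adde0; last first.
  move=> n [_ nA]; rewrite /e; case: pselect => // -[i [Ai fi]]; exfalso; apply: nA.
  by exists i.
rewrite (@reindex_esum _ _ _ A (f @` A) f) //.
- by apply: eq_esum => i Ai; rewrite eP.
- split; [by move=> i Ai; exists i|by move=> i j Ai Aj; exact: fP|by move=> n [i Ai <-]; exists i].
Qed.

Lemma integral_esum {I : choiceType} (A : set I) (f : I -> T -> \bar R) : countable A ->
  (forall i, measurable_fun setT (f i)) -> (forall i x, 0 <= f i x) ->
  \int[lam]_x (\esum_(i in A) f i x) = \esum_(i in A) (\int[lam]_x f i x).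
Proof.
move=> cA mf f0; have [e eP] := esum_nat cA.
rewrite eP; last by move=> i; apply: integral_ge0.
under eq_integral do rewrite (eP (fun i => f i _))//.
rewrite integral_nneseries//.
- apply: eq_eseriesr => n _; case: (e n) => // .
  by rewrite integral0.
- by move=> n; case: (e n).
- by move=> n x _; case: (e n).
Qed.

Lemma measurable_esum {I : choiceType} (A : set I) (f : I -> T -> \bar R) : countable A ->
  (forall i, measurable_fun setT (f i)) -> (forall i x, 0 <= f i x) ->
  measurable_fun setT (fun x => \esum_(i in A) f i x).
Proof.
move=> cA mf f0; have [e eP] := esum_nat cA.
under eq_fun do rewrite (eP (fun i => f i _))//.
apply: ge0_emeasurable_sum => [n x _ _|n _]; first by case: (e n).
by case: (e n) => // i; exact: mf.
Qed.

Lemma countable_negligible {I : choiceType} (A : set I) (N : I -> set T) : countable A ->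
  (forall i, A i -> lam.-negligible (N i)) -> lam.-negligible (\bigcup_(i in A) N i).
Proof.
move=> /countable_injP[f fP] nN.
have -> : \bigcup_(i in A) N i = \bigcup_n \bigcup_(i in A `&` [set i | f i = n]) N i.
  apply/seteqP; split => [x [i Ai Nx]|x [n _ [i [Ai _] Nx]]]; last by exists i.
  by exists (f i) => //; exists i.
apply: negligible_bigcup => n.
have [[i [Ai fi]]|nw] := pselect (exists i, A i /\ f i = n); last first.
  rewrite (_ : _ `&` _ = set0) ?bigcup_set0; first exact: negligible_set0.
  by apply/seteqP; split => // i [Ai fi]; apply: nw; exists i.
rewrite (_ : _ `&` _ = [set i]) ?bigcup_set1; first exact: nN.
apply/seteqP; split => [j [Aj fj]|_ ->]//.
by apply: fP; rewrite ?inE// fj.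
Qed.

End countable_sums.

Lemma lte_lin_pinfty (R : realType) (c : R) (a b : \bar R) : 0 <= c -> (0 <= a)%E ->
  (a < +oo)%E -> (b < +oo)%E -> (c%:E * a + b < +oo)%E.
Proof. by move=> c0 a0 af bf; apply: lte_add_pinfty => //; apply: lte_mul_pinfty. Qed.

Section product_integrals.
Context {R : realType} {X Y : PreTopologicalZmodule.type}.
Variables (mu : {sigma_finite_measure set (borel X) -> \bar R})
  (nu : {sigma_finite_measure set (borel Y) -> \bar R}).
Local Notation Z := (X * Y)%type.
Local Open Scope ereal_scope.

Lemma le_phase_integral (f g : Z -> \bar R) : (forall z, 0 <= f z) -> (forall z, f z <= g z) ->
  \int[(mu \x nu)]_z f z <= \int[(mu \x nu)]_z g z.
Proof. by move=> f0 fg; exact: ge0_le_integral_nomeas. Qed.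

Lemma eq_phase_integral (f g : Z -> \bar R) : (forall z, f z = g z) ->
  \int[(mu \x nu)]_z f z = \int[(mu \x nu)]_z g z.
Proof. by move=> fg; apply: eq_integral => z _; exact: fg. Qed.

Lemma measurable_phaseM (f g : Z -> \bar R) :
  measurable_fun [set: (borel X * borel Y)%type] f -> measurable_fun [set: (borel X * borel Y)%type] g ->
  measurable_fun [set: (borel X * borel Y)%type] (fun z => f z * g z).
Proof. exact: emeasurable_funM. Qed.

End product_integrals.

Section gabor.
Context {R : realType} {G : lcaType} {d1 d2 : nat}.
Local Notation Gh := (dual_group R G).
Local Notation Z := (G * Gh)%type.
Local Notation BZ := (borel G * borel Gh)%type.
Context (t1 : tiling R d1 G) (t2 : tiling R d2 Gh).
Local Notation t := (product_tiling t1 t2).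
Local Notation L := (lattice t).
Hypothesis sc : @second_countable G.
Variables (mu : {sigma_finite_measure set (borel G) -> \bar R})
  (nu : {sigma_finite_measure set (borel Gh) -> \bar R}).
Hypothesis mu_haar : is_haar (fun x y : G => x + y) mu.
Hypothesis nu_haar : is_haar (fun x y : Gh => x + y) nu.
Implicit Types (f g h k : G -> R[i]) (z w : Z).

(** The modulus of the short-time Fourier transform of an L^2 function, an extended real for use in
    integrals and lattice sums. *)
Definition amb f g z : \bar R := (cmod (inner mu f (tfshift z g)))%:E.

Lemma amb_ge0 f g z : (0 <= amb f g z)%E. Proof. by rewrite lee_fin cmod_ge0. Qed.

Lemma amb_sym f g z : cL2 mu f -> cL2 mu g -> amb f g z = amb g f (- z).
Proof. by move=> Lf Lg; rewrite /amb (cmod_stft_sym sc mu_haar). Qed.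

Lemma amb_tfshift w f g z : cL2 mu f -> cL2 mu g -> amb (tfshift w f) g z = amb f g (z - w).
Proof. by move=> Lf Lg; rewrite /amb (cmod_inner_tfshift sc mu_haar). Qed.

Lemma cmod_innerZr (c : R[i]) f g : cL2 mu f -> cL2 mu g ->
  cmod (inner mu f (fun x => c * g x)) = cmod c * cmod (inner mu f g).
Proof.
by move=> Lf Lg; rewrite cmod_inner_sym innerZl// cmodM [X in _ * X]cmod_inner_sym.
Qed.

Lemma measurable_amb f g : cL2 mu f -> cL2 mu g -> measurable_fun [set: BZ] (amb f g).
Proof. by move=> [mf _] [mg _]; apply: measurable_cmodE; exact: cmeasurable_stft. Qed.

Lemma window_tfshift w g : window mu g -> window mu (tfshift w g).
Proof.
move=> [cg Lg Lg' [B gB]]; split.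
- have c1 := continuousT_comp (@group_shift_continuous G (- w.1)) cg.
  by move=> x; apply: cvgM; [exact: pairing_continuous|exact: c1].
- exact: (cL2_tfshift sc mu_haar).
- have := cL2_tfshift sc mu_haar (- w) Lg'; congr cL2; apply/funext => x.
  by rewrite /tfshift /modulation /translation /= pairingNl pairingNr opprD !opprK.
- by exists B => x; rewrite cmod_tfshift.
Qed.

Lemma window_sum (I : Type) (s : seq I) (c : I -> R[i]) (F : I -> G -> R[i]) :
  (forall i, window mu (F i)) -> window mu (fun x => \sum_(i <- s) c i * F i x).
Proof.
move=> WF; split.
- elim: s => [|i s IH] x; first by under eq_fun do rewrite big_nil; exact: cvg_cst.
  rewrite (_ : (fun x => \sum_(i <- i :: s) c i * F i x) =
      fun x => c i * F i x + \sum_(i <- s) c i * F i x); last first.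
    by apply/funext => y; rewrite big_cons.
  apply: cvgD; last exact: IH.
  by apply: cvgM; [exact: cvg_cst|have [cF _ _ _] := WF i; exact: cF].
- by apply: cL2_sum => i; apply: cL2Z; have [] := WF i.
- by apply: cL2_sum => i; apply: cL2Z; have [] := WF i.
- elim: s => [|i s [B IH]]; first by exists 0 => x; rewrite big_nil cmod0.
  have [_ _ _ [B' FB]] := WF i; exists (cmod (c i) * B' + B) => x.
  rewrite big_cons; apply: le_trans (cmodD _ _) _; apply: lerD; last exact: IH.
  by rewrite cmodM ler_wpM2l ?cmod_ge0.
Qed.

Lemma window_span phi g : window mu phi -> gabor_span phi g -> window mu g.
Proof.
move=> Wp [s gE]; rewrite (_ : g = fun x => \sum_(a <- s) a.1 * tfshift a.2 phi x); last exact/funext.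
by apply: window_sum => a; exact: window_tfshift.
Qed.

(** Enlarge [W] by a finite set beyond which the error is at most e: the added terms lie outside
    [W], and e is arbitrary. *)
Lemma cmod_sub_sum_le (a : Z -> R[i]) (A : R[i]) (W : {fset Z}) : [set` W] `<=` L ->
  (forall e : R, 0 < e -> exists W0 : {fset Z}, [set` W0] `<=` L /\
    forall W' : {fset Z}, [set` W0] `<=` [set` W'] -> [set` W'] `<=` L ->
    cmod (A - \sum_(w <- W') a w) <= e) ->
  ((cmod (A - \sum_(w <- W) a w))%:E <=
   \esum_(w in L) (if w \in W then 0 else (cmod (a w))%:E))%E.
Proof.
move=> WL H; apply/lee_addgt0Pr => e e0.
have [W0 [W0L S0]] := H _ e0.
pose W' := (W0 `|` W)%fset.
have W'L : [set` W'] `<=` L by move=> w /=; rewrite inE => /orP[/W0L|/WL].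
have W'0 : [set` W0] `<=` [set` W'] by move=> w /= ww; rewrite inE ww.
have {}S0 := S0 W' W'0 W'L.
have E : A - \sum_(w <- W) a w = (A - \sum_(w <- W') a w) + \sum_(w <- (W' `\` W)%fset) a w.
  have -> : \sum_(w <- W') a w = \sum_(w <- W) a w + \sum_(w <- (W' `\` W)%fset) a w.
    rewrite (big_fsetID _ (mem W)) /=; congr (_ + _); apply: eq_fbigl => w.
      rewrite !inE /=; case: (w \in W); rewrite ?orbT ?andbF//.
    by rewrite !inE /= andbC.
  by rewrite opprD addrA addrNK.
rewrite E addeC; apply: le_trans (_ : (e + \sum_(w <- (W' `\` W)%fset) cmod (a w))%:E <= _)%E.
  by rewrite lee_fin; apply: le_trans (cmodD _ _) _; apply: lerD => //; exact: cmod_sum.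
rewrite EFinD leeD2l// -sumEFin.
apply: esum_ge; exists [set` (W' `\` W)%fset].
  by split => // w /=; rewrite inE => /andP[_]; exact: W'L.
rewrite fsbig_finite//= set_fsetK big_seq [leRHS]big_seq.
by apply: lee_sum => w; rewrite inE => /andP[/negbTE -> _].
Qed.

(** Testing against k, by Cauchy-Schwarz, turns the L^2 expansion into a scalar inequality. The
    frame identity enters all later arguments in this form. *)
Lemma inner_le_frame h g f k (W : {fset Z}) : cL2 mu h -> cL2 mu g -> cL2 mu f -> cL2 mu k ->
  frame_operator mu L h g f f -> [set` W] `<=` L ->
  ((cmod (inner mu (fun x => f x - \sum_(w <- W) inner mu f (tfshift w g) * tfshift w h x) k))%:E <=
   \esum_(w in L) (if w \in W then 0 else amb f g w * (cmod (inner mu (tfshift w h) k))%:E))%E.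
Proof.
move=> Lh Lg Lf Lk S WL.
pose c w := inner mu f (tfshift w g).
have Lhw w : cL2 mu (tfshift w h) by exact: (cL2_tfshift sc mu_haar).
have Lsum (s : seq Z) : cL2 mu (fun x => \sum_(w <- s) c w * tfshift w h x).
  by apply: cL2_sum => w; exact: cL2Z.
have E (V : {fset Z}) : inner mu (fun x => f x - \sum_(w <- V) c w * tfshift w h x) k =
    inner mu f k - \sum_(w <- V) c w * inner mu (tfshift w h) k.
  by rewrite innerBl// inner_suml.
rewrite E; apply: le_trans (cmod_sub_sum_le WL _) _; last first.
  by apply: le_esum => w _; case: ifP => // _; rewrite cmodM EFinM.
move=> e e0; have Nk : cLnorm mu 2%:E k \is a fin_num.
  by rewrite ge0_fin_numE ?Lnorm_ge0//; have [] := Lk.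
pose nk := fine (cLnorm mu 2%:E k).
have nk0 : 0 <= nk by rewrite fine_ge0// Lnorm_ge0.
have e1 : 0 < e / (nk + 1) by rewrite divr_gt0//; lra.
have [W0 [W0L S0]] := S _ e1; exists W0; split => // W' WW' W'L.
have {S0} := S0 W' WW' W'L; rewrite -/c => S0.
rewrite -E -lee_fin; have [mr _] := cL2B Lf (Lsum W'); have [mk _] := Lk.
apply: le_trans (le_inner mu mr mk) _.
apply: (@le_trans _ _ ((e / (nk + 1))%:E * cLnorm mu 2%:E k)%E).
  by apply: lee_wpmul2r; [exact: Lnorm_ge0|exact: ltW].
by rewrite -(fineK Nk) -EFinM lee_fin -/nk mulrAC ler_pdivrMr ?ler_wpM2l ?ltW//; lra.
Qed.

Variable v : Z -> R.
Hypothesis v_meas : measurable_fun [set: BZ] v.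
Hypothesis v_gt0 : forall x, 0 < v x.
Hypothesis v_sub : forall x y, v (x + y) <= v x * v y.
Hypothesis v_even : forall x, v (- x) = v x.
Hypothesis v_low : exists2 c : R, 0 < c & forall z, c <= v z.
Hypothesis v_cube : forall n, exists C, forall x, cube t n x -> v x <= C.
Variable P0 : set Z.
Hypotheses (P0_precompact : precompact P0) (P00 : P0 0).
Variable phi : G -> R[i].
Hypothesis phi_window : window mu phi.
Hypothesis phi_decaying : decaying t v (amb phi phi).
Hypothesis phi_reflected : reflected_inner mu phi phi != 0.
Hypothesis nu_dual : is_dual_haar mu nu.
Local Notation tnorm := (test_norm mu nu phi v).

Let phi_L2 : cL2 mu phi. Proof. by have [] := phi_window. Qed.

Lemma test_normE f : tnorm f = (\int[(mu \x nu)]_z (amb f phi z * (v z)%:E))%E.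
Proof.
rewrite /test_norm Lnorm1; apply: eq_phase_integral => z.
by rewrite gee0_abs ?EFinM// lee_fin mulr_ge0 ?cmod_ge0// ltW.
Qed.

(** A translation of phase space moves the shift from the ambiguity function into the weight, where
    submultiplicativity extracts [v w]. *)
Lemma test_norm_tfshift h : cL2 mu h -> decaying t v (amb h phi) ->
  exists2 C : R, 0 < C & forall w, (tnorm (tfshift w h) <= (C * v w)%:E)%E.
Proof.
move=> Lh kh; have fin := decaying_integral mu_haar nu_haar v_gt0 v_sub v_cube (amb_ge0 h phi) kh.
have fin0 : (0 <= \int[(mu \x nu)]_z (amb h phi z * (v z)%:E))%E.
  by apply: integral_ge0 => z _; rewrite mule_ge0 ?amb_ge0// lee_fin ltW.
exists (fine (\int[(mu \x nu)]_z (amb h phi z * (v z)%:E)) + 1)%R.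
  by rewrite ltr_wpDl// fine_ge0.
move=> w; rewrite test_normE.
have ms := measurable_product_shift t1 t2.
have mv : measurable_fun [set: BZ] (fun z => (v z)%:E) by exact/measurable_EFinP.
rewrite -(integral_product_shift t1 t2 mu_haar nu_haar w); last 2 first.
- apply: measurable_phaseM => //; apply: measurable_amb => //.
  exact: (cL2_tfshift sc mu_haar).
- by move=> z; rewrite mule_ge0 ?amb_ge0// lee_fin ltW.
apply: (@le_trans _ _ (\int[(mu \x nu)]_z ((v w)%:E * (amb h phi z * (v z)%:E)))%E).
  apply: le_phase_integral => z; first by rewrite mule_ge0 ?amb_ge0// lee_fin ltW.
  rewrite amb_tfshift// addrK muleCA; apply: lee_wpmul2l; first exact: amb_ge0.
  by rewrite -EFinM lee_fin mulrC.
rewrite ge0_integralZl//; last 3 first.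
- by apply: measurable_phaseM => //; exact: measurable_amb.
- by move=> z _; rewrite mule_ge0 ?amb_ge0// lee_fin ltW.
- by rewrite lee_fin ltW.
rewrite muleC EFinM; apply: lee_wpmul2r; first by rewrite lee_fin ltW.
by rewrite EFinD fineK ?leeDl// ge0_fin_numE.
Qed.

Lemma amb_section f g x : cL2 mu f -> cL2 mu g -> decaying t v (amb f g) ->
  (\int[nu]_xi amb f g (x, xi) < +oo)%E.
Proof. by move=> Lf Lg k; exact: (@decaying_section _ _ _ _ _ t1 t2 nu nu_haar v v_gt0 (amb f g) x (amb_ge0 f g) k v_low). Qed.

Lemma decaying_tfshift w f g : cL2 mu f -> cL2 mu g -> decaying t v (amb f g) ->
  decaying t v (amb (tfshift w f) g).
Proof.
move=> Lf Lg k; have := decaying_shift v_gt0 v_sub v_even v_cube (- w) (amb_ge0 f g) k.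
by congr decaying; apply/funext => z; rewrite amb_tfshift.
Qed.

(** Orthogonality bounds the sample at w by the average of |V_phi k| against |V_phi phi (z - w)|;
    summed over w with the weight, these kernels amount to at most C v z. This makes single Gabor
    terms continuous on the test space and the pairing with a test function absolutely
    convergent. *)
Lemma test_norm_sampling : exists2 C : R, 0 < C & forall k, cL2 mu k ->
  (\esum_(w in L) (amb k phi w * (v w)%:E) <= C%:E * tnorm k)%E.
Proof.
have [C C0 CP] := decaying_lattice_sum v_gt0 v_sub v_even v_cube P0_precompact P00
  (amb_ge0 phi phi) phi_decaying.
pose kp := cmod (reflected_inner mu phi phi).
have kp0 : 0 < kp by rewrite lt0r cmod_ge0 cmod_eq0 phi_reflected.
exists (C / kp); first by rewrite divr_gt0.
move=> k Lk.
have mk := measurable_amb Lk phi_L2; have mp := measurable_amb phi_L2 phi_L2.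
have ms := measurable_product_shift t1 t2.
have mps w : measurable_fun [set: BZ] (fun z : BZ => amb phi phi ((z : Z) - w)%R).
  exact: (measurableT_comp mp (ms (- w))).
have key w : (kp%:E * amb k phi w <=
    \int[(mu \x nu)]_z (amb phi phi (z - w)%R * amb k phi z))%E.
  rewrite /amb cmod_inner_sym.
  have fin x : (\int[nu]_xi amb (tfshift w phi) phi (x, xi) < +oo)%E.
    by apply: amb_section => //; [exact: (cL2_tfshift sc mu_haar)|exact: decaying_tfshift].
  apply: le_trans (le_stft_orthogonality sc mu_haar nu_dual (window_tfshift w phi_window)
    phi_window phi_window Lk fin) _.
  apply: le_phase_integral => z; first by rewrite mule_ge0 ?lee_fin ?cmod_ge0.
  by rewrite (cmod_inner_tfshift sc mu_haar).
apply: ge_ereal_sup => _ [X [finX XL] <-].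
rewrite mulrC EFinM -muleA lee_pdivlMl//.
rewrite ge0_mule_fsumr; last by move=> w; rewrite mule_ge0 ?amb_ge0// lee_fin ltW.
apply: (@le_trans _ _ (\sum_(w \in X) \int[(mu \x nu)]_z ((v w)%:E * (amb phi phi (z - w)%R * amb k phi z)))%E).
  apply: lee_fsum => // w _; rewrite ge0_integralZl//; last 3 first.
  - exact: measurable_phaseM.
  - by move=> z _; rewrite mule_ge0 ?amb_ge0.
  - by rewrite lee_fin ltW.
  by rewrite muleA muleC; apply: lee_wpmul2l; [rewrite lee_fin ltW|exact: key].
rewrite -ge0_integral_fsum//; last 2 first.
- by move=> w; apply: measurable_phaseM => //; exact: measurable_phaseM.
- by move=> w z _; rewrite !mule_ge0 ?amb_ge0// lee_fin ltW.
rewrite test_normE -ge0_integralZl//; last 3 first.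
- by apply: measurable_phaseM => //; exact/measurable_EFinP.
- by move=> z _; rewrite mule_ge0 ?amb_ge0// lee_fin ltW.
- by rewrite lee_fin ltW.
apply: le_phase_integral => z.
  by rewrite fsume_ge0// => w _; rewrite !mule_ge0 ?amb_ge0// lee_fin ltW.
under eq_fsbigr do rewrite muleA muleC.
rewrite -ge0_mule_fsumr; last by move=> w; rewrite mule_ge0 ?amb_ge0// lee_fin ltW.
rewrite (_ : C%:E * (amb k phi z * (v z)%:E) = amb k phi z * (C * v z)%:E)%E; last first.
  by rewrite muleCA EFinM.
apply: lee_wpmul2l; first exact: amb_ge0.
apply: le_trans (CP z); apply: esum_ge; exists X => //.
apply: lee_fsum => // w _; rewrite muleC amb_sym// opprB.
by [].
Qed.

Let cL : countable L.
Proof.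
rewrite lattice_product; apply: countableX.
  exact: (countable_lattice t1 mu_haar).
exact: (countable_lattice t2 nu_haar).
Qed.

Lemma amb_lin (c : R[i]) f g h z : cL2 mu f -> cL2 mu g -> cL2 mu h ->
  (amb (fun x => (c * f x + g x)%R) h z <= (cmod c)%:E * amb f h z + amb g h z)%E.
Proof.
move=> Lf Lg Lh; have Lhz := cL2_tfshift sc mu_haar z Lh.
rewrite /amb innerDl// ?innerZl//; last exact: cL2Z.
by rewrite -EFinM -EFinD lee_fin -cmodM; exact: cmodD.
Qed.

Local Notation tspace := (test_space mu nu phi v).

Lemma test_space_lin (c : R[i]) f g : tspace f -> tspace g -> tspace (fun x => c * f x + g x).
Proof.
move=> [Lf tf] [Lg tg]; have Lcf := cL2Z c Lf.
split; first exact: cL2D.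
rewrite !test_normE in tf tg *.
have mv : measurable_fun [set: BZ] (fun z => (v z)%:E) by exact/measurable_EFinP.
have a0 f' z : (0 <= amb f' phi z * (v z)%:E)%E by rewrite mule_ge0 ?amb_ge0// lee_fin ltW.
have ma f' : cL2 mu f' -> measurable_fun [set: BZ] (fun z => amb f' phi z * (v z)%:E)%E.
  by move=> Lf'; apply: measurable_phaseM => //; exact: measurable_amb.
apply: (@le_lt_trans _ _ (\int[(mu \x nu)]_z ((cmod c)%:E * (amb f phi z * (v z)%:E) + amb g phi z * (v z)%:E))%E).
  apply: le_phase_integral => // z.
  have ca : (0 <= (cmod c)%:E * amb f phi z)%E by rewrite mule_ge0 ?amb_ge0// lee_fin cmod_ge0.
  rewrite muleA -(ge0_muleDl _ ca (amb_ge0 g phi z)).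
  by apply: lee_wpmul2r; [rewrite lee_fin ltW|exact: amb_lin].
have c0 : (0 <= (cmod c)%:E)%E by rewrite lee_fin cmod_ge0.
rewrite ge0_integralD//.
- rewrite ge0_integralZl//; last exact: ma.
  by apply: lte_lin_pinfty tf tg; [exact: cmod_ge0|exact: integral_ge0].
- by move=> z _; rewrite mule_ge0.
- by apply: measurable_phaseM => //; exact: ma.
- exact: ma.
Qed.

Lemma test_space_tfshift h w : cL2 mu h -> decaying t v (amb h phi) -> tspace (tfshift w h).
Proof.
move=> Lh kh; split; first exact: (cL2_tfshift sc mu_haar).
by have [C _ CP] := test_norm_tfshift Lh kh; apply: le_lt_trans (CP w) (ltry _).
Qed.

(** Functionals in the reservoir are continuous for the test norm only. Integrating the bound of
    [inner_le_frame] over phase space transfers the expansion from L^2 to that norm. *)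
Lemma test_norm_remainder h g : cL2 mu h -> cL2 mu g -> decaying t v (amb h phi) ->
  (forall f, cL2 mu f -> frame_operator mu L h g f f) ->
  exists2 C : R, 0 < C & forall f (W : {fset Z}), cL2 mu f -> [set` W] `<=` L ->
  (tnorm (fun x => (f x - \sum_(w <- W) inner mu f (tfshift w g) * tfshift w h x)%R) <=
   C%:E * \esum_(w in L) (if w \in W then 0 else amb f g w * (v w)%:E))%E.
Proof.
move=> Lh Lg kh S; have [C C0 CP] := test_norm_tfshift Lh kh.
exists C => // f W Lf WL; rewrite test_normE.
have mv : measurable_fun [set: BZ] (fun z => (v z)%:E) by exact/measurable_EFinP.
pose F w z := (if w \in W then 0 else amb f g w * (amb (tfshift w h) phi z * (v z)%:E))%E.
have F0 w z : (0 <= F w z)%E.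
  by rewrite /F; case: ifP => // _; rewrite !mule_ge0 ?amb_ge0// lee_fin ltW.
have mF w : measurable_fun [set: BZ] (F w).
  rewrite /F; case: (w \in W) => //; apply: measurable_phaseM => //; apply: measurable_phaseM => //.
  by apply: measurable_amb => //; exact: (cL2_tfshift sc mu_haar).
apply: (@le_trans _ _ (\int[(mu \x nu)]_z (\esum_(w in L) F w z))%E).
  apply: le_phase_integral => z; first by rewrite mule_ge0 ?amb_ge0// lee_fin ltW.
  apply: le_trans (lee_wpmul2r _ (inner_le_frame Lh Lg Lf (cL2_tfshift sc mu_haar z phi_L2) (S f Lf) WL)) _.
    by rewrite lee_fin ltW.
  rewrite muleC -esumZl ?lee_fin ?(ltW (v_gt0 z))//; last first.
    by move=> w; case: ifP => // _; rewrite mule_ge0 ?amb_ge0// lee_fin cmod_ge0.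
  apply: le_esum => w _; rewrite /F; case: ifP => _; first by rewrite mule0.
  by rewrite muleC muleA.
rewrite integral_esum// -esumZl ?lee_fin ?(ltW C0)//; last first.
  by move=> w; case: ifP => // _; rewrite mule_ge0 ?amb_ge0// lee_fin ltW.
apply: le_esum => w _; rewrite /F; case: ifP => _; first by rewrite integral0 mule0.
rewrite ge0_integralZl ?amb_ge0//.
- rewrite -test_normE (_ : C%:E * (amb f g w * (v w)%:E) = amb f g w * (C * v w)%:E)%E; last first.
    by rewrite muleCA EFinM.
  by apply: lee_wpmul2l; [exact: amb_ge0|exact: CP].
- apply: measurable_phaseM => //; apply: measurable_amb => //.
  exact: (cL2_tfshift sc mu_haar).
- by move=> z _; rewrite mule_ge0 ?amb_ge0// lee_fin ltW.
Qed.

Section functionals.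
Variable F : (G -> R[i]) -> R[i].
Hypothesis F_res : reservoir mu nu phi v F.

Lemma functional_sub_sum f (s : seq Z) (c : Z -> R[i]) h : tspace f ->
  (forall w, tspace (tfshift w h)) ->
  tspace (fun x => f x - \sum_(w <- s) c w * tfshift w h x) /\
  F (fun x => f x - \sum_(w <- s) c w * tfshift w h x) =
  F f - \sum_(w <- s) (c w)^*%C * F (tfshift w h).
Proof.
move=> tf th; have [lin _] := F_res; elim: s => [|w s [IH1 IH2]].
  rewrite (_ : (fun x => _) = f); last by apply/funext => x; rewrite big_nil subr0.
  by rewrite big_nil subr0.
rewrite (_ : (fun x => f x - \sum_(j <- w :: s) c j * tfshift j h x) =
  (fun x => - c w * tfshift w h x + (f x - \sum_(j <- s) c j * tfshift j h x))); last first.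
  by apply/funext => x; rewrite big_cons opprD mulNr addrCA.
split; first exact: test_space_lin.
rewrite lin// IH2 big_cons opprD addrCA; congr (_ + _).
by rewrite rmorphN mulNr.
Qed.

(** Convergence in the test norm allows F to be applied term by term. The limit is then estimated
    again by the omitted terms, with the actual coefficients of F in place of the bound by v. *)
Lemma functional_expansion h g : cL2 mu h -> cL2 mu g -> decaying t v (amb h phi) ->
  (forall f, cL2 mu f -> frame_operator mu L h g f f) ->
  forall f (W : {fset Z}), tspace f -> (\esum_(w in L) (amb f g w * (v w)%:E) < +oo)%E ->
  [set` W] `<=` L ->
  ((cmod (F f - \sum_(w <- W) F (tfshift w h) * inner mu (tfshift w g) f))%:E <=
   \esum_(w in L) (if w \in W then 0 else amb f g w * (cmod (F (tfshift w h)))%:E))%E.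
Proof.
move=> Lh Lg kh S f W tf fin WL; have [lin [CF FP]] := F_res.
have [C C0 CP] := test_norm_remainder Lh Lg kh S.
apply: le_trans (cmod_sub_sum_le WL _) _; last first.
  apply: le_esum => w _; case: ifP => // _.
  by rewrite cmodM mulrC EFinM /amb cmod_inner_sym.
move=> e e0; pose e1 := e / ((`|CF| + 1) * C).
have e10 : 0 < e1 by rewrite divr_gt0// mulr_gt0// ltr_wpDl.
have a0 w : (0 <= amb f g w * (v w)%:E)%E by rewrite mule_ge0 ?amb_ge0// lee_fin ltW.
have [W0 [W0L W0P]] := esum_tail a0 fin e10.
exists W0; split => // W' WW' W'L.
have [t1' e1'] := functional_sub_sum W' (fun w => inner mu f (tfshift w g)) tf
  (fun w => test_space_tfshift w Lh kh).
rewrite (_ : \sum_(w <- W') _ = \sum_(w <- W') (inner mu f (tfshift w g))^*%C * F (tfshift w h)); last first.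
  by apply: eq_bigr => w _; rewrite mulrC -innerJ.
rewrite -e1' -lee_fin; apply: le_trans (FP _ t1') _.
have Lf := proj1 tf.
have tn0 f' : (0 <= tnorm f')%E by rewrite /test_norm Lnorm_ge0.
apply: (@le_trans _ _ ((`|CF| + 1)%:E * (C%:E * e1%:E))%E).
  apply: (@le_trans _ _ ((`|CF| + 1)%:E * tnorm (fun x => (f x - \sum_(w <- W') inner mu f (tfshift w g) * tfshift w h x)%R))%E).
    by apply: lee_wpmul2r => //; rewrite lee_fin; have := ler_norm CF; lra.
  apply: lee_wpmul2l; first by rewrite lee_fin addr_ge0.
  apply: le_trans (CP f W' Lf W'L) _; apply: lee_wpmul2l; first by rewrite lee_fin ltW.
  apply: le_trans (ltW W0P); apply: le_esum => w _.
  case: ifPn => wW'; first by case: ifP.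
  by rewrite ifN//; apply: contra wW' => /WW'.
rewrite -!EFinM lee_fin /e1 le_eqVlt; apply/orP; left; apply/eqP; field.
by rewrite !gt_eqF// ltr_wpDl.
Qed.

End functionals.

End gabor.

(** * Analyzing windows *)

Section essential_suprema.
Context {dT : measure_display} {T : measurableType dT} {R : realType}.
Variable lam : {measure set T -> \bar R}.
Local Open Scope ereal_scope.
Implicit Types (D E : set T) (F : T -> \bar R).

Lemma ess_sup_onP D F (M : \bar R) : (forall x, 0 <= F x) -> 0 <= M ->
  ess_sup_on lam D F <= M <-> lam.-negligible [set x | D x /\ M < F x].
Proof.
move=> F0 M0; have F1 x : (`|F x| = F x) by rewrite gee0_abs.
have E : ~` [set x | ((fun x => `|F x|) \_ D) x <= M] = [set x | D x /\ M < F x].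
  apply/seteqP; split => x /=; rewrite patchE; case: ifPn => [/set_mem Dx|/negP Dx].
  - by move=> /negP; rewrite -ltNge F1.
  - by rewrite M0 => /(_ isT).
  - by move=> [_ MF]; apply/negP; rewrite -ltNge F1.
  - by move=> [/mem_set].
by rewrite -E; split => [/ess_supP//|?]; apply/ess_supP.
Qed.

Lemma ess_sup_on_ge0 D F : 0 < lam setT -> 0 <= ess_sup_on lam D F.
Proof.
by move=> T0; apply: ess_sup_gee => //; apply: nearW => x; rewrite patchE; case: ifP.
Qed.

Lemma le_ess_sup_on D E F : (forall x, 0 <= F x) -> 0 < lam setT -> D `<=` E -> ess_sup_on lam D F <= ess_sup_on lam E F.
Proof.
move=> F0 T0 DE; apply/ess_sup_onP => //; first exact: ess_sup_on_ge0.
have /ess_sup_onP := lexx (ess_sup_on lam E F); move=> /(_ F0 (ess_sup_on_ge0 E F T0)).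
by apply: negligibleS => x [Dx xF]; split => //; exact: DE.
Qed.

End essential_suprema.

Section null_fibers.
Context {d1 d2 : measure_display} {T1 : measurableType d1} {T2 : measurableType d2} {R : realType}.
Variables (m1 : {measure set T1 -> \bar R}) (m2 : {sigma_finite_measure set T2 -> \bar R}).
Local Open Scope ereal_scope.

(** By Tonelli almost every section of a measurable null set [N] covering [E] is null, while over a
    point of [A] that section contains [B x], which has positive measure. *)
Lemma negligible_fibers (E : set (T1 * T2)) (A : set T1) (B : T1 -> set T2) :
  (m1 \x m2).-negligible E ->
  (forall x, A x -> measurable (B x) /\ 0 < m2 (B x)) -> (forall x y, A x -> B x y -> E (x, y)) ->
  m1.-negligible A.
Proof.
move=> [N [mN N0 EN]] Bp BE.
have mx := measurable_fun_xsection m2 mN.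
have : \int[m1]_x (m2 \o xsection N) x = 0 by exact: N0.
rewrite (_ : (\int[m1]_x (m2 \o xsection N) x) = \int[m1]_x `|(m2 \o xsection N) x|); last first.
  by apply: eq_integral => x _; rewrite gee0_abs.
move=> /ae_eq_integral_abs => /(_ measurableT mx).
apply: negligibleS => x Ax /= /(_ I) /= x0.
have [mB B0] := Bp x Ax.
suff : m2 (B x) <= m2 (xsection N x) by rewrite x0 leNgt B0.
apply: le_measure; rewrite ?inE//; first exact: measurable_xsection.
by move=> y Bxy; rewrite /xsection /=; apply/mem_set/EN/BE.
Qed.

Lemma product_setT_gt0 : 0 < m1 setT -> 0 < m2 setT -> 0 < (m1 \x m2) setT.
Proof.
move=> m10 m20; rewrite -(_ : setT `*` setT = setT); last by apply/seteqP; split.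
by rewrite product_measure1E// mule_gt0.
Qed.

Lemma integral_product_fst (f : T1 -> \bar R) : m2 setT = 1 -> measurable_fun setT f ->
  (forall z, 0 <= f z) -> \int[(m1 \x m2)]_a f a.1 = \int[m1]_z f z.
Proof.
move=> m21 mf f0.
rewrite -[LHS](@ge0_integral_pushforward _ _ _ _ R fst measurable_fst (m1 \x m2) setT f measurableT)//.
apply: eq_measure_integral => A mA _.
have E : fst @^-1` A = A `*` [set: T2] by apply/seteqP; split => z; [split|case].
transitivity ((m1 \x m2) (fst @^-1` A)) => //.
by rewrite E product_measure1E// m21 mule1.
Qed.

End null_fibers.

Section small_neighborhoods.
Context {R : realType} {G : lcaType} {d1 d2 : nat}.
Local Notation Gh := (dual_group R G).
Local Notation Z := (G * Gh)%type.
Context (t1 : tiling R d1 G) (t2 : tiling R d2 Gh).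

Lemma nbhs0_sub (A : set G) : nbhs (0 : G) A ->
  exists2 B, nbhs (0 : G) B & forall x y, B x -> B y -> A (x - y).
Proof.
move=> nA; have := @sub_continuous G (0, 0) A; rewrite /= subr0 => /(_ nA) [[B C] [/= nB nC] BC].
by exists (B `&` C); [exact: filterI|move=> x y [Bx _] [_ Cy]; exact: (BC (x, y))].
Qed.

Lemma nbhs0_dual_sub (A : set Gh) : nbhs (0 : Gh) A ->
  exists2 B, nbhs (0 : Gh) B & forall x y, B x -> B y -> A (x - y).
Proof.
move=> /nbhs_dualP [C [e [cC e0 CA]]].
exists [set eta : Gh | forall x, C x -> cmod (pairing (0 : Gh) x - pairing eta x) < e / 2].
  by apply/nbhs_dualP; exists C, (e / 2); split => //; rewrite divr_gt0.
move=> a b /= aC bC; apply: CA => x Cx.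
have -> : pairing (0 : Gh) x - pairing (a - b) x = (pairing b x - pairing a x) * (pairing b x)^*%C.
  by rewrite pairing0l pairingBl mulrBl mulJ_cmod cmod_pairing expr1n.
rewrite cmodM cmodJ cmod_pairing mulr1.
have -> : pairing b x - pairing a x = (pairing (0 : Gh) x - pairing a x) - (pairing (0 : Gh) x - pairing b x).
  by rewrite opprB [RHS]addrC addrA subrK.
by apply: (le_lt_trans (cmodB _ _)); rewrite [ltRHS](splitr e) ltrD ?aC ?bC.
Qed.

(** As differences of points of V1 x V2 lie in [A], the set w + V1 x V2 is contained in z + A for
    each of its points z. So a supremum over a fixed set is dominated by local maxima at all nearby
    points. *)
Lemma small_product (A : set Z) : nbhs (0 : Z) A -> exists (V1 : set G) (V2 : set Gh),
  [/\ open V1 /\ open V2, V1 0 /\ V2 0, V1 `<=` cell t1 /\ V2 `<=` cell t2 &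
    forall x y, (V1 `*` V2) x -> (V1 `*` V2) y -> A (x - y)].
Proof.
move=> [[A1 A2] [/= nA1 nA2] AA].
have [B1 nB1 B1A] := nbhs0_sub nA1; have [B2 nB2 B2A] := nbhs0_dual_sub nA2.
exists (interior (B1 `&` cell t1)), (interior (B2 `&` cell t2)); split.
- by split; exact: open_interior.
- by split; apply: filterI => //; exact: nbhs_cell.
- by split => x /interior_subset [].
move=> x y [/= /interior_subset [x1 _] /interior_subset [x2 _]] [/= /interior_subset [y1 _] /interior_subset [y2 _]].
by apply: AA; split => /=; [exact: B1A|exact: B2A].
Qed.

End small_neighborhoods.

(** * From maximal functions on the Heisenberg group to phase space *)

Section heisenberg_maxima.
Context {R : realType} {G : lcaType}.
Local Notation Gh := (dual_group R G).
Local Notation Z := (G * Gh)%type.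
Variables (mu : {sigma_finite_measure set (borel G) -> \bar R})
  (nu : {sigma_finite_measure set (borel Gh) -> \bar R})
  (tau : probability (borel_circle R) R).
Hypothesis mu_haar : is_haar (fun x y : G => x + y) mu.
Hypothesis nu_haar : is_haar (fun x y : Gh => x + y) nu.
Hypothesis tau_haar : is_haar (fun s t : circle R => (s * t)%g) tau.
Local Open Scope ereal_scope.

Lemma arc_gt0 (W : set (circle R)) (c : circle R) : nbhs (1%g : circle R) W ->
  exists B : set (borel_circle R), [/\ measurable B, 0 < tau B & forall s, B s -> W (s * c)%g].
Proof.
move=> nW; have [_ _ tau0] := tau_haar.
pose B := (fun s : circle R => (s * c)%g) @^-1` (interior W).
have oB : open B.
  apply: open_comp; last exact: open_interior.
  move=> x _; apply: (@circle_mul_continuous R (circle R) id (fun=> c)).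
    by move=> y; exact: cvg_id.
  by move=> y; exact: (@cvg_cst _ _ _ _ (nbhs_filter y)).
exists B; split.
- exact: sub_sigma_algebra.
- by apply: tau0 => //; exists (c^-1)%g; rewrite /B /= mulVg; exact: nW.
- by move=> s /interior_subset.
Qed.

Lemma phase_setT_gt0 : 0 < (mu \x nu) setT.
Proof.
have [_ _ mu0] := mu_haar; have [_ _ nu0] := nu_haar.
apply: product_setT_gt0; [apply: mu0|apply: nu0]; do ?[exact: openT]; by exists 0%R.
Qed.

Lemma heis_setT_gt0 : 0 < heis_measure mu nu tau setT.
Proof. have tau0 : 0 < tau setT by rewrite probability_setT.
by apply: product_setT_gt0; [exact: phase_setT_gt0|exact: tau0]. Qed.

Lemma circle_cancel (a s k : circle R) : (a * (s * (a^-1 * k^-1)) * k)%g = s.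
Proof.
by rewrite [(s * _)%g]circle_mulC !mulgA mulgV mul1g circle_mulC mulgA mulgV mul1g.
Qed.

Variables (QH : set (Z * circle R)) (A : set Z) (W : set (circle R)).
Hypotheses (nW : nbhs (1%g : circle R) W) (AW : A `*` W `<=` QH).
Variable E : Z -> \bar R.
Hypothesis E_ge0 : forall z, 0 <= E z.
Local Notation max1 := (right_max mu nu tau QH (fun b => E b.1)).
Local Notation emax z D := (ess_sup_on (mu \x nu) [set z + y | y in D]%R E).

(* The Heisenberg translate of A x W contains an arc over every point of b.1 + A,
   so that null sets of the Heisenberg group project to null sets. *)
Lemma le_right_max b : emax b.1 A <= max1 b.
Proof.
set M := max1 b; have M0 : 0 <= M by apply: ess_sup_on_ge0; exact: heis_setT_gt0.
apply/ess_sup_onP => //.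
have /ess_sup_onP : M <= M by [].
move=> /(_ (fun b => E_ge0 b.1) M0) NE.
(* [c z] cancels the cocycle: the point over z with circle part s is the product with b, on the
   right, of an element whose circle part is s * c z. *)
pose c (z : Z) : circle R := (b.2 * char_eval b.1.2 (z.1 - b.1.1)%R)^-1%g.
have cP z := cid (arc_gt0 (c z) nW).
apply: (@negligible_fibers _ _ _ _ R (mu \x nu) tau _ _ (fun z => projT1 (cP z)) NE).
  by move=> z _; have [mB B0 _] := projT2 (cP z).
move=> z s [[y Ay <-] ME] Bs; split => //=.
have [_ _ /(_ s Bs) Ws] := projT2 (cP (b.1 + y)%R).
exists (y, (s * c (b.1 + y)%R)%g); first exact: AW.
rewrite /heis_mul /=; apply/pair_equal_spec; split.
  by rewrite [RHS]addrC.
rewrite -mulgA /c /= [(b.1.1 + y.1 - _)%R]addrC addKr -mulgA mulVg mulg1.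
by [].
Qed.

(** If the inner supremum exceeded [M] over z + A for every z in a.1 + V, arcs above these points
    would make the set where [right_max] exceeds [M] non-null. So some z is good, and a.1 + V lies
    in z + A. *)
Lemma le_left_max a (V : set Z) : (forall x y, V x -> V y -> A (x - y)%R) -> 
  ~ (mu \x nu).-negligible ([set a.1 + y | y in V]%R : set (borel G * borel Gh)) -> V `<=` A ->
  emax a.1 V <= left_max mu nu tau QH max1 a.
Proof.
set M := left_max _ _ _ _ _ a => VA nV sVA.
have M0 : 0 <= M by apply: ess_sup_on_ge0; exact: heis_setT_gt0.
have /ess_sup_onP : M <= M by [].
have max0 b : 0 <= max1 b by apply: ess_sup_on_ge0; exact: heis_setT_gt0.
move=> /(_ max0 M0) NE.
have [z [[y Vy <-] zM]] : exists z, [set a.1 + y | y in V]%R z /\ emax z A <= M.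
  apply: contrapT => nz; apply: nV.
  pose c (z : Z) : circle R := (a.2^-1 * (char_eval (z.2 - a.1.2)%R a.1.1)^-1)%g.
  have cP z := cid (arc_gt0 (c z) nW).
  apply: (@negligible_fibers _ _ _ _ R (mu \x nu) tau _ _ (fun z => projT1 (cP z)) NE).
    by move=> z _; have [mB B0 _] := projT2 (cP z).
  move=> z s zV Bs; split; last first.
    apply: lt_le_trans (le_right_max _).
    by rewrite ltNge; apply/negP => zM; apply: nz; exists z.
  case: zV Bs => y Vy <- Bs.
  have [_ _ /(_ s Bs) Ws] := projT2 (cP (a.1 + y)%R).
  exists (y, (s * c (a.1 + y)%R)%g); first by apply: AW; split => //; exact: sVA.
  rewrite /heis_mul /=; apply/pair_equal_spec; split; first exact/pair_equal_spec.
  by rewrite /c /= [(a.1.2 + y.2 - _)%R]addrC addKr circle_cancel.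
apply: le_trans zM.
apply: le_ess_sup_on => //; first exact: phase_setT_gt0.
move=> _ [x Vx <-]; exists (x - y)%R; first exact: VA.
by rewrite [(x - y)%R]addrC addrA addrK.
Qed.

End heisenberg_maxima.

Section product_steps.
Context {R : realType} {d1 d2 : nat} {X Y : PreTopologicalZmodule.type}.
Context (t1 : tiling R d1 X) (t2 : tiling R d2 Y).
Variables (mu : {sigma_finite_measure set (borel X) -> \bar R})
  (nu : {sigma_finite_measure set (borel Y) -> \bar R}).
Hypothesis mu_haar : is_haar (fun x y : X => x + y) mu.
Hypothesis nu_haar : is_haar (fun x y : Y => x + y) nu.
Local Notation Z := (X * Y)%type.
Local Notation BZ := (borel X * borel Y)%type.
Local Notation t := (product_tiling t1 t2).
Local Notation L := (lattice t).
Local Open Scope ereal_scope.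

Lemma measurable_preimage_shift (w : Z) (M : set BZ) : measurable M ->
  measurable ((fun z : Z => z + w)%R @^-1` M : set BZ).
Proof. by move=> mM; rewrite -[X in measurable X]setTI; exact: (measurable_product_shift t1 t2 w). Qed.

Lemma negligible_shift (w : Z) (N : set BZ) : (mu \x nu).-negligible N ->
  (mu \x nu).-negligible ((fun z : Z => z + w)%R @^-1` N : set BZ).
Proof.
move=> [M [mM M0 NM]]; exists ((fun z : Z => z + w)%R @^-1` M); split.
- exact: measurable_preimage_shift.
- by rewrite -M0; exact: (product_haar_shift t1 mu_haar nu_haar w mM).
- by move=> z; exact: NM.
Qed.

Lemma not_negligible_translate (V1 : set X) (V2 : set Y) (w : Z) :
  measurable (V1 : set (borel X)) -> measurable (V2 : set (borel Y)) -> 0 < mu V1 -> 0 < nu V2 ->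
  ~ (mu \x nu).-negligible ([set w + y | y in V1 `*` V2]%R : set BZ).
Proof.
move=> mV1 mV2 V10 V20.
have mV : measurable (V1 `*` V2 : set BZ) by exact: measurableX.
have E : [set w + y | y in V1 `*` V2]%R = (fun z : Z => z - w)%R @^-1` (V1 `*` V2).
  apply/seteqP; split => [_ [y Vy <-]|z Vz].
    have wy : (w + y - w = y)%R by rewrite addrC addKr.
    by change ((V1 `*` V2) (w + y - w)%R); rewrite wy.
  by exists (z - w)%R => //; rewrite addrC subrK.
rewrite E => /(measure_negligible (measurable_preimage_shift (- w)%R mV)) l1.
have : 0 < (mu \x nu) (V1 `*` V2) by rewrite product_measure1E// mule_gt0.
by rewrite -(product_haar_shift t1 mu_haar nu_haar (- w)%R mV) [X in 0 < X]l1 ltxx.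
Qed.

Definition lattice_step (b : Z -> \bar R) (V1 : set X) (V2 : set Y) (z : Z) : \bar R :=
  b (rnd t z) * (\1_V1 (z.1 - rnd t1 z.1)%R)%:E * (\1_V2 (z.2 - rnd t2 z.2)%R)%:E.

Lemma measurable_step_product b (V1 : set X) (V2 : set Y) :
  measurable (V1 : set (borel X)) -> measurable (V2 : set (borel Y)) ->
  V1 `<=` cell t1 -> V2 `<=` cell t2 -> measurable_fun [set: BZ] (lattice_step b V1 V2).
Proof.
move=> mV1 mV2 V1c V2c; apply: emeasurable_funM; first apply: emeasurable_funM.
- exact: measurable_rnd_product mu_haar nu_haar _ _ _.
- have m1 := measurable_step mu_haar (fun=> 1) mV1 V1c.
  apply: (eq_measurable_fun ((fun x => 1 * (\1_V1 (x - rnd t1 x)%R)%:E) \o (fst : BZ -> borel X))).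
    by move=> z _ /=; rewrite mul1e.
  exact: (measurableT_comp m1 measurable_fst).
- have m2 := measurable_step nu_haar (fun=> 1) mV2 V2c.
  apply: (eq_measurable_fun ((fun x => 1 * (\1_V2 (x - rnd t2 x)%R)%:E) \o (snd : BZ -> borel Y))).
    by move=> z _ /=; rewrite mul1e.
  exact: (measurableT_comp m2 measurable_snd).
Qed.

Lemma integral_step_product b (V1 : set X) (V2 : set Y) : (forall z, 0 <= b z) ->
  measurable (V1 : set (borel X)) -> measurable (V2 : set (borel Y)) ->
  V1 `<=` cell t1 -> V2 `<=` cell t2 ->
  \int[(mu \x nu)]_z lattice_step b V1 V2 z = mu V1 * nu V2 * \esum_(z in L) b z.
Proof.
move=> b0 mV1 mV2 V1c V2c.
rewrite (fubini_tonelli1 (m1 := mu) (m2 := nu)) => [||z]; last 2 first.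
- exact: measurable_step_product.
- by rewrite /lattice_step !mule_ge0// lee_fin.
rewrite /fubini_F.
pose B x := \esum_(y in lattice t2) (b (x, y) * nu V2).
have B0 x : 0 <= B x by apply: esum_ge0 => y _; rewrite mule_ge0.
transitivity (\int[mu]_x (B (rnd t1 (x - 0)%R) * (\1_V1 (x - 0 - rnd t1 (x - 0))%R)%:E)).
  apply: eq_integral => x _; rewrite subr0 /B.
  rewrite -(@integral_step _ _ _ t2 nu nu_haar (fun y => b (rnd t1 x, y)) V2 0)//.
  rewrite muleC -ge0_integralZl_EFin//; first last.
  - by have := measurable_step nu_haar (fun y => b (rnd t1 x, y)) mV2 V2c; apply: eq_measurable_fun => y _; rewrite subr0.
  - by move=> y _; rewrite mule_ge0// lee_fin.
  apply: eq_integral => y _; rewrite /lattice_step rnd_product subr0 /=.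
  by rewrite muleA; congr (_ * _); rewrite muleC.
rewrite (@integral_step _ _ _ t1 mu mu_haar B V1 0)// /B.
rewrite -esum_lattice_product// -esumZl//; last 2 first.
- by rewrite mule_ge0.
- by move=> x; exact: esum_ge0.
apply: eq_esum => x _; rewrite -esumZl//; last by rewrite mule_ge0.
rewrite muleC -esumZl//; last by move=> y; rewrite mule_ge0.
by apply: eq_esum => y _; rewrite [b _ * _]muleC muleA.
Qed.

End product_steps.

(** * Decay of ambiguity functions of analyzing windows *)

Section analyzing_windows.
Context {R : realType} {G : lcaType} {d1 d2 : nat}.
Local Notation Gh := (dual_group R G).
Local Notation Z := (G * Gh)%type.
Local Notation BZ := (borel G * borel Gh)%type.
Context (t1 : tiling R d1 G) (t2 : tiling R d2 Gh).
Local Notation t := (product_tiling t1 t2).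
Local Notation L := (lattice t).
Variables (mu : {sigma_finite_measure set (borel G) -> \bar R})
  (nu : {sigma_finite_measure set (borel Gh) -> \bar R})
  (tau : probability (borel_circle R) R).
Hypothesis mu_haar : is_haar (fun x y : G => x + y) mu.
Hypothesis nu_haar : is_haar (fun x y : Gh => x + y) nu.
Hypothesis tau_haar : is_haar (fun s t : circle R => (s * t)%g) tau.
Local Open Scope ereal_scope.

Variable v : Z -> R.
Hypothesis v_gt0 : forall x, (0 < v x)%R.
Hypothesis v_sub : forall x y, (v (x + y) <= v x * v y)%R.
Hypothesis v_even : forall x, v (- x)%R = v x.
Hypothesis v_cube : forall n, exists C, forall x, cube t n x -> (v x <= C)%R.

Lemma integral_heis_fst (f : Z -> \bar R) : measurable_fun [set: BZ] f -> (forall z, 0 <= f z) ->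
  \int[heis_measure mu nu tau]_a f a.1 = \int[(mu \x nu)]_z f z.
Proof.
move=> mf f0; rewrite /heis_measure.
by have -> := @integral_product_fst _ _ _ _ R (mu \x nu) tau f (probability_setT tau) mf f0.
Qed.

(** Above w + V1 x V2 the two-sided maximal function is at least the essential supremum of [E] over
    that set, and v changes by a bounded factor there. The r-th power of the norm thus dominates a
    multiple of the lattice sum of r-th powers. *)
Lemma analyzing_rapid (E : Z -> \bar R) (QH : set (Z * circle R)) : (forall z, 0 <= E z) ->
  nbhs (heis_one : Z * circle R) QH ->
  (forall r : R, (0 < r <= 1)%R -> 'N[heis_measure mu nu tau]_(r%:E)[(fun a =>
     left_max mu nu tau QH (right_max mu nu tau QH (fun b => E b.1)) a * (v a.1)%:E)] < +oo) ->
  exists (V1 : set G) (V2 : set Gh), [/\ open V1 /\ open V2, V1 0%R /\ V2 0%R,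
    V1 `<=` cell t1 /\ V2 `<=` cell t2 &
    rapid L (fun w => ess_sup_on (mu \x nu) [set w + y | y in V1 `*` V2]%R E * (v w)%:E)].
Proof.
move=> E0 [[A W] [/= nA nW] AW] fin.
(* Two nested neighbourhoods: differences of W1 x W2 lie in [A], as [le_left_max] asks, and
   differences of V1 x V2 lie in W1 x W2, so that the base point may move within V1 x V2. *)
have [W1 [W2 [[oW1 oW2] [W10 W20] [W1c W2c] WA]]] := small_product t1 t2 nA.
have nW12 : nbhs (0%R : Z) (W1 `*` W2).
  by exists (W1, W2) => //; split; apply: open_nbhs_nbhs.
have [V1 [V2 [[oV1 oV2] [V10 V20] [V1c V2c] VW]]] := small_product t1 t2 nW12.
exists V1, V2; split => //.
set c := fun w : Z => ess_sup_on (mu \x nu) [set w + y | y in V1 `*` V2]%R E.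
have c0 w : 0 <= c w by apply: ess_sup_on_ge0; exact: phase_setT_gt0.
set X := fun a => _ in fin.
have [_ _ mu_open] := mu_haar; have [_ _ nu_open] := nu_haar.
have mV1 : measurable (V1 : set (borel G)) by exact: sub_sigma_algebra.
have mV2 : measurable (V2 : set (borel Gh)) by exact: sub_sigma_algebra.
have pV1 : 0 < mu V1 by apply: mu_open => //; exists 0%R.
have pV2 : 0 < nu V2 by apply: nu_open => //; exists 0%R.
have W0 : (W1 `*` W2) (0%R : Z) by [].
have cX w u : (V1 `*` V2) u -> forall a, a.1 = (w + u)%R -> 
    c w <= left_max mu nu tau QH (right_max mu nu tau QH (fun b => E b.1)) a.
  move=> Vu a aE; apply: (@le_trans _ _ (ess_sup_on (mu \x nu) [set a.1 + y | y in W1 `*` W2]%R E)).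
    apply: le_ess_sup_on => //; first exact: phase_setT_gt0.
    move=> _ [y Vy <-]; exists (y - u)%R; first exact: VW.
    by rewrite aE [(y - u)%R]addrC addrA addrK.
  apply: (le_left_max mu_haar nu_haar tau_haar nW AW) => //.
    apply: (not_negligible_translate t1 t2 mu_haar nu_haar); do ?[exact: sub_sigma_algebra].
      by apply: mu_open => //; exists 0%R.
    by apply: nu_open => //; exists 0%R.
  by move=> x Wx; rewrite -(subr0 x); exact: WA.
have [C C0 vC] := v_shift v_gt0 v_sub v_cube 1.
pose b w := (C^-1)%:E * (c w * (v w)%:E).
have b0 w : 0 <= b w by rewrite !mule_ge0// lee_fin ?invr_ge0 ltW.
suff rb : rapid L b.
  apply: (@le_rapid _ _ L (fun w => c w * (v w)%:E) (fun w => C%:E * b w)) => [w|w _|].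
  - by apply: mule_ge0 => //; rewrite lee_fin ltW.
  - by rewrite /b muleA -EFinM divff ?gt_eqF// mul1e.
  - by apply: rapidZ => //; [rewrite lee_fin ltW|exact: ltry].
move=> r /[dup] r01 /andP[r0 r1].
have := fin r r01; rewrite unlock /=.
set I := (X in X `^ _) => fI.
have I0 : 0 <= I by apply: integral_ge0 => a _; rewrite poweR_ge0.
have : I < +oo.
  by rewrite -(@poweRrVK _ I r)//; exact: poweR_lty.
pose B w := b w `^ r.
have B0 w : 0 <= B w by exact: poweR_ge0.
have : \int[(mu \x nu)]_z lattice_step t1 t2 B V1 V2 z <= I.
  rewrite -integral_heis_fst; last 2 first.
  - exact: (measurable_step_product mu_haar nu_haar).
  - by move=> z; rewrite /lattice_step !mule_ge0// lee_fin.
  apply: ge0_le_integral_nomeas => a; first by rewrite /lattice_step !mule_ge0// lee_fin.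
  rewrite /lattice_step !indicE.
  case: (boolP ((a.1.1 - rnd t1 a.1.1)%R \in V1)) => [/set_mem h1|_]; last by rewrite mule0 mul0e poweR_ge0.
  case: (boolP ((a.1.2 - rnd t2 a.1.2)%R \in V2)) => [/set_mem h2|_]; last by rewrite mule0 poweR_ge0.
  rewrite !mule1 /B; apply: le_poweR => //.
  have aE : a.1 = (rnd t a.1 + (a.1 - rnd t a.1))%R by rewrite addrC subrK.
  have h : (V1 `*` V2) (a.1 - rnd t a.1)%R by rewrite rnd_product; split.
  rewrite gee0_abs; last first.
    apply: mule_ge0; last by rewrite lee_fin ltW.
    by apply: ess_sup_on_ge0; exact: heis_setT_gt0.
  rewrite /b muleCA; apply: lee_pmul => //.
  - by rewrite -EFinM lee_fin mulr_ge0// ?invr_ge0 ltW.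
  - exact: (cX _ _ h).
  rewrite -EFinM lee_fin mulrC ler_pdivrMr// mulrC.
  rewrite -{1}(subrK a.1 (rnd t a.1)) addrC; apply: vC.
  by rewrite -opprB; apply: cubeN; exact: cube_sub_rnd.
rewrite (integral_step_product mu_haar nu_haar)// => le1 fI'.
rewrite ltey; apply/eqP => sy; move: (le_lt_trans le1 fI').
by rewrite sy gt0_muley ?ltxx// mule_gt0.
Qed.

Hypothesis sc : @second_countable G.
Variables (phi h : G -> R[i]).
Hypothesis h_L2 : cL2 mu h.

(* Almost every z0 in the small cell serves all the points of the countable
   lattice at once, which makes continuity of the ambiguity function irrelevant. *)
Lemma analyzing_good_point (QH : set (Z * circle R)) : nbhs (heis_one : Z * circle R) QH ->
  analyzing mu nu tau v QH h ->
  exists (z0 : Z) (c : Z -> \bar R), [/\ forall w, 0 <= c w, rapid L (fun w => c w * (v w)%:E) &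
    forall w, L w -> amb mu h h (w + z0)%R <= c w].
Proof.
move=> nQ ha.
have E0 z : 0 <= amb mu h h z by exact: amb_ge0.
have hE : (fun b : Z * circle R => (cmod (heis_stft mu h h b))%:E) = (fun b => amb mu h h b.1).
  apply/funext => b; rewrite /heis_stft cmod_innerZr//; first by rewrite cmod_circle mul1r.
  exact: cL2_tfshift.
have [|V1 [V2 [[oV1 oV2] [V10 V20] [V1c V2c] cr]]] := analyzing_rapid E0 nQ.
  by move=> r r01; have [_] := ha r r01; rewrite hE.
set c := fun w : Z => ess_sup_on (mu \x nu) [set w + y | y in V1 `*` V2]%R (amb mu h h).
have c0 w : 0 <= c w by apply: ess_sup_on_ge0; exact: phase_setT_gt0.
have [_ _ mu_open] := mu_haar; have [_ _ nu_open] := nu_haar.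
pose N w : set BZ := [set u : Z | (V1 `*` V2) u /\ c w < amb mu h h (w + u)%R].
have NN : (mu \x nu).-negligible (\bigcup_(w in L) N w).
  apply: countable_negligible => [|w _].
    rewrite lattice_product; apply: countableX; [exact: (countable_lattice t1 mu_haar)|exact: (countable_lattice t2 nu_haar)].
  have /ess_sup_onP : c w <= c w by [].
  move=> /(_ E0 (c0 w)) /(negligible_shift t1 t2 mu_haar nu_haar w).
  apply: negligibleS => u [Vu cu]; rewrite /preimage /= addrC; split => //.
  by exists u.
have [u [Vu Nu]] : exists u, (V1 `*` V2) u /\ ~ (\bigcup_(w in L) N w) u.
  apply: contrapT => nu'; apply: (@not_negligible_translate _ _ _ _ _ t1 t2 mu nu mu_haar nu_haar V1 V2 0%R).
  - exact: sub_sigma_algebra.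
  - exact: sub_sigma_algebra.
  - by apply: mu_open => //; exists 0%R.
  - by apply: nu_open => //; exists 0%R.
  apply: negligibleS NN => _ [u Vu <-]; rewrite add0r.
  by apply: contrapT => Nu; apply: nu'; exists u.
exists u, c; split => // w Lw.
by rewrite leNgt; apply/negP => cw; apply: Nu; exists w.
Qed.

Hypothesis phi_L2 : cL2 mu phi.
Hypothesis S_phi_h : forall f, cL2 mu f -> frame_operator mu L phi h f f.
Variables (QH : set (Z * circle R)).
Hypothesis QH_nbhs : nbhs (heis_one : Z * circle R) QH.
Hypothesis h_analyzing : analyzing mu nu tau v QH h.

(* Frame expansion of pi(-z0) h. *)
Lemma le_amb_analyzing : exists (c : Z -> \bar R) (z0 : Z), [/\ forall w, 0 <= c w,
    rapid L (fun w => c w * (v (z0 + w))%:E) &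
  forall k, cL2 mu k -> forall s, amb mu h k s <= \esum_(w in L) (c w * amb mu phi k (s - (z0 + w))%R)].
Proof.
have [z0 [c [c0 cr cP]]] := analyzing_good_point QH_nbhs h_analyzing.
exists c, z0; split => // [|k k2 s].
  apply: (@le_rapid _ _ L (fun w => c w * (v (z0 + w))%:E) (fun w => (v z0)%:E * (c w * (v w)%:E))) => [w|w _|].
  - by apply: mule_ge0 => //; rewrite lee_fin ltW.
  - by rewrite muleCA; apply: lee_pmul => //; rewrite -?EFinM lee_fin ?v_sub ?ltW.
  - apply: rapidZ => //; [by rewrite lee_fin ltW|exact: ltry|].
    by move=> w; apply: mule_ge0 => //; rewrite lee_fin ltW.
have f2 := cL2_tfshift sc mu_haar (- z0)%R h_L2.
have k'2 := cL2_tfshift sc mu_haar (s - z0)%R k2.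
have := inner_le_frame sc mu_haar phi_L2 h_L2 f2 k'2 (S_phi_h f2) (W := fset0).
have -> : (fun x => tfshift (- z0)%R h x - \sum_(w <- fset0) inner mu (tfshift (- z0)%R h) (tfshift w h) * tfshift w phi x)%R = tfshift (- z0)%R h.
  by apply/funext => x; rewrite big_seq_fset0 subr0.
have fs0 : [set` (fset0 : {fset Z})] `<=` L by move=> x; rewrite /= inE.
move=> /(_ fs0) le1.
rewrite (_ : amb mu h k s = amb mu (tfshift (- z0)%R h) k (s - z0)%R); last first.
  by rewrite (amb_tfshift sc mu_haar)// opprK subrK.
apply: (le_trans le1); apply: le_esum => w Lw.
rewrite [X in X <= _](_ : _ = amb mu (tfshift (- z0)%R h) h w * (cmod (inner mu (tfshift w phi) (tfshift (s - z0)%R k)))%:E)//.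
apply: lee_pmul => //; do ?exact: amb_ge0.
  by rewrite (amb_tfshift sc mu_haar)// opprK cP.
change (amb mu (tfshift w phi) k (s - z0)%R <= amb mu phi k (s - (z0 + w))%R).
by rewrite (amb_tfshift sc mu_haar w (s - z0)%R phi_L2 k2) opprD addrA.
Qed.

Lemma decaying_analyzingl k : cL2 mu k -> decaying t v (amb mu phi k) -> decaying t v (amb mu h k).
Proof.
move=> k2 dk; have [c [z0 [c0 cr cP]]] := le_amb_analyzing.
apply: le_decaying (cP k k2) _.
apply: (decaying_esum v_gt0 v_sub v_even v_cube (a := fun w => - (z0 + w)%R)%R) => //; first by move=> z; exact: amb_ge0.
by under eq_fun do rewrite v_even.
Qed.

Lemma decaying_analyzingr k : cL2 mu k -> decaying t v (amb mu k phi) -> decaying t v (amb mu k h).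
Proof.
move=> k2 dk; have [c [z0 [c0 cr cP]]] := le_amb_analyzing.
apply: (@le_decaying _ _ _ t v _ (fun z => \esum_(w in L) (c w * amb mu k phi (z + (z0 + w))%R))).
  move=> z; rewrite (amb_sym sc mu_haar)//; apply: le_trans (cP k k2 _) _.
  by apply: le_esum => w Lw; rewrite (amb_sym sc mu_haar)// opprB opprK addrC.
by apply: (decaying_esum v_gt0 v_sub v_even v_cube (a := fun w => (z0 + w)%R)%R) => //; move=> z; exact: amb_ge0.
Qed.

End analyzing_windows.

Section span_decay.
Context {R : realType} {G : lcaType} {d : nat}.
Local Notation Gh := (dual_group R G).
Local Notation Z := (G * Gh)%type.
Context (t : tiling R d Z).
Hypothesis sc : @second_countable G.
Variable mu : {sigma_finite_measure set (borel G) -> \bar R}.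
Hypothesis mu_haar : is_haar (fun x y : G => x + y) mu.
Variable v : Z -> R.
Hypothesis v_gt0 : forall x, 0 < v x.
Hypothesis v_sub : forall x y, v (x + y) <= v x * v y.
Hypothesis v_even : forall x, v (- x) = v x.
Hypothesis v_cube : forall n, exists C, forall x, cube t n x -> v x <= C.
Variables (phi g k : G -> R[i]).
Hypotheses (phi_L2 : cL2 mu phi) (k_L2 : cL2 mu k) (g_span : gabor_span phi g).

Lemma le_amb_span : exists s : seq (R[i] * Z), forall z,
  (amb mu g k z <= \sum_(a <- s) (cmod a.1)%:E * amb mu phi k (z - a.2)%R)%E.
Proof.
have [s gs] := g_span; exists s => z.
have -> : g = (fun x => \sum_(a <- s) a.1 * tfshift a.2 phi x) by apply/funext.
have k2 := cL2_tfshift sc mu_haar z k_L2.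
rewrite /amb (inner_suml s (fun a => a.1) (fun a => cL2_tfshift sc mu_haar a.2 phi_L2) k2).
apply: (@le_trans _ _ (\sum_(a <- s) cmod (a.1 * inner mu (tfshift a.2 phi) (tfshift z k)))%:E).
  by rewrite lee_fin cmod_sum.
rewrite -sumEFin; apply: lee_sum => a _.
have := amb_tfshift sc mu_haar a.2 z phi_L2 k_L2; rewrite /amb => <-.
by rewrite -EFinM -cmodM.
Qed.

Lemma decaying_spanl : decaying t v (amb mu phi k) -> decaying t v (amb mu g k).
Proof.
move=> dk; have [s sP] := le_amb_span.
apply: le_decaying sP _; apply: (decaying_sum v_gt0) => a; apply: (decayingZ v_gt0 (cmod_ge0 a.1)).
by apply: decaying_shift => // z; exact: amb_ge0.
Qed.

Hypothesis g_L2 : cL2 mu g.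

Lemma decaying_spanr : decaying t v (amb mu k phi) -> decaying t v (amb mu k g).
Proof.
move=> dk; have [s sP] := le_amb_span.
apply: (@le_decaying _ _ _ t v _ (fun z => \sum_(a <- s) (cmod a.1)%:E * amb mu k phi (z + a.2)%R)%E).
  move=> z; rewrite (amb_sym sc mu_haar z k_L2 g_L2); apply: (le_trans (sP _)).
  by apply: lee_sum => a _; rewrite (amb_sym sc mu_haar _ phi_L2 k_L2) opprB opprK addrC.
apply: (decaying_sum v_gt0) => a; apply: (decayingZ v_gt0 (cmod_ge0 a.1)).
by apply: decaying_shift => // z; exact: amb_ge0.
Qed.

End span_decay.

(** * Norm estimates *)

Section delta_norms.
Context {R : realType}.
Local Open Scope ereal_scope.

Lemma lnorm_delta {T : choiceType} p (A : set T) (a : T) (c : \bar R) : 0 < p -> A a -> 0 <= c ->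
  lnorm p A (fun x => if x == a then c else 0) = c.
Proof.
move=> p0 Aa c0; case: p p0 => [r||] //=.
- rewrite lte_fin => r0.
  rewrite (_ : (fun i => `|if i == a then c else 0| `^ r) = (fun i => if i \in [set a] then c `^ r else 0)); last first.
    apply/funext => i; case: (eqVneq i a) => [->|ia].
      by rewrite gee0_abs// mem_set.
    rewrite abse0 memNset// ?poweR0r ?gt_eqF//.
    by move=> /= /eqP; apply/negP.
  rewrite -esum_mkcondr (_ : A `&` [set a] = [set a]); last first.
    by apply/seteqP; split => [i []//|i ->]; split.
  rewrite esum_set1 ?poweR_ge0//; exact: poweRrK.
- move=> _; apply/eqP; rewrite eq_le; apply/andP; split.
    by apply: ge_ereal_sup => _ [i Ai <-]; case: ifP => _; rewrite ?abse0// gee0_abs.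
  by apply: ereal_sup_ubound; exists a; rewrite ?eqxx ?gee0_abs.
Qed.

Lemma lnorm0 {T : choiceType} p (A : set T) : 0 < p -> A !=set0 -> lnorm p A (fun=> 0 : \bar R) = 0.
Proof. by move=> p0 [a Aa]; rewrite -[RHS](lnorm_delta p0 Aa (lexx 0)); congr lnorm; apply/funext => x; rewrite if_same. Qed.

Context {d1 d2 : nat} {X Y : PreTopologicalZmodule.type}.
Context (t1 : tiling R d1 X) (t2 : tiling R d2 Y).
Local Notation Z := (X * Y)%type.
Local Notation t := (product_tiling t1 t2).
Local Notation L := (lattice t).

Lemma lattice_norm_delta p q (w : Z) (c : \bar R) : 0 < p -> 0 < q -> L w -> 0 <= c ->
  lattice_norm t1 t2 p q (fun z => if z == w then c else 0) = c.
Proof.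
move=> p0 q0; rewrite lattice_product => -[/= w1 w2] c0.
rewrite /lattice_norm -[RHS](lnorm_delta q0 w2 c0); congr lnorm; apply/funext => y.
case: (eqVneq y w.2) => [->|yw].
  rewrite -[RHS](lnorm_delta p0 w1 c0); congr lnorm; apply/funext => x.
  by case: w {w1 w2} => w1 w2; rewrite xpair_eqE eqxx andbT.
rewrite -[RHS](lnorm0 p0 (ex_intro _ _ w1)); congr lnorm; apply/funext => x.
by case: w {w1 w2} yw => w1 w2 /= yw; rewrite xpair_eqE (negbTE yw) andbF.
Qed.

(** On a finite index set the constant weights 1 are rapid, so [quasi_minkowski] becomes a
    quasi-triangle inequality valid for all exponents. *)
Lemma lattice_norm_sum {I : choiceType} (S : set I) p q : finite_set S -> 0 < p -> 0 < q ->
  exists k : I -> \bar R, [/\ forall i, 0 <= k i, forall i, S i -> k i < +oo &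
  forall B : I -> Z -> \bar R, (forall i z, 0 <= B i z) ->
  lattice_norm t1 t2 p q (fun z => \esum_(i in S) B i z) <=
  \esum_(i in S) k i * lattice_norm t1 t2 p q (B i)].
Proof.
move=> fS p0 q0.
have r1 : rapid S (fun _ : I => 1%:E : \bar R) by apply: rapid_finite.
have [k1 [k10 k1r k1P]] := quasi_minkowski (lattice t1) p0 (fun _ => lee01) r1.
have [k2 [k20 k2r k2P]] := quasi_minkowski (lattice t2) q0 k10 k1r.
exists k2; split => // [i Si|B B0].
  by apply: (le_lt_trans (esum_term k20 Si)); exact: rapid_sum.
have n0 i y : 0 <= lnorm p (lattice t1) (fun x => B i (x, y)) by apply: lnorm_ge0; exact: lattice_neq0.
have e0 y : 0 <= lnorm p (lattice t1) (fun x => \esum_(i in S) B i (x, y)) by apply: lnorm_ge0; exact: lattice_neq0.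
apply: le_trans (k2P (fun i y => lnorm p (lattice t1) (fun x => B i (x, y))) n0).
apply: le_lnorm => // y _; rewrite !gee0_abs//; last by apply: esum_ge0 => i _; rewrite mule_ge0.
apply: le_trans (k1P (fun i x => B i (x, y)) _) => //.
apply: le_lnorm => // x _; rewrite (eq_esum (b := fun i => 1 * B i (x, y)))// => i _; by rewrite mul1e.
Qed.

End delta_norms.

Section expansions.
Context {R : realType} {G : lcaType} {d1 d2 : nat}.
Local Notation Gh := (dual_group R G).
Local Notation Z := (G * Gh)%type.
Local Notation BZ := (borel G * borel Gh)%type.
Context (t1 : tiling R d1 G) (t2 : tiling R d2 Gh).
Local Notation t := (product_tiling t1 t2).
Local Notation L := (lattice t).
Hypothesis sc : @second_countable G.
Variables (mu : {sigma_finite_measure set (borel G) -> \bar R})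
  (nu : {sigma_finite_measure set (borel Gh) -> \bar R}).
Hypothesis mu_haar : is_haar (fun x y : G => x + y) mu.
Hypothesis nu_haar : is_haar (fun x y : Gh => x + y) nu.
Variable v : Z -> R.
Hypothesis v_meas : measurable_fun [set: BZ] v.
Hypothesis v_gt0 : forall x, 0 < v x.
Hypothesis v_sub : forall x y, v (x + y) <= v x * v y.
Hypothesis v_even : forall x, v (- x) = v x.
Hypothesis v_low : exists2 c : R, 0 < c & forall z, c <= v z.
Hypothesis v_cube : forall n, exists C, forall x, cube t n x -> v x <= C.
Variable Q : set Z.
Hypotheses (Q_precompact : precompact Q) (Q_nbhs : nbhs 0 Q).
Variable phi : G -> R[i].
Hypothesis phi_window : window mu phi.
Hypothesis phi_decaying : decaying t v (amb mu phi phi).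
Hypothesis phi_reflected : reflected_inner mu phi phi != 0.
Hypothesis nu_dual : is_dual_haar mu nu.
Variable g : G -> R[i].
Hypothesis g_window : window mu g.
Local Notation tnorm := (test_norm mu nu phi v).
Local Notation tspace := (test_space mu nu phi v).
Local Notation lam := (mu \x nu)%E.
Local Open Scope ereal_scope.

Let Q0 : Q 0%R. Proof. exact: nbhs_singleton. Qed.
Let phi_L2 : cL2 mu phi. Proof. by have [] := phi_window. Qed.
Let g_L2 : cL2 mu g. Proof. by have [] := g_window. Qed.
Let vE0 z : 0 <= (v z)%:E. Proof. by rewrite lee_fin ltW. Qed.

Let lattice_sum (Theta : Z -> \bar R) : (forall z, 0 <= Theta z) -> decaying t v Theta ->
  exists2 C : R, (0 < C)%R & forall z,
  \esum_(w in L) (Theta (w - z)%R * (v w)%:E) <= (C * v z)%:E.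
Proof. exact: (decaying_lattice_sum v_gt0 v_sub v_even v_cube Q_precompact Q0). Qed.

(** The frame expansion of k dominates its samples against k' by the convolution of its samples
    against [phi] with a decaying kernel, which reduces the claim to [test_norm_sampling]. *)
Lemma test_norm_sampling_dual h k' : cL2 mu h -> cL2 mu k' -> decaying t v (amb mu h k') ->
  (forall f, cL2 mu f -> frame_operator mu L h phi f f) ->
  exists2 C : R, (0 < C)%R & forall k, cL2 mu k ->
  \esum_(w in L) (amb mu k k' w * (v w)%:E) <= C%:E * tnorm k.
Proof.
move=> h2 k'2 dk S.
have [C C0 CP] := test_norm_sampling sc mu_haar nu_haar v_meas v_gt0 v_sub v_even v_low v_cube
  Q_precompact Q0 phi_window phi_decaying phi_reflected nu_dual.
have [C' C'0 C'P] := lattice_sum (amb_ge0 mu h k') dk.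
exists (C' * C)%R; first exact: mulr_gt0.
move=> k k2; have le1 w : amb mu k k' w <= \esum_(w' in L) (amb mu k phi w' * amb mu h k' (w - w')%R).
  have kw2 := cL2_tfshift sc mu_haar w k'2.
  have fs0 : [set` (fset0 : {fset Z})] `<=` L by move=> x; rewrite /= inE.
  have := inner_le_frame sc mu_haar h2 phi_L2 k2 kw2 (S k k2) fs0.
  have -> : (fun x => k x - \sum_(w <- (fset0 : {fset Z})) inner mu k (tfshift w phi) * tfshift w h x)%R = k.
    by apply/funext => x; rewrite big_seq_fset0 subr0.
  move=> le1; apply: (le_trans le1); apply: le_esum => w' _.
  rewrite [X in X <= _](_ : _ = amb mu k phi w' * (cmod (inner mu (tfshift w' h) (tfshift w k')))%:E)//.
  apply: lee_wpmul2l; first exact: amb_ge0.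
  change (amb mu (tfshift w' h) k' w <= amb mu h k' (w - w')%R).
  by rewrite (amb_tfshift sc mu_haar w' w h2 k'2).
apply: (@le_trans _ _ (\esum_(w in L) \esum_(w' in L) (amb mu k phi w' * amb mu h k' (w - w')%R * (v w)%:E))).
  apply: le_esum => w _; under eq_esum do rewrite muleC.
  rewrite esumZl//; last by move=> w'; rewrite mule_ge0 ?amb_ge0.
  by rewrite muleC; apply: lee_wpmul2l.
rewrite exchange_esum; last by move=> w w'; rewrite !mule_ge0 ?amb_ge0.
rewrite EFinM -muleA; apply: (@le_trans _ _ (C'%:E * \esum_(w in L) (amb mu k phi w * (v w)%:E))); last first.
  by apply: lee_wpmul2l; [rewrite lee_fin ltW|exact: CP].
rewrite -esumZl ?lee_fin ?(ltW C'0)//; last by move=> w; rewrite mule_ge0 ?amb_ge0.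
apply: le_esum => w' _; under eq_esum do rewrite -muleA.
rewrite esumZl ?amb_ge0//; last by move=> w; rewrite mule_ge0 ?amb_ge0.
rewrite (_ : C'%:E * (amb mu k phi w' * (v w')%:E) = amb mu k phi w' * (C' * v w')%:E); last by rewrite muleCA EFinM.
by apply: lee_wpmul2l; [exact: amb_ge0|exact: C'P].
Qed.

Section weighted_norms.
Variables (m : Z -> R) (p q : \bar R).
Hypothesis m_gt0 : forall z, (0 < m z)%R.
Hypothesis m_moderate : exists C, forall z w, (m (z + w) <= C * v z * m w)%R.
Hypotheses (p_gt0 : 0 < p) (q_gt0 : 0 < q).

Lemma moderate_ge0 : exists2 C, (0 < C)%R & forall z w, (m (z + w) <= C * v z * m w)%R.
Proof.
have [C CP] := m_moderate; exists C => //.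
have := lt_le_trans (m_gt0 _) (CP 0%R 0%R).
by rewrite pmulr_lgt0// pmulr_lgt0.
Qed.

Lemma moderate_cube n : exists C, forall z u, cube t n u -> (m (z + u) <= C * m z)%R.
Proof.
have [C C0 CP] := moderate_ge0; have [C' C'P] := v_cube n.
exists (C * C')%R => z u nu'; rewrite addrC; apply: le_trans (CP u z) _.
by rewrite ler_wpM2r ?ler_wpM2l ?C'P ?ltW.
Qed.

(** The common source of the upper bounds: b will be the tail of a coefficient family or a single
    coefficient. *)
Lemma mixed_norm_local_max (Theta : Z -> \bar R) : (forall z, 0 <= Theta z) -> decaying t v Theta ->
  exists2 C : R, (0 < C)%R & forall (b H : Z -> \bar R), (forall z, 0 <= b z) ->
  (forall z, `|H z| <= \esum_(w in L) (Theta (w - z)%R * b w)) ->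
  mixed_norm mu nu p q m (local_max mu nu Q H) <=
  C%:E * lattice_norm t1 t2 p q (fun z => b z * (m z)%:E).
Proof.
move=> T0 dT.
have [C C0 CP] := decaying_convolution v_gt0 v_sub v_even v_cube T0 dT Q_precompact m_gt0 m_moderate p_gt0 q_gt0.
have [C' C'0 C'P] := mixed_norm_lattice mu_haar nu_haar p_gt0 q_gt0 m_gt0 (moderate_cube 1).
exists (C' * C)%R => [|b H b0 Hb]; first exact: mulr_gt0.
have [a [a0 aP aN]] := CP b b0.
apply: (le_trans (C'P _ a a0 _)) => [z|]; last first.
  by rewrite EFinM -muleA; apply: lee_wpmul2l => //; rewrite lee_fin ltW.
have l0 := phase_setT_gt0 mu_haar nu_haar.
rewrite gee0_abs; last exact: ess_sup_on_ge0.
apply/ess_supP; apply: nearW => x; rewrite patchE; case: ifPn => [/set_mem [y Qy <-]|_]; last exact: a0.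
apply: (le_trans (Hb _)).
have zE : (z + y = rnd t z + (z - rnd t z) + y)%R by rewrite [(rnd t z + _)%R]addrC subrK.
rewrite zE; apply: aP => //; [exact: lattice_rnd|exact: cube_sub_rnd].
Qed.

End weighted_norms.
Hypotheses (g_phi : decaying t v (amb mu g phi)).

(** * Upper bounds and expansions for a dual pair, later (phi, h) and (h, phi) *)

Section dual_pair.
Variables g1 g2 : G -> R[i].
Hypotheses (g1_L2 : cL2 mu g1) (g2_L2 : cL2 mu g2).
Hypotheses (g1_phi : decaying t v (amb mu g1 phi)) (g_g2 : decaying t v (amb mu g g2)).
Hypothesis S : forall f, cL2 mu f -> frame_operator mu L g1 g2 f f.
Hypothesis sampling : exists2 C : R, (0 < C)%R & forall k, cL2 mu k ->
  \esum_(w in L) (amb mu k g2 w * (v w)%:E) <= C%:E * tnorm k.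
Local Notation res := (reservoir mu nu phi v).
Local Notation term F := (gabor_term mu F g1 g2).

Let coef (F : (G -> R[i]) -> R[i]) (w : Z) : \bar R := (cmod (F (tfshift w g1)))%:E.

Let coef_ge0 F w : 0 <= coef F w. Proof. by rewrite lee_fin cmod_ge0. Qed.

Section norms.
Variables (m : Z -> R) (p q : \bar R).
Hypothesis m_gt0 : forall z, (0 < m z)%R.
Hypothesis m_moderate : exists C, forall z w, (m (z + w) <= C * v z * m w)%R.
Hypotheses (p_gt0 : 0 < p) (q_gt0 : 0 < q).
Local Notation mnorm := (mod_norm mu nu p q m g Q).
Local Notation dnorm b := (lattice_norm t1 t2 p q (fun z => b z * (m z)%:E)).

Lemma expansion_remainder : exists2 C : R, (0 < C)%R & forall F (W : {fset Z}), res F ->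
  [set` W] `<=` L ->
  mnorm (fun k => F k - \sum_(w <- W) term F w k)%R <=
  C%:E * dnorm (fun w => if w \in W then 0 else coef F w).
Proof.
have [C C0 CP] := mixed_norm_local_max m_gt0 m_moderate p_gt0 q_gt0 (amb_ge0 mu g g2) g_g2.
exists C => // F W Fr WL; apply: CP => [z|z]; first by case: ifP.
have zt : tspace (tfshift z g).
  exact: (test_space_tfshift sc mu_haar nu_haar v_meas v_gt0 v_sub v_cube phi_window z g_L2 g_phi).
have ambE w : amb mu (tfshift z g) g2 w = amb mu g g2 (w - z)%R by exact: amb_tfshift.
have [C' C'0 C'P] := lattice_sum (amb_ge0 mu g g2) g_g2.
have fin : \esum_(w in L) (amb mu (tfshift z g) g2 w * (v w)%:E) < +oo.
  rewrite (eq_esum (b := fun w => amb mu g g2 (w - z)%R * (v w)%:E)) => [|w _]; last by rewrite ambE.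
  by apply: le_lt_trans (C'P z) _; exact: ltry.
have := functional_expansion sc mu_haar nu_haar v_meas v_gt0 v_sub v_cube phi_window Fr g1_L2 g2_L2 g1_phi S zt fin WL.
move=> le1; rewrite gee0_abs ?lee_fin ?cmod_ge0//.
apply: (le_trans le1); apply: le_esum => w _; rewrite ambE.
by case: ifP => _; rewrite ?mule0.
Qed.

Lemma mod_norm_le_coef : exists2 C : R, (0 < C)%R & forall F, res F ->
  mnorm F <= C%:E * dnorm (coef F).
Proof.
have [C C0 CP] := expansion_remainder; exists C => // F Fr.
have fs0 : [set` (fset0 : {fset Z})] `<=` L by move=> x; rewrite /= inE.
have := CP F fset0 Fr fs0.
have -> : (fun k => F k - \sum_(w <- (fset0 : {fset Z})) term F w k)%R = F.
  by apply/funext => k; rewrite big_seq_fset0 subr0.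
by [].
Qed.

(** One term of the sampling inequality bounds <f, pi(w) g2> by a multiple of the test norm of f. *)
Lemma gabor_term_reservoir F w : L w -> res (term F w).
Proof.
move=> Lw; have w2 := cL2_tfshift sc mu_haar w g2_L2; split.
  move=> c f k [f2 _] [k2 _]; rewrite /gabor_term innerJ innerDl//; last exact: cL2Z.
  by rewrite innerZl// conjcD conjcM -!innerJ mulrDr mulrCA.
have [C C0 CP] := sampling.
exists (cmod (F (tfshift w g1)) * ((v w)^-1 * C))%R => f [f2 _].
rewrite /gabor_term cmodM cmod_inner_sym// EFinM EFinM [((v w)^-1 * C)%:E]EFinM -!muleA.
apply: lee_wpmul2l; first by rewrite lee_fin cmod_ge0.
rewrite -(lee_pmul2l (x := (v w)%:E))//; last by rewrite lte_fin.
have vv : (v w)%:E * ((v w)^-1)%:E = 1 by rewrite -EFinM divff// gt_eqF.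
rewrite [X in _ <= X](_ : _ = C%:E * tnorm f); last by rewrite muleA vv mul1e.
apply: le_trans (CP f f2); rewrite muleC.
change (amb mu f g2 w * (v w)%:E <= \esum_(w0 in L) (amb mu f g2 w0 * (v w0)%:E)).
apply: (esum_term (a := fun w0 => amb mu f g2 w0 * (v w0)%:E)) => // i.
by rewrite mule_ge0// amb_ge0.
Qed.

Lemma gabor_term_mod_norm F w : L w -> mnorm (term F w) < +oo.
Proof.
move=> Lw.
have [C C0 CP] := mixed_norm_local_max m_gt0 m_moderate p_gt0 q_gt0 (amb_ge0 mu g g2) g_g2.
pose b z := if z == w then coef F w else 0.
apply: (@le_lt_trans _ _ (C%:E * dnorm b)).
  apply: CP => z; rewrite /b; first by case: ifP.
  rewrite gee0_abs ?lee_fin ?cmod_ge0// /stft /gabor_term cmodM.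
  apply: (@le_trans _ _ (amb mu g g2 (w - z)%R * b w)); last first.
    apply: (esum_term (a := fun w => amb mu g g2 (w - z)%R * b w)) => // i.
    by rewrite mule_ge0 ?amb_ge0// /b; case: ifP.
  rewrite /b eqxx EFinM muleC; apply: lee_wpmul2r; first exact: coef_ge0.
  rewrite cmod_inner_sym.
  change (amb mu (tfshift z g) g2 w <= amb mu g g2 (w - z)%R).
  by rewrite (amb_tfshift sc mu_haar z w g_L2 g2_L2).
rewrite (_ : (fun z => b z * (m z)%:E) = (fun z => if z == w then coef F w * (m w)%:E else 0)).
  have cm0 : 0 <= coef F w * (m w)%:E by rewrite mule_ge0// lee_fin ltW.
  rewrite (lattice_norm_delta p_gt0 q_gt0 Lw cm0).
  exact: (ltry (C * (cmod (F (tfshift w g1)) * m w))%R).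
by apply/funext => z; rewrite /b; case: eqVneq => [->|]; rewrite ?mul0e.
Qed.

Lemma unconditional_expansion F : p <> +oo -> q <> +oo -> res F -> dnorm (coef F) < +oo ->
  mod_unconditional_sum mu nu phi v p q m g Q L (term F) F.
Proof.
move=> poo qoo Fr fin; split => [w Lw|e e0].
  by split; [exact: gabor_term_reservoir|exact: gabor_term_mod_norm].
have [C C0 CP] := expansion_remainder.
have cm0 z : 0 <= coef F z * (m z)%:E by rewrite mule_ge0// lee_fin ltW.
have eC : (0 < e / C)%R by rewrite divr_gt0.
have [W0 [W0L W0P]] := lattice_norm_tail p_gt0 q_gt0 poo qoo cm0 fin eC.
exists W0; split => // W W0W WL.
apply: (le_lt_trans (CP F W Fr WL)).
rewrite (_ : (fun z => (if z \in W then 0 else coef F z) * (m z)%:E) =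
             (fun z => if z \in W then 0 else coef F z * (m z)%:E)); last first.
  by apply/funext => z; case: ifP => _; rewrite ?mul0e.
rewrite (_ : e%:E = C%:E * (e / C)%:E); last by rewrite -EFinM mulrC divfK// gt_eqF.
by rewrite lte_pmul2l ?lte_fin//; exact: W0P.
Qed.

End norms.
Lemma coef_bound F : res F -> exists2 C : R, (0 <= C)%R & forall w, coef F w <= (C * v w)%:E.
Proof.
move=> [_ [CF CFP]].
have [C C0 CP] := test_norm_tfshift sc mu_haar nu_haar v_meas v_gt0 v_sub v_cube phi_window g1_L2 g1_phi.
exists (`|CF| * C)%R; first by rewrite mulr_ge0// ltW.
move=> w; have wt : tspace (tfshift w g1).
  exact: (test_space_tfshift sc mu_haar nu_haar v_meas v_gt0 v_sub v_cube phi_window w g1_L2 g1_phi).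
apply: (le_trans (CFP _ wt)); apply: (@le_trans _ _ (`|CF|%:E * tnorm (tfshift w g1))).
  by apply: lee_wpmul2r; [exact: Lnorm_ge0|rewrite lee_fin ler_norm].
by rewrite -mulrA EFinM; apply: lee_wpmul2l; [rewrite lee_fin|exact: CP].
Qed.

(** The coefficients of any functional in the reservoir grow at most like v ([coef_bound]), which
    places F in M^oo_{1/v}. Against a test function k the error is the tail of the samples of k
    times these coefficients, summable by the sampling inequality. *)
Lemma weakstar_expansion F : res F -> mod_weakstar_sum mu nu phi v g Q L (term F) F.
Proof.
move=> Fr; have [C C0 CP] := coef_bound Fr.
have vi_gt0 z : (0 < (v z)^-1)%R by rewrite invr_gt0.
have vi_mod : exists C, forall z w, ((v (z + w))^-1 <= C * v z * (v w)^-1)%R.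
  exists 1%R => z w; rewrite mul1r -[(v z * _)%R]invrK invfM invrK lef_pV2 ?posrE ?divr_gt0 ?mulr_gt0//.
  rewrite ler_pdivrMl//.
  by rewrite -{1}(addKr z w) -[v z]v_even; apply: v_sub.
have oo0 : 0 < +oo :> \bar R by [].
split.
- split => //; have [C' C'0 C'P] := mod_norm_le_coef vi_gt0 vi_mod oo0 oo0.
  apply: (le_lt_trans (C'P F Fr)).
  apply: (@le_lt_trans _ _ (C' * C)%:E); last exact: ltry.
  rewrite EFinM; apply: lee_wpmul2l; first by rewrite lee_fin ltW.
  have h z : coef F z * ((v z)^-1)%:E <= C%:E.
    apply: (@le_trans _ _ ((C * v z)%:E * ((v z)^-1)%:E)).
      by apply: lee_wpmul2r => //; rewrite lee_fin ltW.
    by rewrite -EFinM mulfK// gt_eqF.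
  have h0 z : 0 <= coef F z * ((v z)^-1)%:E by rewrite mule_ge0// lee_fin ltW.
  apply: ge_ereal_sup => _ [y Ly <-]; rewrite gee0_abs; last by apply: lnorm_ge0; exact: lattice_neq0.
  by apply: ge_ereal_sup => _ [x Lx <-]; rewrite gee0_abs.
- move=> w Lw; split; first exact: gabor_term_reservoir.
  exact: gabor_term_mod_norm.
move=> k [k2 kt] _ e e0.
have [C' C'0 C'P] := sampling.
pose a w := amb mu k g2 w * coef F w.
have a0 w : 0 <= a w by rewrite mule_ge0 ?amb_ge0.
have fink : \esum_(w in L) (amb mu k g2 w * (v w)%:E) < +oo.
  apply: (le_lt_trans (C'P k k2)).
  by apply: lte_mul_pinfty => //; rewrite lee_fin ltW.
have fin : \esum_(w in L) a w < +oo.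
  apply: (@le_lt_trans _ _ (C%:E * \esum_(w in L) (amb mu k g2 w * (v w)%:E))).
    rewrite -esumZl ?lee_fin//; last by move=> w; rewrite mule_ge0 ?amb_ge0.
    apply: le_esum => w _; rewrite (_ : C%:E * (amb mu k g2 w * (v w)%:E) = amb mu k g2 w * (C * v w)%:E); last by rewrite muleCA EFinM.
    by apply: lee_wpmul2l => //; exact: amb_ge0.
  by apply: lte_mul_pinfty => //; rewrite lee_fin.
have [W0 [W0L W0P]] := esum_tail a0 fin e0.
exists W0; split => // W W0W WL.
have := functional_expansion sc mu_haar nu_haar v_meas v_gt0 v_sub v_cube phi_window Fr g1_L2 g2_L2 g1_phi S (conj k2 kt) fink WL.
move=> le1; apply: (le_lt_trans le1); apply: le_lt_trans W0P.
apply: le_esum => w _; case: ifPn => [_|wW]; first by case: ifP.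
rewrite ifF//; apply/negP => wW0; move/negP: wW; apply; exact: W0W.
Qed.

End dual_pair.

(** * Lower bounds through a reproducing inequality *)

Section lower_bounds.
Variable h : G -> R[i].
Hypothesis h_L2 : cL2 mu h.
Hypotheses (h_phi : decaying t v (amb mu h phi)) (phi_h : decaying t v (amb mu phi h))
  (h_h : decaying t v (amb mu h h)) (g_h : decaying t v (amb mu g h))
  (phi_g : decaying t v (amb mu phi g)).
Hypothesis g_reflected : reflected_inner mu g g != 0%R.
Hypothesis S_phi_h : forall f, cL2 mu f -> frame_operator mu L phi h f f.
Local Notation res := (reservoir mu nu phi v).
Let coef (F : (G -> R[i]) -> R[i]) g (w : Z) : \bar R := (cmod (F (tfshift w g)))%:E.
Let coef_ge0 F k w : 0 <= coef F k w. Proof. by rewrite lee_fin cmod_ge0. Qed.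

Let cL : countable L.
Proof.
rewrite lattice_product; apply: countableX.
  exact: (countable_lattice t1 mu_haar).
exact: (countable_lattice t2 nu_haar).
Qed.

Section reproducing.
Variables (F : (G -> R[i]) -> R[i]) (S : Z -> \bar R) (a : Z).
Hypothesis F_res : res F.
Hypothesis S_ge0 : forall z, 0 <= S z.
Hypothesis F_le_S : lam.-negligible [set z : BZ | S (rnd t (z : Z)) < coef F g z].
Let f := tfshift a phi.
Let f2 : cL2 mu f. Proof. exact: cL2_tfshift. Qed.
Let X z := amb mu f g z.
Let Y w z := amb mu (tfshift w h) g z.
Let kappa : \bar R := (cmod (reflected_inner mu g g))%:E.
(** The w-th terms of two truncation errors: that of F at pi(a) phi, and that of z |-> F (pi(z) g)
    under the integral. Summability of [b] lets one finite set make both small in [reproducing]. *)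
Let b w := kappa * (amb mu f h w * coef F phi w) + coef F phi w * \int[lam]_z (X z * Y w z).

Let X0 z : 0 <= X z. Proof. exact: amb_ge0. Qed.
Let Y0 w z : 0 <= Y w z. Proof. exact: amb_ge0. Qed.
Let kappa0 : 0 <= kappa. Proof. by rewrite lee_fin cmod_ge0. Qed.
Let mX : measurable_fun [set: BZ] X. Proof. exact: measurable_amb. Qed.
Let mY w : measurable_fun [set: BZ] (Y w).
Proof. by apply: measurable_amb => //; exact: cL2_tfshift. Qed.
Let mXY w : measurable_fun [set: BZ] (fun z => X z * Y w z).
Proof. exact: measurable_phaseM. Qed.
Let iXY0 w : 0 <= \int[lam]_z (X z * Y w z).
Proof. by apply: integral_ge0 => z _; rewrite mule_ge0. Qed.
Let b1_ge0 w : 0 <= kappa * (amb mu f h w * coef F phi w).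
Proof. by rewrite !mule_ge0// amb_ge0. Qed.
Let b2_ge0 w : 0 <= coef F phi w * \int[lam]_z (X z * Y w z). Proof. by rewrite mule_ge0. Qed.
Let b_ge0 w : 0 <= b w. Proof. by rewrite adde_ge0. Qed.

Let YE w z : Y w z = amb mu g h (w - z)%R.
Proof. by rewrite /Y (amb_tfshift sc mu_haar w z h_L2 g_L2) (amb_sym sc mu_haar _ h_L2 g_L2) opprB. Qed.

Let integral_Xv : \int[lam]_z (X z * (v z)%:E) < +oo.
Proof.
apply: (decaying_integral mu_haar nu_haar v_gt0 v_sub v_cube X0).
exact: (decaying_tfshift sc mu_haar v_gt0 v_sub v_even v_cube a phi_L2 g_L2 phi_g).
Qed.

Let b_sum : \esum_(w in L) b w < +oo.
Proof.
have [C C0 CP] := coef_bound phi_L2 phi_decaying F_res.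
rewrite esumD//; apply: lte_add_pinfty.
  rewrite esumZl//; last by move=> w; rewrite mule_ge0 ?amb_ge0.
  apply: lte_mul_pinfty => //.
  have [C1 C10 C1P] := lattice_sum (amb_ge0 mu phi h) phi_h.
  apply: (@le_lt_trans _ _ (C%:E * (C1 * v a)%:E)); last by rewrite -EFinM ltry.
  apply: le_trans (lee_wpmul2l _ (C1P a)); last by rewrite lee_fin.
  rewrite -esumZl ?lee_fin//; last by move=> w; rewrite mule_ge0 ?amb_ge0.
  apply: le_esum => w _; rewrite (amb_tfshift sc mu_haar a w phi_L2 h_L2).
  rewrite (_ : C%:E * (amb mu phi h (w - a)%R * (v w)%:E) = amb mu phi h (w - a)%R * (C * v w)%:E); last by rewrite muleCA EFinM.
  by apply: lee_wpmul2l; [exact: amb_ge0|exact: CP].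
have [C1 C10 C1P] := lattice_sum (amb_ge0 mu g h) g_h.
have le1 : \esum_(w in L) (coef F phi w * \int[lam]_z (X z * Y w z)) <=
    C%:E * \int[lam]_z (X z * (C1 * v z)%:E).
  apply: (@le_trans _ _ (C%:E * \esum_(w in L) \int[lam]_z (X z * Y w z * (v w)%:E))).
    rewrite -esumZl ?lee_fin//; last by move=> w; apply: integral_ge0 => z _; rewrite !mule_ge0.
    apply: le_esum => w _.
    rewrite (_ : (fun z : BZ => X z * Y w z * (v w)%:E) = (fun z => (v w)%:E * (X z * Y w z))); last first.
      by apply/funext => z; rewrite muleC.
    rewrite ge0_integralZl//; last by move=> z _; rewrite mule_ge0.
    by rewrite muleA; apply: lee_wpmul2r => //; rewrite -EFinM; exact: CP.
  apply: lee_wpmul2l; first by rewrite lee_fin.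
  rewrite -integral_esum//; last 2 first.
  - by move=> w; apply: measurable_phaseM => //; exact: measurable_cst.
  - by move=> w z; rewrite !mule_ge0.
  apply: le_phase_integral => z; first by apply: esum_ge0 => w _; rewrite !mule_ge0.
  rewrite (eq_esum (b := fun w => X z * (Y w z * (v w)%:E))); last by move=> w _; rewrite muleA.
  rewrite esumZl//; last by move=> w; rewrite mule_ge0.
  apply: lee_wpmul2l => //; rewrite (eq_esum (b := fun w => amb mu g h (w - z)%R * (v w)%:E)) => [|w _]; [exact: C1P|by rewrite YE].
apply: (le_lt_trans le1); apply: lte_mul_pinfty; rewrite ?lee_fin//.
rewrite (_ : (fun z : BZ => X z * (C1 * v z)%:E) = (fun z => C1%:E * (X z * (v z)%:E))); last first.
  by apply/funext => z; rewrite EFinM muleCA.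
rewrite ge0_integralZl//; last 3 first.
- by apply: measurable_phaseM => //; exact/measurable_EFinP.
- by move=> z _; rewrite mule_ge0.
- by rewrite lee_fin ltW.
by apply: lte_mul_pinfty; rewrite ?lee_fin ?(ltW C10).
Qed.

(* F is represented by the partial sums of sum_w F(pi(w) phi) pi(w) h, to which
   the orthogonality relation in L^2 applies. The bound by S is only used almost
   everywhere, so z |-> F(pi(z) g) need not be shown to be measurable. *)
Lemma reproducing : kappa * coef F phi a <= \int[lam]_z (X z * S (rnd t z)).
Proof.
apply/lee_addgt0Pr => e e0.
have [W [WL We]] := esum_tail b_ge0 b_sum e0.
pose kW : G -> R[i] := fun x => (\sum_(w <- W) F (tfshift w phi) * tfshift w h x)%R.
have h'2 w : cL2 mu (tfshift w h) by exact: cL2_tfshift.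
have kW2 : cL2 mu kW by apply: cL2_sum => w; exact: cL2Z.
have expand f' : tspace f' -> \esum_(w in L) (amb mu f' h w * (v w)%:E) < +oo ->
    (cmod (F f' - inner mu kW f'))%:E <= \esum_(w in L) (if w \in W then 0 else amb mu f' h w * coef F phi w).
  move=> tf' fin; have f'2 := tf'.1.
  rewrite /kW inner_suml//.
  exact: (functional_expansion sc mu_haar nu_haar v_meas v_gt0 v_sub v_cube phi_window F_res phi_L2 h_L2 phi_decaying S_phi_h tf' fin WL).
have shift_sum k z : cL2 mu k -> decaying t v (amb mu k h) ->
    \esum_(w in L) (amb mu (tfshift z k) h w * (v w)%:E) < +oo.
  move=> k2 dk; have [C1 C10 C1P] := lattice_sum (amb_ge0 mu k h) dk.
  apply: le_lt_trans (ltry (C1 * v z)%R); apply: le_trans (C1P z).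
  by apply: le_esum => w _; rewrite (amb_tfshift sc mu_haar z w k2 h_L2).
have tf : tspace f.
  exact: (test_space_tfshift sc mu_haar nu_haar v_meas v_gt0 v_sub v_cube phi_window a phi_L2 phi_decaying).
have tg z : tspace (tfshift z g).
  exact: (test_space_tfshift sc mu_haar nu_haar v_meas v_gt0 v_sub v_cube phi_window z g_L2 g_phi).
pose tail1 := \esum_(w in L) (if w \in W then 0 else amb mu f h w * coef F phi w).
pose T z := \esum_(w in L) (if w \in W then 0 else coef F phi w * Y w z).
have T0 z : 0 <= T z by apply: esum_ge0 => w _; case: ifP => // _; rewrite mule_ge0.
have tail10 : 0 <= tail1 by apply: esum_ge0 => w _; case: ifP => // _; rewrite mule_ge0 ?amb_ge0.
have le1 : coef F phi a <= (cmod (inner mu f kW))%:E + tail1.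
  rewrite cmod_inner_sym; have := expand f tf (shift_sum phi a phi_L2 phi_h).
  by move=> /(leeD2l (cmod (inner mu kW f))%:E); apply: le_trans; rewrite -EFinD lee_fin cmod_dist.
have le2 : kappa * (cmod (inner mu f kW))%:E <= \int[lam]_z (X z * amb mu kW g z).
  apply: (le_stft_orthogonality sc mu_haar nu_dual _ g_window g_window kW2).
    exact: (window_tfshift sc mu_haar a phi_window).
  move=> x; apply: (amb_section nu_haar v_gt0 v_low x f2 g_L2).
  exact: (decaying_tfshift sc mu_haar v_gt0 v_sub v_even v_cube a phi_L2 g_L2 phi_g).
have mT : measurable_fun [set: BZ] T.
  apply: measurable_esum => // w; last by move=> z; case: ifP => // _; rewrite mule_ge0.
  by case: (w \in W); [exact: measurable_cst|apply: measurable_phaseM => //; exact: measurable_cst].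
have mS : measurable_fun [set: BZ] (fun z : BZ => S (rnd t (z : Z))).
  exact: (measurable_rnd_product t1 t2 mu_haar nu_haar S).
have le3 : \int[lam]_z (X z * amb mu kW g z) <= \int[lam]_z (X z * (S (rnd t z) + T z)).
  apply: ae_ge0_le_integral => //.
  - by move=> z _; rewrite mule_ge0// amb_ge0.
  - by apply: measurable_phaseM => //; exact: measurable_amb.
  - by move=> z _; rewrite mule_ge0// adde_ge0.
  - by apply: measurable_phaseM => //; exact: emeasurable_funD.
  apply: negligibleS F_le_S => z /= nz; rewrite ltNge; apply/negP => Sz; apply: nz => _.
  apply: lee_wpmul2l => //.
  have := expand (tfshift z g) (tg z) (shift_sum g z g_L2 g_h).
  move=> le1'; apply: (@le_trans _ _ (coef F g z + T z)); last by apply: leeD2r.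
  apply: (@le_trans _ _ (coef F g z + (cmod (F (tfshift z g) - inner mu kW (tfshift z g)))%:E)).
    by rewrite /amb /coef -EFinD lee_fin [X in (_ + X)%R]cmodBC cmod_dist.
  apply: leeD2l; apply: (le_trans le1'); apply: le_esum => w _; case: ifP => // _.
  by rewrite YE (amb_tfshift sc mu_haar z w g_L2 h_L2) muleC.
have le4 : \int[lam]_z (X z * (S (rnd t z) + T z)) = \int[lam]_z (X z * S (rnd t z)) +
   \esum_(w in L) (if w \in W then 0 else coef F phi w * \int[lam]_z (X z * Y w z)).
  rewrite (_ : (fun z : BZ => X z * (S (rnd t (z : Z)) + T z)) = (fun z => X z * S (rnd t (z : Z)) + X z * T z)); last first.
    by apply/funext => z; rewrite ge0_muleDr.
  rewrite ge0_integralD//; last 4 first.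
  - by move=> z _; rewrite mule_ge0.
  - exact: measurable_phaseM.
  - by move=> z _; rewrite mule_ge0.
  - exact: measurable_phaseM.
  congr (_ + _).
  rewrite (_ : (fun z : BZ => X z * T z) = (fun z => \esum_(w in L) (if w \in W then 0 else coef F phi w * (X z * Y w z)))); last first.
    apply/funext => z; rewrite /T -esumZl//; last by move=> w; case: ifP => // _; rewrite mule_ge0.
    by apply: eq_esum => w _; case: ifP => _; rewrite ?mule0// muleCA.
  rewrite integral_esum//; last 2 first.
  - by move=> w; case: (w \in W); [exact: measurable_cst|apply: measurable_phaseM => //; exact: measurable_cst].
  - by move=> w z; case: ifP => // _; rewrite !mule_ge0.
  apply: eq_esum => w _; case: ifP => _; first exact: integral0.
  by rewrite ge0_integralZl// => z _; rewrite mule_ge0.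
apply: (@le_trans _ _ (kappa * ((cmod (inner mu f kW))%:E + tail1))); first exact: lee_wpmul2l.
rewrite ge0_muleDr ?lee_fin ?cmod_ge0//.
apply: (@le_trans _ _ (\int[lam]_z (X z * S (rnd t z)) + \esum_(w in L) (if w \in W then 0 else b w))); last first.
  by apply: leeD2l; exact: ltW.
rewrite (_ : \esum_(w in L) (if w \in W then 0 else b w) = kappa * tail1 +
   \esum_(w in L) (if w \in W then 0 else coef F phi w * \int[lam]_z (X z * Y w z))); last first.
  rewrite -esumZl//; last by move=> w; case: ifP => // _; rewrite mule_ge0 ?amb_ge0.
  rewrite -esumD.
  - by apply: eq_esum => w _; case: ifP => _; rewrite ?mule0 ?adde0.
  - by move=> w _; case: ifP => _; rewrite ?mule0.
  - by move=> w _; case: ifP.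
rewrite addeCA addeC; apply: leeD2r.
by rewrite -le4; apply: (le_trans le2).
Qed.

End reproducing.
Lemma decaying_cube_sup (Theta : Z -> \bar R) : (forall z, 0 <= Theta z) -> decaying t v Theta ->
  decaying t v (fun y => ereal_sup [set Theta (y + u)%R | u in cube t 1]).
Proof.
move=> T0 dT n; have [k [k0 kP kr]] := dT (n + 1)%N.
exists k; split => // w u Lw nu'.
apply: ge_ereal_sup => _ [u' cu' <-]; rewrite -addrA; apply: kP => //; exact: cubeD.
Qed.

Section local_suprema.
Variables (V1 : set G) (V2 : set Gh) (s : seq Z).
Hypotheses (oV : open V1 /\ open V2) (V0 : V1 0%R /\ V2 0%R) (Vc : V1 `<=` cell t1 /\ V2 `<=` cell t2).
Hypothesis VQ : forall x y, (V1 `*` V2) x -> (V1 `*` V2) y -> Q (x - y)%R.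
Hypothesis sV : cube t 1 `<=` [set y | exists2 x, x \in s & (V1 `*` V2) (y - x)%R].
Let B (F : (G -> R[i]) -> R[i]) (u w : Z) := ess_sup_on lam [set w + u + y | y in V1 `*` V2]%R (coef F g).
Let B0 F u w : 0 <= B F u w. Proof. by apply: ess_sup_on_ge0; exact: phase_setT_gt0. Qed.

(** Every point of a cell lies in one of finitely many translates of V1 x V2. Exceeding the
    essential supremum over it happens on a null set, and there are countably many cells. *)
Lemma negligible_local_sup F :
  lam.-negligible [set z : BZ | \esum_(u in [set` s]) B F u (rnd t (z : Z)) < coef F g z].
Proof.
pose N u w : set BZ := [set z : Z | [set w + u + y | y in V1 `*` V2]%R z /\ B F u w < coef F g z].
have NN : lam.-negligible (\bigcup_(w in L) \bigcup_(u in [set` s]) N u w).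
  apply: countable_negligible => // w _; apply: countable_negligible => [|u _].
    exact/finite_set_countable/finite_seq.
  by have /ess_sup_onP : B F u w <= B F u w by []; move=> /(_ (coef_ge0 F g) (B0 F u w)).
apply: negligibleS NN => z /= Bz.
have [u us Vu] := sV (cube_sub_rnd t z).
exists (rnd t z); first exact: lattice_rnd.
exists u => //; split.
  by exists (z - rnd t z - u)%R => //; rewrite -addrA [(u + _)%R]addrC subrK addrC subrK.
apply: le_lt_trans Bz.
exact: (esum_term (a := fun u => B F u (rnd t z))).
Qed.

Variables (m : Z -> R) (p q : \bar R).
Hypothesis m_gt0 : forall z, (0 < m z)%R.
Hypothesis m_moderate : exists C, forall z w, (m (z + w) <= C * v z * m w)%R.
Hypotheses (p_gt0 : 0 < p) (q_gt0 : 0 < q).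
Local Notation mnorm := (mod_norm mu nu p q m g Q).
Local Notation dnorm b := (lattice_norm t1 t2 p q (fun z => b z * (m z)%:E)).

Lemma le_shift_moderate u : exists C, forall w x, cell t x -> (m w <= C * m (w + x + u))%R.
Proof.
have [C C0 CP] := moderate_ge0 m_gt0 m_moderate; have [C' C'P] := v_cube 1.
exists (C * (C' * v u))%R => w x cx.
have e : w = (- (x + u) + (w + x + u))%R by rewrite [RHS]addrC -[(w + x + u)%R]addrA addrK.
rewrite {1}e; apply: (le_trans (CP _ _)); rewrite v_even.
apply: ler_wpM2r; first exact: ltW.
apply: ler_wpM2l; first exact: ltW.
apply: (le_trans (v_sub _ _)); apply: ler_wpM2r; first exact: ltW.
by apply: C'P; exact: cell_cube.
Qed.

(** For fixed u the essential supremum over w + u + V1 x V2 is at most the local maximum at each of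
    its points, because differences of V1 x V2 lie in [Q]; [lattice_le_mixed_norm] applies, and the
    finitely many u are added by [lattice_norm_sum]. *)
Lemma local_sup_norm : exists2 C : R, (0 < C)%R & forall F, 
  dnorm (fun w => \esum_(u in [set` s]) B F u w) <= C%:E * mnorm F.
Proof.
have [_ _ mu_open] := mu_haar; have [_ _ nu_open] := nu_haar.
have [[oV1 oV2] [V10 V20] [V1c V2c]] := And3 oV V0 Vc.
have mV1 : measurable (V1 : set (borel G)) by exact: sub_sigma_algebra.
have mV2 : measurable (V2 : set (borel Gh)) by exact: sub_sigma_algebra.
have pV1 : 0 < mu V1 by apply: mu_open => //; exists 0%R.
have pV2 : 0 < nu V2 by apply: nu_open => //; exists 0%R.
have CP u := cid2 (lattice_le_mixed_norm mu_haar nu_haar p_gt0 q_gt0 m_gt0 (le_shift_moderate u)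
  mV1 mV2 V1c V2c pV1 pV2).
pose C u := s2val (CP u).
have C0 u : (0 < C u)%R := s2valP (CP u).
have BC F u : dnorm (B F u) <= (C u)%:E * mnorm F.
  apply: (s2valP' (CP u)) => [w|w x Lw x1 x2]; first exact: B0.
  have l0 := phase_setT_gt0 mu_haar nu_haar.
  rewrite gee0_abs; last exact: ess_sup_on_ge0.
  apply: le_ess_sup_on => // _ [y Vy <-]; exists (y - x)%R; first exact: VQ.
  by rewrite -!addrA; congr (w + _)%R; rewrite addrCA; congr (u + _)%R; rewrite addrC subrK.
have fs : finite_set [set` s] by exact: finite_seq.
have [k [k0 kfin kP]] := @lattice_norm_sum R _ _ _ _ t1 t2 _ [set` s] p q fs p_gt0 q_gt0.
pose K := \esum_(u in [set` s]) (fine (k u) * C u)%:E.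
have kC u : (0 <= fine (k u) * C u)%R by apply: mulr_ge0; [exact: fine_ge0|exact: ltW].
have K0 : 0 <= K by apply: esum_ge0 => u _; rewrite lee_fin.
have Kfin : K < +oo.
  by apply: rapid_sum => [u|]; [rewrite lee_fin|exact: rapid_finite].
exists (fine K + 1)%R; first by rewrite ltr_wpDl// fine_ge0.
move=> F; have N0 : 0 <= mnorm F by exact: Lnorm_ge0.
apply: (@le_trans _ _ (K * mnorm F)); last first.
  by apply: lee_wpmul2r => //; rewrite EFinD fineK ?ge0_fin_numE// leeDl.
rewrite (_ : (fun z => (\esum_(u in [set` s]) B F u z) * (m z)%:E) = (fun z => \esum_(u in [set` s]) (B F u z * (m z)%:E))); last first.
  apply/funext => z; rewrite muleC -esumZl ?lee_fin ?ltW//.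
  by apply: eq_esum => u _; rewrite muleC.
have Bm0 u z : 0 <= B F u z * (m z)%:E by rewrite mule_ge0// lee_fin ltW.
apply: (le_trans (kP (fun u z => B F u z * (m z)%:E) Bm0)).
rewrite muleC -esumZl//.
apply: le_esum => u us; rewrite EFinM fineK ?ge0_fin_numE ?kfin//.
by rewrite [X in _ <= X]muleC -muleA; apply: lee_wpmul2l.
Qed.

End local_suprema.

Section analysis_bounds.
Variables (m : Z -> R) (p q : \bar R).
Hypothesis m_gt0 : forall z, (0 < m z)%R.
Hypothesis m_moderate : exists C, forall z w, (m (z + w) <= C * v z * m w)%R.
Hypotheses (p_gt0 : 0 < p) (q_gt0 : 0 < q).
Local Notation mnorm := (mod_norm mu nu p q m g Q).
Local Notation dnorm b := (lattice_norm t1 t2 p q (fun z => b z * (m z)%:E)).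

Lemma coef_le_mod_norm : exists2 C : R, (0 < C)%R & forall F, res F ->
  dnorm (coef F phi) <= C%:E * mnorm F.
Proof.
have [V1 [V2 [oV V0 Vc VQ]]] := small_product t1 t2 Q_nbhs.
have [oV1 oV2] := oV; have [V10 V20] := V0.
have nV : nbhs (0%R : Z) (V1 `*` V2).
  by exists (V1, V2) => //; split; apply: open_nbhs_nbhs.
have [s sV] := cube_cover t 1 nV.
pose S F w := \esum_(u in [set` s]) ess_sup_on lam [set w + u + y | y in V1 `*` V2]%R (coef F g).
have S0 F w : 0 <= S F w.
  by apply: esum_ge0 => u _; apply: ess_sup_on_ge0; exact: phase_setT_gt0.
have [C1 C10 C1P] := local_sup_norm s oV V0 Vc VQ m_gt0 m_moderate p_gt0 q_gt0.
(* Taking the supremum over a unit cube allows the kernel to be evaluated at the lattice point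
   [rnd t z] instead of z. *)
pose Th y := ereal_sup [set amb mu phi g (y + u)%R | u in cube t 1].
have Th0 y : 0 <= Th y.
  apply: (@le_trans _ _ (amb mu phi g y)); first exact: amb_ge0.
  by apply: ereal_sup_ubound; exists 0%R; rewrite ?addr0//; exact: cube0.
have dTh : decaying t v Th by apply: decaying_cube_sup => // z; exact: amb_ge0.
have [C2 C20 C2P] := decaying_convolution v_gt0 v_sub v_even v_cube Th0 dTh Q_precompact m_gt0 m_moderate p_gt0 q_gt0.
have [C3 C30 C3P] := integral_le_lattice t1 t2 mu_haar nu_haar.
pose kappa := cmod (reflected_inner mu g g).
have kappa0 : (0 < kappa)%R by rewrite lt_neqAle eq_sym cmod_eq0 g_reflected cmod_ge0.
exists (kappa^-1 * (C3 * (C2 * C1)))%R; first by rewrite !mulr_gt0 ?invr_gt0.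
move=> F Fr; have [a [a0 aP aN]] := C2P (S F) (S0 F).
have le1 w : L w -> kappa%:E * coef F phi w <= C3%:E * a w.
  move=> Lw; apply: (le_trans (reproducing w Fr (S0 F) (negligible_local_sup sV F))).
  apply: (@le_trans _ _ (C3%:E * \esum_(z in L) (Th (z - w)%R * S F z))).
    apply: (C3P _ (fun z => Th (z - w)%R * S F z)) => [z|z|z]; rewrite ?mule_ge0 ?amb_ge0//.
    apply: lee_wpmul2r => //; rewrite (amb_tfshift sc mu_haar w z phi_L2 g_L2).
    apply: ereal_sup_ubound; exists (z - rnd t z)%R; first exact: cube_sub_rnd.
    by congr (amb mu phi g _); rewrite addrC addrA subrK.
  apply: lee_wpmul2l; first by rewrite lee_fin ltW.
  by have := aP w 0%R 0%R Lw (cube0 t 1) Q0; rewrite !addr0.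
have -> : dnorm (coef F phi) = (kappa^-1)%:E * (kappa%:E * dnorm (coef F phi)).
  by rewrite muleA -EFinM mulVf ?gt_eqF// mul1e.
rewrite EFinM -muleA; apply: lee_wpmul2l; first by rewrite lee_fin invr_ge0 ltW.
rewrite -(lattice_normZ t1 t2 (fun z => coef F phi z * (m z)%:E) p_gt0 q_gt0 kappa0).
apply: (@le_trans _ _ (C3%:E * dnorm a)).
  rewrite -(lattice_normZ t1 t2 (fun z => a z * (m z)%:E) p_gt0 q_gt0 C30).
  apply: le_lattice_norm => // z Lz.
  have m0 : 0 <= (m z)%:E by rewrite lee_fin ltW.
  rewrite !gee0_abs ?mule_ge0 ?lee_fin ?(ltW C30) ?(ltW kappa0) ?cmod_ge0//.
  by rewrite !muleA; apply: lee_wpmul2r => //; exact: le1.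
rewrite EFinM -muleA; apply: lee_wpmul2l; first by rewrite lee_fin ltW.
apply: (le_trans aN); rewrite EFinM -muleA; apply: lee_wpmul2l; first by rewrite lee_fin ltW.
exact: C1P.
Qed.

(** Coefficients against [h] are compared with those against [phi] instead of being derived from
    [reproducing]: the orthogonality relation asks for continuous windows, and [h] is only known to
    be square integrable. *)
Lemma coef_dual_le : exists2 C : R, (0 < C)%R & forall F, res F ->
  dnorm (coef F h) <= C%:E * dnorm (coef F phi).
Proof.
have [C C0 CP] := decaying_convolution v_gt0 v_sub v_even v_cube (amb_ge0 mu h h) h_h Q_precompact m_gt0 m_moderate p_gt0 q_gt0.
exists C => // F Fr; have [a [a0 aP aN]] := CP (coef F phi) (coef_ge0 F phi).
apply: le_trans aN; apply: le_lattice_norm => // z Lz.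
have m0 : 0 <= (m z)%:E by rewrite lee_fin ltW.
rewrite !gee0_abs ?mule_ge0//; apply: lee_wpmul2r => //.
have := aP z 0%R 0%R Lz (cube0 t 1) Q0; rewrite !addr0; apply: le_trans.
have zt : tspace (tfshift z h).
  exact: (test_space_tfshift sc mu_haar nu_haar v_meas v_gt0 v_sub v_cube phi_window z h_L2 h_phi).
have ambE w : amb mu (tfshift z h) h w = amb mu h h (w - z)%R by exact: amb_tfshift.
have [C' C'0 C'P] := lattice_sum (amb_ge0 mu h h) h_h.
have fin : \esum_(w in L) (amb mu (tfshift z h) h w * (v w)%:E) < +oo.
  rewrite (eq_esum (b := fun w => amb mu h h (w - z)%R * (v w)%:E)) => [|w _]; last by rewrite ambE.
  by apply: le_lt_trans (C'P z) _; exact: ltry.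
have fs0 : [set` (fset0 : {fset Z})] `<=` L by move=> x; rewrite /= inE.
have := functional_expansion sc mu_haar nu_haar v_meas v_gt0 v_sub v_cube phi_window Fr phi_L2 h_L2 phi_decaying S_phi_h zt fin fs0.
rewrite big_seq_fset0 subr0 => le1; apply: (le_trans le1).
by apply: le_esum => w _; rewrite ambE.
Qed.

End analysis_bounds.
End lower_bounds.
End expansions.

(** * Conclusion *)

Section reflected_norm.
Context {R : realType} {X : lcaType}.
Variable mu : {sigma_finite_measure set (borel X) -> \bar R}.
Hypothesis mu_haar : is_haar (fun x y : X => x + y) mu.

(** The quantity is the squared norm of the reflection of g. A continuous function different from 0
    at a point is so on an open set, which has positive Haar measure. *)
Lemma reflected_inner_neq0 (g : X -> R[i]) : window mu g -> (exists x, g x != 0) ->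
  reflected_inner mu g g != 0.
Proof.
move=> [cg g2 g2' _] [x0 gx0]; apply/negP => /eqP r0.
have [_ _ mu_open] := mu_haar.
pose N : set X := [set x | g (- x) != 0].
have cg' : continuous ((fun x => g (- x)) : X -> R[i]^o).
  exact: (continuousT_comp (@opp_continuous X) cg).
have oN : open N.
  rewrite (_ : N = (fun x => cmod (g (- x))) @^-1` [set r : R | 0 < r]).
    apply: open_comp; last exact: open_gt.
    by move=> x _; exact: (continuousT_comp cg' cmod_continuous).
  have e x : (0 < cmod (g (- x))) = (g (- x) != 0) by rewrite lt_neqAle cmod_ge0 andbT eq_sym cmod_eq0.
  by apply/seteqP; split => x; rewrite /N /= e.
have N0 : N !=set0 by exists (- x0); rewrite /N /= opprK.
have mf : measurable_fun [set: borel X] (fun x => (cmod (g (- x)) ^+ 2)%:E).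
  by apply/measurable_EFinP; apply: measurable_funX; apply: measurable_cmod; exact: g2'.1.
have fin : (\int[mu]_x (cmod (g (- x)) ^+ 2)%:E < +oo)%E by exact/cLnorm2_ltyE/g2'.2.
have i0 : (0 <= \int[mu]_x (cmod (g (- x)) ^+ 2)%:E)%E.
  by apply: integral_ge0 => x _; rewrite lee_fin sqr_ge0.
have : (\int[mu]_x `|(cmod (g (- x)) ^+ 2)%:E| = 0)%E.
  rewrite (_ : (\int[mu]_x _)%E = (\int[mu]_x (cmod (g (- x)) ^+ 2)%:E)%E); last first.
    by apply: eq_integral => x _; rewrite gee0_abs// lee_fin sqr_ge0.
  have fn : (\int[mu]_x (cmod (g (- x)) ^+ 2)%:E)%E \is a fin_num by rewrite ge0_fin_numE.
  rewrite -(fineK fn); congr (_%:E); have := congr1 (@complex.Re R) r0.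
  rewrite /reflected_inner /cintegral /=; move=> <-.
  by rewrite /Rintegral; congr fine; apply: eq_integral => x _; rewrite mulJ_cmod.
move=> /ae_eq_integral_abs => /(_ measurableT mf) [A [mA A0 NA]].
have : (mu N <= mu A)%E.
  apply: le_measure; rewrite ?inE//; first exact: sub_sigma_algebra.
  move=> x Nx; apply: NA => /= /(_ I) [] /eqP.
  by rewrite sqrf_eq0 cmod_eq0; apply/negP.
by rewrite A0 leNgt mu_open.
Qed.

End reflected_norm.

Lemma gaussian_window (R : realType) (G G0 : lcaType) (d : nat) (iso : G -> 'cV[R]_d * G0)
    (S : splitting iso) (K : set G0) (K_subgroup : compact_open_subgroup K) (A : 'M[R]_d)
    (A_unit : A \in unitmx) (D : set G0) (DP : coset_representatives K D)
    (mu : {sigma_finite_measure set (borel G) -> \bar R}) :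
  is_haar (fun x y : G => x + y) mu -> window mu (gaussian iso K).
Proof.
move=> mu_haar; rewrite gaussianE.
have L2 := cL2_gauss S K_subgroup A_unit DP mu_haar.
split => //; first exact: (cgauss_continuous S K_subgroup).
  by under eq_fun do rewrite (gaussN S K_subgroup).
exists 1 => x; rewrite cmod_cgauss /gauss.
rewrite -[leRHS]mulr1; apply: ler_pM; [exact: expR_ge0|by []| |].
  by rewrite -expR0 ler_expR oppr_le0 mulr_ge0 ?pi_ge0 ?sq_ge0.
by rewrite indicE; case: (_ \in _); rewrite ?ler01.
Qed.

Lemma gaussian_neq0 (R : realType) (G G0 : lcaType) (d : nat) (iso : G -> 'cV[R]_d * G0)
    (S : splitting iso) (K : set G0) : compact_open_subgroup K ->
  exists x, gaussian iso K x != 0.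
Proof.
move=> [_ _ K0 _]; exists 0; rewrite gaussianE -cmod_eq0 cmod_cgauss gt_eqF//.
by apply: gauss_gt0; rewrite (iso0 S).
Qed.

Theorem theorem4p17 (R : realType) (G : lcaType)
    (G_second_countable : @second_countable G)
    (G_sigma_compact : sigma_compact G)
    (d : nat) (G0 : lcaType) (iso : G -> 'cV[R]_d * G0) (K : set G0)
    (iso_lca : is_lca_iso iso) (K_subgroup : compact_open_subgroup K)
    (mu : {sigma_finite_measure set (borel G) -> \bar R})
    (nu : {sigma_finite_measure set (borel (dual_group R G)) -> \bar R})
    (tau : probability (borel_circle R) R)
    (mu_haar : is_haar (fun x y : G => x + y) mu)
    (nu_haar : is_haar (fun xi eta : dual_group R G => xi + eta) nu)
    (nu_dual : is_dual_haar mu nu)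
    (tau_haar : is_haar (fun s t : circle R => (s * t)%g) tau)
    (v m : G * dual_group R G -> R)
    (v_admissible : is_admissible v) (m_moderate : is_moderate v m)
    (p q : \bar R) (p_gt0 : (0 < p)%E) (q_gt0 : (0 < q)%E)
    (phi : G -> R[i]) (phi_gaussian : phi = gaussian iso K)
    (Q : set (G * dual_group R G)) (Q_nbhd : phase_unit_nbhd Q)
    (g : G -> R[i]) (g_span : gabor_span phi g) (g_neq0 : exists x, g x != 0)
    (QH : set (G * dual_group R G * circle R)) (QH_nbhd : heis_unit_nbhd QH)
    (A1 A2 : 'M[R]_d) (A1_unit : A1 \in unitmx) (A2_unit : A2 \in unitmx)
    (D1 : set G0) (D2 : set (dual_group R G0))
    (D1_repr : coset_representatives K D1)
    (D2_repr : coset_representatives (annihilator K) D2)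
    (L1 : set G) (L2 : set (dual_group R G)) (L : set (G * dual_group R G))
    (L1_def : L1 = lattice1 iso A1 D1) (L2_def : L2 = lattice2 iso A2 D2)
    (L_def : L = L1 `*` L2)
    (h : G -> R[i]) (h_analyzing : analyzing mu nu tau v QH h)
    (S_h_phi : forall f, cL2 mu f -> frame_operator mu L h phi f f)
    (S_phi_h : forall f, cL2 mu f -> frame_operator mu L phi h f f) :
  [/\ forall F, mod_space mu nu phi v p q m g Q F ->
        (p <> +oo%E /\ q <> +oo%E ->
           mod_unconditional_sum mu nu phi v p q m g Q L
             (gabor_term mu F phi h) F /\
           mod_unconditional_sum mu nu phi v p q m g Q L
             (gabor_term mu F h phi) F) /\
        (p = +oo%E \/ q = +oo%E ->
           mod_weakstar_sum mu nu phi v g Q L (gabor_term mu F phi h) F /\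
           mod_weakstar_sum mu nu phi v g Q L (gabor_term mu F h phi) F),
      equivalent_on (mod_space mu nu phi v p q m g Q)
        (mod_norm mu nu p q m g Q)
        (fun F => coefficient_norm p q m L1 L2 F phi) &
      equivalent_on (mod_space mu nu phi v p q m g Q)
        (mod_norm mu nu p q m g Q)
        (fun F => coefficient_norm p q m L1 L2 F h)].
Proof.
have [S] := splitting_exists iso_lca.
have [[v_meas v_gt0] v_sub v_even v_low _] := v_admissible.
have [[_ m_gt0] m_mod] := m_moderate.
have [_ Q_pre Q0] := Q_nbhd.
have [_ _ QH0] := QH_nbhd.
pose t1 := group_tiling S K_subgroup A1_unit D1_repr.
pose t2 := dual_tiling S K_subgroup A2_unit D2_repr.
pose t := product_tiling t1 t2.
have Lt : L = lattice t.
  rewrite L_def L1_def L2_def lattice_product; congr (_ `*` _).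
    by rewrite (lattice_group_tiling S K_subgroup A1_unit D1_repr).
  by rewrite (lattice_dual_tiling S K_subgroup A2_unit D2_repr).
have [M M1 v_growth] := weight_growth t1 t2 mu_haar nu_haar v_meas v_gt0 v_sub v_even.
have v_cube := weight_bounded_cube t1 t2 mu_haar nu_haar v_meas v_gt0 v_sub v_even.
have phi_window : window mu phi.
  by rewrite phi_gaussian; exact: (gaussian_window S K_subgroup A1_unit D1_repr mu_haar).
have phi_L2 : cL2 mu phi by have [] := phi_window.
have phi_phi : decaying t v (amb mu phi phi).
  rewrite phi_gaussian gaussianE.
  exact: (stft_gauss_decaying G_second_countable mu_haar v_gt0 M1 v_growth).
have phi_reflected : reflected_inner mu phi phi != 0.
  apply: (reflected_inner_neq0 mu_haar phi_window).
  by rewrite phi_gaussian; exact: (gaussian_neq0 S K_subgroup).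
have g_window := window_span G_second_countable mu_haar phi_window g_span.
have g_L2 : cL2 mu g by have [] := g_window.
have g_reflected := reflected_inner_neq0 mu_haar g_window g_neq0.
have h_L2 : cL2 mu h by have [] := h_analyzing 1 (introT andP (conj ltr01 (lexx 1))).
rewrite Lt in S_h_phi S_phi_h *.
have analyzingl := decaying_analyzingl mu_haar nu_haar tau_haar v_gt0 v_sub v_even v_cube
  G_second_countable h_L2 phi_L2 S_phi_h QH0 h_analyzing.
have analyzingr := decaying_analyzingr mu_haar nu_haar tau_haar v_gt0 v_sub v_even v_cube
  G_second_countable h_L2 phi_L2 S_phi_h QH0 h_analyzing.
(* The decay for the pair (h, h) is reached from that for (phi, phi) by replacing one argument at a
   time. *)
have h_phi := analyzingl _ phi_L2 phi_phi.
have phi_h := analyzingr _ phi_L2 phi_phi.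
have h_h := analyzingl _ h_L2 phi_h.
have g_phi := decaying_spanl G_second_countable mu_haar v_gt0 v_sub v_even v_cube phi_L2 phi_L2 g_span phi_phi.
have phi_g := decaying_spanr G_second_countable mu_haar v_gt0 v_sub v_even v_cube phi_L2 phi_L2 g_span g_L2 phi_phi.
have g_h := decaying_spanl G_second_countable mu_haar v_gt0 v_sub v_even v_cube phi_L2 h_L2 g_span phi_h.
have sampling_phi := test_norm_sampling G_second_countable mu_haar nu_haar v_meas v_gt0 v_sub v_even v_low v_cube
  Q_pre (nbhs_singleton Q0) phi_window phi_phi phi_reflected nu_dual.
have sampling_h := test_norm_sampling_dual G_second_countable mu_haar nu_haar v_meas v_gt0 v_sub v_even v_low v_cube
  Q_pre Q0 phi_window phi_phi phi_reflected nu_dual h_L2 h_L2 h_h S_h_phi.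
have [C1 C10 C1P] := mod_norm_le_coef G_second_countable mu_haar nu_haar v_meas v_gt0 v_sub v_even v_cube
  Q_pre Q0 phi_window g_window g_phi phi_L2 h_L2 phi_phi g_h S_phi_h m_gt0 m_mod p_gt0 q_gt0.
have [C2 C20 C2P] := mod_norm_le_coef G_second_countable mu_haar nu_haar v_meas v_gt0 v_sub v_even v_cube
  Q_pre Q0 phi_window g_window g_phi h_L2 phi_L2 h_phi g_phi S_h_phi m_gt0 m_mod p_gt0 q_gt0.
have [C3 C30 C3P] := coef_le_mod_norm G_second_countable mu_haar nu_haar v_meas v_gt0 v_sub v_even v_low v_cube
  Q_pre Q0 phi_window phi_phi nu_dual g_window g_phi h_L2 phi_h g_h phi_g g_reflected S_phi_h m_gt0 m_mod p_gt0 q_gt0.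
have [C4 C40 C4P] := coef_dual_le G_second_countable mu_haar nu_haar v_meas v_gt0 v_sub v_even v_cube
  Q_pre Q0 phi_window phi_phi h_L2 h_phi h_h S_phi_h m_gt0 m_mod p_gt0 q_gt0.
have coefE F k : coefficient_norm p q m L1 L2 F k =
    lattice_norm t1 t2 p q (fun z => (cmod (F (tfshift z k)))%:E * (m z)%:E)%E.
  rewrite /coefficient_norm /lattice_norm L1_def L2_def.
  rewrite -(lattice_group_tiling S K_subgroup A1_unit D1_repr).
  by rewrite -(lattice_dual_tiling S K_subgroup A2_unit D2_repr).
have C5P F : reservoir mu nu phi v F ->
    (lattice_norm t1 t2 p q (fun z => (cmod (F (tfshift z h)))%:E * (m z)%:E) <=
     (C4 * C3)%:E * mod_norm mu nu p q m g Q F)%E.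
  move=> Fr; apply: (le_trans (C4P F Fr)); rewrite EFinM -muleA.
  by apply: lee_wpmul2l; [rewrite lee_fin ltW|exact: C3P].
have lower (C : R) (a b : \bar R) : 0 < C -> (a <= C%:E * b)%E -> ((C^-1)%:E * a <= b)%E.
  by move=> C0; rewrite lee_pdivrMl.
split.
- move=> F [Fr Ffin]; split => [[poo qoo]|_].
    split.
      apply: (unconditional_expansion G_second_countable mu_haar nu_haar v_meas v_gt0 v_sub v_even v_cube
        Q_pre Q0 phi_window g_window g_phi phi_L2 h_L2 phi_phi g_h S_phi_h sampling_h m_gt0 m_mod p_gt0 q_gt0 poo qoo Fr).
      apply: (le_lt_trans (C3P F Fr)); apply: lte_mul_pinfty => //; by rewrite lee_fin ltW.
    apply: (unconditional_expansion G_second_countable mu_haar nu_haar v_meas v_gt0 v_sub v_even v_cube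
      Q_pre Q0 phi_window g_window g_phi h_L2 phi_L2 h_phi g_phi S_h_phi sampling_phi m_gt0 m_mod p_gt0 q_gt0 poo qoo Fr).
    apply: (le_lt_trans (C5P F Fr)); apply: lte_mul_pinfty => //; by rewrite lee_fin mulr_ge0 ?ltW.
  split.
    exact: (weakstar_expansion G_second_countable mu_haar nu_haar v_meas v_gt0 v_sub v_even v_cube
      Q_pre Q0 phi_window g_window g_phi phi_L2 h_L2 phi_phi g_h S_phi_h sampling_h Fr).
  exact: (weakstar_expansion G_second_countable mu_haar nu_haar v_meas v_gt0 v_sub v_even v_cube
    Q_pre Q0 phi_window g_window g_phi h_L2 phi_L2 h_phi g_phi S_h_phi sampling_phi Fr).
- exists C1^-1, C3; split => //; first by rewrite invr_gt0.
  by move=> F [Fr _]; rewrite coefE; split; [apply: lower => //; exact: C1P|exact: C3P].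
- exists C2^-1, (C4 * C3); split; [by rewrite invr_gt0|exact: mulr_gt0|].
  by move=> F [Fr _]; rewrite coefE; split; [apply: lower => //; exact: C2P|exact: C5P].
Qed.
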